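(* Let $X\subseteq\mathbb{C}^N$ be the affine cone over a smooth projective complete intersection $Y\subseteq\mathbb{P}^{N-1}$ of degree $d<2n+\nu-1$, where $n=\dim X$ and $\nu=\operatorname{codim}X=N-n$. Let $\Omega\subset\subset\Omega'\subset\subset\mathbb{C}^N$ be two strictly pseudoconvex domains, $D:=X\cap\Omega$, $D':=X\cap\Omega'$, assume that $D$ has smooth boundary, and let $\mathcal{K}$ be the Andersson--Samuelsson integral operator on $D'$ (defined in the context). Let $\varphi\in\operatorname{Dom}\bar\partial_s\subseteq L^p_{0,q}(D')$, $1\leq q\leq n$, where $$\frac{2n}{2n-(d-\nu)}<p\leq 2n.$$ Then $$\mathcal{K}\varphi\in\operatorname{Dom}\bar\partial_s\subset L^p_{0,q-1}(D).$$
   Context: **Setting.** $f=(f_1,\dots,f_\nu)$ are homogeneous polynomials on $\mathbb{C}^N$ of degrees $d_1,\dots,d_\nu$, $d:=d_1+\dots+d_\nu$ (the ''degree'' of $X$ and of $Y$), $Y=\{[z]\in\mathbb{P}^{N-1}: f(z)=0\}$ and $X=\{\zeta\in\mathbb{C}^N: f(\zeta)=0\}$ has pure dimension $n=N-\nu$. That $Y$ is a smooth complete intersection means that $\partial f/\partial\zeta$ has rank $\nu$ at every point of $X\setminus\{0\}$. ''$D$ has smooth boundary'' means that the boundary of $D$ in $X$ is a smooth real hypersurface contained in the regular part of $X$. **Spaces and $\bar\partial_s$.** $X^*=\operatorname{Reg}X$ carries the Hermitian metric induced from $\mathbb{C}^N$; $dV_X$ is the induced volume measure, extended by zero to $\operatorname{Sing}X$.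 $L^p_{0,q}(D)$ is the space of $(0,q)$-forms on $D\cap X^*$ with pointwise norm in $L^p(D,dV_X)$. $\bar\partial_s=\bar\partial_s^{(p)}$ is the closure of the graph of $\bar\partial$ on smooth forms with support away from the singularity: $\varphi\in L^p_{0,q}(D)$ is in $\operatorname{Dom}\bar\partial_s$ if there is a sequence of smooth forms $\varphi_j\in L^p_{0,q}(D)$ with $\operatorname{supp}\varphi_j\cap\{0\}=\emptyset$ such that $\varphi_j\to\varphi$ in $L^p_{0,q}(D)$ and $\bar\partial\varphi_j\to\bar\partial\varphi$ in $L^p_{0,q+1}(D)$; then $\bar\partial_s\varphi=\bar\partial\varphi$ (in the sense of distributions). **The operator.** Write $\eta_j=\zeta_j-z_j$, with $d\eta_j$ treated as formal $(1,0)$-generators and $d\bar\eta_j=d\bar\zeta_j-d\bar z_j$; $\bar\partial$ acts in $(\zeta,z)$; $\delta_\eta$ is interior multiplication by $2\pi i\sum_j\eta_j\,\partial/\partial\eta_j$. - Structure form: $\omega_X$ is the pull-back to $X$ of $(2\pi i)^\nu\,\dfrac{\sum_I\overline{\det(\partial f/\partial\zeta_I)}\;\widehat{d\zeta_I}}{\|m(\nu,\partial f/\partial\zeta)\|^2}$, the sum over $I=(I_1<\dots<I_\nu)\subseteq\{1,\dots,N\}$, where $\widehat{d\zeta_I}$ is defined by $d\zeta_I\wedge\widehat{d\zeta_I}=d\zeta_1\wedge\dots\wedge d\zeta_N$ and $m(\nu,\partial f/\partial\zeta)$ is the tuple of all $\nu\times\nu$ minors of $\partial f/\partial\zeta$.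 - Hefer form: $h=h_1\wedge\dots\wedge h_\nu$, $h_i=\sum_jh_i^j(\zeta,z)\,d\eta_j$ with $\delta_\eta h_i=f_i(\zeta)-f_i(z)$, where the $h_i^j$ are homogeneous polynomials in $(\zeta,z)$ of degree $d_i-1$. - Weight: $\chi(\zeta)$ is a smooth cut-off function with compact support in $\Omega'$, $\chi\equiv1$ near $\overline\Omega$; $s=\sum_is_i(\zeta,z)\,d\eta_i$ satisfies $\delta_\eta s=1$ and is smooth for $\zeta$ near $\operatorname{supp}\bar\partial\chi$ and $z$ near $\overline\Omega$, holomorphic in $z$; $g:=\chi-\bar\partial\chi\wedge\big(s+s\wedge\bar\partial s+\dots+s\wedge(\bar\partial s)^{n-1}\big)$. - Bochner--Martinelli form: $b:=\dfrac{1}{2\pi i}\dfrac{\sum_j\bar\eta_j\,d\eta_j}{\|\eta\|^2}$, $B:=b+b\wedge\bar\partial b+\dots+b\wedge(\bar\partial b)^{n-1}$. $\tilde K$ is defined by $\tilde K\wedge d\eta_1\wedge\dots\wedge d\eta_N=h\wedge(g\wedge B)_n$, where $(\cdot)_n$ denotes the part of degree $n$ in the $d\eta_j$. Put $K=\pm\,\omega_X(\zeta)\wedge\tilde K(\zeta,z)$, the sign (depending only on $n,N$ and orientation conventions) being the one for which the Andersson--Samuelsson Koppelman formula $\varphi=\bar\partial\mathcal K\varphi+\mathcal K\bar\partial\varphi$ holds on $D$ for smooth $(0,q)$-forms $\varphi$ on $D'$, $q\ge1$ (a known result of Andersson and Samuelsson). Then $(\mathcal K\varphi)(z)=\int_{D'}K(\zeta,z)\wedge\varphi(\zeta)$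 for $z\in D$, integration being over $\zeta$ (component of bidegree $(n,n)$ in $\zeta$). *)

(* Defs.v *)
From HB Require Import structures.
From mathcomp Require Import all_boot all_order all_algebra.
From mathcomp Require Import -(notations) mpoly.
From mathcomp Require Import complex.
From mathcomp Require Import all_classical all_reals all_analysis.

Set Implicit Arguments.
Unset Strict Implicit.
Unset Printing Implicit Defensive.

Import Order.TTheory GRing.Theory Num.Theory numFieldNormedType.Exports.
Local Open Scope ring_scope.

(* Exterior algebra on the (linearly ordered) finite set of generators G:     *)
(* the coefficient at S : {set G} is that of the product of the generators in *)
(* S taken in increasing order.                                               *)
Section Exterior.
Variable K : fieldType.

Definition ext (G : finType) := {ffun {set G} -> K^o}.

(* x_S /\ x_T = esgn S T x_(S u T) for disjoint S and T *)
Definition esgn (G : finType) (S T : {set G}) : K :=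
  (-1) ^+ #|[set u : G * G | [&& u.1 \in S, u.2 \in T &
                              (enum_rank u.2 < enum_rank u.1)%N]]%SET|.

Definition emono (G : finType) (S : {set G}) : ext G := [ffun T : {set G} => (T == S)%:R].
Definition egen (G : finType) (x : G) : ext G := emono [set x]%SET.
Definition eone (G : finType) : ext G := emono finset.set0.

Definition ewedge (G : finType) (a b : ext G) : ext G :=
  [ffun S : {set G} => \sum_(T : {set G} | T \subset S)
               esgn T (S :\: T) * a T * b (S :\: T)].
Definition ewedges (G : finType) (s : seq (ext G)) : ext G :=
  foldr (@ewedge G) (eone G) s.
Definition epow (G : finType) (a : ext G) (k : nat) : ext G :=
  iter k (ewedge a) (eone G).

Definition epart (G : finType) (P : pred {set G}) (a : ext G) : ext G :=
  [ffun S : {set G} => if P S then a S else 0].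

(* the algebra morphism sending the generator x to the 1-form theta x *)
Definition esubst (G H : finType) (theta : G -> ext H) (a : ext G) : ext H :=
  \sum_(S : {set G}) a S *: ewedges [seq theta x | x <- enum S].

Definition ehomog (G : finType) (q : nat) (a : ext G) : Prop :=
  forall S : {set G}, a S != 0 -> #|S| = q.
End Exterior.

(* The generators d eta_j, d zeta_j, d zetabar_j, d zbar_j, in this order. *)
Definition gens (N : nat) := ('I_4 * 'I_N)%type.
Definition geta (N : nat) (j : 'I_N) : gens N := (inord 0, j).
Definition gzeta (N : nat) (j : 'I_N) : gens N := (inord 1, j).
Definition gzetab (N : nat) (j : 'I_N) : gens N := (inord 2, j).
Definition gzb (N : nat) (j : 'I_N) : gens N := (inord 3, j).

Local Open Scope classical_set_scope.

(* C^N is R^N x R^N, split into real and imaginary parts. *)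
Definition Cn (R : realType) (N : nat) := ('rV[R]_N * 'rV[R]_N)%type.

Section Calculus.
Variable R : realType.
Local Notation C := R[i].

Definition ci : C := (0 +i* 1)%C.
Definition rc (x : R) : C := (x +i* 0)%C.
Definition twopii : C := rc (2 * pi) * ci.

Section General.
Variable V : normedModType R.

(* f is of class C^k on the open set U *)
Fixpoint Ck (k : nat) (U : set V) (f : V -> R^o) : Prop :=
  (forall x, U x -> {for x, continuous f}) /\
  match k with
  | 0 => True
  | k'.+1 => forall v : V,
      (forall x, U x -> derivable f x v) /\ Ck k' U (fun x => 'D_v f x)
  end.

Definition smooth (U : set V) (f : V -> R^o) : Prop := forall k, Ck k U f.

Definition csmooth (U : set V) (F : V -> C) : Prop :=
  smooth U (fun x => complex.Re (F x)) /\ smooth U (fun x => complex.Im (F x)).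

Definition cderive (v : V) (F : V -> C) (x : V) : C :=
  ('D_v (fun y => complex.Re (F y) : R^o) x +i*
   'D_v (fun y => complex.Im (F y) : R^o) x)%C.

(* u and w are the real directions of Re and Im of one complex coordinate *)
Definition wirt (u w : V) (F : V -> C) (x : V) : C :=
  (cderive u F x - ci * cderive w F x) / 2.
Definition wirtb (u w : V) (F : V -> C) (x : V) : C :=
  (cderive u F x + ci * cderive w F x) / 2.
End General.

(* integral of F >= 0 for Lebesgue measure on R^m, as an iterated integral *)
Fixpoint lebint (m : nat) : ('rV[R]_m -> \bar R) -> \bar R :=
  match m return ('rV[R]_m -> \bar R) -> \bar R with
  | 0 => fun F => F 0
  | m'.+1 => fun F =>
      (\int[lebesgue_measure]_(t in [set: R])
         lebint (fun x : 'rV[R]_m' =>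
                   F (row_mx (t%:M : 'rV[R]_1) x : 'rV[R]_(1 + m'))))%E
  end.

Section Space.
Variable N : nat.
Local Notation E := (Cn R N).

Definition crd (z : E) (j : 'I_N) : C := (z.1 0 j +i* z.2 0 j)%C.
Definition ure (j : 'I_N) : E := (delta_mx 0 j, 0).
Definition uim (j : 'I_N) : E := (0, delta_mx 0 j).

Definition del (j : 'I_N) : (E -> C) -> E -> C := wirt (ure j) (uim j).
Definition delb (j : 'I_N) : (E -> C) -> E -> C := wirtb (ure j) (uim j).

(* the anti-holomorphic derivatives in zeta and in z of F (zeta, z) *)
Definition delb_zeta (j : 'I_N) : (E * E -> C) -> E * E -> C :=
  wirtb (ure j, 0) (uim j, 0).
Definition delb_z (j : 'I_N) : (E * E -> C) -> E * E -> C :=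
  wirtb (0, ure j) (0, uim j).

Definition rcinto (Om Om' : set E) : Prop :=
  compact (closure Om) /\ closure Om `<=` Om'.

(* bounded domain with C^2 boundary whose Levi form is positive definite on *)
(* the complex tangent spaces of the boundary                               *)
Definition strictly_pseudoconvex (Om : set E) : Prop :=
  [/\ open Om, connected Om, compact (closure Om) &
   forall z0, (closure Om `\` Om) z0 ->
   exists (U : set E) (rho : E -> R),
   [/\ open U /\ U z0,
       Ck 2 U rho,
       (forall z, U z -> (Om z <-> rho z < 0)),
       (exists v : E, 'D_v (rho : E -> R^o) z0 != 0) &
       forall t : 'I_N -> C, (exists j, t j != 0) ->
         \sum_j del j (fun z => rc (rho z)) z0 * t j = 0 ->
         0 < \sum_j \sum_k
               del j (delb k (fun z => rc (rho z))) z0 * t j * (t k)^*]].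
End Space.
End Calculus.

Section Cone.
Variables (R : realType) (n nu : nat).
Local Notation C := R[i].
Local Notation N := (n + nu)%N.
Local Notation E := (Cn R N).
Local Notation form := (ext C 'I_N).       (* sum_J phi_J d zetabar_J *)
Local Notation bigform := (ext C (gens N)).
Variable f : 'I_nu -> mpoly N C.

Definition feval (i : 'I_nu) (z : E) : C := meval (crd z) (f i).

Definition jac (z : E) : 'M[C]_(nu, N) :=
  \matrix_(i, j) meval (crd z) (mderiv j (f i)).

Definition coneX : set E := [set z | forall i, feval i z = 0].

(* The projective zero set of f is a smooth complete intersection. *)
Definition smooth_ci : Prop :=
  forall z, coneX z -> z != 0 -> \rank (jac z) = nu.

(* Reg X, by the Jacobian criterion (0 is included iff X is linear) *)
Definition regX : set E := [set z | coneX z /\ \rank (jac z) = nu].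

(* orthogonal projection of C^N onto T_z X = ker (jac z), acting on columns *)
Definition tproj (z : E) : 'M[C]_N :=
  let A := jac z in
  let As := map_mx (fun x : C => x^*) A^T in
  1%:M - As *m invmx (A *m As) *m A.

(* Pull-back of forms to T_z X, represented canonically in the ambient space   *)
(* (pull-back by tproj z).  Two ambient forms agree on X at z iff their        *)
(* restrictions are equal, and the induced norm is that of the restriction.    *)
Definition restr (z : E) : form -> form :=
  esubst (fun j => \sum_k (tproj z j k)^* *: egen C k).

Definition bigrestr (z : E) : bigform -> bigform :=
  esubst (fun g : gens N =>
    if g.1 == inord 1 then \sum_k tproj z g.2 k *: egen C (gzeta k)
    else if g.1 == inord 2 then \sum_k (tproj z g.2 k)^* *: egen C (gzetab k)
    else egen C g).

Definition fnorm (z : E) (a : form) : R :=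
  Num.sqrt (\sum_(S : {set 'I_N})
    (complex.Re (restr z a S) ^+ 2 + complex.Im (restr z a S) ^+ 2)).

Definition edot (a b : bigform) : C := \sum_S a S * (b S)^*.

(* volume form of X : omega^n / n! with omega = (i/2) sum_j dzeta_j dzetabar_j *)
Definition kahler : bigform :=
  \sum_j (ci R / 2) *: ewedge (egen C (gzeta j)) (egen C (gzetab j)).
Definition volform (z : E) : bigform :=
  bigrestr z (n`!%:R^-1 *: epow kahler n).

(* the factor c with Theta = c dV_X on T_z X, for Theta of bidegree (n, n) *)
Definition density (z : E) (Theta : bigform) : C :=
  edot (bigrestr z Theta) (volform z) / edot (volform z) (volform z).

Definition borelCn := g_sigma_algebraType (@open E).

(* smooth injective immersion of U in R^(2n) into Reg X *)
Definition local_param (U : set 'rV[R]_(n + n)) (psi : 'rV[R]_(n + n) -> E)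
    (gram : 'rV[R]_(n + n) -> 'M[R]_(n + n)) : Prop :=
  [/\ open U,
      (forall j, smooth U (fun x => (psi x).1 0 j) /\
                 smooth U (fun x => (psi x).2 0 j)),
      {in U &, injective psi},
      (forall x, U x -> regX (psi x)) &
      (forall x, U x ->
        gram x = \matrix_(a, b) \sum_j
          ('D_(delta_mx 0 a) (fun y => (psi y).1 0 j : R^o) x *
           'D_(delta_mx 0 b) (fun y => (psi y).1 0 j : R^o) x +
           'D_(delta_mx 0 a) (fun y => (psi y).2 0 j : R^o) x *
           'D_(delta_mx 0 b) (fun y => (psi y).2 0 j : R^o) x)
        /\ \det (gram x) != 0)].

(* dV is the Riemannian volume measure of Reg X, extended by zero. *)
Definition is_volume (dV : {measure set borelCn -> \bar R}) : Prop :=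
  dV (~` regX) = 0%E /\
  forall U psi gram, local_param U psi gram ->
  forall B : set borelCn, measurable B ->
    dV (B `&` psi @` U) =
    lebint (fun x => if `[< U x /\ B (psi x) >]
                     then (Num.sqrt (\det (gram x)))%:E else 0%E).

(* The boundary of D in X is a smooth real hypersurface contained in Reg X. *)
Definition smooth_boundary (D : set E) : Prop :=
  let bd := coneX `&` closure D `&` closure (coneX `\` D) in
  forall z0, bd z0 -> regX z0 /\
    exists (U : set E) (rho : E -> R),
    [/\ open U /\ U z0,
        smooth U rho,
        (exists v : E, 'D_v (rho : E -> R^o) z0 != 0 /\
           forall i, \sum_j jac z0 i j * crd v j = 0) &
        forall z, U z -> coneX z -> (bd z <-> rho z = 0)].

Definition dbar_form (phi : E -> form) (z : E) : form :=
  \sum_(S : {set 'I_N}) \sum_k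
    delb k (fun y => phi y S) z *: ewedge (egen C k) (emono C S).

(* phi is a smooth (0,q)-form near every point of A, and dphi is its dbar. *)
Definition is_dbar (A : set E) (q : nat) (phi dphi : E -> form) : Prop :=
  forall z0, A z0 -> exists (U : set E) (ph : E -> form),
  [/\ open U, U z0,
      (forall S : {set 'I_N}, csmooth U (fun z => ph z S)) &
      forall z, U z -> A z -> regX z ->
      [/\ ehomog q (phi z), ehomog q.+1 (dphi z),
          restr z (phi z) = restr z (ph z) &
          restr z (dphi z) = restr z (dbar_form ph z)]].

Section Volume.
Variable dV : {measure set borelCn -> \bar R}.

Definition cmeasurable (A : set borelCn) (F : E -> C) : Prop :=
  measurable_fun A (fun z : borelCn => complex.Re (F z)) /\
  measurable_fun A (fun z : borelCn => complex.Im (F z)).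

Definition cintegrable (A : set borelCn) (F : E -> C) : Prop :=
  dV.-integrable A (fun z : borelCn => (complex.Re (F z))%:E) /\
  dV.-integrable A (fun z : borelCn => (complex.Im (F z))%:E).

Definition cintegral (A : set borelCn) (F : E -> C) : C :=
  (Rintegral dV A (fun z : borelCn => complex.Re (F z)) +i*
   Rintegral dV A (fun z : borelCn => complex.Im (F z)))%C.

Definition Lpnorm (D : set E) (p : R) (phi : E -> form) : \bar R :=
  Lnorm dV p%:E
    ((fun z : borelCn => (fnorm z (phi z))%:E) \_ (D `&` regX : set borelCn)).

(* the space L^p_{0,q}(D) *)
Definition in_Lp (D : set E) (p : R) (q : nat) (phi : E -> form) : Prop :=
  [/\ (forall z, D z -> regX z -> ehomog q (phi z)),
      (forall S : {set 'I_N},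
         cmeasurable (D `&` regX) (fun z => restr z (phi z) S)) &
      (Lpnorm D p phi < +oo)%E].

Definition supp_off_zero (D : set E) (phi : E -> form) : Prop :=
  D 0 -> exists W : set E, [/\ open W, W 0 &
    forall z, W z -> D z -> regX z -> restr z (phi z) = 0].

(* Domain of dbar_s^(p) : the closure in L^p x L^p of the graph of dbar on    *)
(* smooth forms supported away from 0.                                        *)
Definition dom_dbar_s (D : set E) (p : R) (q : nat) (phi : E -> form) : Prop :=
  in_Lp D p q phi /\
  exists (psi : E -> form) (phi_ dphi_ : nat -> E -> form),
  [/\ in_Lp D p q.+1 psi,
      (forall k, [/\ in_Lp D p q (phi_ k),
                     is_dbar (D `&` regX) q (phi_ k) (dphi_ k),
                     in_Lp D p q.+1 (dphi_ k) &
                     supp_off_zero D (phi_ k)]),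
      (fun k => Lpnorm D p (fun z => phi_ k z - phi z)) @ \oo --> 0%E &
      (fun k => Lpnorm D p (fun z => dphi_ k z - psi z)) @ \oo --> 0%E].
End Volume.

Section Operator.

(* interior multiplication by 2 pi i sum_j eta_j d/d eta_j on the 1-form    *)
(* sum_j s_j d eta_j                                                        *)
Definition delta_eta (s : 'I_N -> E * E -> C) (p : E * E) : C :=
  twopii R * \sum_j (crd p.1 j - crd p.2 j) * s j p.

Definition oneform (s : 'I_N -> E * E -> C) (p : E * E) : bigform :=
  \sum_j s j p *: egen C (geta j).

(* dbar acts in both variables (zeta, z) *)
Definition dbar_fun (F : E * E -> C) (p : E * E) : bigform :=
  \sum_k (delb_zeta k F p *: egen C (gzetab k) +
          delb_z k F p *: egen C (gzb k)).

Definition dbar_oneform (s : 'I_N -> E * E -> C) (p : E * E) : bigform :=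
  \sum_j ewedge (dbar_fun (s j) p) (egen C (geta j)).

(* s + s /\ dbar s + ... + s /\ (dbar s)^(n-1) *)
Definition fullform (s : 'I_N -> E * E -> C) (p : E * E) : bigform :=
  \sum_(k < n) ewedge (oneform s p) (epow (dbar_oneform s p) k).

Definition weight (chi : E -> R) (s : 'I_N -> E * E -> C) (p : E * E) : bigform :=
  rc (chi p.1) *: eone C (gens N) -
  ewedge (dbar_fun (fun p' => rc (chi p'.1)) p) (fullform s p).

Definition bm (j : 'I_N) (p : E * E) : C :=
  (crd p.1 j - crd p.2 j)^* /
  (twopii R * \sum_k (crd p.1 k - crd p.2 k) * (crd p.1 k - crd p.2 k)^*).

Definition hval (h : 'I_nu -> 'I_N -> mpoly (N + N)%N C)
    (i : 'I_nu) (j : 'I_N) (p : E * E) : C :=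
  meval (fun k => match fintype.split k with
                  | inl a => crd p.1 a
                  | inr a => crd p.2 a
                  end) (h i j).

Definition hefer (d : 'I_nu -> nat) (h : 'I_nu -> 'I_N -> mpoly (N + N)%N C) :
    Prop :=
  (forall i j, h i j \is @ishomog1 _ _ (d i).-1 mdeg) /\
  (forall i p, delta_eta (hval h i) p = feval i p.1 - feval i p.2).

Definition heferform (h : 'I_nu -> 'I_N -> mpoly (N + N)%N C) (p : E * E) :
    bigform :=
  ewedges [seq oneform (hval h i) p | i <- enum 'I_nu].

Definition etas : {set gens N} := [set g : gens N | g.1 == inord 0]%SET.

(* h /\ (g /\ B)_n *)
Definition hgB chi s h (p : E * E) : bigform :=
  ewedge (heferform h p)
    (epart (fun S : {set gens N} => #|S :&: etas| == n)
           (ewedge (weight chi s p) (fullform bm p))).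

(* the form without d eta's such that
   Ktilde /\ d eta_1 /\ ... /\ d eta_N = h /\ (g /\ B)_n *)
Definition Ktilde chi s h (p : E * E) : bigform :=
  [ffun T : {set gens N} => if T :&: etas == finset.set0
             then esgn C T etas * hgB chi s h p (T :|: etas) else 0].

(* The structure form.  I ranges over increasing maps, and the form hat(d     *)
(* zeta_I) is esgn I I^c times the product of the d zeta_j, j not in I.       *)
Definition increasing (I : {ffun 'I_nu -> 'I_N}) : bool :=
  [forall a : 'I_nu, forall b : 'I_nu, (a < b)%N ==> (I a < I b)%N].

Definition minor (z : E) (I : {ffun 'I_nu -> 'I_N}) : C :=
  \det (\matrix_(a, b) jac z a (I b)).

Definition hatdzeta (I : {ffun 'I_nu -> 'I_N}) : bigform :=
  let S := [set gzeta (I a) | a in 'I_nu]%SET in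
  let T := [set gzeta j | j : 'I_N]%SET :\: S in
  esgn C S T *: emono C T.

Definition omegaX (z : E) : bigform :=
  (twopii R ^+ nu / \sum_(I | increasing I) minor z I * (minor z I)^*) *:
  \sum_(I | increasing I) (minor z I)^* *: hatdzeta I.

Variable dV : {measure set borelCn -> \bar R}.
Variables (D' : set E) (chi : E -> R) (s : 'I_N -> E * E -> C).
Variables (h : 'I_nu -> 'I_N -> mpoly (N + N)%N C) (eps : bool).

(* the sign in K = +- omega_X /\ Ktilde is (-1)^eps *)
Definition ASkernel (zeta z : E) : bigform :=
  (-1) ^+ eps *: ewedge (omegaX zeta) (Ktilde chi s h (zeta, z)).

(* The form Theta_L of bidegree (n, n) in zeta in the decomposition
   Theta = sum_L Theta_L /\ d zbar_L. *)
Definition zpart (L : {set 'I_N}) (Theta : bigform) : bigform :=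
  let ZL := [set gzb j | j in L]%SET in
  [ffun S : {set gens N} =>
    if [&& #|S| == (n + n)%N,
           #|S :&: [set gzeta j | j : 'I_N]%SET| == n &
           #|S :&: [set gzetab j | j : 'I_N]%SET| == n]
    then esgn C S ZL * Theta (S :|: ZL) else 0].

Definition ASintegrand (phi : E -> form) (z : E) (L : {set 'I_N}) (zeta : E) : C :=
  density zeta (zpart L (ewedge (ASkernel zeta z)
    (esubst (fun j => egen C (gzetab j)) (phi zeta)))).

(* (K phi)(z) is a form in d zbar *)
Definition ASop (phi : E -> form) (z : E) : form :=
  [ffun L : {set 'I_N} => cintegral dV (D' `&` regX) (ASintegrand phi z L)].

Definition ASconverges (phi : E -> form) (z : E) : Prop :=
  forall L : {set 'I_N}, cintegrable dV (D' `&` regX) (ASintegrand phi z L).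

(* phi = dbar (K phi) + K (dbar phi) on (the regular part of) D for smooth
   (0,q)-forms on D', q >= 1; this singles out the sign eps. *)
Definition koppelman (D : set E) : Prop :=
  forall (q : nat) (phi dphi : E -> form), (1 <= q)%N ->
    is_dbar D' q phi dphi ->
    is_dbar (D `&` regX) q.-1 (ASop phi) (fun z => phi z - ASop dphi z).
End Operator.

Definition cutoff (Om Om' : set E) (chi : E -> R) : Prop :=
  [/\ smooth setT chi,
      compact (closure [set z | chi z != 0]),
      closure [set z | chi z != 0] `<=` Om' &
      exists W : set E, [/\ open W, closure Om `<=` W &
                            forall z, W z -> chi z = 1]].

Definition weight_section (Om : set E) (chi : E -> R)
    (s : 'I_N -> E * E -> C) : Prop :=
  exists U W : set E,
  [/\ open U /\ open W,
      closure [set z | exists k, delb k (fun y => rc (chi y)) z != 0] `<=` U,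
      closure Om `<=` W,
      (forall i, csmooth (U `*` W) (s i)) &
      forall p, U p.1 -> W p.2 ->
        delta_eta s p = 1 /\ forall i k, delb_z k (s i) p = 0].
End Cone.

(* Main.v *)
(* The kernel K(zeta, z) is controlled by the homogeneity of the Hefer form and of the structure form: with
   m = d - nu it is at most a constant times
   (|zeta| + |z|)^m |zeta|^(-m) |zeta - z|^(1 - 2n),
   because omega_X is homogeneous of degree -m, h of degree m, and the Bochner-Martinelli part has a singularity of
   order 2n - 1 on the diagonal.  Since X has volume growth of order r^(2n) around each of its points, Schur's test with
   the weight |zeta|^(-al) shows that such kernels are bounded on L^p as soon as p > 2n / (2n - m).  Hence the integral
   operator is L^p continuous, and it remains to treat good approximants.  If phi is smooth and vanishes near the vertex,
   the Koppelman formula holds and K phi is bounded near the vertex; multiplying by logarithmic cut-off functions, whose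
   gradients are small in L^p for p <= 2n, makes it vanish near the vertex with small error in the graph norm. *)
From HB Require Import structures.
Require Import Defs.
From mathcomp Require Import all_boot all_order all_algebra.
From mathcomp Require Import -(notations) mpoly.
From mathcomp Require Import complex.
From mathcomp Require Import all_classical all_reals all_analysis.
From mathcomp Require Import measurable_realfun perm.
From mathcomp Require Import ring lra zify.
Import Order.TTheory GRing.Theory Num.Theory numFieldNormedType.Exports.
Local Open Scope ring_scope.
Set Implicit Arguments.
Unset Strict Implicit.
Unset Printing Implicit Defensive.

(** In general no chart exists at the vertex, so the local geometry is worked out on one spherical
    shell and carried to all others by dilations, which leave Gram matrices unchanged. The charts
    come from the Hefer form: it writes f(a) - f(b) exactly as a matrix times a - b, which gives a
    quantitative inverse function theorem together with the derivatives of the inverse. The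
    condition on p says m q < 2n for the conjugate exponent q, that is, local integrability of
    |zeta|^(-mq). In the last stage the obstacle is that the Koppelman formula asks for forms smooth
    across the vertex, whereas the forms of the defining sequence are controlled on the regular part
    only, and near the vertex only their restrictions vanish. They are cut off on D' until they are
    literally zero there, and K of the result is cut off a second time on D. The limit of the dbar's
    is phi - K psi with psi = dbar phi, so continuity of K is used in degrees q and q + 1. At p = 2n
    a single scale gives no smallness; averaging many separated scales does, because p > 1. *)

(** * Exterior algebra: signs, associativity and anticommutation *)

Section ExteriorAlgebra.
Variables (K : fieldType) (G : finType).
Implicit Types (a b c : ext K G) (S T U : {set G}).
Local Open Scope set_scope.
Local Open Scope ring_scope.

Lemma ewedgeDl a b c : ewedge (a + b) c = ewedge a c + ewedge b c.
Proof.
apply/ffunP => S; rewrite !ffunE -big_split; apply: eq_bigr => T _.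
by rewrite !ffunE mulrDr mulrDl.
Qed.

Lemma ewedgeDr a b c : ewedge a (b + c) = ewedge a b + ewedge a c.
Proof.
apply/ffunP => S; rewrite !ffunE -big_split; apply: eq_bigr => T _.
by rewrite !ffunE mulrDr.
Qed.

Lemma ewedgeZl k a b : ewedge (k *: a) b = k *: ewedge a b.
Proof.
apply/ffunP => S; rewrite !ffunE scaler_sumr; apply: eq_bigr => T _.
by rewrite !ffunE /GRing.scale /=; ring.
Qed.

Lemma ewedgeZr k a b : ewedge a (k *: b) = k *: ewedge a b.
Proof.
apply/ffunP => S; rewrite !ffunE scaler_sumr; apply: eq_bigr => T _.
by rewrite !ffunE /GRing.scale /=; ring.
Qed.

Lemma ewedge0l a : ewedge 0 a = 0.
Proof. by rewrite -(scale0r (0 : ext K G)) ewedgeZl !scale0r. Qed.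

Lemma ewedge0r a : ewedge a 0 = 0.
Proof. by rewrite -(scale0r (0 : ext K G)) ewedgeZr !scale0r. Qed.

Lemma ewedge_suml (I : Type) (r : seq I) (P : pred I) (F : I -> ext K G) b :
  ewedge (\sum_(i <- r | P i) F i) b = \sum_(i <- r | P i) ewedge (F i) b.
Proof.
by elim/big_rec2: _ => [|i y x _ <-]; rewrite ?ewedge0l ?ewedgeDl.
Qed.

Lemma ewedge_sumr (I : Type) (r : seq I) (P : pred I) (F : I -> ext K G) b :
  ewedge b (\sum_(i <- r | P i) F i) = \sum_(i <- r | P i) ewedge b (F i).
Proof.
by elim/big_rec2: _ => [|i y x _ <-]; rewrite ?ewedge0r ?ewedgeDr.
Qed.

Lemma ewedgeNl a b : ewedge (- a) b = - ewedge a b.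
Proof. by rewrite -scaleN1r ewedgeZl scaleN1r. Qed.

Lemma ewedgeNr a b : ewedge a (- b) = - ewedge a b.
Proof. by rewrite -scaleN1r ewedgeZr scaleN1r. Qed.

Lemma ext_sum a : a = \sum_(S : {set G}) a S *: emono K S.
Proof.
apply/ffunP => T; rewrite sum_ffunE (bigD1 T) //= big1 ?addr0.
  by rewrite !ffunE eqxx /GRing.scale /= mulr1.
move=> S neST; rewrite !ffunE eq_sym (negbTE neST).
by rewrite /GRing.scale /= mulr0.
Qed.

(** Reduces a multilinear identity to monomials, where it becomes a statement about disjoint sets
    and signs. *)
Lemma ext_ind (P : ext K G -> Prop) :
  P 0 -> (forall a b, P a -> P b -> P (a + b)) ->
  (forall k a, P a -> P (k *: a)) -> (forall S, P (emono K S)) ->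
  forall a, P a.
Proof.
move=> P0 PD PZ PM a; rewrite (ext_sum a).
by elim/big_ind: _ => // S _; apply: PZ.
Qed.

(** The inversions of the union against [U] are those of [S] together with those of [T], a disjoint
    union, so exponents add. With [esgnUr] this is the cocycle identity behind associativity. *)
Lemma esgnUl S T U : [disjoint S & T] ->
  esgn K (S :|: T) U = esgn K S U * esgn K T U.
Proof.
move=> dST; rewrite /esgn -exprD; congr (_ ^+ _).
rewrite -cardsUI [X in (_ + X)%N](_ : _ = 0%N) ?addn0; last first.
  apply/eqP; rewrite cards_eq0; apply/eqP/setP => u; rewrite !inE.
  case uS: (u.1 \in S) => //=.
  by rewrite (disjointFr dST uS) /= andbF.
congr #|pred_of_set _|; apply/setP => u; rewrite !inE.
by case: (_ \in S); case: (_ \in T); rewrite ?orbF ?orbb.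
Qed.

Lemma esgnUr S T U : [disjoint T & U] ->
  esgn K S (T :|: U) = esgn K S T * esgn K S U.
Proof.
move=> dST; rewrite /esgn -exprD; congr (_ ^+ _).
rewrite -cardsUI [X in (_ + X)%N](_ : _ = 0%N) ?addn0; last first.
  apply/eqP; rewrite cards_eq0; apply/eqP/setP => u; rewrite !inE.
  case uS: (u.2 \in T); rewrite ?andbF //=.
  by rewrite (disjointFr dST uS) /= !andbF.
congr #|pred_of_set _|; apply/setP => u; rewrite !inE.
by case: (_ \in S); case: (_ \in T); case: (_ \in U); rewrite ?orbF ?orbb.
Qed.

Lemma esgn0l S : esgn K finset.set0 S = 1.
Proof.
rewrite /esgn [X in #|pred_of_set X|](_ : _ = finset.set0) ?cards0 ?expr0 //.
by apply/setP => u; rewrite !inE.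
Qed.

Lemma esgn0r S : esgn K S finset.set0 = 1.
Proof.
rewrite /esgn [X in #|pred_of_set X|](_ : _ = finset.set0) ?cards0 ?expr0 //.
by apply/setP => u; rewrite !inE andbF.
Qed.

Lemma esgn_sqr S T : esgn K S T * esgn K S T = 1.
Proof. by rewrite /esgn -expr2 sqrr_sign. Qed.

Lemma esgn11 (x y : G) :
  esgn K [set x]%SET [set y]%SET = (-1) ^+ (enum_rank y < enum_rank x)%N.
Proof.
rewrite /esgn; congr (_ ^+ _); case: ltnP => h /=.
  rewrite [X in #|pred_of_set X|](_ : _ = [set (x, y)]%SET) ?cards1 //.
  apply/setP => -[u v]; rewrite !inE /= xpair_eqE.
  by case: (u =P x) => [->|] //=; case: (v =P y) => [->|].
rewrite [X in #|pred_of_set X|](_ : _ = finset.set0) ?cards0 //.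
apply/setP => -[u v]; rewrite !inE /=.
case: (u =P x) => [->|] //=; case: (v =P y) => [->|] //=.
by rewrite ltnNge h.
Qed.

Lemma ewedge_mono S T : ewedge (emono K S) (emono K T) =
  if [disjoint S & T] then esgn K S T *: emono K (S :|: T) else 0.
Proof.
apply/ffunP => U; rewrite ffunE.
case: ifPn => dST; rewrite !ffunE /GRing.scale /=.
  case: (U =P S :|: T) => [->|neU].
    rewrite (bigD1 S) ?finset.subsetUl //= big1 ?addr0.
      rewrite !ffunE eqxx mulr1 (_ : (S :|: T) :\: S = T) ?eqxx //.
      rewrite finset.setDUl finset.setDv finset.set0U; apply/finset.setDidPl.
      by rewrite disjoint_sym.
    by move=> V /andP[_ neV]; rewrite !ffunE (negbTE neV) mulr0 mul0r.
  rewrite mulr0 big1 // => V sVU; rewrite !ffunE.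
  case: (V =P S) => [eVS|]; last by rewrite mulr0 mul0r.
  case: (_ =P T) => [eT|]; last by rewrite mulr0.
  by case: neU; rewrite -eT -eVS finset.setDE finset.setUIr finset.setUCr
    finset.setIT; apply/esym/finset.setUidPr.
rewrite big1 // => V sVU; rewrite !ffunE.
case: (V =P S) => [eVS|]; last by rewrite mulr0 mul0r.
case: (_ =P T) => [eT|]; last by rewrite mulr0.
case/negP: dST; rewrite -eT -eVS -finset.setI_eq0 finset.setIC; apply/eqP.
by rewrite finset.setIC finset.setIDA finset.setDIl finset.setDv finset.set0I.
Qed.

Lemma disjointsU S T U :
  [disjoint S :|: T & U] = [disjoint S & U] && [disjoint T & U].
Proof. by rewrite -!finset.setI_eq0 finset.setIUl finset.setU_eq0. Qed.

(** On monomials both sides vanish unless the three sets are pairwise disjoint, and then both signs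
    count the inversions of the pairs (S,T), (S,U) and (T,U). *)
Lemma ewedgeA a b c : ewedge a (ewedge b c) = ewedge (ewedge a b) c.
Proof.
elim/ext_ind: a => [|a a' h h'|k a h|S]; rewrite ?ewedge0l //.
- by rewrite !ewedgeDl h h'.
- by rewrite !ewedgeZl h.
elim/ext_ind: b => [|b b' h h'|k b h|T]; rewrite ?ewedge0l ?ewedge0r ?ewedge0l //.
- by rewrite !(ewedgeDl, ewedgeDr) h h'.
- by rewrite !(ewedgeZl, ewedgeZr) h.
elim/ext_ind: c => [|c c' h h'|k c h|U]; rewrite ?ewedge0r //.
- by rewrite !ewedgeDr h h'.
- by rewrite !ewedgeZr h.
rewrite !ewedge_mono; case: ifPn => dTU; last first.
  rewrite ewedge0r; case: ifPn; rewrite ?ewedge0l // => dST.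
  rewrite ewedgeZl ewedge_mono disjointsU (negbTE dTU) andbF scaler0.
  by [].
rewrite ewedgeZr ewedge_mono.
have -> : [disjoint S & T :|: U] = [disjoint S & T] && [disjoint S & U].
  by rewrite ![[disjoint S & _]]disjoint_sym disjointsU.
case: (boolP [disjoint S & T]) => dST; rewrite /= ?ewedge0l ?scaler0 //.
rewrite ewedgeZl ewedge_mono disjointsU dTU andbT; case: ifPn => dSU; rewrite ?scaler0 //.
rewrite !scalerA finset.setUA; congr (_ *: _).
by rewrite (esgnUr _ dTU) (esgnUl _ dST); ring.
Qed.

Lemma ewedge1l a : ewedge (eone K G) a = a.
Proof.
elim/ext_ind: a => [|a a' h h'|k a h|S]; rewrite ?ewedge0r //.
- by rewrite !ewedgeDr h h'.
- by rewrite !ewedgeZr h.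
by rewrite /eone ewedge_mono -finset.setI_eq0 finset.set0I eqxx finset.set0U esgn0l scale1r.
Qed.

Lemma ewedge1r a : ewedge a (eone K G) = a.
Proof.
elim/ext_ind: a => [|a a' h h'|k a h|S]; rewrite ?ewedge0l //.
- by rewrite !ewedgeDl h h'.
- by rewrite !ewedgeZl h.
by rewrite /eone ewedge_mono -finset.setI_eq0 finset.setI0 eqxx finset.setU0 esgn0r scale1r.
Qed.

Lemma epowS a k : epow a k.+1 = ewedge a (epow a k).
Proof. by []. Qed.

Lemma enum_rank_index (x : G) : enum_rank x = index x (enum G) :> nat.
Proof.
rewrite -{2}(enum_rankK x) (enum_val_nth x) index_uniq ?enum_uniq //.
by rewrite -cardE; apply: ltn_ord.
Qed.

(** [esubst] multiplies along [enum S] while [esgn] compares [enum_rank]; this reconciles the two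
    orders. *)
Lemma enum_sorted S :
  sorted (fun x y : G => (enum_rank x < enum_rank y)%N) (enum S).
Proof.
rewrite (_ : enum S = [seq x <- enum G | x \in S]); last by rewrite enumT.
apply: sorted_filter; first by move=> x y z; apply: ltn_trans.
have [x0 _|G0] := pickP (xpredT : pred G); last first.
  by case e: (enum G) => [//|x l]; have := G0 x.
apply/(sortedP x0) => i hi; rewrite !enum_rank_index !index_uniq ?enum_uniq //.
exact: ltnW.
Qed.

Lemma enum_setU1 (x : G) S :
  x \notin S -> {in S, forall y, (enum_rank x < enum_rank y)%N} ->
  enum (x |: S) = x :: enum S.
Proof.
move=> xS minx.
have tr : transitive (fun u v : G => (enum_rank u < enum_rank v)%N).
  by move=> u v w; apply: ltn_trans.
apply: (@irr_sorted_eq _ _ tr); first by move=> u; rewrite /= ltnn.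
- exact: enum_sorted.
- rewrite /= (path_sortedE tr) enum_sorted andbT.
  by apply/allP => y; rewrite mem_enum => /minx.
- by move=> y; rewrite inE !mem_enum !inE.
Qed.

(** The set grows by a new smallest generator, which stands first in [enum] and so contributes no
    sign. *)
Lemma set_rank_ind (P : {set G} -> Prop) : P finset.set0 ->
  (forall x S, x \notin S -> {in S, forall y, (enum_rank x < enum_rank y)%N} ->
    P S -> P (x |: S)) -> forall S, P S.
Proof.
move=> P0 PS S; elim: {S}#|S| {-2}S (erefl #|S|) => [|m IH] S cS.
  by move/eqP: cS; rewrite cards_eq0 => /eqP ->.
have [x0 x0S] : exists x, x \in S by apply/card_gt0P; rewrite cS.
have [x xS minx] := arg_minnP (fun y : G => enum_rank y : nat) x0S.
rewrite -(finset.setD1K xS); apply: PS; rewrite ?inE ?eqxx //.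
  move=> y; rewrite !inE => /andP[nyx yS].
  rewrite ltn_neqAle minx // andbT.
  by apply: contra nyx => /eqP/val_inj/enum_rank_inj ->.
have {}xS : x \in S by [].
by apply: IH; move: cS; rewrite (cardsD1 x S) xS => -[].
Qed.

Lemma esgn_min (x : G) S :
  {in S, forall y, (enum_rank x < enum_rank y)%N} -> esgn K [set x]%SET S = 1.
Proof.
move=> minx.
rewrite /esgn [X in #|pred_of_set X|](_ : _ = finset.set0) ?cards0 ?expr0 //.
apply/setP => u; rewrite !inE; apply/negbTE; apply: contraTN isT.
case/and3P => /eqP -> /minx h1 h2.
by have := ltn_trans h1 h2; rewrite ltnn.
Qed.

Definition eone_form a := exists l : G -> K, a = \sum_x l x *: egen K x.

Lemma egen_sqr (x : G) : ewedge (egen K x) (egen K x) = 0.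
Proof. by rewrite /egen ewedge_mono -finset.setI_eq0 finset.setIid -cards_eq0 cards1. Qed.

Lemma egenC (x y : G) : ewedge (egen K x) (egen K y) = - ewedge (egen K y) (egen K x).
Proof.
rewrite /egen !ewedge_mono disjoint_sym.
case: ifPn => d; rewrite ?oppr0 // finset.setUC -scaleNr; congr (_ *: _).
rewrite !esgn11; have nxy : x != y.
  apply: contraTneq d => ->.
  by rewrite -finset.setI_eq0 finset.setIid -cards_eq0 cards1.
case: (ltngtP (enum_rank x) (enum_rank y)) => //= h.
  by rewrite expr1 expr0 opprK.
by move/val_inj/enum_rank_inj: h nxy => ->; rewrite eqxx.
Qed.

Lemma one_formC a b : eone_form a -> eone_form b -> ewedge a b = - ewedge b a.
Proof.
move=> [l ->] [m ->]; rewrite ewedge_suml ewedge_sumr -sumrN.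
under eq_bigr do rewrite ewedge_sumr.
under [RHS]eq_bigr do rewrite ewedge_suml -sumrN.
apply: eq_bigr => y _; apply: eq_bigr => x _.
by rewrite !(ewedgeZl, ewedgeZr) egenC !scalerN !scalerA mulrC.
Qed.

(** Anticommutation alone does not give this in characteristic 2. The double sum is peeled off one
    generator at a time: the square of the generator is zero and its mixed terms cancel in pairs. *)
Lemma one_form_sqr a : eone_form a -> ewedge a a = 0.
Proof.
move=> [l ->]; rewrite ewedge_suml; under eq_bigr do rewrite ewedge_sumr.
elim: (index_enum G) => [|x r IH]; first by rewrite big_nil.
rewrite big_cons big_cons ewedgeZl ewedgeZr egen_sqr !scaler0 add0r.
under [X in _ + X]eq_bigr do rewrite big_cons.
rewrite big_split /= IH addr0 -big_split big1 //= => y _.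
by rewrite !(ewedgeZl, ewedgeZr) egenC !scalerN !scalerA mulrC addNr.
Qed.

Lemma egen_one_form (x : G) : eone_form (egen K x).
Proof.
exists (fun y => (y == x)%:R); rewrite (bigD1 x) //= eqxx scale1r big1 ?addr0 //.
by move=> y /negbTE ->; rewrite scale0r.
Qed.

Lemma one_formD a b : eone_form a -> eone_form b -> eone_form (a + b).
Proof.
move=> [l ->] [m ->]; exists (fun x => l x + m x); rewrite -big_split.
by apply: eq_bigr => x _; rewrite scalerDl.
Qed.

Lemma one_formZ k a : eone_form a -> eone_form (k *: a).
Proof.
move=> [l ->]; exists (fun x => k * l x); rewrite scaler_sumr.
by apply: eq_bigr => x _; rewrite scalerA.
Qed.

Lemma one_form_sum (I : Type) (r : seq I) (P : pred I) (F : I -> ext K G) :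
  (forall i, P i -> eone_form (F i)) -> eone_form (\sum_(i <- r | P i) F i).
Proof.
move=> hF; elim/big_ind: _ => // [|]; last exact: one_formD.
by exists (fun _ => 0); rewrite big1 // => x _; rewrite scale0r.
Qed.

End ExteriorAlgebra.

(** * Algebra morphisms given by the substitution of 1-forms *)

Section Substitution.
Variables (K : fieldType) (G H : finType) (theta : G -> ext K H).
Implicit Types (a b : ext K G) (S T : {set G}).
Local Open Scope set_scope.
Local Open Scope ring_scope.

Definition etheta S := ewedges [seq theta x | x <- enum S].

Lemma esubstD a b : esubst theta (a + b) = esubst theta a + esubst theta b.
Proof.
by rewrite /esubst -big_split; apply: eq_bigr => S _; rewrite ffunE scalerDl.
Qed.

Lemma esubstZ k a : esubst theta (k *: a) = k *: esubst theta a.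
Proof.
rewrite /esubst scaler_sumr; apply: eq_bigr => S _.
by rewrite ffunE scalerA.
Qed.

Lemma esubst0 : esubst theta 0 = 0.
Proof. by rewrite -(scale0r (0 : ext K G)) esubstZ scale0r. Qed.

Lemma esubst_sum (I : Type) (r : seq I) (P : pred I) (F : I -> ext K G) :
  esubst theta (\sum_(i <- r | P i) F i) = \sum_(i <- r | P i) esubst theta (F i).
Proof.
by elim/big_rec2: _ => [|i y x _ <-]; rewrite ?esubst0 ?esubstD.
Qed.

Lemma esubst_mono S : esubst theta (emono K S) = etheta S.
Proof.
rewrite /esubst (bigD1 S) //= big1 ?addr0; first by rewrite ffunE eqxx scale1r.
by move=> T /negbTE neTS; rewrite ffunE neTS scale0r.
Qed.

Lemma esubst_one : esubst theta (eone K G) = eone K H.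
Proof. by rewrite esubst_mono /etheta enum_set0. Qed.

Lemma esubst_gen x : esubst theta (egen K x) = theta x.
Proof. by rewrite esubst_mono /etheta enum_set1 /= ewedge1r. Qed.

Hypothesis theta1 : forall x, eone_form (theta x).

(** Insertion sort: [theta x] moves to the right past the factors of lower rank, and each exchange
    costs one of the signs counted by [esgn]. If [x] is already in [S], the move ends at a square,
    which is zero. *)
Lemma etheta_insert x S : ewedge (theta x) (etheta S) =
  if x \in S then 0 else esgn K [set x]%SET S *: etheta (x |: S).
Proof.
elim/set_rank_ind: S => [|y S yS miny IH].
  by rewrite inE finset.setU0 esgn0r scale1r /etheta enum_set0 enum_set1.
have eyS : etheta (y |: S) = ewedge (theta y) (etheta S).
  by rewrite /etheta enum_setU1.
rewrite !inE; case: (x =P y) => [->|/eqP nxy] /=.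
  by rewrite eyS ewedgeA (one_form_sqr (theta1 y)) ewedge0l.
have dyS : [disjoint [set y]%SET & S] by rewrite disjoints1.
case: (ltngtP (enum_rank x) (enum_rank y)) => hxy.
- have minx : {in y |: S, forall z, (enum_rank x < enum_rank z)%N}.
    by move=> z; rewrite !inE => /orP[/eqP->//|/miny]; apply: ltn_trans.
  have xS : x \notin y |: S by apply: contraTN isT => /minx; rewrite ltnn.
  have := xS; rewrite !inE (negbTE nxy) /= => /negbTE ->.
  by rewrite esgn_min // scale1r [in RHS]/etheta enum_setU1.
- rewrite eyS ewedgeA (one_formC (theta1 x) (theta1 y)) ewedgeNl -ewedgeA IH.
  case: ifPn => xS; first by rewrite ewedge0r oppr0.
  rewrite ewedgeZr -scaleNr esgnUr // esgn11 hxy expr1 mulN1r; congr (_ *: _).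
  rewrite finset.setUCA /etheta [in RHS]enum_setU1 //.
    by rewrite !inE eq_sym (negbTE nxy) (negbTE yS).
  by move=> z; rewrite !inE => /orP[/eqP->//|/miny].
- by move/val_inj/enum_rank_inj: hxy nxy => ->; rewrite eqxx.
Qed.

Lemma etheta_mul S T : ewedge (etheta S) (etheta T) =
  if [disjoint S & T] then esgn K S T *: etheta (S :|: T) else 0.
Proof.
elim/set_rank_ind: S T => [|x S xS minx IH] T.
  rewrite -finset.setI_eq0 finset.set0I eqxx finset.set0U esgn0l scale1r.
  by rewrite /etheta enum_set0 /= ewedge1l.
rewrite {1}/etheta enum_setU1 //= -/(etheta S) -ewedgeA IH disjointsU disjoints1.
case: (boolP [disjoint S & T]) => dST; rewrite ?ewedge0r ?andbF //.
rewrite ewedgeZr etheta_insert inE (negbTE xS) /= andbT.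
case: ifPn => xT; rewrite /= ?scaler0 //.
rewrite scalerA finset.setUA; congr (_ *: _).
rewrite esgnUr // esgnUl ?disjoints1 //.
by rewrite esgn_min // mul1r mulrC.
Qed.

(** The universal property of the exterior algebra: 1-forms anticommute and square to zero, so their
    products obey the multiplication table of the monomials ([etheta_mul]). *)
Lemma esubstM a b : esubst theta (ewedge a b) = ewedge (esubst theta a) (esubst theta b).
Proof.
elim/ext_ind: a => [|a a' h h'|k a h|S].
- by rewrite ewedge0l esubst0 ewedge0l.
- by rewrite ewedgeDl !esubstD ewedgeDl h h'.
- by rewrite ewedgeZl !esubstZ ewedgeZl h.
elim/ext_ind: b => [|b b' h h'|k b h|T].
- by rewrite ewedge0r esubst0 ewedge0r.
- by rewrite ewedgeDr !esubstD ewedgeDr h h'.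
- by rewrite ewedgeZr !esubstZ ewedgeZr h.
rewrite ewedge_mono !esubst_mono etheta_mul; case: ifP => _.
  by rewrite esubstZ esubst_mono.
by rewrite esubst0.
Qed.

Lemma esubst_wedges (s : seq (ext K G)) :
  esubst theta (ewedges s) = ewedges [seq esubst theta a | a <- s].
Proof.
elim: s => [|a s IH] /=; first exact: esubst_one.
by rewrite esubstM IH.
Qed.

Lemma esubst_pow a k : esubst theta (epow a k) = epow (esubst theta a) k.
Proof.
elim: k => [|k IH] /=; first exact: esubst_one.
by rewrite esubstM IH.
Qed.

End Substitution.

(** Only the outer substitution has to be multiplicative, since the inner one is simply expanded by
    definition. *)
Lemma esubst_comp (K : fieldType) (G H L : finType) (theta : G -> ext K H)
    (theta' : H -> ext K L) (a : ext K G) :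
  (forall x, eone_form (theta' x)) ->
  esubst theta' (esubst theta a) = esubst (fun x => esubst theta' (theta x)) a.
Proof.
move=> h; rewrite {2}/esubst esubst_sum; apply: eq_bigr => S _.
by rewrite esubstZ esubst_wedges // -map_comp.
Qed.

Lemma eq_esubst (K : fieldType) (G H : finType) (theta theta' : G -> ext K H)
    (a : ext K G) : theta =1 theta' -> esubst theta a = esubst theta' a.
Proof. by move=> e; apply: eq_bigr => S _; rewrite (eq_map e). Qed.

Local Open Scope classical_set_scope.
Local Open Scope ring_scope.

(** * Real-valued modulus, and a norm on the exterior algebra *)

Section ComplexModulus.
Variable R : realType.
Local Notation C := R[i].
Implicit Types x y : C.

(** The norm of [R[i]] takes its values in [R[i]]; estimates against real quantities call for a
    modulus in [R]. *)
Definition cn x : R := Normc.normc x.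
Arguments cn : simpl never.

Lemma cnE x : cn x = Num.sqrt (complex.Re x ^+ 2 + complex.Im x ^+ 2).
Proof. by case: x. Qed.

Lemma cn_ge0 x : 0 <= cn x.
Proof. by rewrite cnE sqrtr_ge0. Qed.

Lemma cn0 : cn 0 = 0.
Proof. exact: Normc.normc0. Qed.

Lemma cn1 : cn 1 = 1.
Proof. exact: Normc.normc1. Qed.

Lemma cn0_eq0 x : cn x = 0 -> x = 0.
Proof. exact: Normc.eq0_normc. Qed.

Lemma cnM x y : cn (x * y) = cn x * cn y.
Proof. exact: Normc.normcM. Qed.

Lemma cnV x : cn x^-1 = (cn x)^-1.
Proof. exact: Normc.normcV. Qed.

Lemma normrcE x : `|x| = (cn x)%:C%C.
Proof. by rewrite normc_def cnE. Qed.

Lemma cnD x y : cn (x + y) <= cn x + cn y.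
Proof.
have := ler_normD x y; rewrite !normrcE -rmorphD /=.
by rewrite lecE /= => /andP[].
Qed.

Lemma cnN x : cn (- x) = cn x.
Proof. by rewrite !cnE; case: x => a b /=; rewrite !sqrrN. Qed.

Lemma conjE x : x^* = (complex.Re x -i* complex.Im x)%C.
Proof. by case: x. Qed.

Lemma cn_conj x : cn (x^*) = cn x.
Proof. by rewrite conjE !cnE /= sqrrN. Qed.

Lemma cnX x k : cn (x ^+ k) = cn x ^+ k.
Proof. by elim: k => [|k IH]; rewrite ?expr0 ?cn1 // !exprS cnM IH. Qed.

Lemma cn_sum (I : Type) (r : seq I) (P : pred I) (F : I -> C) :
  cn (\sum_(i <- r | P i) F i) <= \sum_(i <- r | P i) cn (F i).
Proof.
elim/big_rec2: _ => [|i y x _ h]; first by rewrite cn0.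
by apply: (le_trans (cnD _ _)); rewrite lerD2l.
Qed.

Lemma cn_prod (I : Type) (r : seq I) (P : pred I) (F : I -> C) :
  cn (\prod_(i <- r | P i) F i) = \prod_(i <- r | P i) cn (F i).
Proof. by elim/big_rec2: _ => [|i y x _ <-]; rewrite ?cn1 ?cnM. Qed.

Lemma cn_rc (r : R) : cn (rc r) = `|r|.
Proof. by rewrite cnE /= expr0n addr0 sqrtr_sqr. Qed.

Lemma cn_Re x : `|complex.Re x| <= cn x.
Proof.
rewrite cnE -sqrtr_sqr ler_wsqrtr // lerDl; exact: sqr_ge0.
Qed.

Lemma cn_Im x : `|complex.Im x| <= cn x.
Proof.
rewrite cnE -sqrtr_sqr ler_wsqrtr // lerDr; exact: sqr_ge0.
Qed.

Lemma cn_le x : cn x <= `|complex.Re x| + `|complex.Im x|.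
Proof.
rewrite cnE -(ler_pXn2r (ltn0Sn 1)) ?nnegrE ?sqrtr_ge0 ?addr_ge0 //.
rewrite sqr_sqrtr ?addr_ge0 ?sqr_ge0 // sqrrD !real_normK ?num_real //.
by rewrite -addrA lerD2l lerDr mulrn_wge0 // mulr_ge0.
Qed.

Lemma cn_sqr x : cn x ^+ 2 = complex.Re x ^+ 2 + complex.Im x ^+ 2.
Proof. by rewrite cnE sqr_sqrtr ?addr_ge0 ?sqr_ge0. Qed.

Lemma mul_conj x : x * x^* = rc (cn x ^+ 2).
Proof.
rewrite cn_sqr conjE; case: x => a b; rewrite /rc /=.
by apply/eqP; rewrite eq_complex /= ; apply/andP; split; apply/eqP; ring.
Qed.

Lemma cn_nat k : cn (k%:R) = k%:R.
Proof.
have -> : (k%:R : C) = rc k%:R by rewrite /rc -(rmorph_nat (@real_complex R)).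
by rewrite cn_rc normr_nat.
Qed.

Lemma cn_sign (b : bool) : cn ((-1) ^+ b) = 1.
Proof. by case: b; rewrite ?expr1 ?expr0 ?cnN cn1. Qed.

Lemma rcD (a b : R) : rc (a + b) = rc a + rc b.
Proof. by apply/eqP; rewrite eq_complex /= addr0 !eqxx. Qed.

Lemma rcV (a : R) : rc (a^-1) = (rc a)^-1.
Proof. by rewrite /rc -(fmorphV (@real_complex R)). Qed.

Lemma rc_sum (I : Type) (r : seq I) (P : pred I) (F : I -> R) :
  rc (\sum_(i <- r | P i) F i) = \sum_(i <- r | P i) rc (F i).
Proof. by elim/big_rec2: _ => [|i y x _ <-]; rewrite ?rcD. Qed.

Lemma cn_twopii : 0 < cn (twopii R).
Proof.
rewrite /twopii cnM cn_rc cnE /= expr1n expr0n add0r sqrtr1 mulr1.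
by rewrite gtr0_norm ?mulr_gt0 ?pi_gt0.
Qed.

Lemma twopii_neq0 : twopii R != 0.
Proof. by apply/eqP => h; have := cn_twopii; rewrite h cn0 ltxx. Qed.

End ComplexModulus.
#[global] Arguments cn {R} x : simpl never.

Section ExtNorm.
Variable R : realType.
Local Notation C := R[i].

(** The l^1 norm of the coefficients is preferred because it is submultiplicative for the wedge
    product with constant 1. *)
Definition enrm (G : finType) (a : ext C G) : R := \sum_S cn (a S).

Section One.
Variable G : finType.
Implicit Types a b : ext C G.

Lemma enrm_ge0 a : 0 <= enrm a.
Proof. by apply: sumr_ge0 => S _; exact: cn_ge0. Qed.

Lemma cn_enrm a S : cn (a S) <= enrm a.
Proof.
rewrite /enrm (bigD1 S) //= lerDl; apply: sumr_ge0 => T _; exact: cn_ge0.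
Qed.

Lemma enrm0 : enrm (0 : ext C G) = 0.
Proof. by rewrite /enrm big1 // => S _; rewrite ffunE cn0. Qed.

Lemma enrmD a b : enrm (a + b) <= enrm a + enrm b.
Proof.
by rewrite /enrm -big_split; apply: ler_sum => S _; rewrite ffunE cnD.
Qed.

Lemma enrmZ (k : C) a : enrm (k *: a) = cn k * enrm a.
Proof.
by rewrite /enrm mulr_sumr; apply: eq_bigr => S _; rewrite ffunE -cnM.
Qed.

Lemma enrmN a : enrm (- a) = enrm a.
Proof. by apply: eq_bigr => S _; rewrite ffunE cnN. Qed.

Lemma enrmB a b : enrm (a - b) <= enrm a + enrm b.
Proof. by rewrite -(enrmN b) enrmD. Qed.

Lemma enrm_sum (I : Type) (r : seq I) (P : pred I) (F : I -> ext C G) :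
  enrm (\sum_(i <- r | P i) F i) <= \sum_(i <- r | P i) enrm (F i).
Proof.
elim/big_rec2: _ => [|i y x _ h]; first by rewrite enrm0.
by apply: (le_trans (enrmD _ _)); rewrite lerD2l.
Qed.

Lemma enrm_mono (S : {set G}) : enrm (emono C S) = 1.
Proof.
rewrite /enrm (bigD1 S) //= big1 ?addr0; first by rewrite ffunE eqxx cn1.
by move=> T /negbTE neT; rewrite ffunE neT cn0.
Qed.

Lemma cn_esgn (S T : {set G}) : cn (esgn C S T) = 1.
Proof. by rewrite /esgn cnX cnN cn1 expr1n. Qed.

Lemma enrmM a b : enrm (ewedge a b) <= enrm a * enrm b.
Proof.
rewrite [a in ewedge a](ext_sum a) ewedge_suml (le_trans (enrm_sum _ _ _))//.
rewrite {2}/enrm mulr_suml; apply: ler_sum => S _.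
rewrite ewedgeZl enrmZ ler_wpM2l ?cn_ge0 //.
rewrite [b in ewedge _ b](ext_sum b) ewedge_sumr (le_trans (enrm_sum _ _ _))//.
apply: ler_sum => T _; rewrite ewedgeZr enrmZ ler_piMr ?cn_ge0 //.
rewrite ewedge_mono; case: ifP => _; last by rewrite enrm0 ler01.
by rewrite enrmZ cn_esgn mul1r enrm_mono.
Qed.

Lemma enrm_pow a k : enrm (epow a k) <= enrm a ^+ k.
Proof.
elim: k => [|k IH]; first by rewrite expr0 /= enrm_mono.
by rewrite exprS; apply: (le_trans (enrmM _ _)); rewrite ler_wpM2l ?enrm_ge0.
Qed.

Lemma enrm_wedges (s : seq (ext C G)) :
  enrm (ewedges s) <= \prod_(a <- s) enrm a.
Proof.
elim: s => [|a s IH]; first by rewrite big_nil enrm_mono.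
by rewrite big_cons /=; apply: (le_trans (enrmM _ _)); rewrite ler_wpM2l ?enrm_ge0.
Qed.

Lemma enrm_part (P : pred {set G}) a : enrm (epart P a) <= enrm a.
Proof.
by apply: ler_sum => S _; rewrite ffunE; case: ifP => _ //; rewrite cn0 cn_ge0.
Qed.

End One.

Lemma cn_edot (n nu : nat) (a b : ext C (gens (n + nu))) : cn (edot a b) <= enrm a * enrm b.
Proof.
rewrite /edot (le_trans (cn_sum _ _ _))// mulr_suml; apply: ler_sum => S _.
by rewrite cnM cn_conj ler_wpM2l ?cn_ge0 // cn_enrm.
Qed.

(** A monomial has at most [#|G|] factors, each of norm at most [M]; the condition [1 <= M] allows
    the exponent to be raised to [#|G|] uniformly. *)
Lemma enrm_subst (G H : finType) (theta : G -> ext C H) (M : R) (a : ext C G) :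
  1 <= M -> (forall x, enrm (theta x) <= M) ->
  enrm (esubst theta a) <= M ^+ #|G| * enrm a.
Proof.
move=> M1 hM; rewrite /esubst (le_trans (enrm_sum _ _ _)) // {2}/enrm mulr_sumr.
apply: ler_sum => S _; rewrite enrmZ mulrC ler_wpM2r ?cn_ge0 //.
rewrite (le_trans (enrm_wedges _)) // big_map.
apply: (@le_trans _ _ (\prod_(x <- enum S) M)).
  by apply: ler_prod => x _; rewrite enrm_ge0 hM.
rewrite big_const_seq count_predT iter_mulr_1 -cardE ler_weXn2l // max_card //.
Qed.

End ExtNorm.

(** * Calculus of functions of class C^k, real and complex, and coordinates on C^N *)

Section CkCalculus.
Variables (R : realType) (V : normedModType R).
Implicit Types (U : set V) (f g : V -> R^o) (k : nat).

Lemma Ck_continuous k U f x : Ck k U f -> U x -> {for x, continuous f}.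
Proof. by case: k => [|k] [] h _ /h. Qed.

Lemma Ck_derivable k U f x v : Ck k.+1 U f -> U x -> derivable f x v.
Proof. by move=> [_ /(_ v)[h _]] /h. Qed.

Lemma Ck_derive k U f v : Ck k.+1 U f -> Ck k U (fun x => 'D_v f x).
Proof. by move=> [_ /(_ v)[]]. Qed.

Lemma CkW k U f : Ck k.+1 U f -> Ck k U f.
Proof.
elim: k f => [|k IH] f [hc hd]; first by split.
by split=> // v; have [h1 h2] := hd v; split=> //; apply: IH.
Qed.

Lemma Ck_sub k U U' f : U' `<=` U -> Ck k U f -> Ck k U' f.
Proof.
move=> sU; elim: k f => [|k IH] f [hc hd]; first by split=> // x /sU; apply: hc.
split; first by move=> x /sU; apply: hc.
by move=> v; have [h1 h2] := hd v; split=> [x /sU/h1//|]; apply: IH.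
Qed.

Lemma open_near_eq U f g x : open U -> U x -> (forall y, U y -> f y = g y) ->
  {near x, f =1 g}.
Proof.
move=> oU Ux e; near=> y; apply: e; near: y; exact: open_nbhs_nbhs.
Unshelve. all: by end_near. Qed.

Lemma open_eq_continuous U f g x : open U -> U x -> (forall y, U y -> f y = g y) ->
  {for x, continuous f} -> {for x, continuous g}.
Proof.
move=> oU Ux e; rewrite /prop_for /continuous_at -(e _ Ux).
by apply: cvg_trans; apply: near_eq_cvg; apply: open_near_eq Ux e.
Qed.

Lemma Ck_eq k U f g : open U -> (forall x, U x -> f x = g x) ->
  Ck k U f -> Ck k U g.
Proof.
move=> oU; elim: k f g => [|k IH] f g e [hc hd].
  by split=> // x Ux; apply: (open_eq_continuous oU Ux e); apply: hc.
split; first by move=> x Ux; apply: (open_eq_continuous oU Ux e); apply: hc.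
move=> v; have [h1 h2] := hd v; split.
  by move=> x Ux; apply: near_eq_derivable (h1 _ Ux); apply: open_near_eq Ux e.
by apply: IH h2 => x Ux; apply: near_eq_derive; apply: open_near_eq Ux e.
Qed.

(** [Ck] refers to the global function ['D_v f], whereas a formula for the derivative is usually
    valid on [U] only. Openness of [U] makes the two interchangeable. *)
Lemma Ck_step k U f : open U -> (forall x, U x -> {for x, continuous f}) ->
  (forall v, exists2 g : V -> R^o,
     forall x, U x -> is_derive x v f (g x) & Ck k U g) ->
  Ck k.+1 U f.
Proof.
move=> oU hc hd; split=> // v; have [g hg Cg] := hd v; split.
  by move=> x /hg [].
by apply: Ck_eq Cg => // x /hg [_ ->].
Qed.

Lemma Ck_is_derive k U f x v : Ck k.+1 U f -> U x -> is_derive x v f ('D_v f x).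
Proof. by move=> h Ux; apply: derivableP; apply: Ck_derivable h Ux. Qed.

Lemma Ck_cst k U (c : R) : Ck k U (fun _ => c : R^o).
Proof.
elim: k c => [|k IH] c; first by split=> // x _; apply: cvg_cst.
split; first by move=> x _; apply: cvg_cst.
move=> v; split; first by move=> x _; apply: derivable_cst.
have := IH 0; congr (Ck k U _).
by apply/funext => x; rewrite derive_cst.
Qed.

Lemma CkD k U f g : open U -> Ck k U f -> Ck k U g ->
  Ck k U (fun x => f x + g x : R^o).
Proof.
move=> oU; elim: k f g => [|k IH] f g hf hg.
  by split=> // x Ux; apply: cvgD; [exact: Ck_continuous hf Ux|exact: Ck_continuous hg Ux].
apply: Ck_step => // [x Ux|v].
  by apply: cvgD; [exact: Ck_continuous hf Ux|exact: Ck_continuous hg Ux].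
exists (fun x => 'D_v f x + 'D_v g x); last by apply: IH; apply: Ck_derive.
move=> x Ux; exact: (is_deriveD (Ck_is_derive v hf Ux) (Ck_is_derive v hg Ux)).
Qed.

Lemma CkM k U f g : open U -> Ck k U f -> Ck k U g ->
  Ck k U (fun x => f x * g x : R^o).
Proof.
move=> oU; elim: k f g => [|k IH] f g hf hg.
  by split=> // x Ux; apply: cvgM; [exact: Ck_continuous hf Ux|exact: Ck_continuous hg Ux].
apply: Ck_step => // [x Ux|v].
  by apply: cvgM; [exact: Ck_continuous hf Ux|exact: Ck_continuous hg Ux].
exists (fun x => f x * 'D_v g x + g x * 'D_v f x).
  move=> x Ux; exact: (is_deriveM (Ck_is_derive v hf Ux) (Ck_is_derive v hg Ux)).
by apply: CkD => //; apply: IH; by [exact: CkW|exact: Ck_derive].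
Qed.

Lemma CkZ k U (c : R) f : open U -> Ck k U f -> Ck k U (fun x => c * f x : R^o).
Proof. by move=> oU; apply: CkM => //; apply: Ck_cst. Qed.

Lemma CkN k U f : open U -> Ck k U f -> Ck k U (fun x => - f x : R^o).
Proof.
move=> oU hf; have := CkZ (-1) oU hf; congr (Ck k U _).
by apply/funext => x; rewrite mulN1r.
Qed.

Lemma CkV k U f : open U -> (forall x, U x -> f x != 0) -> Ck k U f ->
  Ck k U (fun x => (f x)^-1 : R^o).
Proof.
move=> oU nz; elim: k => [|k IH] hf.
  by split=> // x Ux; apply: cvgV; [exact: nz|exact: Ck_continuous hf Ux].
apply: Ck_step => // [x Ux|v].
  by apply: cvgV; [exact: nz|exact: Ck_continuous hf Ux].
exists (fun x => - ((f x)^-1 * (f x)^-1) * 'D_v f x).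
  move=> x Ux; split; first by apply: derivableV; [exact: nz|exact: Ck_derivable hf Ux].
  rewrite deriveV //; [|exact: nz|exact: Ck_derivable hf Ux].
  by rewrite expr2 invfM.
by apply: CkM => //; [apply: CkN => //; apply: CkM => //; apply: IH; exact: CkW|exact: Ck_derive].
Qed.

Lemma Ck_sum k U (I : Type) (r : seq I) (P : pred I) (F : I -> V -> R) :
  open U -> (forall i, P i -> Ck k U (F i)) ->
  Ck k U (fun x => \sum_(i <- r | P i) F i x : R^o).
Proof.
move=> oU hF; elim: r => [|i r IH].
  rewrite (_ : (fun x => _) = (fun _ => 0)); first exact: Ck_cst.
  by apply/funext => x; rewrite big_nil.
case: (boolP (P i)) => Pi.
  rewrite (_ : (fun x => _) = (fun x => F i x + \sum_(j <- r | P j) F j x)).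
    by apply: CkD => //; apply: hF.
  by apply/funext => x; rewrite big_cons Pi.
rewrite (_ : (fun x => _) = (fun x => \sum_(j <- r | P j) F j x)) //.
by apply/funext => x; rewrite big_cons (negbTE Pi).
Qed.

Lemma derive_affine f (a : V) (s : R) x v : derivable f (a + s *: x) v ->
  is_derive x v (fun y => f (a + s *: y)) (s * 'D_v f (a + s *: x)).
Proof.
move=> df.
suff h : (fun h => h^-1 *: (((fun y => f (a + s *: y)) \o shift x) (h *: v) -
    f (a + s *: x))) @ 0^' --> s * 'D_v f (a + s *: x).
  by split; [apply/cvg_ex; exists (s * 'D_v f (a + s *: x))|apply: cvg_lim h].
(* The substitution of s h for h maps punctured neighbourhoods of 0 to such neighbourhoods only if s
   is nonzero; for s = 0 the function is constant. *)
have [->|s0] := eqVneq s 0.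
  rewrite mul0r (_ : (fun h => _) = (fun _ => 0 : R^o)); first exact: cvg_cst.
  by apply/funext => h; rewrite /= !scale0r subrr scaler0.
have -> : (fun h : R => h^-1 *: (((fun y => f (a + s *: y)) \o shift x) (h *: v) -
    f (a + s *: x))) =
  (fun h => s * ((fun h => h^-1 *: ((f \o shift (a + s *: x)) (h *: v) -
    f (a + s *: x))) (s * h))).
  apply/funext => h /=.
  rewrite (_ : a + s *: (h *: v + x) = (s * h) *: v + (a + s *: x)); last first.
    by rewrite scalerDr scalerA addrCA.
  by rewrite /GRing.scale /= mulrA invfM mulrA divff // mul1r.
apply: cvgM; first exact: cvg_cst.
apply: (@cvg_comp _ _ _ (fun h : R => s * h) _ _ 0^' _ _ df).
move=> A [e /= e0 hA]; exists (e / `|s|); first by rewrite /= divr_gt0 ?normr_gt0.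
move=> y /=; rewrite sub0r normrN => ye y0; apply: hA => /=.
  by rewrite sub0r normrN normrM mulrC -ltr_pdivlMr ?normr_gt0.
by rewrite mulf_neq0.
Qed.

Lemma affine_continuous (a : V) (s : R) : continuous (fun y : V => a + s *: y).
Proof.
by move=> x; apply: cvgD; [exact: cvg_cst|exact: scaler_continuous].
Qed.

Lemma open_affine U (a : V) (s : R) : open U -> open [set x | U (a + s *: x)].
Proof. by move=> oU; apply: (open_comp (f := fun y : V => a + s *: y)) => // x _; exact: affine_continuous. Qed.

Lemma Ck_affine k U f (a : V) (s : R) : open U -> Ck k U f ->
  Ck k [set x | U (a + s *: x)] (fun x => f (a + s *: x)).
Proof.
move=> oU; have ca := @affine_continuous a s; have oU' := open_affine a s oU.
elim: k f => [|k IH] f hf.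
  split=> // x /= Ux.
  by apply: (@cvg_comp _ _ _ (fun y : V => a + s *: y) f _ _ _ (ca x)); apply: Ck_continuous hf Ux.
apply: Ck_step => // [x Ux|v].
  by apply: (@cvg_comp _ _ _ (fun y : V => a + s *: y) f _ _ _ (ca x)); apply: Ck_continuous hf Ux.
exists (fun x => s * 'D_v f (a + s *: x)).
  by move=> x Ux; apply: derive_affine; apply: Ck_derivable hf Ux.
by apply: CkZ => //; apply: (IH (fun x => 'D_v f x)); apply: Ck_derive.
Qed.

End CkCalculus.

Section ComplexCk.
Variables (R : realType) (V : normedModType R).
Local Notation C := R[i].
Implicit Types (U : set V) (F G : V -> C).

Definition cCk k U F :=
  Ck k U (fun x => complex.Re (F x)) /\ Ck k U (fun x => complex.Im (F x)).

Lemma ReM (x y : C) : complex.Re (x * y) =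
  complex.Re x * complex.Re y - complex.Im x * complex.Im y.
Proof. by case: x; case: y. Qed.

Lemma ImM (x y : C) : complex.Im (x * y) =
  complex.Re x * complex.Im y + complex.Im x * complex.Re y.
Proof. by case: x; case: y. Qed.

Lemma ReD (x y : C) : complex.Re (x + y) = complex.Re x + complex.Re y.
Proof. by case: x; case: y. Qed.

Lemma ImD (x y : C) : complex.Im (x + y) = complex.Im x + complex.Im y.
Proof. by case: x; case: y. Qed.

Lemma ReN (x : C) : complex.Re (- x) = - complex.Re x.
Proof. by case: x. Qed.

Lemma ImN (x : C) : complex.Im (- x) = - complex.Im x.
Proof. by case: x. Qed.

Lemma ReV (x : C) : complex.Re (x^-1) = complex.Re x * (cn x ^+ 2)^-1.
Proof. by rewrite cn_sqr; case: x. Qed.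

Lemma ImV (x : C) : complex.Im (x^-1) = - (complex.Im x * (cn x ^+ 2)^-1).
Proof. by rewrite cn_sqr; case: x => a b /=. Qed.

Lemma complexP (x y : C) : complex.Re x = complex.Re y ->
  complex.Im x = complex.Im y -> x = y.
Proof. by case: x => a b; case: y => c d /= -> ->. Qed.

Lemma cCk_cst k U (c : C) : cCk k U (fun _ => c).
Proof. by split; apply: Ck_cst. Qed.

Lemma cCkD k U F G : open U -> cCk k U F -> cCk k U G -> cCk k U (fun x => F x + G x).
Proof.
move=> oU [f1 f2] [g1 g2]; split.
  by have := CkD oU f1 g1; congr (Ck k U _); apply/funext => x; rewrite ReD.
by have := CkD oU f2 g2; congr (Ck k U _); apply/funext => x; rewrite ImD.
Qed.

Lemma cCkN k U F : open U -> cCk k U F -> cCk k U (fun x => - F x).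
Proof.
move=> oU [f1 f2]; split.
  by have := CkN oU f1; congr (Ck k U _); apply/funext => x; rewrite ReN.
by have := CkN oU f2; congr (Ck k U _); apply/funext => x; rewrite ImN.
Qed.

Lemma cCkM k U F G : open U -> cCk k U F -> cCk k U G -> cCk k U (fun x => F x * G x).
Proof.
move=> oU [f1 f2] [g1 g2]; split.
  have := CkD oU (CkM oU f1 g1) (CkN oU (CkM oU f2 g2)).
  by congr (Ck k U _); apply/funext => x; rewrite ReM.
have := CkD oU (CkM oU f1 g2) (CkM oU f2 g1).
by congr (Ck k U _); apply/funext => x; rewrite ImM.
Qed.

Lemma cCkV k U F : open U -> (forall x, U x -> F x != 0) -> cCk k U F ->
  cCk k U (fun x => (F x)^-1).
Proof.
move=> oU nz [f1 f2].
have h : Ck k U (fun x => (cn (F x) ^+ 2)^-1 : R^o).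
  apply: CkV => // [x /nz|].
    by apply: contra; rewrite sqrf_eq0 => /eqP /cn0_eq0 ->.
  have := CkD oU (CkM oU f1 f1) (CkM oU f2 f2).
  by congr (Ck k U _); apply/funext => x; rewrite cn_sqr !expr2.
split.
  by have := CkM oU f1 h; congr (Ck k U _); apply/funext => x; rewrite ReV.
have := CkN oU (CkM oU f2 h); congr (Ck k U _); apply/funext => x.
by rewrite ImV.
Qed.

Lemma cCk_sum k U (I : Type) (r : seq I) (P : pred I) (F : I -> V -> C) :
  open U -> (forall i, P i -> cCk k U (F i)) ->
  cCk k U (fun x => \sum_(i <- r | P i) F i x).
Proof.
move=> oU hF; elim: r => [|i r IH].
  have := cCk_cst k U 0; congr (cCk k U _).
  by apply/funext => x; rewrite big_nil.
case: (boolP (P i)) => Pi.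
  have := cCkD oU (hF i Pi) IH; congr (cCk k U _).
  by apply/funext => x; rewrite big_cons Pi.
have := IH; congr (cCk k U _).
by apply/funext => x; rewrite big_cons (negbTE Pi).
Qed.

Lemma cCk_prod k U (I : Type) (r : seq I) (P : pred I) (F : I -> V -> C) :
  open U -> (forall i, P i -> cCk k U (F i)) ->
  cCk k U (fun x => \prod_(i <- r | P i) F i x).
Proof.
move=> oU hF; elim: r => [|i r IH].
  have := cCk_cst k U 1; congr (cCk k U _).
  by apply/funext => x; rewrite big_nil.
case: (boolP (P i)) => Pi.
  have := cCkM oU (hF i Pi) IH; congr (cCk k U _).
  by apply/funext => x; rewrite big_cons Pi.
have := IH; congr (cCk k U _).
by apply/funext => x; rewrite big_cons (negbTE Pi).
Qed.

Lemma cCk_det k U m (F : 'I_m -> 'I_m -> V -> C) : open U ->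
  (forall i j, cCk k U (F i j)) ->
  cCk k U (fun x => \det (\matrix_(i, j) F i j x)).
Proof.
move=> oU hF; rewrite /determinant; apply: cCk_sum => // s _.
apply: cCkM => //; first exact: cCk_cst.
have : cCk k U (fun x => \prod_i F i (perm.fun_of_perm s i) x).
  by apply: cCk_prod => // i _; apply: hF.
by congr (cCk k U _); apply/funext => x; apply: eq_bigr => i _; rewrite mxE.
Qed.

Lemma cCk_sub k U U' F : U' `<=` U -> cCk k U F -> cCk k U' F.
Proof. by move=> s [h1 h2]; split; apply: Ck_sub s _. Qed.

Lemma csmoothP U F : csmooth U F <-> forall k, cCk k U F.
Proof.
by split=> [[h1 h2] k|h]; split=> // k; have [] := h k.
Qed.

End ComplexCk.

Section Coordinates.
Variables (R : realType) (N : nat).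
Local Notation C := R[i].
Local Notation E := (Cn R N).
Implicit Types (a b z : E).

Definition mkCn (w : 'I_N -> C) : E :=
  (\row_j complex.Re (w j), \row_j complex.Im (w j)).

Lemma crdK (w : 'I_N -> C) j : crd (mkCn w) j = w j.
Proof. by rewrite /crd /mkCn /= !mxE; case: (w j). Qed.

Lemma mkCnK z : mkCn (crd z) = z.
Proof.
by case: z => x y; congr pair; apply/rowP => j; rewrite !mxE /crd.
Qed.

Lemma crdP a b : (forall j, crd a j = crd b j) -> a = b.
Proof. by move=> e; rewrite -(mkCnK a) -(mkCnK b); congr mkCn; apply/funext. Qed.

Lemma crdD a b j : crd (a + b) j = crd a j + crd b j.
Proof. by apply: complexP; rewrite ?ReD ?ImD /= !mxE. Qed.

Lemma crdN a j : crd (- a) j = - crd a j.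
Proof. by apply: complexP; rewrite ?ReN ?ImN /= !mxE. Qed.

Lemma crdB a b j : crd (a - b) j = crd a j - crd b j.
Proof. by rewrite crdD crdN. Qed.

Lemma crdZ (t : R) a j : crd (t *: a) j = rc t * crd a j.
Proof.
by apply: complexP; rewrite ?ReM ?ImM /= !mxE mul0r ?subr0 ?addr0.
Qed.

Lemma crd0 j : crd (0 : E) j = 0.
Proof. by apply: complexP; rewrite /= !mxE. Qed.

Lemma rV_entry_le m (x : 'rV[R]_m) j : `|x 0 j| <= `|x|.
Proof.
rewrite (_ : `|x| = mx_norm x) // mx_normrE.
by apply: (le_bigmax_cond 0 (fun i => `|x i.1 i.2|) (isT : xpredT (0, j))).
Qed.

Lemma rV_norm_le m (x : 'rV[R]_m) (M : R) : 0 <= M ->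
  (forall j, `|x 0 j| <= M) -> `|x| <= M.
Proof.
move=> M0 h; rewrite (_ : `|x| = mx_norm x) // mx_normrE; apply/bigmax_leP; split=> //.
by move=> [i j] _ /=; rewrite (ord1 i).
Qed.

Lemma fst_norm_le (A B : normedModType R) (x : A * B) : `|x.1| <= `|x|.
Proof. by rewrite prod_normE le_max lexx. Qed.

Lemma snd_norm_le (A B : normedModType R) (x : A * B) : `|x.2| <= `|x|.
Proof. by rewrite prod_normE le_max lexx orbT. Qed.

Lemma Re_crd_le a j : `|complex.Re (crd a j)| <= `|a|.
Proof. exact: le_trans (rV_entry_le a.1 j) (fst_norm_le a). Qed.

Lemma Im_crd_le a j : `|complex.Im (crd a j)| <= `|a|.
Proof. exact: le_trans (rV_entry_le a.2 j) (snd_norm_le a). Qed.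

Lemma crd_le a j : cn (crd a j) <= 2 * `|a|.
Proof.
by apply: le_trans (cn_le _) _; rewrite mulr_natl mulr2n lerD ?Re_crd_le ?Im_crd_le.
Qed.

Lemma Cn_norm_le a (M : R) : 0 <= M -> (forall j, cn (crd a j) <= M) -> `|a| <= M.
Proof.
move=> M0 h; rewrite prod_normE ge_max; apply/andP; split.
  by apply: rV_norm_le => // j; apply: le_trans (h j); apply: (cn_Re (crd a j)).
by apply: rV_norm_le => // j; apply: le_trans (h j); apply: (cn_Im (crd a j)).
Qed.

Lemma Cn_norm_sum a : `|a| <= \sum_j cn (crd a j).
Proof.
apply: Cn_norm_le => [|j]; first by apply: sumr_ge0 => j _; exact: cn_ge0.
by rewrite (bigD1 j) //= lerDl; apply: sumr_ge0 => k _; exact: cn_ge0.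
Qed.

Lemma norm_sub_continuous (V : normedModType R) (x0 : V) :
  continuous (fun x : V => `|x - x0|).
Proof.
move=> x; apply: (@cvg_comp _ _ _ (fun y : V => y - x0) (fun y : V => `|y|) _ (nbhs (x - x0))).
  by apply: cvgB; [exact: cvg_id|exact: cvg_cst].
exact: norm_continuous.
Qed.

(** The norm of a pair is the maximum of the two norms, so a ball of C^N is a product of two balls
    of row spaces, each closed and bounded. *)
Lemma closed_ball_compact (z0 : E) (r : R) : compact [set z | `|z - z0| <= r].
Proof.
have cB (m : nat) (x0 : 'rV[R]_m) : compact [set x | `|x - x0| <= r].
  apply: bounded_closed_compact.
    exists (r + `|x0|); split; first exact: num_real.
    move=> M hM x /= hx; apply: ltW; apply: le_lt_trans hM.
    by rewrite -(subrK x0 x); apply: le_trans (ler_normD _ _) _; rewrite lerD2r.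
  rewrite (_ : [set x | _] = (fun x => `|x - x0|) @^-1` [set y | y <= r]) //.
  by apply: (closed_comp _ (@closed_le _ r)) => x _; exact: norm_sub_continuous.
have := compact_setX (cB _ z0.1) (cB _ z0.2); congr compact.
apply/seteqP; split => [[x y] /= [h1 h2]|[x y] /=].
  by rewrite prod_normE ge_max /= h1 h2.
by rewrite prod_normE ge_max /= => /andP[h1 h2]; split.
Qed.

Lemma bounded_closed_compactC (A : set E) (r : R) :
  closed A -> (forall z, A z -> `|z| <= r) -> compact A.
Proof.
move=> cA h; have cB := @closed_ball_compact 0 r; apply: (subclosed_compact cA cB).
by move=> z Az /=; rewrite subr0 h.
Qed.

Lemma Ck_linear (V : normedModType R) (L : V -> R^o) k (U : set V) :
  (forall (a : R) x y, L (a *: x + y) = a * L x + L y) -> continuous L -> Ck k U L.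
Proof.
move=> lL cL; case: k => [|k]; split=> //; try by move=> *; exact: cL.
have LD (v x : V) (t : R) : L (t *: v + x) - L x = t * L v.
  by rewrite lL addrK.
have h v x : is_derive x v L (L v).
  have hl : (fun h : R => h^-1 *: ((L \o shift x) (h *: v) - L x)) @ 0^' --> (L v : R^o).
    apply: (@cvg_trans _ ((fun _ : R => L v : R^o) @ 0^')); last exact: cvg_cst.
    apply: near_eq_cvg; near=> t; rewrite /= LD /GRing.scale /= mulrA mulVf ?mul1r //.
    by near: t; apply: nbhs_dnbhs_neq.
  by split; [apply/cvg_ex; exists (L v)|apply: cvg_lim hl].
move=> v; split; first by move=> x _; apply: ex_derive.
have := Ck_cst k U (L v); congr (Ck k U _); apply/funext => y.
by rewrite (derive_val (is_derive := h v y)).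
Unshelve. all: by end_near. Qed.

Lemma cont_crd_Re j : continuous (fun z : E => complex.Re (crd z j) : R^o).
Proof.
move=> z; apply: (@cvg_comp _ _ _ fst (fun x : 'rV[R]_N => x 0 j) _ _ _ cvg_fst).
exact: coord_continuous.
Qed.

Lemma cont_crd_Im j : continuous (fun z : E => complex.Im (crd z j) : R^o).
Proof.
move=> z; apply: (@cvg_comp _ _ _ snd (fun x : 'rV[R]_N => x 0 j) _ _ _ cvg_snd).
exact: coord_continuous.
Qed.

Lemma crd_cCk k U j : cCk k U (fun z : E => crd z j).
Proof.
split; apply: Ck_linear; try exact: cont_crd_Re; try exact: cont_crd_Im.
  by move=> a x y; rewrite crdD crdZ ReD ReM /= mul0r subr0.
by move=> a x y; rewrite crdD crdZ ImD ImM /= mul0r addr0.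
Qed.

Lemma crd1_cCk k U j : cCk k U (fun p : E * E => crd p.1 j).
Proof.
split; apply: Ck_linear.
- by move=> a x y; rewrite crdD crdZ ReD ReM /= mul0r subr0.
- move=> p; exact: (@cvg_comp _ _ _ fst (fun z : E => complex.Re (crd z j)) _ _ _ cvg_fst (@cont_crd_Re j _)).
- by move=> a x y; rewrite crdD crdZ ImD ImM /= mul0r addr0.
- move=> p; exact: (@cvg_comp _ _ _ fst (fun z : E => complex.Im (crd z j)) _ _ _ cvg_fst (@cont_crd_Im j _)).
Qed.

Lemma crd2_cCk k U j : cCk k U (fun p : E * E => crd p.2 j).
Proof.
split; apply: Ck_linear.
- by move=> a x y; rewrite crdD crdZ ReD ReM /= mul0r subr0.
- move=> p; exact: (@cvg_comp _ _ _ snd (fun z : E => complex.Re (crd z j)) _ _ _ cvg_snd (@cont_crd_Re j _)).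
- by move=> a x y; rewrite crdD crdZ ImD ImM /= mul0r addr0.
- move=> p; exact: (@cvg_comp _ _ _ snd (fun z : E => complex.Im (crd z j)) _ _ _ cvg_snd (@cont_crd_Im j _)).
Qed.

End Coordinates.

(** * Polynomials, their restrictions to lines, and the Hefer coefficients *)

Section Polynomials.
Variable R : realType.
Local Notation C := R[i].

Lemma mevalE m (v : 'I_m -> C) (p : mpoly m C) :
  meval v p = \sum_(k <- msupp p) mcoeff k p * \prod_i v i ^+ (k i).
Proof. by rewrite /meval /mmap. Qed.

Lemma cCkX (V : normedModType R) k (U : set V) (F : V -> C) m : open U ->
  cCk k U F -> cCk k U (fun x => F x ^+ m).
Proof.
move=> oU hF; elim: m => [|m IH].
  by have := cCk_cst k U (1 : C); congr (cCk k U _).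
have := cCkM oU hF IH; congr (cCk k U _).
by apply/funext => x; rewrite exprS.
Qed.

Lemma cCk_meval (V : normedModType R) k (U : set V) m (F : 'I_m -> V -> C)
    (p : mpoly m C) : open U -> (forall i, cCk k U (F i)) ->
  cCk k U (fun x => meval (fun i => F i x) p).
Proof.
move=> oU hF; have : cCk k U (fun x => \sum_(k <- msupp p)
    mcoeff k p * \prod_i F i x ^+ (k i)).
  apply: cCk_sum => // mm _; apply: cCkM => //; first exact: cCk_cst.
  by apply: cCk_prod => // i _; apply: cCkX.
by congr (cCk k U _); apply/funext => x; rewrite mevalE.
Qed.

Lemma homog_supp m (p : mpoly m C) e : p \is @ishomog1 _ _ e mdeg ->
  forall k, k \in msupp p -> mdeg k = e.
Proof. by move/allP => h k /h /eqP. Qed.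

Lemma prod_homog m (k : multinom m) (c : C) :
  \prod_(i < m) c ^+ (k i) = c ^+ (mdeg k).
Proof. by rewrite mdegE expr_sum. Qed.

Lemma meval_homog m (p : mpoly m C) e (c : C) (v : 'I_m -> C) :
  p \is @ishomog1 _ _ e mdeg ->
  meval (fun i => c * v i) p = c ^+ e * meval v p.
Proof.
move=> hp; rewrite !mevalE mulr_sumr; apply: eq_big_seq => k kp.
under eq_bigr do rewrite exprMn.
by rewrite big_split /= prod_homog (homog_supp hp kp) mulrCA.
Qed.

Lemma meval_bound m (p : mpoly m C) e : p \is @ishomog1 _ _ e mdeg ->
  exists2 K : R, 0 <= K & forall (v : 'I_m -> C) (M : R),
    (forall i, cn (v i) <= M) -> 0 <= M -> cn (meval v p) <= K * M ^+ e.
Proof.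
move=> hp; exists (\sum_(k <- msupp p) cn (mcoeff k p)).
  by apply: sumr_ge0 => k _; exact: cn_ge0.
move=> v M hv M0; rewrite mevalE; apply: le_trans (cn_sum _ _ _) _.
rewrite mulr_suml big_seq [leRHS]big_seq; apply: ler_sum => k kp.
rewrite cnM ler_wpM2l ?cn_ge0 // cn_prod -(homog_supp hp kp) mdegE expr_sum.
apply: ler_prod => i _; rewrite cnX exprn_ge0 ?cn_ge0 //=.
by rewrite lerXn2r ?nnegrE ?cn_ge0.
Qed.

(** The restriction of [p] to the line through [v] in the j-th direction, as a univariate
    polynomial. Identities between such restrictions can be checked on values, and partial
    derivatives become [deriv]. *)
Definition mline m (j : 'I_m) (v : 'I_m -> C) (p : mpoly m C) : {poly C} :=
  mmap (@polyC C) (fun k => (v k)%:P + (k == j)%:R *: 'X) p.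

Lemma mlineE m (j : 'I_m) (v : 'I_m -> C) (p : mpoly m C) t :
  (mline j v p).[t] = meval (fun k => v k + (k == j)%:R * t) p.
Proof.
rewrite /mline /mmap mevalE horner_sum; apply: eq_bigr => k _.
rewrite hornerM hornerC horner_prod; congr (_ * _); apply: eq_bigr => i _.
by rewrite horner_exp hornerD hornerC hornerZ hornerX.
Qed.

(** The naturals are pairwise distinct in [C], so a nonzero difference would have more roots than
    its size permits. *)
Lemma poly_fun_inj (p q : {poly C}) : (forall t, p.[t] = q.[t]) -> p = q.
Proof.
move=> h; apply/eqP; rewrite -subr_eq0; apply/negPn/negP => nz.
have := max_poly_roots nz (rs := [seq k%:R | k <- iota 0 (size (p - q)%R)]).
rewrite size_map size_iota ltnn => H; have : true by []; apply/negP.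
apply/negP => _; suff : false by []; apply: H.
  by apply/allP => x _; rewrite rootE hornerD hornerN h subrr.
rewrite map_inj_uniq ?iota_uniq // => a b /eqP; rewrite eqr_nat => /eqP.
by [].
Qed.

(** The property [Q] holds for constants and variables and is stable under products by the Leibniz
    rule, hence holds for monomials; linearity does the rest. *)
Lemma mline_deriv m (j : 'I_m) (v : 'I_m -> C) (p : mpoly m C) :
  (mline j v p)^`() = mline j v (mderiv j p).
Proof.
pose Q p := (mline j v p)^`() = mline j v (mderiv j p).
have lM p1 p2 : mline j v (p1 * p2) = mline j v p1 * mline j v p2.
  by apply: poly_fun_inj => t; rewrite hornerM !mlineE rmorphM.
have lD p1 p2 : mline j v (p1 + p2) = mline j v p1 + mline j v p2.
  by apply: poly_fun_inj => t; rewrite hornerD !mlineE rmorphD.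
have lZ c p1 : mline j v (c *: p1) = c *: mline j v p1.
  by apply: poly_fun_inj => t; rewrite hornerZ !mlineE mevalZ.
have lC c : mline j v (mpolyC m c) = c%:P.
  by apply: poly_fun_inj => t; rewrite hornerC !mlineE mevalC.
have lX k : mline j v (mpolyX C (mnm1 k)) = (v k)%:P + (k == j)%:R *: 'X.
  apply: poly_fun_inj => t.
  by rewrite hornerD hornerC hornerZ hornerX !mlineE mevalXU.
have QM p1 p2 : Q p1 -> Q p2 -> Q (p1 * p2).
  by rewrite /Q mderivM lD !lM derivM => -> ->.
have QC c : Q (mpolyC m c).
  by rewrite /Q mderivC -[0](mpolyC0 m) !lC derivC.
have QX k : Q (mpolyX C (mnm1 k)).
  rewrite /Q lX mderivX derivD derivC add0r derivZ derivX lZ mnmE.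
  case: (k =P j) => [->|nkj] /=; last by rewrite !scale0r.
  rewrite !scale1r; have -> : mnm_sub (mnm1 j) (mnm1 j) = mnm0 :> multinom m.
    by apply/mnmP => i; rewrite mnmBE mnm0E subnn.
  by rewrite mpolyX0 -mpolyC1 lC.
have QXn k e : Q (mpolyX C (mnm1 k) ^+ e).
  elim: e => [|e IH]; first by rewrite expr0 -mpolyC1; apply: QC.
  by rewrite exprS; apply: QM.
have Q1 : Q 1 by rewrite -(mpolyC1 m); exact: QC.
have Q0 : Q 0 by rewrite -(mpolyC0 m); exact: QC.
elim/mpolyind: p => [|c mm p _ _ IH]; first exact: Q0.
have Qmm : Q (mpolyX C mm).
  by rewrite mpolyXE_id; apply: (big_ind Q Q1 QM) => i _; exact: QXn.
by rewrite mderivD mderivZ !lD !lZ derivD derivZ IH Qmm.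
Qed.

End Polynomials.

Section Hefer.
Variables (R : realType) (n nu : nat).
Local Notation C := R[i].
Local Notation N := (n + nu)%N.
Local Notation E := (Cn R N).
Variable f : 'I_nu -> mpoly N C.
Variable d : 'I_nu -> nat.
Variable h : 'I_nu -> 'I_N -> mpoly (N + N)%N C.
Hypothesis hH : hefer f d h.

(** Absorbs the factor 2 pi i of [delta_eta], so that the Hefer identity becomes an exact
    first-order expansion with no constant. *)
Definition hG (p : E * E) (i : 'I_nu) (j : 'I_N) : C := twopii R * hval h i j p.

Lemma hG_diff a b i :
  feval f i a - feval f i b = \sum_j (crd a j - crd b j) * hG (a, b) i j.
Proof.
rewrite -(hH.2 i (a, b)).
rewrite /delta_eta mulr_sumr; apply: eq_bigr => j _.
by rewrite mulrCA.
Qed.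

Lemma hG_cCk (V : normedModType R) k (U : set V) (A B : V -> E) i j : open U ->
  (forall l, cCk k U (fun x => crd (A x) l)) ->
  (forall l, cCk k U (fun x => crd (B x) l)) ->
  cCk k U (fun x => hG (A x, B x) i j).
Proof.
move=> oU hA hB; apply: cCkM => //; first exact: cCk_cst.
apply: (@cCk_meval R V k U _ (fun k x => match fintype.split k with
   | inl a => crd (A x) a | inr a => crd (B x) a end)) => // l.
by case: (fintype.split l).
Qed.

(** Along z + t e_j the Hefer identity reads f_i(z + t e_j) = f_i(z) + t g(t), where g(t) is the
    coefficient at (z + t e_j, z). Comparing derivatives at t = 0, as polynomials in t, identifies
    g(0). *)
Lemma jac_hG z i j : jac f z i j = hG (z, z) i j.
Proof.
pose v k : C := match fintype.split k with inl a => crd z a | inr a => crd z a end.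
rewrite mxE.
have e0 : meval (crd z) (mderiv j (f i)) = (mline j (crd z) (mderiv j (f i))).[0].
  by rewrite mlineE; congr meval; apply/funext => k; rewrite mulr0 addr0.
rewrite e0 -mline_deriv.
pose g : {poly C} := mmap (@polyC C) (fun k : 'I_(N + N) =>
  match fintype.split k with
  | inl a => (crd z a)%:P + (a == j)%:R *: 'X | inr a => (crd z a)%:P end) (h i j).
have gE t : g.[t] = hval h i j (mkCn (fun k => crd z k + (k == j)%:R * t), z).
  rewrite /g /hval mevalE /mmap horner_sum; apply: eq_bigr => k _.
  rewrite hornerM hornerC horner_prod; congr (_ * _); apply: eq_bigr => l _.
  rewrite horner_exp; case: (fintype.split l) => a /=; last by rewrite hornerC.
  by rewrite crdK hornerD hornerC hornerZ hornerX.
have E : mline j (crd z) (f i) = (feval f i z)%:P + 'X * (twopii R *: g).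
  apply: poly_fun_inj => t; rewrite mlineE hornerD hornerC hornerM hornerX hornerZ gE.
  set a := mkCn _; have := hG_diff a z i; rewrite (bigD1 j) //= big1 => [|k nkj].
    rewrite addr0 crdK eqxx mul1r addrAC subrr add0r => <-.
    rewrite addrC subrK /feval; congr meval; apply/funext => k; by rewrite crdK.
  by rewrite crdK (negbTE nkj) mul0r addr0 subrr mul0r.
rewrite E derivD derivC add0r derivM derivX mul1r hornerD hornerM hornerX mul0r.
rewrite addr0 hornerZ gE /hG; congr (_ * hval h i j (_, _)).
by apply: crdP => k; rewrite crdK mulr0 addr0.
Qed.

Lemma hG_homog (t : R) a b i j : hG (t *: a, t *: b) i j =
  rc t ^+ (d i).-1 * hG (a, b) i j.
Proof.
rewrite /hG mulrCA; congr (_ * _); rewrite /hval -(meval_homog _ _ (hH.1 i j)).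
congr meval; apply/funext => k.
by case: (fintype.split k) => l; rewrite crdZ.
Qed.

Lemma hG_bound i j : exists2 K : R, 0 <= K & forall a b (M : R),
  `|a| <= M -> `|b| <= M -> cn (hG (a, b) i j) <= K * M ^+ (d i).-1.
Proof.
have [K K0 hK] := meval_bound (hH.1 i j).
exists (cn (twopii R) * (K * 2 ^+ (d i).-1)); first by rewrite !mulr_ge0 ?cn_ge0 ?exprn_ge0.
move=> a b M ha hb; have M0 : 0 <= M := le_trans (normr_ge0 a) ha.
rewrite cnM -mulrA ler_wpM2l ?cn_ge0 // -mulrA -exprMn; apply: hK; last by rewrite mulr_ge0.
by move=> k; case: (fintype.split k) => l; apply: le_trans (crd_le _ _) _; rewrite ler_wpM2l.
Qed.

End Hefer.

(** * Charts of the regular part, from the Hefer factorisation *)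

Section Columns.
Variables (R : realType) (N : nat).
Local Notation C := R[i].
Local Notation E := (Cn R N).

Definition cvec (a : E) : 'cV[C]_N := \col_j crd a j.
Definition uncol (v : 'cV[C]_N) : E := mkCn (fun j => v j 0).

Lemma crd_uncol v j : crd (uncol v) j = v j 0.
Proof. exact: crdK. Qed.

Lemma cvecK a : uncol (cvec a) = a.
Proof. by apply: crdP => j; rewrite crd_uncol mxE. Qed.

Lemma uncolK v : cvec (uncol v) = v.
Proof. by apply/colP => j; rewrite mxE crd_uncol. Qed.

Lemma cvecB a b : cvec (a - b) = cvec a - cvec b.
Proof. by apply/colP => j; rewrite !mxE crdB. Qed.

Lemma cvec0 : cvec 0 = 0.
Proof. by apply/colP => j; rewrite !mxE crd0. Qed.

Lemma uncolB v w : uncol (v - w) = uncol v - uncol w.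
Proof. by apply: crdP => j; rewrite crdB !crd_uncol !mxE. Qed.

Lemma uncolD v w : uncol (v + w) = uncol v + uncol w.
Proof. by apply: crdP => j; rewrite crdD !crd_uncol !mxE. Qed.

Lemma uncol_mul_le (M : 'M[C]_N) v :
  `|uncol (M *m v)| <= (\sum_i \sum_j cn (M i j)) * (2 * `|uncol v|).
Proof.
apply: le_trans (Cn_norm_sum _) _; rewrite mulr_suml; apply: ler_sum => i _.
rewrite crd_uncol mxE mulr_suml; apply: le_trans (cn_sum _ _ _) _.
apply: ler_sum => j _; rewrite cnM ler_wpM2l ?cn_ge0 // -(crd_uncol v) crd_le.
by [].
Qed.

End Columns.

Section CkMatrix.
Variables (R : realType) (V : normedModType R).
Local Notation C := R[i].

Lemma near_dist (x : V) (e : R) : 0 < e -> \forall y \near x, `|x - y| < e.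
Proof. by move=> e0; apply/nbhs_normP; exists e. Qed.

Lemma lip_cvg (W : normedModType R) (U : set V) (F : V -> W) x (K : R) :
  open U -> U x -> 0 <= K -> (forall y, U y -> `|F x - F y| <= K * `|x - y|) ->
  F @ x --> F x.
Proof.
move=> oU Ux K0 hF; apply/cvgrPdist_lt => e e0.
have K1 : 0 < K + 1 by rewrite ltr_wpDl.
near=> y; have Uy : U y by near: y; exact: open_nbhs_nbhs.
apply: le_lt_trans (hF _ Uy) _.
apply: (@le_lt_trans _ _ ((K + 1) * `|x - y|)); first by rewrite ler_wpM2r // lerDl.
by rewrite mulrC -ltr_pdivlMr //; near: y; apply: near_dist (divr_gt0 e0 K1).
Unshelve. all: by end_near. Qed.

Lemma open_norm_lt (x0 : V) (r : R) : open [set a : V | `|a - x0| < r].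
Proof.
apply: (@open_comp _ _ (fun a : V => `|a - x0|) [set y | y < r]) => [a _|].
  exact: norm_sub_continuous.
exact: open_lt.
Qed.

Lemma cCk_near0 (U : set V) (F : V -> C) x (e : R) : cCk 0 U F -> U x -> 0 < e ->
  \forall y \near x, cn (F y - F x) < e.
Proof.
move=> [hR hI] Ux e0; have e20 : 0 < e / 2 by rewrite divr_gt0.
have cR := Ck_continuous hR Ux; have cI := Ck_continuous hI Ux.
have nR : \forall t \near x, `|complex.Re (F x) - complex.Re (F t)| < e / 2.
  exact: cvgr_dist_lt cR _ e20.
have nI : \forall t \near x, `|complex.Im (F x) - complex.Im (F t)| < e / 2.
  exact: cvgr_dist_lt cI _ e20.
near=> y; apply: le_lt_trans (cn_le _) _; rewrite [e]splitr ReD ImD ReN ImN.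
by apply: ltrD; rewrite distrC; near: y; [exact: nR|exact: nI].
Unshelve. all: by end_near. Qed.

Lemma cCk_near_neq0 (U : set V) (F : V -> C) x : cCk 0 U F -> U x -> F x != 0 ->
  \forall y \near x, F y != 0.
Proof.
move=> hF Ux nz; have c0 : 0 < cn (F x).
  by rewrite lt_neqAle cn_ge0 eq_sym andbT; apply: contra nz => /eqP /cn0_eq0 ->.
apply: filterS (cCk_near0 hF Ux c0) => y; apply: contraTneq => ->.
by rewrite sub0r cnN ltxx.
Qed.

Lemma cCk_invmx k (U : set V) m (M : V -> 'M[C]_m) : open U ->
  (forall i j, cCk k U (fun x => M x i j)) ->
  (forall x, U x -> M x \in unitmx) ->
  forall i j, cCk k U (fun x => invmx (M x) i j).
Proof.
move=> oU hM uM i j.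
have hdet : cCk k U (fun x => \det (M x)).
  have := cCk_det oU hM; congr (cCk k U _); apply/funext => x.
  by congr (\det _); apply/matrixP => a b; rewrite mxE.
have hcof : cCk k U (fun x => cofactor (M x) j i).
  rewrite /cofactor; apply: cCkM => //; first exact: cCk_cst.
  have := @cCk_det R V k U m.-1 (fun a b x => M x (lift j a) (lift i b)) oU
    (fun a b => hM _ _).
  congr (cCk k U _); apply/funext => x.
  by congr (\det _); apply/matrixP => a b; rewrite !mxE.
have h : cCk k U (fun x => (\det (M x))^-1 * cofactor (M x) j i).
  by apply: (cCkM oU) => //; apply: (cCkV oU) => // x /uM; rewrite unitmxE unitfE.
case: h => h1 h2; split.
  by apply: Ck_eq h1 => // x Ux; rewrite /invmx uM // !mxE.
by apply: Ck_eq h2 => // x Ux; rewrite /invmx uM // !mxE.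
Qed.

End CkMatrix.

(** The added rows form a basis of a complement of the row space of [A]; quantifying over an
    arbitrary [l] performs the cast between two equal dimensions. *)
Lemma completion_mx (F : fieldType) m k (A : 'M[F]_(k, m + k)) : \rank A = k ->
  exists B : 'M[F]_(m, m + k), col_mx B A \in unitmx.
Proof.
move=> rA; have e : \rank (A^C)%MS = m by rewrite mxrank_compl rA addnK.
have [B hB] : exists B : 'M[F]_(m, m + k), (B :=: A^C)%MS.
  have : forall l, l = \rank (A^C)%MS -> exists B : 'M[F]_(l, m + k), (B :=: A^C)%MS.
    by move=> l ->; exists (row_base (A^C)%MS); exact: eq_row_base.
  by apply.
exists B; rewrite -row_full_unit /row_full -(addsmxE B A).
rewrite (adds_eqmx hB (eqmx_refl A)) addsmxC.
exact: addsmx_compl_full.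
Qed.

Section Line.
Variables (R : realType) (V : normedModType R).

Lemma line_cvg (x v : V) : (fun t : R => t *: v + x) @ 0^' --> x.
Proof.
suff H : (fun t : R^o => t *: v + x) @ (0 : R^o) --> x by exact: cvg_within_filter H.
have h (t : R^o) : setT t -> `|((0 : R^o) *: v + x) - (t *: v + x)| <= `|v| * `|0 - t|.
  by move=> _; rewrite opprD addrACA subrr addr0 -scalerBl normrZ mulrC.
have := @lip_cvg R R^o V setT (fun t => t *: v + x) 0 `|v| openT I (normr_ge0 v) h.
by rewrite scale0r add0r.
Qed.

Lemma line_near (U : set V) (x v : V) : open U -> U x ->
  \forall t \near (0 : R)^', U (t *: v + x).
Proof. by move=> oU Ux; have := @line_cvg x v; apply; exact: open_nbhs_nbhs. Qed.

Lemma line_comp (W : normedModType R) (F : V -> W) (x v : V) :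
  F @ x --> F x -> (fun t : R => F (t *: v + x)) @ 0^' --> F x.
Proof. by move=> hF; exact: (cvg_comp _ _ (@line_cvg x v) hF). Qed.

End Line.

Section ContractionSurjective.
Variables (R : realType) (V : normedModType R).

(* Minimising [|H a - w|] over the compact ball replaces a fixed point
   iteration: at a minimiser [a] the point [a + (w - H a)] does strictly better
   unless [H a = w]. *)
Lemma contraction_surj (H : V -> V) (z0 : V) (delta : R) (w : V) : 0 < delta ->
  compact [set a | `|a - z0| <= delta] ->
  (forall a b, `|a - z0| <= delta -> `|b - z0| <= delta ->
     `|(H a - H b) - (a - b)| <= 2^-1 * `|a - b|) ->
  `|w - H z0| <= delta / 2 ->
  exists2 a, `|a - z0| <= delta & H a = w.
Proof.
move=> delta0 cB hH hw; set B := [set a | _] in cB.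
have Bz0 : B z0 by rewrite /B /= subrr normr0 ltW.
have cg : {within B, continuous (fun a => `|H a - w| : R^o)}.
  apply/subspace_continuousP => a Ba; apply/cvgrPdist_le => e e0.
  rewrite near_withinE; near=> b => Bb.
  apply: le_trans (ler_dist_dist _ _) _; rewrite opprB addrA subrK.
  have h2 : `|H a - H b| <= 2 * `|a - b|.
    have := hH _ _ Ba Bb; have := normr_ge0 (a - b).
    have : `|H a - H b| <= `|(H a - H b) - (a - b)| + `|a - b|.
      by rewrite -{1}[H a - H b](subrK (a - b)) ler_normD.
    by set x := `|a - b|; set y := `|_ - (a - b)|; set z := `|_|; lra.
  apply: le_trans h2 _; rewrite mulrC -ler_pdivlMr //.
  near: b; have e20 : 0 < e / 2 by rewrite divr_gt0.
  by apply: filterS (near_dist a e20) => b /ltW.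
have [a /set_mem Ba mina] := compact_EVT_min (ex_intro _ z0 Bz0) cB cg.
exists a => //; pose u : V := w - H a; pose a' : V := a + u.
have ea' : a' - a = u by rewrite /a' addrAC subrr add0r.
have Ba' : B a'.
  rewrite /B /=; have -> : a' - z0 = (w - H z0) - ((H a - H z0) - (a - z0)).
    rewrite opprB [a - z0 - _]addrC addrA opprB [w - _ + (_ - _)]addrA subrK.
    by rewrite /a' /u [a + _]addrC addrA.
  apply: le_trans (ler_normB _ _) _; rewrite [delta]splitr lerD //.
  apply: le_trans (hH _ _ Ba Bz0) _.
  by rewrite mulrC ler_wpM2r ?invr_ge0.
have := mina _ (mem_set Ba').
have -> : H a' - w = (H a' - H a) - (a' - a).
  by rewrite ea' /u opprB addrA subrK.
have h1 := hH _ _ Ba' Ba; move: h1; rewrite ea'.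
have -> : `|H a - w| = `|u| by rewrite /u distrC.
move=> h1 h2; apply/esym/eqP; rewrite -subr_eq0 -/u -normr_eq0 eq_le normr_ge0 andbT.
have := le_trans h2 h1; set x := `|u|; lra.
Unshelve. all: by end_near. Qed.

End ContractionSurjective.

Section Chart.
Variables (R : realType) (n nu : nat).
Local Notation C := R[i].
Local Notation N := (n + nu)%N.
Local Notation E := (Cn R N).
Variable f : 'I_nu -> mpoly N C.
Variable d : 'I_nu -> nat.
Variable h : 'I_nu -> 'I_N -> mpoly (N + N)%N C.
Hypothesis hH : hefer f d h.
Local Notation hG := (hG h).
Variables (z0 : E) (Cm : 'M[C]_(n, N)).

(** A matrix-valued difference quotient of [Phi], exact by [Phi_diff] and equal to the Jacobian of
    [Phi] on the diagonal. It replaces Taylor estimates in the inverse function theorem below. *)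
Definition Gam (p : E * E) : 'M[C]_N :=
  col_mx Cm (\matrix_(i, j) hG p i j).

Definition Phi (a : E) : 'cV[C]_N := col_mx (Cm *m cvec a) (\col_i feval f i a).

Lemma Phi_diff a b : Phi a - Phi b = Gam (a, b) *m cvec (a - b).
Proof.
rewrite /Phi /Gam mul_col_mx opp_col_mx add_col_mx; congr col_mx.
  by rewrite -mulmxBr cvecB.
apply/colP => i; rewrite !mxE (hG_diff hH); apply: eq_bigr => j _.
by rewrite !mxE mulrC crdB.
Qed.

Lemma Gam_diag a : Gam (a, a) = col_mx Cm (jac f a).
Proof. by congr col_mx; apply/matrixP => i j; rewrite (jac_hG hH) mxE. Qed.

Lemma Gam_cCk (V : normedModType R) k (U : set V) (A B : V -> E) i j : open U ->
  (forall l, cCk k U (fun x => crd (A x) l)) ->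
  (forall l, cCk k U (fun x => crd (B x) l)) ->
  cCk k U (fun x => Gam (A x, B x) i j).
Proof.
move=> oU hA hB; rewrite /Gam.
case: (splitP i) => l il.
  have -> : i = lshift nu l by exact: val_inj.
  have := cCk_cst k U (Cm l j); congr (cCk k U _); apply/funext => x.
  by rewrite col_mxEu.
have -> : i = rshift n l by exact: val_inj.
have := hG_cCk h l j oU hA hB; congr (cCk k U _); apply/funext => x.
by rewrite col_mxEd mxE.
Qed.

Hypothesis uT : Gam (z0, z0) \in unitmx.
Variable Ti : 'M[C]_N.
Hypothesis TiK : Ti *m Gam (z0, z0) = 1%:M.
Hypothesis TiKr : Gam (z0, z0) *m Ti = 1%:M.

Lemma Gam_near : exists2 delta : R, 0 < delta & forall a b,
  `|a - z0| <= delta -> `|b - z0| <= delta ->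
  Gam (a, b) \in unitmx /\
  (forall v, `|uncol ((Ti *m Gam (a, b) - 1%:M) *m v)| <= 2^-1 * `|uncol v|).
Proof.
pose U := [set: E * E]; have oU : open U := openT.
have hGa i j : cCk 0 U (fun p : E * E => Gam p i j).
  have := @Gam_cCk _ 0 U fst snd i j oU (fun l => crd1_cCk 0 U l) (fun l => crd2_cCk 0 U l).
  by congr (cCk 0 U _); apply/funext => -[].
(* A matrix whose N^2 entries have modulus at most e moves vectors by at most 2 N^2 e times their
   norm, the 2 coming from [uncol_mul_le]. This choice keeps that below 1/2, and the added 1 covers
   N = 0. *)
pose e : R := (4 * (N * N)%:R + 1)^-1.
have e0 : 0 < e by rewrite invr_gt0 ltr_wpDl ?ltr01 // mulr_ge0.
have hM i j : cCk 0 U (fun p => (Ti *m Gam p) i j).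
  have : cCk 0 U (fun p => \sum_k Ti i k * Gam p k j).
    by apply: cCk_sum => // k _; apply: cCkM => //; exact: cCk_cst.
  congr (cCk 0 U _); apply/funext => p; by rewrite [RHS]mxE.
have near1 : \forall p \near ((z0, z0) : E * E), forall ij : 'I_N * 'I_N,
    cn ((Ti *m Gam p) ij.1 ij.2 - (Ti *m Gam (z0, z0)) ij.1 ij.2) < e.
  apply: (@filter_forall _ _ (fun ij p => cn ((Ti *m Gam p) ij.1 ij.2 -
    (Ti *m Gam (z0, z0)) ij.1 ij.2) < e) (nbhs (z0, z0)) _ _) => -[i j] /=.
  exact: (cCk_near0 (hM i j)).
have near2 : \forall p \near ((z0, z0) : E * E), \det (Gam p) != 0.
  apply: (cCk_near_neq0 (U := U)) => //.
  have := cCk_det oU hGa; congr (cCk 0 U _); apply/funext => p.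
  by congr (\det _); apply/matrixP => a b; rewrite mxE.
have [r /= r0 hr] := (nbhs_normP _ _).1 (filterI near1 near2).
exists (r / 2); first by rewrite divr_gt0.
move=> a b ha hb.
have [] : [set p | (forall ij, cn ((Ti *m Gam p) ij.1 ij.2 -
    (Ti *m Gam (z0, z0)) ij.1 ij.2) < e) /\ \det (Gam p) != 0] (a, b).
  apply: hr; rewrite /= distrC prod_normE gt_max; apply/andP; split.
    by apply: le_lt_trans ha _; rewrite gtr_pMr // invf_lt1 // ltr1n.
  by apply: le_lt_trans hb _; rewrite gtr_pMr // invf_lt1 // ltr1n.
move=> h1 h2; split; first by rewrite unitmxE unitfE.
move=> v; apply: le_trans (uncol_mul_le _ _) _.
rewrite mulrA ler_wpM2r //.
have : \sum_i \sum_j cn ((Ti *m Gam (a, b) - 1%:M) i j) <= \sum_(i < N) \sum_(j < N) e.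
  apply: ler_sum => i _; apply: ler_sum => j _; apply: ltW.
  have := h1 (i, j); rewrite TiK /=.
  by rewrite [(_ - 1%:M) i j]mxE [(- 1%:M) i j]mxE.
rewrite !sumr_const !card_ord -mulrnA => H.
apply: le_trans (ler_wpM2r _ H) _ => //.
rewrite -(mulr_natl e) mulrAC /e ler_pdivrMr ?ltr_wpDl ?ltr01 ?mulr_ge0 //.
by lra.
Qed.

Variable delta : R.
Hypothesis delta0 : 0 < delta.
Hypothesis hdelta : forall a b,
  `|a - z0| <= delta -> `|b - z0| <= delta ->
  Gam (a, b) \in unitmx /\
  (forall v, `|uncol ((Ti *m Gam (a, b) - 1%:M) *m v)| <= 2^-1 * `|uncol v|).

(** After composition with [Ti], [Phi] differs from the identity by a map of Lipschitz constant 1/2.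
    Injectivity, surjectivity and the two-sided Lipschitz bounds all follow from this. *)
Lemma Phi_defect a b : `|a - z0| <= delta -> `|b - z0| <= delta ->
  `|uncol (Ti *m (Phi a - Phi b)) - (a - b)| <= 2^-1 * `|a - b|.
Proof.
move=> ha hb; have := (hdelta ha hb).2 (cvec (a - b)).
by rewrite mulmxBl mul1mx -mulmxA -Phi_diff uncolB !cvecK.
Qed.

Lemma Phi_lower a b : `|a - z0| <= delta -> `|b - z0| <= delta ->
  `|a - b| <= 2 * `|uncol (Ti *m (Phi a - Phi b))|.
Proof.
move=> ha hb; have := Phi_defect ha hb; set u := uncol _ => hu.
have : `|a - b| <= `|u| + `|u - (a - b)|.
  by rewrite -{1}[a - b](subKr u) ler_normB.
by move: hu; set x := `|a - b|; set y := `|u - _|; set z := `|u|; lra.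
Qed.

Lemma Phi_upper a b : `|a - z0| <= delta -> `|b - z0| <= delta ->
  `|uncol (Ti *m (Phi a - Phi b))| <= 2 * `|a - b|.
Proof.
move=> ha hb; have := Phi_defect ha hb; set u := uncol _ => hu.
have : `|u| <= `|u - (a - b)| + `|a - b|.
  by rewrite -{1}[u](subrK (a - b)) ler_normD.
have := normr_ge0 (a - b).
by move: hu; set x := `|a - b|; set y := `|u - _|; set z := `|u|; lra.
Qed.

Lemma Ti_inj v w : uncol (Ti *m (v - w)) = 0 -> v = w.
Proof.
move=> e; apply/eqP; rewrite -subr_eq0; apply/eqP.
rewrite -[v - w]mul1mx -TiKr -mulmxA -[X in _ *m X]uncolK e.
by rewrite cvec0 mulmx0.
Qed.

Lemma Phi_surj w : `|uncol (Ti *m (w - Phi z0))| <= delta / 2 ->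
  exists2 a, `|a - z0| <= delta & Phi a = w.
Proof.
pose H a := uncol (Ti *m Phi a).
have HB v v' : uncol (Ti *m (v - v')) = uncol (Ti *m v) - uncol (Ti *m v').
  by rewrite mulmxBr uncolB.
rewrite HB -/(H z0) => hw.
have hH' a b : `|a - z0| <= delta -> `|b - z0| <= delta ->
    `|(H a - H b) - (a - b)| <= 2^-1 * `|a - b|.
  by move=> ha hb; rewrite /H -HB; apply: Phi_defect.
have [a ha ea] := contraction_surj delta0 (@closed_ball_compact R N z0 delta) hH' hw.
exists a => //; apply: Ti_inj; rewrite HB -/(H a) ea subrr.
by [].
Qed.

(** Parameters sit in C^n x 0, the slice of the target of [Phi] on which all equations vanish; the
    first n entries are real parts, the last n imaginary parts. *)
Definition wvec (x : 'rV[R]_(n + n)) : 'cV[C]_N :=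
  col_mx (\col_(l < n) (x 0 (lshift n l) +i* x 0 (rshift n l))%C) 0.

Lemma wvecB x y : wvec (x - y) = wvec x - wvec y.
Proof.
rewrite /wvec opp_col_mx add_col_mx subr0; congr col_mx.
by apply/colP => l; rewrite !mxE; apply/eqP; rewrite eq_complex /= !eqxx.
Qed.

Lemma wvecD x y : wvec (x + y) = wvec x + wvec y.
Proof.
rewrite /wvec add_col_mx addr0; congr col_mx.
by apply/colP => l; rewrite !mxE; apply/eqP; rewrite eq_complex /= !eqxx.
Qed.

Lemma wvec0 : wvec 0 = 0.
Proof. by rewrite -(subrr (0 : 'rV[R]_(n + n))) wvecB subrr. Qed.

Lemma wvecZ (t : R) x : wvec (t *: x) = rc t *: wvec x.
Proof.
rewrite /wvec scale_col_mx scaler0; congr col_mx; apply/colP => l; rewrite !mxE.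
by apply: complexP; rewrite ?ReM ?ImM /= ?mul0r ?subr0 ?addr0.
Qed.

Lemma wvec_norm x : `|uncol (wvec x)| <= 2 * `|x|.
Proof.
apply: Cn_norm_le => [|j]; first by rewrite mulr_ge0.
rewrite crd_uncol /wvec; case: (splitP j) => l jl.
  have -> : j = lshift nu l by exact: val_inj.
  rewrite col_mxEu mxE; apply: le_trans (cn_le _) _ => /=.
  by rewrite mulr_natl mulr2n lerD ?rV_entry_le.
have -> : j = rshift n l by exact: val_inj.
by rewrite col_mxEd mxE cn0 mulr_ge0.
Qed.

Definition dU := [set x | `|uncol (Ti *m (wvec x - Phi z0))| < delta / 2].

(** The local inverse of [Phi] on the slice; on [dU] the preimage exists by [Phi_surj] and is unique
    in the ball by [Phi_lower]. *)
Definition psi x := xget z0 [set a | `|a - z0| <= delta /\ Phi a = wvec x].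

Lemma psiP x : dU x -> `|psi x - z0| <= delta /\ Phi (psi x) = wvec x.
Proof.
move=> Ux; have [a ha ea] := Phi_surj (ltW Ux).
exact: (xgetPex z0 (ex_intro [set a | `|a - z0| <= delta /\ Phi a = wvec x] a (conj ha ea))).
Qed.

Lemma psi_in x : dU x -> `|psi x - z0| < delta.
Proof.
move=> Ux; have [h1 h2] := psiP Ux.
have hz : `|z0 - z0| <= delta by rewrite subrr normr0 ltW.
apply: le_lt_trans (Phi_lower h1 hz) _; rewrite h2 mulrC -ltr_pdivlMr //.
Qed.

(** The outer 2 comes from [Phi_lower]; the entry sum of [Ti] and one inner 2 come from
    [uncol_mul_le], and the other inner 2 from [wvec_norm]. *)
Definition lipK := 2 * ((\sum_i \sum_j cn (Ti i j)) * (2 * 2)).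

Lemma lipK_ge0 : 0 <= lipK.
Proof.
rewrite /lipK !mulr_ge0 //; apply: sumr_ge0 => i _; apply: sumr_ge0 => j _.
exact: cn_ge0.
Qed.

Lemma Ti_wvec x : 2 * `|uncol (Ti *m wvec x)| <= lipK * `|x|.
Proof.
rewrite /lipK -mulrA ler_wpM2l //; apply: le_trans (uncol_mul_le _ _) _.
rewrite -!mulrA ler_wpM2l ?ler_wpM2l ?wvec_norm //.
by apply: sumr_ge0 => i _; apply: sumr_ge0 => j _; exact: cn_ge0.
Qed.

Lemma psi_lip x y : dU x -> dU y -> `|psi x - psi y| <= lipK * `|x - y|.
Proof.
move=> /psiP[hx ex] /psiP[hy ey]; apply: le_trans (Phi_lower hx hy) _.
by rewrite ex ey -wvecB Ti_wvec.
Qed.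

Lemma open_dU : open dU.
Proof.
rewrite openE => x Ux; rewrite /interior.
have e0 : 0 < delta / 2 - `|uncol (Ti *m (wvec x - Phi z0))| by rewrite subr_gt0.
have K0 : 0 < lipK + 1 by rewrite ltr_wpDl // lipK_ge0.
near=> y; rewrite /dU /= -(subrK (wvec x) (wvec y)) -addrA mulmxDr uncolD.
apply: le_lt_trans (ler_normD _ _) _; rewrite -ltrBrDr -wvecB.
apply: (@le_lt_trans _ _ (2 * `|uncol (Ti *m wvec (y - x))|)).
  by rewrite ler_peMl // ler1n.
apply: le_lt_trans (Ti_wvec _) _.
apply: (@le_lt_trans _ _ ((lipK + 1) * `|y - x|)).
  by rewrite ler_wpM2r // lerDl.
rewrite mulrC -ltr_pdivlMr // distrC.
near: y; exact: (@near_dist R 'rV[R]_(n + n) x _ (divr_gt0 e0 K0)).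
Unshelve. all: by end_near. Qed.

Lemma psi_cont x : dU x -> psi @ x --> psi x.
Proof.
move=> Ux; apply: (@lip_cvg R 'rV[R]_(n + n) E dU psi x lipK) => //.
- exact: open_dU.
- exact: lipK_ge0.
- by move=> y Uy; apply: psi_lip.
Qed.

Lemma psi_regX x : dU x -> regX f (psi x).
Proof.
move=> /psiP[h1 h2]; split.
  move=> i; have := congr1 (fun v : 'cV_N => v (rshift n i) 0) h2.
  by rewrite /Phi /wvec !col_mxEd !mxE.
have [u _] := hdelta h1 h1; rewrite Gam_diag in u.
apply/eqP; rewrite eqn_leq rank_leq_row /=.
have := u; rewrite -row_free_unit /row_free -(addsmxE Cm (jac f (psi x))) => /eqP e.
have := (mxrank_adds_leqif Cm (jac f (psi x))).1; rewrite e => le1.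
by have := leq_trans le1 (leq_add (rank_leq_row Cm) (leqnn _)); rewrite leq_add2l.
Qed.

(** At a pair of points of the chart this is the exact difference quotient of [psi] ([psi_diff]), on
    the diagonal its differential. *)
Definition dQ (p : E * E) (v : 'rV[R]_(n + n)) : 'cV[C]_N :=
  invmx (Gam p) *m wvec v.

Lemma dQK p v : Gam p \in unitmx -> Gam p *m dQ p v = wvec v.
Proof. by move=> u; rewrite /dQ mulmxA mulmxV // mul1mx. Qed.

Lemma psi_diff x y : dU x -> dU y ->
  cvec (psi y - psi x) = dQ (psi y, psi x) (y - x).
Proof.
move=> /psiP[hx ex] /psiP[hy ey]; rewrite /dQ wvecB -ey -ex Phi_diff mulmxA mulVmx ?mul1mx //.
by have [] := hdelta hy hx.
Qed.

Lemma dQ_norm a b v : `|a - z0| <= delta -> `|b - z0| <= delta ->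
  `|uncol (dQ (a, b) v)| <= lipK * `|v|.
Proof.
move=> ha hb; have [u hu] := hdelta ha hb; have := hu (dQ (a, b) v).
have -> : (Ti *m Gam (a, b) - 1%:M) *m dQ (a, b) v = Ti *m wvec v - dQ (a, b) v.
  by rewrite mulmxBl mul1mx -mulmxA dQK.
rewrite uncolB.
set t := uncol (Ti *m wvec v); set s := uncol (dQ _ _) => h1.
have h2 : `|s| <= `|t| + `|t - s| by rewrite -{1}[s](subKr t) ler_normB.
apply: le_trans (Ti_wvec v); rewrite -/t.
by move: h1 h2; set x := `|s|; set y := `|t|; set z := `|_|; lra.
Qed.

(** The difference quotient at x + t v equals [dQ] at the pair (psi (x + t v), psi x), with no
    remainder, so continuity of [psi] and of [dQ] gives the limit. *)
Lemma psi_is_derive x v j : dU x ->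
  is_derive x v (fun y => complex.Re (crd (psi y) j) : R^o)
    (complex.Re (dQ (psi x, psi x) v j 0)) /\
  is_derive x v (fun y => complex.Im (crd (psi y) j) : R^o)
    (complex.Im (dQ (psi x, psi x) v j 0)).
Proof.
move=> Ux; pose O := [set a : E | `|a - z0| < delta].
have oO : open O by exact: open_norm_lt.
have Ox : O (psi x) by exact: psi_in.
have hF : cCk 0 O (fun a => dQ (a, psi x) v j 0).
  have : cCk 0 O (fun a => \sum_k invmx (Gam (a, psi x)) j k * wvec v k 0).
    apply: cCk_sum => // k _; apply: cCkM => //; last exact: cCk_cst.
    apply: (@cCk_invmx R E 0 O N (fun a => Gam (a, psi x)) oO).
      move=> i l; apply: Gam_cCk => // m; first exact: crd_cCk.
      exact: cCk_cst.
    by move=> a Oa; have [] := hdelta (ltW Oa) (ltW Ox).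
  by congr (cCk 0 O _); apply/funext => a; rewrite [RHS]mxE.
have near0 : \forall t \near (0 : R)^',
    crd (psi (t *: v + x)) j - crd (psi x) j =
    rc t * dQ (psi (t *: v + x), psi x) v j 0.
  have nU : \forall t \near (0 : R)^', dU (t *: v + x).
    by apply: (@line_near R 'rV[R]_(n + n)) => //; exact: open_dU.
  apply: filterS nU => t Uy; rewrite -crdB.
  have := congr1 (fun M : 'cV_N => M j 0) (psi_diff Ux Uy).
  by rewrite addrK mxE => ->; rewrite /dQ wvecZ -scalemxAr mxE.
have cc : (fun t : R => psi (t *: v + x)) @ 0^' --> psi x.
  exact: (@line_comp R 'rV[R]_(n + n) E psi x v (psi_cont Ux)).
have key (P : C -> R) : (forall (t : R) c, P (rc t * c) = t * P c) ->
    (forall c c' : C, P (c - c') = P c - P c') ->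
    {for psi x, continuous (fun a => P (dQ (a, psi x) v j 0) : R^o)} ->
    is_derive x v (fun y => P (crd (psi y) j) : R^o) (P (dQ (psi x, psi x) v j 0)).
  move=> PZ PB cP.
  have lim : (fun t : R => t^-1 *: (((fun y => P (crd (psi y) j) : R^o) \o shift x) (t *: v)
      - P (crd (psi x) j))) @ 0^' --> (P (dQ (psi x, psi x) v j 0) : R^o).
    apply: (@cvg_trans _ ((fun t : R => P (dQ (psi (t *: v + x), psi x) v j 0)) @ 0^')).
      apply: near_eq_cvg; near=> t; rewrite /= -PB.
      rewrite (near near0 t) //; rewrite PZ /GRing.scale /= mulrA mulVf ?mul1r //.
      by near: t; apply: nbhs_dnbhs_neq.
    exact: (cvg_comp _ _ cc cP).
  by split; [apply/cvg_ex; exists (P (dQ (psi x, psi x) v j 0))|apply: cvg_lim lim].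
split; apply: key.
- by move=> t c; rewrite ReM /= mul0r subr0.
- by move=> c c'; rewrite ReD ReN.
- exact: Ck_continuous hF.1 Ox.
- by move=> t c; rewrite ImM /= mul0r addr0.
- by move=> c c'; rewrite ImD ImN.
- exact: Ck_continuous hF.2 Ox.
Unshelve. all: by end_near. Qed.

(** Bootstrap: the differential of [psi] is an inverse matrix with entries polynomial in [psi], so
    class C^k of [psi] passes to its derivatives and gives class C^(k+1). *)
Lemma psi_cCk k j : cCk k dU (fun x => crd (psi x) j).
Proof.
have oU := open_dU.
have cP j' x : dU x -> {for x, continuous (fun y => complex.Re (crd (psi y) j') : R^o)} /\
    {for x, continuous (fun y => complex.Im (crd (psi y) j') : R^o)}.
  move=> Ux; split.
    exact: (cvg_comp _ _ (psi_cont Ux) (@cont_crd_Re R N j' (psi x))).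
  exact: (cvg_comp _ _ (psi_cont Ux) (@cont_crd_Im R N j' (psi x))).
elim: k j => [|k IH] j; first by split; split=> // x /(cP j)[].
have hQ v : cCk k dU (fun x => dQ (psi x, psi x) v j 0).
  have : cCk k dU (fun x => \sum_l invmx (Gam (psi x, psi x)) j l * wvec v l 0).
    apply: cCk_sum => // l _; apply: cCkM => //; last exact: cCk_cst.
    apply: (@cCk_invmx R 'rV[R]_(n + n) k dU N (fun a => Gam (psi a, psi a)) oU).
      move=> i m; apply: Gam_cCk => // m'; exact: IH.
    by move=> a Ua; have [h1 _] := psiP Ua; have [] := hdelta h1 h1.
  by congr (cCk k dU _); apply/funext => a; rewrite [RHS]mxE.
split; apply: Ck_step => //.
- by move=> x /(cP j)[].
- move=> v; exists (fun x => complex.Re (dQ (psi x, psi x) v j 0)); last exact: (hQ v).1.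
  by move=> x Ux; have [] := psi_is_derive v j Ux.
- by move=> x /(cP j)[].
- move=> v; exists (fun x => complex.Im (dQ (psi x, psi x) v j 0)); last exact: (hQ v).2.
  by move=> x Ux; have [] := psi_is_derive v j Ux.
Qed.

Definition dgram x : 'M[R]_(n + n) := \matrix_(a, b) \sum_j
  ('D_(delta_mx 0 a) (fun y => (psi y).1 0 j : R^o) x *
   'D_(delta_mx 0 b) (fun y => (psi y).1 0 j : R^o) x +
   'D_(delta_mx 0 a) (fun y => (psi y).2 0 j : R^o) x *
   'D_(delta_mx 0 b) (fun y => (psi y).2 0 j : R^o) x).

Lemma dgramE x a b : dU x -> dgram x a b = \sum_j
  (complex.Re (dQ (psi x, psi x) (delta_mx 0 a) j 0) *
   complex.Re (dQ (psi x, psi x) (delta_mx 0 b) j 0) +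
   complex.Im (dQ (psi x, psi x) (delta_mx 0 a) j 0) *
   complex.Im (dQ (psi x, psi x) (delta_mx 0 b) j 0)).
Proof.
move=> Ux; rewrite mxE; apply: eq_bigr => j _.
have [[_ r1] [_ i1]] := psi_is_derive (delta_mx 0 a) j Ux.
have [[_ r2] [_ i2]] := psi_is_derive (delta_mx 0 b) j Ux.
by congr (_ * _ + _ * _).
Qed.

Lemma delta_norm a : `|delta_mx 0 a : 'rV[R]_(n + n)| <= 1.
Proof.
apply: rV_norm_le => // j; rewrite mxE eqxx /=.
by case: (j == a); rewrite ?normr1 ?normr0.
Qed.

Definition gramK : R :=
  \sum_(s : {perm 'I_(n + n)}) (N%:R * (2 * lipK ^+ 2)) ^+ (n + n).

Lemma det_dgram_le x : dU x -> \det (dgram x) <= gramK.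
Proof.
move=> Ux; have [hx _] := psiP Ux.
have hd a j : cn (dQ (psi x, psi x) (delta_mx 0 a) j 0) <= 2 * lipK.
  rewrite -crd_uncol; apply: le_trans (crd_le _ _) _; rewrite ler_wpM2l //.
  apply: le_trans (dQ_norm _ hx hx) _; rewrite ler_piMr ?lipK_ge0 ?delta_norm //.
have hR a j : `|complex.Re (dQ (psi x, psi x) (delta_mx 0 a) j 0)| <= lipK.
  rewrite -crd_uncol; apply: le_trans (Re_crd_le _ _) _.
  by apply: le_trans (dQ_norm _ hx hx) _; rewrite ler_piMr ?lipK_ge0 ?delta_norm.
have hI a j : `|complex.Im (dQ (psi x, psi x) (delta_mx 0 a) j 0)| <= lipK.
  rewrite -crd_uncol; apply: le_trans (Im_crd_le _ _) _.
  by apply: le_trans (dQ_norm _ hx hx) _; rewrite ler_piMr ?lipK_ge0 ?delta_norm.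
have he a b : `|dgram x a b| <= N%:R * (2 * lipK ^+ 2).
  rewrite dgramE //; apply: le_trans (ler_norm_sum _ _ _) _.
  have -> : N%:R * (2 * lipK ^+ 2) = \sum_(j < N) (2 * lipK ^+ 2).
    by rewrite sumr_const card_ord mulr_natl.
  apply: ler_sum => j _; apply: le_trans (ler_normD _ _) _.
  rewrite mulr_natl mulr2n !normrM expr2.
  by apply: lerD; apply: ler_pM => //; rewrite ?normr_ge0.
rewrite /determinant; apply: le_trans (ler_norm _) _.
apply: le_trans (ler_norm_sum _ _ _) _.
apply: (@le_trans _ _ (\sum_(s : {perm 'I_(n + n)}) (N%:R * (2 * lipK ^+ 2)) ^+ (n + n))).
  apply: ler_sum => s _; rewrite normrM normrX normrN1 expr1n mul1r normr_prod.
  apply: (@le_trans _ _ (\prod_(i < n + n) (N%:R * (2 * lipK ^+ 2)))).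
    by apply: ler_prod => i _; rewrite normr_ge0 he.
  by rewrite prodr_const card_ord.
by [].
Qed.

Lemma dQ_sum p (u : 'rV[R]_(n + n)) j :
  dQ p u j 0 = \sum_a rc (u 0 a) * dQ p (delta_mx 0 a) j 0.
Proof.
rewrite /dQ; have -> : wvec u = \sum_a rc (u 0 a) *: wvec (delta_mx 0 a).
  rewrite [u in wvec u]row_sum_delta; elim/big_rec2: _ => [|a y x _ <-].
    exact: wvec0.
  by rewrite wvecD wvecZ.
rewrite mulmx_sumr summxE; apply: eq_bigr => a _.
by rewrite -scalemxAr mxE.
Qed.

(** A vector [u] in the kernel of the Gram matrix has a differential of squared length 0, so [dQ]
    kills it; multiplying back by [Gam] returns [wvec u = 0]. *)
Lemma det_dgram_neq0 x : dU x -> \det (dgram x) != 0.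
Proof.
move=> Ux; have [hx _] := psiP Ux; have [ux _] := hdelta hx hx.
apply/det0P => -[u u0 ug]; case/eqP: u0.
have hD (u' : 'rV[R]_(n + n)) j : dQ (psi x, psi x) u' j 0 =
    ((\sum_a u' 0 a * complex.Re (dQ (psi x, psi x) (delta_mx 0 a) j 0)) +i*
     (\sum_a u' 0 a * complex.Im (dQ (psi x, psi x) (delta_mx 0 a) j 0)))%C.
  rewrite dQ_sum; apply: complexP => /=.
    by elim/big_rec2: _ => // a y z _ <-; rewrite ReD ReM /= mul0r subr0.
  by elim/big_rec2: _ => // a y z _ <-; rewrite ImD ImM /= mul0r addr0.
pose A1 : 'M[R]_(n + n, N) :=
  \matrix_(a, j) complex.Re (dQ (psi x, psi x) (delta_mx 0 a) j 0).
pose A2 : 'M[R]_(n + n, N) :=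
  \matrix_(a, j) complex.Im (dQ (psi x, psi x) (delta_mx 0 a) j 0).
have eg : dgram x = A1 *m A1^T + A2 *m A2^T.
  apply/matrixP => a b; rewrite dgramE // !mxE -big_split /=.
  by apply: eq_bigr => j _; rewrite !mxE.
have uA1 j : (u *m A1) 0 j = complex.Re (dQ (psi x, psi x) u j 0).
  by rewrite hD mxE; apply: eq_bigr => a _; rewrite mxE.
have uA2 j : (u *m A2) 0 j = complex.Im (dQ (psi x, psi x) u j 0).
  by rewrite hD mxE; apply: eq_bigr => a _; rewrite mxE.
have s0 : \sum_j ((u *m A1) 0 j ^+ 2 + (u *m A2) 0 j ^+ 2) = 0.
  have e : (u *m dgram x *m u^T) 0 0 = 0 by rewrite ug mul0mx mxE.
  have q (A : 'M[R]_(n + n, N)) :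
      (u *m (A *m A^T) *m u^T) 0 0 = \sum_j (u *m A) 0 j ^+ 2.
    rewrite mulmxA -mulmxA -trmx_mul mxE; apply: eq_bigr => j _.
    by rewrite expr2 [_^T _ _]mxE.
  by rewrite -[RHS]e eg mulmxDr mulmxDl [RHS]mxE big_split /= -!q.
have z j : dQ (psi x, psi x) u j 0 = 0.
  have /eqP := psumr_eq0P (fun j _ => addr_ge0 (sqr_ge0 _) (sqr_ge0 _)) s0 (i := j) isT.
  rewrite paddr_eq0 ?sqr_ge0 // !sqrf_eq0 => /andP[/eqP h1 /eqP h2].
  by apply: complexP; rewrite -?uA1 -?uA2 ?h1 ?h2.
have w0 : wvec u = 0.
  rewrite -(dQK u ux) (_ : dQ _ _ = 0) ?mulmx0 //.
  by apply/colP => j; rewrite z mxE.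
apply/rowP => a; rewrite mxE.
case: (splitP a) => l al.
  have -> : a = lshift n l by exact: val_inj.
  have := congr1 (fun v : 'cV_N => complex.Re (v (lshift nu l) 0)) w0.
  by rewrite /wvec col_mxEu !mxE.
have -> : a = rshift n l by exact: val_inj.
have := congr1 (fun v : 'cV_N => complex.Im (v (lshift nu l) 0)) w0.
by rewrite /wvec col_mxEu !mxE.
Qed.

(** The radius delta/4 is doubled by [Phi_upper] and so meets the bound delta/2 in the definition of
    [dU]. *)
Lemma psi_cover a : coneX f a -> `|a - z0| < delta / 4 ->
  exists x, dU x /\ psi x = a.
Proof.
move=> Xa ha; pose c := Cm *m cvec a.
pose x : 'rV[R]_(n + n) := row_mx (\row_l complex.Re (c l 0)) (\row_l complex.Im (c l 0)).
have ex : wvec x = Phi a.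
  rewrite /wvec /Phi -/c; congr col_mx; apply/colP => l; rewrite !mxE ?Xa //.
  rewrite (unsplitK (inl l)) (unsplitK (inr l)) !mxE.
  by apply: complexP.
have hz : `|z0 - z0| <= delta by rewrite subrr normr0 ltW.
have had : `|a - z0| <= delta.
  by apply: ltW; apply: lt_trans ha _; rewrite gtr_pMr // invf_lt1 // ltr1n.
have Ux : dU x.
  rewrite /dU /= ex; apply: le_lt_trans (Phi_upper had hz) _.
  by move: ha; set y := `|a - z0|; lra.
exists x; split=> //; have [h1 h2] := psiP Ux.
apply/eqP; rewrite -subr_eq0 -normr_le0; apply: le_trans (Phi_lower h1 had) _.
by rewrite h2 ex subrr mulmx0 -cvec0 cvecK normr0 mulr0.
Qed.

Lemma psi_local_param : local_param f dU psi dgram.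
Proof.
split.
- exact: open_dU.
- by move=> j; split=> k; have [] := psi_cCk k j.
- move=> x y /set_mem Ux /set_mem Uy e.
  have [_ ex] := psiP Ux; have [_ ey] := psiP Uy.
  have ew : wvec x = wvec y by rewrite -ex -ey e.
  apply/rowP => a; case: (splitP a) => l al.
    have -> : a = lshift n l by exact: val_inj.
    have := congr1 (fun v : 'cV_N => complex.Re (v (lshift nu l) 0)) ew.
    by rewrite /wvec !col_mxEu !mxE.
  have -> : a = rshift n l by exact: val_inj.
  have := congr1 (fun v : 'cV_N => complex.Im (v (lshift nu l) 0)) ew.
  by rewrite /wvec !col_mxEu !mxE.
- exact: psi_regX.
- by move=> x Ux; split; [|exact: det_dgram_neq0].
Qed.

End Chart.

Section LocalChart.
Variables (R : realType) (n nu : nat).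
Local Notation C := R[i].
Local Notation N := (n + nu)%N.
Local Notation E := (Cn R N).
Variable f : 'I_nu -> mpoly N C.

(** The chart inverts these real coordinates. Being Lipschitz and compatible with dilations, they
    place the parameters of a ball of radius r in a cube of side O(r), at every scale. *)
Definition rcoord (Cm : 'M[C]_(n, N)) (a : E) : 'rV[R]_(n + n) :=
  row_mx (\row_l complex.Re ((Cm *m cvec a) l 0))
         (\row_l complex.Im ((Cm *m cvec a) l 0)).

Lemma rcoord_lip Cm : exists2 L : R, 0 <= L &
  forall a b i, `|rcoord Cm a 0 i - rcoord Cm b 0 i| <= L * `|a - b|.
Proof.
exists (\sum_i \sum_j cn (Cm i j) * 2).
  by apply: sumr_ge0 => i _; apply: sumr_ge0 => j _; rewrite mulr_ge0 ?cn_ge0.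
have key a b l : cn ((Cm *m cvec a) l 0 - (Cm *m cvec b) l 0) <=
    (\sum_i \sum_j cn (Cm i j) * 2) * `|a - b|.
  have -> : (Cm *m cvec a) l 0 - (Cm *m cvec b) l 0 = (Cm *m cvec (a - b)) l 0.
    by rewrite cvecB mulmxBr [in RHS]mxE [(- _ : 'cV_n) l 0]mxE.
  rewrite mxE; apply: le_trans (cn_sum _ _ _) _.
  apply: (@le_trans _ _ ((\sum_j cn (Cm l j) * 2) * `|a - b|)).
    rewrite mulr_suml; apply: ler_sum => j _; rewrite cnM mxE -mulrA.
    by rewrite ler_wpM2l ?cn_ge0 ?crd_le.
  rewrite ler_wpM2r // [leRHS](bigD1 l) //= lerDl.
  by apply: sumr_ge0 => i _; apply: sumr_ge0 => j _; rewrite mulr_ge0 ?cn_ge0.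
move=> a b i; case: (splitP i) => l il.
  have -> : i = lshift n l by exact: val_inj.
  rewrite /rcoord !row_mxEl [X in `|X - _|]mxE [X in `|_ - X|]mxE -ReN -ReD.
  by apply: le_trans (cn_Re _) (key _ _ _).
have -> : i = rshift n l by exact: val_inj.
rewrite /rcoord !row_mxEr [X in `|X - _|]mxE [X in `|_ - X|]mxE -ImN -ImD.
by apply: le_trans (cn_Im _) (key _ _ _).
Qed.

Lemma rcoordZ Cm (t : R) a i : rcoord Cm (t *: a) 0 i = t * rcoord Cm a 0 i.
Proof.
have e l : (Cm *m cvec (t *: a)) l 0 = rc t * (Cm *m cvec a) l 0.
  rewrite !mxE mulr_sumr; apply: eq_bigr => j _.
  by rewrite !mxE crdZ mulrCA.
case: (splitP i) => l il.
  have -> : i = lshift n l by exact: val_inj.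
  by rewrite /rcoord !row_mxEl [LHS]mxE [in RHS]mxE e ReM /= mul0r subr0.
have -> : i = rshift n l by exact: val_inj.
by rewrite /rcoord !row_mxEr [LHS]mxE [in RHS]mxE e ImM /= mul0r addr0.
Qed.

Lemma local_chart d h z0 : hefer f d h -> regX f z0 ->
  exists (V : set E) U psi gram Cm (K : R),
  [/\ open V /\ V z0, local_param f U psi gram,
      forall a, coneX f a -> V a -> exists x, U x /\ psi x = a,
      (forall x i, U x -> rcoord Cm (psi x) 0 i = x 0 i) &
      0 <= K /\ forall x, U x -> Num.sqrt (\det (gram x)) <= K].
Proof.
move=> hH [Xz0 rz0]; have [Cm uC] := completion_mx rz0.
have uT : Gam h Cm (z0, z0) \in unitmx by rewrite (Gam_diag hH).
have [delta delta0 hd] := Gam_near uT (mulVmx uT).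
have hp := psi_local_param hH (mulmxV uT) delta0 hd.
exists [set a | `|a - z0| < delta / 4].
exists (dU f z0 Cm (invmx (Gam h Cm (z0, z0))) delta), (psi f z0 Cm delta).
exists (dgram f z0 Cm delta), Cm, (Num.sqrt (gramK (invmx (Gam h Cm (z0, z0))))).
split=> //.
- by split; [exact: open_norm_lt|rewrite /= subrr normr0 divr_gt0].
- by move=> a Xa Va; exact: (psi_cover hH (mulmxV uT) delta0 hd).
- move=> x i Ux; have [_ ex] := psiP hH (mulmxV uT) delta0 hd Ux.
  have e l : (Cm *m cvec (psi f z0 Cm delta x)) l 0 =
      (x 0 (lshift n l) +i* x 0 (rshift n l))%C.
    have := congr1 (fun v : 'cV_N => v (lshift nu l) 0) ex.
    by rewrite /Phi /wvec !col_mxEu => ->; rewrite mxE.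
  case: (splitP i) => l il.
    have -> : i = lshift n l by exact: val_inj.
    by rewrite /rcoord row_mxEl mxE e.
  have -> : i = rshift n l by exact: val_inj.
  by rewrite /rcoord row_mxEr mxE e.
- split; first exact: sqrtr_ge0.
  by move=> x Ux; rewrite ler_wsqrtr // (det_dgram_le hH (mulmxV uT) delta0 hd).
Qed.

End LocalChart.

(** * Iterated integrals and the growth of volume on the cone *)

Section MonotoneIntegral.
Context d (T : measurableType d) (R : realType).
Variable mu : {measure set T -> \bar R}.
Local Open Scope ereal_scope.

(* The integral of a nonnegative function is a supremum over the simple functions
   below it, whether or not the function is measurable. *)
Lemma ge0_le_int (D : set T) (f g : T -> \bar R) :
  (forall x, D x -> 0 <= f x) -> (forall x, D x -> f x <= g x) ->
  \int[mu]_(x in D) f x <= \int[mu]_(x in D) g x.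
Proof.
move=> f0 fg; have g0 x : D x -> 0 <= g x.
  by move=> Dx; apply: le_trans (f0 _ Dx) (fg _ Dx).
rewrite !ge0_integralE //; apply: le_ereal_sup => _ [h /= hf <-].
exists h => //= x; apply: le_trans (hf x) _; rewrite /patch; case: ifPn => //.
by move=> /set_mem /fg.
Qed.

End MonotoneIntegral.

Lemma nneseries_le (R : realType) (u : nat -> \bar R) (M : \bar R) :
  (forall k, 0 <= u k)%E -> (forall m, \sum_(0 <= k < m) u k <= M)%E ->
  (\sum_(0 <= k <oo) u k <= M)%E.
Proof.
move=> u0 h; apply: lime_le; first by apply: is_cvg_nneseries => k _ _; exact: u0.
by apply: nearW => m; exact: h.
Qed.

Section Lebint.
Variable R : realType.

Lemma lebint_ge0 m (F : 'rV[R]_m -> \bar R) :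
  (forall x, 0 <= F x)%E -> (0 <= lebint F)%E.
Proof.
elim: m F => [|m IH] F F0 /=; first exact: F0.
by apply: integral_ge0 => t _; apply: IH => x; exact: F0.
Qed.

(** Slicing off one coordinate at a time, each slice variable is confined to an interval of length 2
    rho. Only monotonicity of the integral is used, so [F] may be non-measurable. *)
Lemma lebint_box m (c : 'rV[R]_m) (rho K : R) (F : 'rV[R]_m -> \bar R) :
  0 <= rho -> 0 <= K -> (forall x, 0 <= F x)%E -> (forall x, F x <= K%:E)%E ->
  (forall x : 'rV[R]_m, (exists i, rho < `|x 0 i - c 0 i|) -> F x = 0%E) ->
  (lebint F <= (K * (2 * rho) ^+ m)%:E)%E.
Proof.
move=> rho0; elim: m c K F => [|m IH] c K F K0 F0 FK Fc /=.
  by rewrite expr0 mulr1 FK.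
pose c' : 'rV[R]_m := \row_i c 0 (lift ord0 i).
have hentry t (x : 'rV[R]_m) i : (row_mx (t%:M : 'rV[R]_1) x : 'rV[R]_(1 + m)) 0 (lift ord0 i) = x 0 i.
  have -> : lift ord0 i = rshift 1 i by exact: val_inj.
  by rewrite row_mxEr.
have h0 t (x : 'rV[R]_m) : (row_mx (t%:M : 'rV[R]_1) x : 'rV[R]_(1 + m)) 0 ord0 = t.
  have -> : ord0 = lshift m (ord0 : 'I_1) :> 'I_(1 + m) by apply: val_inj.
  by rewrite row_mxEl mxE eqxx mulr1n.
pose B := `[c 0 ord0 - rho, c 0 ord0 + rho]%classic : set R.
have hB t : ~ B t -> rho < `|t - c 0 ord0|.
  move=> nB; rewrite ltNge; apply/negP => h; apply: nB.
  by rewrite /B /= in_itv /= -ler_distl.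
apply: (@le_trans _ _ (\int[lebesgue_measure]_(t in [set: R])
    ((K * (2 * rho) ^+ m)%:E * (\1_B t)%:E)))%E.
  apply: ge0_le_int => t _; first by apply: lebint_ge0.
  rewrite indicE; case: (boolP (t \in B)) => tB.
    rewrite mule1; apply: (IH c') => // x [i hi]; apply: Fc.
    by exists (lift ord0 i); rewrite hentry; move: hi; rewrite mxE.
  (* For t outside the interval the whole slice vanishes, and the induction hypothesis with bound 0
     gives the value at most 0. *)
  rewrite mule0; have h := IH c' 0 (fun x => F (row_mx t%:M x)).
  move: h; rewrite mul0r; apply => // x.
    rewrite (Fc (row_mx t%:M x)) //.
    by exists ord0; rewrite h0; apply: hB => /mem_set Bt; rewrite Bt in tB.
  move=> _; rewrite (Fc (row_mx t%:M x)) //.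
  by exists ord0; rewrite h0; apply: hB => /mem_set Bt; rewrite Bt in tB.
rewrite ge0_integralZl_EFin //; last by rewrite mulr_ge0 ?exprn_ge0 ?mulr_ge0.
- have mB : measurable B by exact: measurable_itv.
  rewrite integral_indic //.
  have -> : B `&` [set: R] = B by apply/seteqP; split => [t []|t Bt].
  have mBle : (lebesgue_measure B <= (2 * rho)%:E)%E.
    rewrite /B lebesgue_measure_itv /= lte_fin; case: ifPn => _.
      by rewrite -EFinB lee_fin le_eqVlt; apply/orP; left; apply/eqP; ring.
    by rewrite lee_fin mulr_ge0.
  rewrite exprSr mulrA [in leRHS]EFinM; apply: lee_wpmul2l => //.
  by rewrite lee_fin mulr_ge0 ?exprn_ge0 ?mulr_ge0.
- by apply/measurable_EFinP; apply: measurable_indic; exact: measurable_itv.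
Qed.

End Lebint.

Section VolumeGrowth.
Variables (R : realType) (n nu : nat).
Local Notation C := R[i].
Local Notation N := (n + nu)%N.
Local Notation E := (Cn R N).
Variable f : 'I_nu -> mpoly N C.
Variable d : 'I_nu -> nat.
Variable h : 'I_nu -> 'I_N -> mpoly (N + N)%N C.
Hypothesis hH : hefer f d h.
Hypothesis hf : forall i, (0 < d i)%N /\ f i \is @ishomog1 _ _ (d i) mdeg.
Hypothesis hci : smooth_ci f.
Variable dV : {measure set (borelCn R n nu) -> \bar R}.
Hypothesis hdV : is_volume f dV.
Local Notation X := (coneX f).

Lemma open_borel (A : set E) : open A -> measurable (A : set (borelCn R n nu)).
Proof. by move=> oA; apply: sub_sigma_algebra. Qed.

Lemma closed_borel (A : set E) : closed A -> measurable (A : set (borelCn R n nu)).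
Proof.
move=> cA; rewrite -(setCK A); apply: measurableC.
by apply: open_borel; exact: closed_openC.
Qed.

Lemma coneX_scale (t : R) z : X z -> X (t *: z).
Proof.
move=> Xz i; rewrite /feval.
have -> : crd (t *: z) = fun j => rc t * crd z j by apply/funext => j; rewrite crdZ.
by rewrite (meval_homog _ _ (hf i).2) -/(feval f i z) Xz mulr0.
Qed.

Lemma feval0 i : feval f i 0 = 0.
Proof.
have := meval_homog 0 (crd (0 : E)) (hf i).2; rewrite expr0n.
rewrite eqn0Ngt (hf i).1 mul0r => <-; rewrite /feval; congr meval.
by apply/funext => j; rewrite crd0 mul0r.
Qed.

Lemma coneX0 : X 0.
Proof. by move=> i; exact: feval0. Qed.

Lemma feval_cCk k U i : open U -> cCk k U (feval f i).
Proof. by move=> oU; apply: cCk_meval => // j; exact: crd_cCk. Qed.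

Lemma cCk_continuous0 (V : normedModType R) (F : V -> C) : cCk 0 setT F ->
  continuous (fun x => complex.Re (F x) : R^o) /\
  continuous (fun x => complex.Im (F x) : R^o).
Proof.
by move=> [h1 h2]; split=> x; [exact: Ck_continuous h1 _|exact: Ck_continuous h2 _].
Qed.

Lemma closed_coneX : closed X.
Proof.
have -> : X = \bigcap_(i in [set: 'I_nu]) [set z | feval f i z = 0].
  by apply/seteqP; split => [z Xz i _|z h1 i]; [exact: Xz|exact: h1].
apply: closed_bigI => i _.
have [cR cI] := cCk_continuous0 (feval_cCk 0 i openT).
have -> : [set z | feval f i z = 0] =
    ((fun z => complex.Re (feval f i z)) @^-1` [set 0]) `&`
    ((fun z => complex.Im (feval f i z)) @^-1` [set 0]).
  apply/seteqP; split => [z /= ->//|z /= [h1 h2]].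
  exact: complexP.
apply: closedI; apply: closed_comp => //; exact: closed_eq.
Qed.

Lemma regX_neq0 z : X z -> z != 0 -> regX f z.
Proof. by move=> Xz z0; split=> //; apply: hci. Qed.

Lemma jacZ (t : R) z i j : jac f (t *: z) i j = rc t ^+ (d i).-1 * jac f z i j.
Proof. by rewrite !(jac_hG hH) (hG_homog hH). Qed.

Lemma jac_scale (t : R) z : jac f (t *: z) =
  diag_mx (\row_i rc t ^+ (d i).-1) *m jac f z.
Proof.
apply/matrixP => i j; rewrite jacZ mul_diag_mx !mxE.
by [].
Qed.

Lemma regX_scale (t : R) z : 0 < t -> regX f z -> regX f (t *: z).
Proof.
move=> t0 [Xz rz]; split; first exact: coneX_scale.
rewrite jac_scale eqmxMfull ?rz // row_full_unit unitmxE det_diag unitfE.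
apply/prodf_neq0 => i _; rewrite mxE expf_neq0 //.
by apply/eqP => /(congr1 (@complex.Re R)) /= e; rewrite e ltxx in t0.
Qed.

Definition cball (z : E) (r : R) := [set a : E | `|a - z| <= r].

Lemma measurable_cball z r : measurable (cball z r : set (borelCn R n nu)).
Proof.
apply: closed_borel; apply: (closed_comp _ (@closed_le _ r)) => x _.
exact: norm_sub_continuous.
Qed.

Lemma cball0 z : cball z 0 = [set z].
Proof.
apply/seteqP; split => [a|a ->]; last by rewrite /cball /= subrr normr0.
by rewrite /cball /= normr_le0 subr_eq0 => /eqP.
Qed.

Lemma measurable_regX : measurable (regX f : set (borelCn R n nu)).
Proof.
have mX := closed_borel closed_coneX.
have [r0|nr0] := pselect (regX f 0).
  have -> : regX f = X.
    apply/seteqP; split => [z []//|z Xz].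
    by have [->//|z0] := eqVneq z 0; apply: regX_neq0.
  exact: mX.
have -> : regX f = X `\` [set 0].
  apply/seteqP; split => [z rz|z [Xz /= z0]]; last by apply: regX_neq0 => //; apply/eqP.
  by split; [case: rz|move=> /= z0; apply: nr0; rewrite -z0].
by apply: measurableD => //; rewrite -cball0; exact: measurable_cball.
Qed.

Lemma dV_regX (A : set (borelCn R n nu)) : measurable A -> dV A = dV (A `&` regX f).
Proof.
move=> mA; rewrite [LHS](measureDI dV mA measurable_regX) //.
rewrite -[RHS]add0e; congr (_ + _)%E.
apply/eqP; rewrite eq_le measure_ge0 andbT -hdV.1.
apply: le_measure; rewrite ?inE //.
- exact: measurableD mA measurable_regX.
- exact: measurableC measurable_regX.
Qed.

(** The constant does not depend on the dilation [t]. This uniformity turns compactness of a single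
    shell into an estimate on the whole cone. *)
Definition tamed (V : set E) := exists2 K : R, 0 <= K &
  forall (t : R) z r, 0 < t -> 0 <= r -> forall A : set (borelCn R n nu),
    measurable A -> A `<=` cball z r -> A `<=` X ->
    (forall a, A a -> V (t^-1 *: a)) -> (dV A <= (K * r ^+ (n + n))%:E)%E.

(** Scaling the parameters and the target by the same factor leaves first derivatives, hence the
    Gram matrix, unchanged: t and its inverse cancel in the chain rule. *)
Lemma scaled_param (t : R) U psi gram : 0 < t -> local_param f U psi gram ->
  local_param f [set x | U (t^-1 *: x)] (fun x => t *: psi (t^-1 *: x))
    (fun x => gram (t^-1 *: x)).
Proof.
move=> t0 [oU smU injU regU gramU].
have tn0 : t != 0 by rewrite gt_eqF.
have eU : [set x : 'rV[R]_(n + n) | U (t^-1 *: x)] = [set x | U (0 + t^-1 *: x)].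
  by apply/seteqP; split => x /=; rewrite add0r.
have oU' : open [set x : 'rV[R]_(n + n) | U (t^-1 *: x)].
  by rewrite eU; apply: open_affine.
split=> //.
- have smZ (g : 'rV[R]_(n + n) -> R^o) : smooth U g ->
      smooth [set x | U (t^-1 *: x)] (fun x => t * g (t^-1 *: x) : R^o).
    move=> hg k; apply: CkZ => //; rewrite eU.
    have := Ck_affine 0 t^-1 oU (hg k); congr (Ck k _ _).
    by apply/funext => x; rewrite add0r.
  move=> j; have [h1 h2] := smU j; split.
    by move=> k; have := smZ _ h1 k; congr (Ck k _ _); apply/funext => x; rewrite mxE.
  by move=> k; have := smZ _ h2 k; congr (Ck k _ _); apply/funext => x; rewrite mxE.
- move=> x y /set_mem Ux /set_mem Uy /= e.
  have e' : psi (t^-1 *: x) = psi (t^-1 *: y) by apply: scalerI e.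
  have := injU _ _ (mem_set Ux) (mem_set Uy) e'.
  by apply: scalerI; rewrite invr_neq0.
- by move=> x Ux; apply: regX_scale => //; exact: regU.
- move=> x Ux; have [-> dg] := gramU _ Ux; split; last exact: dg.
  have dZ (g : 'rV[R]_(n + n) -> R^o) v : derivable g (t^-1 *: x) v ->
      'D_v (fun y => t * g (t^-1 *: y) : R^o) x = 'D_v g (t^-1 *: x).
    move=> dg'; have dg0 : derivable g (0 + t^-1 *: x) v by rewrite add0r.
    have [h1 h2] := derive_affine dg0.
    have e1 : (fun y => g (0 + t^-1 *: y)) = (fun y => g (t^-1 *: y)).
      by apply/funext => y; rewrite add0r.
    rewrite e1 in h1 h2.
    have -> : (fun y => t * g (t^-1 *: y)) = t *: (fun y => g (t^-1 *: y)) by [].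
    by rewrite deriveZ // h2 add0r /GRing.scale /= mulrA divff // mul1r.
  apply/matrixP => a b; rewrite !mxE; apply: eq_bigr => j _.
  have [h1 h2] := smU j.
  have d1 v : 'D_v (fun y => (t *: psi (t^-1 *: y)).1 0 j : R^o) x =
      'D_v (fun y => (psi y).1 0 j : R^o) (t^-1 *: x).
    have dd : derivable (fun y => (psi y).1 0 j : R^o) (t^-1 *: x) v.
      have c1 : Ck 1 U (fun x => (psi x).1 0 j : R^o) := h1 1%N.
      exact: (c1.2 v).1 _ Ux.
    rewrite -(dZ _ v dd).
    by congr (derive _ _ _); apply/funext => y; rewrite mxE.
  have d2 v : 'D_v (fun y => (t *: psi (t^-1 *: y)).2 0 j : R^o) x =
      'D_v (fun y => (psi y).2 0 j : R^o) (t^-1 *: x).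
    have dd : derivable (fun y => (psi y).2 0 j : R^o) (t^-1 *: x) v.
      have c1 : Ck 1 U (fun x => (psi x).2 0 j : R^o) := h2 1%N.
      exact: (c1.2 v).1 _ Ux.
    rewrite -(dZ _ v dd).
    by congr (derive _ _ _); apply/funext => y; rewrite mxE.
  by rewrite !d1 !d2.
Qed.

(** In the rescaled chart the real coordinates of a point are again its parameter. The part of a
    ball of radius r thus has parameters in a cube of half-side L r, over which the volume density
    is at most K. *)
Lemma chart_tamed z0 : regX f z0 -> exists V, [/\ open V, V z0 & tamed V].
Proof.
move=> rz0; have [V [U [psi [gram [Cm [K [[oV Vz0] hp hc hr [K0 hK]]]]]]]] := local_chart hH rz0.
have [L L0 hL] := rcoord_lip Cm.
exists V; split=> //; exists (K * (2 * L) ^+ (n + n)).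
  by rewrite mulr_ge0 ?exprn_ge0 ?mulr_ge0.
move=> t z r t0 r0 A mA Ab AX AV.
have tn0 : t != 0 by rewrite gt_eqF.
have AU : A = A `&` (fun x => t *: psi (t^-1 *: x)) @` [set x | U (t^-1 *: x)].
  apply/seteqP; split => [a Aa|a []//]; split=> //.
  have [x [Ux ex]] := hc (t^-1 *: a) (coneX_scale _ (AX _ Aa)) (AV _ Aa).
  exists (t *: x) => /=; first by rewrite scalerA mulVf // scale1r.
  by rewrite scalerA mulVf // scale1r ex scalerA divff // scale1r.
rewrite AU (hdV.2 _ _ _ (scaled_param t0 hp) A mA) -mulrA -exprMn -[2 * L * r]mulrA.
apply: (@lebint_box _ _ (rcoord Cm z)) => //; first by rewrite mulr_ge0.
- by move=> x; case: asboolP => _ //; rewrite lee_fin sqrtr_ge0.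
- move=> x; case: asboolP => [[Ux _]|_]; last by rewrite lee_fin.
  by rewrite lee_fin; apply: hK.
- move=> x [i hi]; case: asboolP => // -[/= Ux Ax]; exfalso.
  have := hL (t *: psi (t^-1 *: x)) z i.
  rewrite rcoordZ hr // mxE mulrA divff // mul1r => h1.
  have h2 : L * `|t *: psi (t^-1 *: x) - z| <= L * r.
    by apply: ler_wpM2l => //; exact: (Ab _ Ax).
  by have := lt_le_trans hi (le_trans h1 h2); rewrite ltxx.
Qed.

Lemma tamedU V W : open V -> tamed V -> tamed W -> tamed (V `|` W).
Proof.
move=> oV [K1 K10 h1] [K2 K20 h2]; exists (K1 + K2); first exact: addr_ge0.
move=> t z r t0 r0 A mA Ab AX AVW.
pose B : set (borelCn R n nu) := [set a | V (t^-1 *: a)].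
have mB : measurable B.
  apply: open_borel; have := open_affine 0 t^-1 oV.
  by congr open; apply/seteqP; split => a /=; rewrite add0r.
rewrite [dV A](measureDI dV mA mB) mulrDl addrC EFinD; apply: leeD.
  apply: (h1 t z) => //; first exact: measurableI.
  - by move=> a [/Ab].
  - by move=> a [/AX].
  - by move=> a [].
apply: (h2 t z) => //; first exact: measurableD.
- by move=> a [/Ab].
- by move=> a [/AX].
- by move=> a [/AVW[|//]].
Qed.

Lemma tamed0 : tamed set0.
Proof.
exists 0 => // t z r t0 r0 A mA _ _ h0; rewrite mul0r (_ : A = set0) ?measure0 //.
by apply/seteqP; split => // a /h0.
Qed.

Definition shell (t : R) := [set a : E | t <= `|a| <= 2 * t].

Lemma closed_shell t : closed (shell t).
Proof.
have -> : shell t = ((fun a : E => `|a - 0|) @^-1` [set y | t <= y]) `&`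
    ((fun a : E => `|a - 0|) @^-1` [set y | y <= 2 * t]).
  apply/seteqP; split => a; rewrite /shell /= subr0; first by case/andP.
  by move=> [h1 h2]; apply/andP.
apply: closedI.
  apply: (closed_comp _ (@closed_ge _ t)) => x _; exact: norm_sub_continuous.
apply: (closed_comp _ (@closed_le _ (2 * t))) => x _; exact: norm_sub_continuous.
Qed.

Lemma shell_compact : compact (X `&` shell 1).
Proof.
apply: (@bounded_closed_compactC _ _ _ (2 * 1)); last by move=> z [_ /andP[]].
apply: closedI; first exact: closed_coneX.
exact: closed_shell.
Qed.

Lemma shell_tamed : exists W, tamed W /\ X `&` shell 1 `<=` W.
Proof.
(* Finite subcovers in filter form: [G] consists of the properties shared by all supersets of some
   open tamed set, and stability under finite unions makes it a filter. The near-covering form of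
   compactness then yields one such set containing the shell. *)
pose G : set_system (set E) := [set Q | exists W0, [/\ open W0, tamed W0 &
  forall W, W0 `<=` W -> Q W]].
have FG : Filter G.
  split.
  - by exists set0; split=> //; exact: tamed0.
  - move=> P Q [V [oV tV hV]] [W [oW tW hW]]; exists (V `|` W); split.
    + exact: openU.
    + exact: tamedU.
    + by move=> U hU; split; [apply: hV|apply: hW] => z Vz; apply: hU; [left|right].
  - by move=> P Q PQ [V [oV tV hV]]; exists V; split=> // W /hV /PQ.
have nc := (compact_near_coveringP (X `&` shell 1)).1 (@shell_compact).
have [z [Xz sz]|W0 [oW0 tW0 hW0]] := nc (set E) G (fun W z => W z) FG.
  have rz : regX f z.
    apply: regX_neq0 => //; case/andP: sz => h1 _; apply: contraTneq h1 => ->.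
    by rewrite normr0 -ltNge.
  have [V [oV Vz tV]] := chart_tamed rz.
  exists (V, [set W | V `<=` W]) => /=; last by move=> [y W] /= [Vy VW]; exact: VW.
  by split; [exact: open_nbhs_nbhs|exists V].
by exists W0; split=> //; apply: hW0.
Qed.

Lemma shell_bound : exists2 K : R, 0 <= K &
  forall (t : R) z r, 0 < t -> 0 <= r -> forall A : set (borelCn R n nu),
    measurable A -> A `<=` cball z r -> A `<=` X -> A `<=` shell t ->
    (dV A <= (K * r ^+ (n + n))%:E)%E.
Proof.
have [W [[K K0 hK] SW]] := shell_tamed; exists K => // t z r t0 r0 A mA Ab AX At.
apply: (hK t z) => // a Aa; apply: SW; split; first by apply: coneX_scale; exact: AX.
have /andP[h1 h2] := At _ Aa.
rewrite /shell /= normrZ gtr0_norm ?invr_gt0 // mulr1.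
by rewrite ler_pdivlMl // mulr1 h1 mulrC ler_pdivrMr.
Qed.

Lemma measurable_shell t : measurable (shell t : set (borelCn R n nu)).
Proof.
apply: closed_borel; exact: closed_shell.
Qed.

Hypothesis n0 : (0 < n)%N.

(** If 0 is singular this is part of [is_volume]. If 0 is regular a chart exists there, and its
    bound with radius 0 is 0 since n > 0. *)
Lemma dV_set0 : dV [set 0] = 0%E.
Proof.
have m0 : measurable ([set 0] : set (borelCn R n nu)).
  by rewrite -cball0; exact: measurable_cball.
have [r0|nr0] := pselect (regX f 0); last first.
  rewrite dV_regX // (_ : _ `&` _ = set0) ?measure0 //.
  by apply/seteqP; split => // a [/= ->].
have [V [oV V0 [K K0 hK]]] := chart_tamed r0.
apply/eqP; rewrite eq_le measure_ge0 andbT.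
have := hK 1 0 0 ltr01 (lexx _) _ m0; rewrite expr0n.
rewrite (_ : (n + n == 0)%N = false) ?mulr0; last by case: (n) n0.
apply.
- by rewrite cball0.
- by move=> a ->; exact: coneX0.
- by move=> a ->; rewrite scaler0.
Qed.

(** Balls around the vertex are summed over dyadic shells. A ball whose radius is at least |z|/2
    lies in one around the vertex of three times the radius; a smaller one meets only two shells,
    where [shell_bound] applies with the given centre. *)
Lemma volume_growth : exists2 K : R, 0 < K &
  forall z r, 0 <= r -> (dV (cball z r) <= (K * r ^+ (n + n))%:E)%E.
Proof.
have [K K0 hK] := shell_bound.
have mX := closed_borel closed_coneX.
have dVX (A : set (borelCn R n nu)) : measurable A -> dV A = dV (A `&` X).
  move=> mA; rewrite dV_regX // [in RHS]dV_regX; last exact: measurableI.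
  by congr (dV _); apply/seteqP; split => a; [move=> [h1 [h2 h3]]|move=> [[h1 h2] h3]].
have ball0 r : 0 <= r -> (dV (cball 0%R r) <= (2 * K * r ^+ (n + n))%:E)%E.
  rewrite le_eqVlt => /orP[/eqP <-|r0].
    rewrite cball0 dV_set0 lee_fin !mulr_ge0 ?exprn_ge0 //.
  pose t k : R := r * 2^-1 ^+ k.+1.
  have t0 k : 0 < t k by rewrite mulr_gt0 ?exprn_gt0.
  have t2 k : 2 * t k = r * 2^-1 ^+ k by rewrite /t exprS; field.
  (* Index 0 is reserved for the vertex, which lies in no shell; the ball in the other sets provides
     the inclusion that [shell_bound] asks for. *)
  pose F k : set (borelCn R n nu) :=
    if k is k'.+1 then X `&` shell (t k') `&` cball 0 (2 * t k') else [set 0].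
  have mF k : measurable (F k).
    case: k => [|k] /=; first by rewrite -cball0; exact: measurable_cball.
    apply: measurableI; last exact: measurable_cball.
    by apply: measurableI; [exact: mX|exact: measurable_shell].
  rewrite dVX; last exact: measurable_cball.
  apply: (@le_trans _ _ (\sum_(0 <= k <oo) dV (F k))%E).
    apply: measure_sigma_subadditive => //.
      by apply: measurableI => //; exact: measurable_cball.
    move=> a [ar Xa]; have [->|a0] := eqVneq a 0; first by exists 0%N.
    have na : 0 < `|a| by rewrite normr_gt0.
    have exk : exists k, t k <= `|a|.
      exists (Num.bound (r / `|a|)); rewrite /t exprVn ler_pdivrMr ?exprn_gt0 //.
      rewrite mulrC -ler_pdivrMr //.
      have hb : r / `|a| < (Num.bound (r / `|a|))%:R.
        by apply: archi_boundP; rewrite divr_ge0 ?ltW.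
      apply: ltW; apply: lt_le_trans hb _; rewrite -natrX ler_nat.
      by apply: leq_trans (ltnW (ltn_expl _ (ltnSn 1))) _; rewrite leq_exp2l.
    have [k hk mk] := ex_minnP exk.
    exists k.+1 => //=; have h2 : `|a| <= 2 * t k.
      case: k hk mk => [|k] hk mk.
        by move: ar; rewrite /cball /= subr0 /t expr1 mulrCA divff ?mulr1.
      have : ~~ (t k <= `|a|) by apply/negP => /mk; rewrite ltnn.
      by rewrite -ltNge => /ltW hlt; rewrite t2.
    split; last by rewrite /cball /= subr0.
    by split=> //; rewrite /shell /= hk.
  apply: nneseries_le => [k|m]; first exact: measure_ge0.
  have hF k : (dV (F k.+1) <= (K * r ^+ (n + n) * 2^-1 ^+ k)%:E)%E.
    apply: (@le_trans _ _ (K * (2 * t k) ^+ (n + n))%:E).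
      apply: (hK (t k) 0) => //=; first by rewrite mulr_ge0 // ltW.
      - exact: (mF k.+1).
      - by move=> a [[]].
      - by move=> a [[]].
    rewrite lee_fin -mulrA ler_wpM2l // t2 exprMn ler_wpM2l ?exprn_ge0 ?(ltW r0) //.
    rewrite -exprM ler_wiXn2l ?invr_ge0 ?invf_le1 ?ler1n //.
    by rewrite leq_pmulr // addn_gt0 n0.
  (* Geometric partial sums in closed form. The rate 1/2 is weaker than the true rate 2^(-2n), but
     it suffices. *)
  have hm k : (\sum_(0 <= i < k.+1) dV (F i) <=
      (K * r ^+ (n + n) * (2 - 2 * 2^-1 ^+ k))%:E)%E.
    elim: k => [|k IH].
      by rewrite big_nat1 /= dV_set0 expr0 mulr1 subrr mulr0.
    rewrite big_nat_recr //=; apply: le_trans (leeD IH (hF k)) _.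
    rewrite -EFinD lee_fin -mulrDr ler_wpM2l ?mulr_ge0 ?exprn_ge0 ?(ltW r0) //.
    by rewrite exprS; lra.
  case: m => [|m].
    by rewrite big_geq // lee_fin !mulr_ge0 ?exprn_ge0 // ltW.
  apply: le_trans (hm m) _; rewrite lee_fin [X in _ <= X](_ : _ = K * r ^+ (n + n) * 2).
    rewrite ler_wpM2l ?mulr_ge0 ?exprn_ge0 ?(ltW r0) //.
    by rewrite lerBlDr lerDl mulr_ge0 ?exprn_ge0.
  by ring.
exists (2 * K * 3 ^+ (n + n) + 1); first by rewrite ltr_wpDl // !mulr_ge0 ?exprn_ge0.
move=> z r r0; have [hz|hz] := leP (`|z|) (2 * r).
  apply: (@le_trans _ _ (dV (cball 0 (3 * r)))).
    apply: le_measure; rewrite ?inE; [exact: measurable_cball|exact: measurable_cball|].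
    move=> a; rewrite /cball /= subr0 => ha; rewrite -(subrK z a).
    by apply: le_trans (ler_normD _ _) _; lra.
  apply: le_trans (ball0 _ _) _; first by rewrite mulr_ge0.
  by rewrite lee_fin exprMn [X in _ <= X]mulrDl mul1r [X in X <= _]mulrA lerDl exprn_ge0.
have z0 : 0 < `|z| by apply: le_lt_trans hz; rewrite mulr_ge0.
have t0 : 0 < `|z| / 2 by rewrite divr_gt0.
(* As r < |z|/2, every point of the ball has norm between |z|/2 and 2|z|, so the two consecutive
   shells cover it. *)
pose A1 : set (borelCn R n nu) := cball z r `&` X `&` shell (`|z| / 2).
pose A2 : set (borelCn R n nu) := cball z r `&` X `&` shell `|z|.
have mA1 : measurable A1.
  by apply: measurableI; [apply: measurableI => //; exact: measurable_cball|exact: measurable_shell].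
have mA2 : measurable A2.
  by apply: measurableI; [apply: measurableI => //; exact: measurable_cball|exact: measurable_shell].
have h1 : (dV A1 <= (K * r ^+ (n + n))%:E)%E.
  by apply: (hK (`|z| / 2) z _ t0 r0 _ mA1); [move=> a [[]]|move=> a [[]]|move=> a []].
have h2 : (dV A2 <= (K * r ^+ (n + n))%:E)%E.
  by apply: (hK `|z| z _ z0 r0 _ mA2); [move=> a [[]]|move=> a [[]]|move=> a []].
rewrite dVX; last exact: measurable_cball.
apply: (@le_trans _ _ (dV (A1 `|` A2))).
  apply: le_measure; rewrite ?inE.
  - by apply: measurableI => //; exact: measurable_cball.
  - exact: measurableU.
  - move=> a [ha Xa]; move: (ha); rewrite /cball /= => ha'.
    have l1 : `|a| <= `|z| + r.
      by rewrite -(subrK z a); apply: le_trans (ler_normD _ _) _; lra.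
    have l2 : `|z| <= `|a| + r.
      by rewrite -(subKr a z); apply: le_trans (ler_normB _ _) _; rewrite lerD2l.
    have [h3|h3] := leP `|a| `|z|; [left|right]; split=> //; rewrite /shell /=;
      by apply/andP; split; lra.
apply: le_trans (measureU2 _ _ _) _ => //.
apply: le_trans (leeD h1 h2) _; rewrite -EFinD lee_fin -mulrDl.
rewrite ler_wpM2r ?exprn_ge0 //.
have : 2 * K <= 2 * K * 3 ^+ (n + n) by rewrite ler_peMr ?mulr_ge0 // exprn_ege1 // ler1n.
lra.
Qed.

End VolumeGrowth.

(** * Schur's test, Borel structure on products, and the model kernel *)

Section Schur.
Context d (T : measurableType d) (R : realType).
Variable mu : {sigma_finite_measure set T -> \bar R}.
Variables (p q : R).
Hypotheses (p0 : 0 < p) (q0 : 0 < q) (pq : p^-1 + q^-1 = 1).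

Lemma measurable_powR_comp d' (T' : measurableType d') (a : R) (g : T' -> R) :
  measurable_fun [set: T'] g -> measurable_fun [set: T'] (fun x => g x `^ a).
Proof. exact: (@measurableT_comp _ _ _ _ _ _ (@powR R ^~ a)). Qed.

(** Hoelder's inequality for the factorisation k u = (k^(1/q) w)(k^(1/p) u wi). The function [wi]
    stands for 1/w and is tied to [w] only where the kernel is nonzero, so that weights may
    degenerate at the vertex. Raising to the power p turns the exponent 1/q of c into p - 1. *)
Lemma weighted_hoelder (k u w wi : T -> R) (c : R) :
  measurable_fun setT k -> measurable_fun setT u ->
  measurable_fun setT w -> measurable_fun setT wi ->
  (forall x, 0 <= k x) -> (forall x, 0 <= u x) ->
  (forall x, 0 <= w x) -> (forall x, 0 <= wi x) ->
  (forall x, k x != 0 -> w x * wi x = 1) -> 0 <= c ->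
  (\int[mu]_x (k x * w x `^ q)%:E <= c%:E)%E ->
  ((\int[mu]_x (k x * u x)%:E) `^ p <=
    (c `^ (p - 1))%:E * \int[mu]_x (k x * (u x `^ p * wi x `^ p))%:E)%E.
Proof.
move=> mk mu_ mw mwi k0 u0 w0 wi0 kw c0 hc.
pose F x := k x `^ q^-1 * w x; pose G x := k x `^ p^-1 * (u x * wi x).
have mF : measurable_fun setT F by apply: measurable_funM => //; exact: measurable_powR_comp.
have mG : measurable_fun setT G.
  by apply: measurable_funM; [exact: measurable_powR_comp|exact: measurable_funM].
have FG x : F x * G x = k x * u x.
  rewrite /F /G; have [->|kx] := eqVneq (k x) 0.
    by rewrite powR0 ?invr_neq0 ?gt_eqF // !mul0r.
  have -> : k x `^ q^-1 * w x * (k x `^ p^-1 * (u x * wi x)) =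
    (k x `^ q^-1 * k x `^ p^-1) * u x * (w x * wi x) by ring.
  by rewrite kw // mulr1 -powRD ?kx ?implybT // addrC pq powRr1.
have Fq x : `|F x| `^ q = k x * w x `^ q.
  rewrite ger0_norm ?mulr_ge0 ?powR_ge0 // powRM ?powR_ge0 //.
  by rewrite -powRrM mulVf ?gt_eqF // powRr1.
have Gp x : `|G x| `^ p = k x * (u x `^ p * wi x `^ p).
  rewrite ger0_norm ?mulr_ge0 ?powR_ge0 // powRM ?powR_ge0 ?mulr_ge0 // powRM //.
  by rewrite -powRrM mulVf ?gt_eqF // powRr1.
have := hoelder mu mF mG q0 p0; rewrite addrC => /(_ pq).
rewrite Lnorm1 unlock.
have -> : (\int[mu]_x `|(EFin \o (F \* G)%R) x| = \int[mu]_x (k x * u x)%:E)%E.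
  by apply: eq_integral => x _; rewrite /= FG ger0_norm ?mulr_ge0.
have -> : (\int[mu]_x `|(EFin \o F) x| `^ q = \int[mu]_x (k x * w x `^ q)%:E)%E.
  by apply: eq_integral => x _; rewrite /= Fq.
have -> : (\int[mu]_x `|(EFin \o G) x| `^ p =
    \int[mu]_x (k x * (u x `^ p * wi x `^ p))%:E)%E.
  by apply: eq_integral => x _; rewrite /= Gp.
move=> hold.
set I1 := (\int[mu]_x (k x * u x)%:E)%E; set I2 := (X in (_ <= _ * X)%E).
rewrite -/I1 -/I2 in hold.
have I10 : (0 <= I1)%E by apply: integral_ge0 => x _; rewrite lee_fin mulr_ge0.
have I20 : (0 <= I2)%E by apply: integral_ge0 => x _; rewrite lee_fin !mulr_ge0 ?powR_ge0.
have hq : ((\int[mu]_x (k x * w x `^ q)%:E) `^ q^-1 <= (c `^ q^-1)%:E)%E.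
  rewrite -poweR_EFin; apply: gt0_ler_poweR => //; first by rewrite invr_ge0 (ltW q0).
    rewrite in_itv /= leey andbT; apply: integral_ge0 => x _.
    by rewrite lee_fin mulr_ge0 ?powR_ge0.
  by rewrite in_itv /= leey andbT lee_fin.
have h2 : (I1 <= (c `^ q^-1)%:E * I2 `^ p^-1)%E.
  by apply: le_trans hold _; apply: lee_wpmul2r => //; exact: poweR_ge0.
have pm : p - 1 = q^-1 * p.
  rewrite (_ : q^-1 = 1 - p^-1); last by rewrite -pq addrC addKr.
  by rewrite mulrBl mulVf ?gt_eqF // mul1r.
have -> : ((c `^ (p - 1))%:E * I2 = ((c `^ q^-1)%:E * I2 `^ p^-1) `^ p)%E.
  rewrite poweRM ?poweR_ge0 ?lee_fin ?powR_ge0 // -poweRrM mulVf ?gt_eqF // poweRe1 //.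
  by rewrite poweR_EFin -powRrM -pm.
apply: gt0_ler_poweR h2; rewrite ?in_itv /= ?leey ?andbT ?(ltW p0) //.
by rewrite mule_ge0 ?poweR_ge0 // lee_fin powR_ge0.
Qed.

(** Hoelder in x produces the factor a(z)^(p-1); Tonelli exchanges the integrals, and the second
    bound controls what is left in z. *)
Lemma schur_test (k : T * T -> R) (u w wi a : T -> R) (B : R) :
  measurable_fun setT k -> measurable_fun setT u ->
  measurable_fun setT w -> measurable_fun setT wi -> measurable_fun setT a ->
  (forall x, 0 <= k x) -> (forall x, 0 <= u x) ->
  (forall x, 0 <= w x) -> (forall x, 0 <= wi x) -> (forall z, 0 <= a z) ->
  (forall z x, k (z, x) != 0 -> w x * wi x = 1) -> 0 <= B ->
  (forall z, (\int[mu]_x (k (z, x) * w x `^ q)%:E <= (a z)%:E)%E) ->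
  (forall x, (\int[mu]_z (a z `^ (p - 1) * k (z, x) * wi x `^ p)%:E <= B%:E)%E) ->
  (\int[mu]_z (\int[mu]_x (k (z, x) * u x)%:E) `^ p <= B%:E * \int[mu]_x (u x `^ p)%:E)%E.
Proof.
move=> mk mu_ mw mwi ma k0 u0 w0 wi0 a0 kw B0 h1 h2.
pose g (y : T * T) : \bar R :=
  (a y.1 `^ (p - 1) * (k y * (u y.2 `^ p * wi y.2 `^ p)))%:E.
have g0 y : (0 <= g y)%E by rewrite lee_fin !mulr_ge0 ?powR_ge0.
have mg : measurable_fun setT g.
  apply/measurable_EFinP; apply: measurable_funM.
    apply: measurable_powR_comp; exact: measurableT_comp.
  apply: measurable_funM => //.
  by apply: measurable_funM; apply: measurable_powR_comp; exact: measurableT_comp.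
have mkz z : measurable_fun setT (fun x => k (z, x)).
  by apply: measurableT_comp => //; exact: pair1_measurable.
have mkx x : measurable_fun setT (fun z => k (z, x)).
  by apply: measurableT_comp => //; exact: pair2_measurable.
apply: (@le_trans _ _ (\int[mu]_z \int[mu]_x g (z, x))%E).
  apply: ge0_le_int => z _; first exact: poweR_ge0.
  apply: le_trans (weighted_hoelder (mkz z) mu_ mw mwi _ _ _ _ _ (a0 z) (h1 z)) _ => //.
    exact: kw.
  rewrite -ge0_integralZl_EFin ?powR_ge0 //.
    by move=> x _; rewrite lee_fin !mulr_ge0 ?powR_ge0.
  apply/measurable_EFinP; apply: measurable_funM => //.
  by apply: measurable_funM; exact: measurable_powR_comp.
rewrite (@fubini_tonelli _ _ _ _ _ mu mu g mg g0) -ge0_integralZl_EFin //; last 2 first.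
- by move=> x _; rewrite lee_fin powR_ge0.
- by apply/measurable_EFinP; exact: measurable_powR_comp.
apply: ge0_le_int => x _; first by apply: integral_ge0.
have -> : (\int[mu]_z g (z, x) =
    \int[mu]_z ((u x `^ p)%:E * (a z `^ (p - 1) * k (z, x) * wi x `^ p)%:E))%E.
  by apply: eq_integral => z _; rewrite /g -EFinM /=; congr (_%:E); ring.
rewrite ge0_integralZl_EFin ?powR_ge0 //.
- by rewrite muleC; apply: lee_wpmul2r; rewrite ?lee_fin ?powR_ge0.
- by move=> z _; rewrite lee_fin !mulr_ge0 ?powR_ge0.
- apply/measurable_EFinP; apply: measurable_funM => //; apply: measurable_funM => //.
  exact: measurable_powR_comp.
Qed.
End Schur.

Section Borel.
Variables (R : realType) (n nu : nat).
Local Notation E := (Cn R (n + nu)).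
Local Notation T := (borelCn R n nu).

Definition ratpt (a : 'rV[rat]_(n + nu) * 'rV[rat]_(n + nu)) : E :=
  (map_mx ratr a.1, map_mx ratr a.2).

Lemma rat_dense_row m (x : 'rV[R]_m) (e : R) : 0 < e ->
  exists a : 'rV[rat]_m, `|map_mx ratr a - x| < e.
Proof.
move=> e0.
have ex j : exists q : rat, `|ratr q - x 0 j| <= e / 2.
  have [|q] := @rat_in_itvoo R (x 0 j - e / 2) (x 0 j + e / 2); first lra.
  by rewrite in_itv /= => hq; exists q; rewrite ler_norml; lra.
have [q hq] := choice ex; exists (\row_j q j).
apply: (@le_lt_trans _ _ (e / 2)); last lra.
apply: rV_norm_le => [|j]; first lra.
by rewrite !mxE.
Qed.

Lemma rat_dense (x : E) (e : R) : 0 < e -> exists a, `|ratpt a - x| < e.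
Proof.
move=> e0; have [a ha] := rat_dense_row x.1 e0; have [b hb] := rat_dense_row x.2 e0.
by exists (a, b); rewrite prod_normE /= gt_max ha hb.
Qed.

(** Separability: an open set is the countable union of the products of balls with rational centres
    and radii 1/(k+1) that it contains, hence lies in the product sigma-algebra. *)
Lemma open_borel2 (O : set (E * E)) : open O -> measurable (O : set (T * T)).
Proof.
move=> oO.
pose box (i : ('rV[rat]_(n + nu) * 'rV[rat]_(n + nu)) *
    ('rV[rat]_(n + nu) * 'rV[rat]_(n + nu)) * nat) : set (T * T) :=
  [set y : E * E | `|y.1 - ratpt i.1.1| < i.2.+1%:R^-1 /\ `|y.2 - ratpt i.1.2| < i.2.+1%:R^-1].
have -> : O = \bigcup_i [set y | box i y /\ box i `<=` O].
  apply/seteqP; split => [y Oy|y [i _] [/[swap]]]; last exact.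
  have /nbhs_ballP[e /= e0 he] : nbhs y O by exact: open_nbhs_nbhs.
  have [k hk] : exists k : nat, k.+1%:R^-1 < e / 2.
    have := near_infty_natSinv_lt (PosNum (divr_gt0 e0 (ltr0n R 2))).
    by move=> [k _ /(_ k (leqnn k))] /= ?; exists k.
  have k0 : 0 < k.+1%:R^-1 :> R by rewrite invr_gt0.
  have [a ha] := rat_dense y.1 k0; have [b hb] := rat_dense y.2 k0.
  exists ((a, b), k) => //; split; first by rewrite /box /= distrC ha distrC hb.
  move=> y' [/= h1 h2]; apply: he; split => /=; rewrite -ball_normE /=.
    have := ler_distD (ratpt a) y.1 y'.1; rewrite distrC in ha; rewrite distrC in h1.
    move=> h3; apply: le_lt_trans h3 _.
    by rewrite [e]splitr; apply: ltrD; [exact: lt_trans ha hk|exact: lt_trans h1 hk].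
  have := ler_distD (ratpt b) y.2 y'.2; rewrite distrC in hb; rewrite distrC in h2.
  move=> h3; apply: le_lt_trans h3 _.
  by rewrite [e]splitr; apply: ltrD; [exact: lt_trans hb hk|exact: lt_trans h2 hk].
apply: countable_bigcupT_measurable => [|i]; first exact: countableP.
have [hi|hi] := pselect (box i `<=` O); last first.
  by rewrite (_ : [set y | _] = set0) //; apply/seteqP; split => // y [].
have mb (c : E) (r : R) : measurable ([set x : E | `|x - c| < r] : set T).
  by apply: open_borel; exact: open_norm_lt.
rewrite (_ : [set y | _] = box i); last by apply/seteqP; split => // y [].
exact: (measurableX (mb (ratpt i.1.1) i.2.+1%:R^-1) (mb (ratpt i.1.2) i.2.+1%:R^-1)).
Qed.

Lemma continuous_borel (O : set E) (g : E -> R^o) : open O ->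
  (forall x, O x -> {for x, continuous g}) -> measurable_fun (O : set T) (g : T -> R).
Proof.
move=> oO cg; apply: (measurability _ (RGenOpens.measurableE R)).
move=> _ [_ [a [b ->] <-]]; apply: open_borel; rewrite openE => x [Ox gx].
have : open_nbhs x O by [].
have nb : nbhs (g x) (`]a, b[%classic : set R) by apply: open_nbhs_nbhs; split => //; exact: interval_open.
move=> /open_nbhs_nbhs nO.
by apply: filterS2 nO (cg x Ox _ nb) => y; split.
Qed.

Lemma continuous_borel2 (O : set (E * E)) (g : E * E -> R^o) : open O ->
  (forall x, O x -> {for x, continuous g}) ->
  measurable_fun (O : set (T * T)) (g : T * T -> R).
Proof.
move=> oO cg; apply: (measurability _ (RGenOpens.measurableE R)).
move=> _ [_ [a [b ->] <-]]; apply: open_borel2; rewrite openE => x [Ox gx].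
have : open_nbhs x O by [].
have nb : nbhs (g x) (`]a, b[%classic : set R) by apply: open_nbhs_nbhs; split => //; exact: interval_open.
move=> /open_nbhs_nbhs nO.
by apply: filterS2 nO (cg x Ox _ nb) => y; split.
Qed.

Lemma measurable_dist (z : E) : measurable_fun [set: T] (fun x : T => `|(x : E) - z|).
Proof.
by apply: continuous_borel; [exact: openT|move=> x _; exact: norm_sub_continuous].
Qed.

Lemma measurable_dist2 : measurable_fun [set: T * T] (fun y : T * T => `|(y.1 : E) - y.2|).
Proof.
apply: (@continuous_borel2 setT); first exact: openT.
move=> y _; apply: (@continuous_comp _ _ _ (fun y : E * E => y.1 - y.2) (fun x => `|x| : R^o)).
  apply: continuousB; [exact: cvg_fst|exact: cvg_snd].
exact: norm_continuous.
Qed.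
End Borel.

Section Riesz.
Variables (R : realType) (n nu : nat).
Local Notation E := (Cn R (n + nu)).
Local Notation T := (borelCn R n nu).
Variable dV : {measure set T -> \bar R}.
Local Notation M := (n + n)%N.
Variable K : R.
Hypothesis K0 : 0 < K.
Hypothesis hK : forall (z : E) r, 0 <= r -> (dV (cball z r) <= (K * r ^+ M)%:E)%E.

Lemma powRDp (x a b : R) : 0 < x -> x `^ (a + b) = x `^ a * x `^ b.
Proof. by move=> x0; rewrite powRD // (gt_eqF x0) implybT. Qed.

Lemma powR_exprn (x a : R) k : 0 <= x -> (x ^+ k) `^ a = (x `^ a) ^+ k.
Proof. by move=> x0; rewrite -(powR_mulrn k x0) -(powR_mulrn k (powR_ge0 x a)) powRAC. Qed.

Lemma dyadic_scale (r t : R) : 0 < t -> t <= r ->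
  exists k : nat, r * 2^-1 ^+ k.+1 < t /\ t <= r * 2^-1 ^+ k.
Proof.
move=> t0 tr.
have ex : exists k, r * 2^-1 ^+ k.+1 < t.
  have r0 : 0 < r by apply: lt_le_trans tr.
  have [k hk] : exists k, 2^-1 ^+ k < t / r.
    have := @cvg_expr R 2^-1; rewrite ger0_norm // => /(_ _).
    move=> /(_ ltac:(lra)) /cvgrPdist_lt /(_ (t / r)); rewrite divr_gt0 // => /(_ isT) [k _].
    by move=> /(_ k (leqnn k)) /=; rewrite sub0r normrN ger0_norm ?exprn_ge0 // => hk; exists k.
  exists k; rewrite -ltr_pdivlMl // mulrC; apply: le_lt_trans hk.
  by rewrite exprS ler_piMl ?exprn_ge0 //; lra.
have [k hk kmin] := ex_minnP ex; exists k; split => //.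
case: k hk kmin => [|k] hk kmin; first by rewrite expr0 mulr1.
by rewrite leNgt; apply/negP => /kmin; rewrite ltnn.
Qed.

(** On the annulus between two dyadic radii the integrand is at most its value at the inner radius.
    With volume growth r^(2n) the sum is geometric of ratio [th] = 2^(a - 2n), below 1 because a <
    2n. *)
Lemma riesz_integral (a r : R) : 0 <= a -> a < M%:R -> 0 < r ->
  exists2 C, 0 <= C & forall z : E,
    (\int[dV]_(x in cball z r) ((`|(x : E) - z| `^ (- a))%:E) <= C%:E)%E.
Proof.
move=> a0 aM r0.
pose rho k := r * 2^-1 ^+ k.
have rho0 k : 0 < rho k by rewrite mulr_gt0 ?exprn_gt0.
pose th := 2^-1 `^ (M%:R - a) : R.
have th0 : 0 <= th by exact: powR_ge0.
have th1 : th < 1.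
  have <- : (1 : R) `^ (M%:R - a) = 1 by rewrite powR1.
  rewrite /th; apply: gt0_ltr_powR.
  - by rewrite subr_gt0.
  - by rewrite nnegrE.
  - by rewrite nnegrE.
  - lra.
pose C0 := K * (r * 2^-1) `^ (- a) * r ^+ M.
have C00 : 0 <= C0 by rewrite !mulr_ge0 ?powR_ge0 ?exprn_ge0 // ltW.
exists (C0 / (1 - th)); first by rewrite divr_ge0 // subr_ge0 ltW.
move=> z.
pose g k (x : T) : \bar R := ((rho k.+1 `^ (- a)) * \1_(cball z (rho k) : set T) x)%:E.
have g0 k x : (0 <= g k x)%E by rewrite lee_fin mulr_ge0 ?powR_ge0.
have mg k : measurable_fun [set: T] (g k).
  apply/measurable_EFinP; apply: measurable_funM => //.
  by apply: measurable_indic; exact: measurable_cball.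
apply: (@le_trans _ _ (\int[dV]_x \sum_(0 <= k <oo) g k x)%E).
  rewrite integral_mkcond; apply: ge0_le_int => x _; rewrite patchE; case: ifPn => //.
  - rewrite inE /cball /= => hx.
    have [k hk] : exists k, ((`|(x : E) - z| `^ (- a))%:E <= g k x)%E.
      (* At x = z the integrand is [powR 0 (- a)], by convention 0, or 1 when a = 0; the first term
         of the series dominates both. *)
      have [e0|ne0] := eqVneq `|(x : E) - z| 0.
        exists 0; rewrite /g indicE mem_set ?mulr1 ?lee_fin; last first.
          by rewrite /cball /= e0 ltW.
        have [->|an0] := eqVneq a 0; first by rewrite oppr0 !powRr0.
        by rewrite e0 powR0 ?oppr_eq0 // powR_ge0.
      have [||k [h1 h2]] := @dyadic_scale r `|(x : E) - z|; rewrite ?lt_def ?ne0 //=.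
      exists k; rewrite /g indicE mem_set // mulr1 lee_fin !powRN.
      rewrite lef_pV2 ?posrE ?powR_gt0 // ?lt_def ?ne0 //=.
      apply: ge0_ler_powR => //; rewrite ?nnegrE ?(ltW (rho0 _)) //; exact: ltW.
    apply: le_trans hk _.
    have := @nneseries_lim_ge R (fun k => g k x) xpredT 0 k.+1 (fun i _ _ => g0 i x).
    apply: le_trans; rewrite big_nat_recr //= leeDr //.
    by apply: sume_ge0.
  - by move=> _; apply: nneseries_ge0.
rewrite integral_nneseries //.
apply: nneseries_le => [k|m]; first exact: integral_ge0.
apply: (@le_trans _ _ (\sum_(0 <= k < m) (C0 * th ^+ k)%:E)%E).
  apply: lee_sum => k _.
  rewrite /g; under eq_integral do rewrite EFinM.
  rewrite ge0_integralZl_EFin ?powR_ge0 //; last first.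
    by apply/measurable_EFinP; apply: measurable_indic; exact: measurable_cball.
  rewrite integral_indic ?setIT //; last exact: measurable_cball.
  apply: le_trans (lee_wpmul2l _ (hK z (ltW (rho0 k)))) _.
    by rewrite lee_fin powR_ge0.
  rewrite -EFinM lee_fin le_eqVlt; apply/orP; left; apply/eqP.
  have -> : rho k.+1 = (r * 2^-1) * 2^-1 ^+ k by rewrite /rho exprS mulrA.
  rewrite /rho /C0 /th powRM ?mulr_ge0 ?exprn_ge0 ?(ltW r0) //.
  rewrite [(r * _) ^+ M]exprMn -powR_exprn // powRD ?powR_mulrn ?exprn_ge0 //; last first.
    by rewrite expf_eq0 invr_eq0 pnatr_eq0 /= andbF implybT.
  ring.
rewrite sumEFin lee_fin -mulr_sumr.
apply: ler_wpM2l => //.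
rewrite big_mkord.
have := subrX1 th m; rewrite -(opprB 1) -(opprB 1 th) mulNr => /oppr_inj e.
rewrite -[leRHS]mul1r ler_pdivlMr ?subr_gt0 // mulrC -e.
by rewrite gerBl exprn_ge0.
Qed.

(** The model kernel, with t = |zeta|, s = |zeta - z| and u = |z|. The exponent b is m for the
    operator itself and m q inside Schur's test. *)
Definition kb (b t s u : R) : R := (t + u) `^ b * t `^ (- b) * s `^ (1 - M%:R).

Lemma kb_ge0 b t s u : 0 <= kb b t s u.
Proof. by rewrite !mulr_ge0 ?powR_ge0. Qed.

Hypothesis n0 : (0 < n)%N.

Lemma dV_pt (z : E) : dV [set z] = 0%E.
Proof.
apply/eqP; rewrite eq_le measure_ge0 andbT -cball0.
apply: le_trans (hK z (lexx 0)) _.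
by rewrite expr0n addn_eq0 andbb (gtn_eqF n0) mulr0.
Qed.

Lemma M1_ge1 : 1 <= M%:R - 1 :> R.
Proof.
have : 2%:R <= M%:R :> R by rewrite ler_nat; lia.
lra.
Qed.

(** If s <= t then t + u <= 3 t and the factors of exponent b cancel up to 3^b. If t < s then t + u
    <= 3 s, and the remaining power of s is compared with t when its exponent is negative, with rho
    otherwise. The result is a sum of Riesz kernels centred at z and at the vertex. *)
Lemma kb_le b rho t s u : 0 <= b -> 0 < rho -> 0 <= t -> 0 <= s -> 0 <= u ->
  s <= rho -> u <= t + s ->
  kb b t s u <= 3 `^ b * (s `^ (- (M%:R - 1)) + t `^ (- (M%:R - 1)) +
    (if b < M%:R - 1 then 0 else rho `^ (b - (M%:R - 1)) * t `^ (- b))).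
Proof.
move=> b0 rho0 t0 s0 u0 sr ut; have m1 := M1_ge1.
have P x y : 0 <= x `^ y :> R by exact: powR_ge0.
have I0 : 0 <= (if b < M%:R - 1 then 0 else rho `^ (b - (M%:R - 1)) * t `^ (- b)).
  by case: ifP => // _; rewrite mulr_ge0.
have e1 : 1 - M%:R = - (M%:R - 1) :> R by ring.
rewrite /kb e1.
have [s00|sn] := eqVneq s 0.
  have -> : s `^ (- (M%:R - 1)) = 0 by rewrite s00 powR0 //; lra.
  rewrite mulr0.
  by rewrite mulr_ge0 // !addr_ge0.
have sp : 0 < s by rewrite lt_def sn.
have [t00|tn] := eqVneq t 0.
  have [b00|bn] := eqVneq b 0.
    rewrite b00 oppr0 !powRr0 !mul1r -addrA lerDl addr_ge0 //.
    by case: ifP => // _; rewrite mulr1.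
  have e0 : t `^ (- b) = 0 by rewrite t00 powR0 ?oppr_eq0.
  by rewrite {1}e0 mulr0 mul0r mulr_ge0 // !addr_ge0.
have tp : 0 < t by rewrite lt_def tn.
have [st|ts] := leP s t.
  apply: (@le_trans _ _ (3 `^ b * s `^ (- (M%:R - 1)))); last first.
    by rewrite ler_pM2l ?powR_gt0 // -addrA lerDl addr_ge0.
  apply: ler_wpM2r => //.
  apply: (@le_trans _ _ ((3 * t) `^ b * t `^ (- b))).
    apply: ler_wpM2r => //; apply: ge0_ler_powR => //; rewrite ?nnegrE; lra.
  by rewrite powRM // -mulrA powRN divff ?mulr1 // gt_eqF // powR_gt0.
have h1 : (t + u) `^ b <= 3 `^ b * s `^ b.
  rewrite -powRM //; apply: ge0_ler_powR => //; rewrite ?nnegrE; lra.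
apply: (@le_trans _ _ (3 `^ b * s `^ b * t `^ (- b) * s `^ (- (M%:R - 1)))).
  by apply: ler_wpM2r => //; apply: ler_wpM2r.
have -> : 3 `^ b * s `^ b * t `^ (- b) * s `^ (- (M%:R - 1)) =
    3 `^ b * (s `^ (b - (M%:R - 1)) * t `^ (- b)).
  rewrite powRD; last by rewrite sn implybT.
  by ring.
rewrite ler_pM2l ?powR_gt0 //; case: ltP => hb.
  rewrite addr0; apply: (@le_trans _ _ (t `^ (- (M%:R - 1)))); last by rewrite lerDr.
  have -> : t `^ (- (M%:R - 1)) = t `^ (b - (M%:R - 1)) * t `^ (- b).
    rewrite -powRD; last by rewrite tn implybT.
    by congr powR; ring.
  apply: ler_wpM2r => //.
  rewrite -(opprB _ b) !powRN lef_pV2 ?posrE ?powR_gt0 //.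
  by apply: ge0_ler_powR; rewrite ?nnegrE ?(ltW ts) //; lra.
apply: (@le_trans _ _ (rho `^ (b - (M%:R - 1)) * t `^ (- b))); last by rewrite lerDr addr_ge0.
apply: ler_wpM2r => //; apply: ge0_ler_powR; rewrite ?nnegrE //; lra.
Qed.

(** One of the Riesz kernels is centred at z, so radii are doubled: the ball of radius rho around 0
    lies in the one of radius 2 rho around z. *)
Lemma kb_integral (b rho : R) : 0 <= b -> b < M%:R -> 0 < rho ->
  exists2 C, 0 <= C & forall z : E, `|z| <= rho ->
    (\int[dV]_(x in cball (0%R : E) rho) ((kb b `|x : E| `|(x : E) - z| `|z|)%:E) <= C%:E)%E.
Proof.
move=> b0 bM rho0; have m1 := M1_ge1.
have r2 : 0 < 2 * rho by lra.
have h1 : 0 <= M%:R - 1 :> R by lra.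
have h2 : M%:R - 1 < M%:R :> R by lra.
have [C1 C10 hC1] := riesz_integral h1 h2 r2.
have [C2 C20 hC2] := riesz_integral b0 bM r2.
pose q := if b < M%:R - 1 then 0 else (2 * rho) `^ (b - (M%:R - 1)) : R.
have q0 : 0 <= q by rewrite /q; case: ifP => // _; exact: powR_ge0.
exists (3 `^ b * (C1 + C1 + q * C2)).
  by rewrite mulr_ge0 ?powR_ge0 // !addr_ge0 // mulr_ge0.
move=> z zr.
pose g a w (x : T) : \bar R := (`|(x : E) - w| `^ (- a))%:E.
have mg a w : measurable_fun [set: T] (g a w).
  apply/measurable_EFinP; apply: measurable_powR_comp; exact: measurable_dist.
have g0 a w x : (0 <= g a w x)%E by rewrite lee_fin powR_ge0.
have hi a w (A : R) : 0 <= A -> (\int[dV]_(x in cball w (2 * rho)) g a w x <= A%:E)%E ->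
    (w = z \/ w = 0) -> (\int[dV]_(x in cball (0%R : E) rho) g a w x <= A%:E)%E.
  move=> A0 hA hw; apply: le_trans hA; apply: ge0_subset_integral => //.
  - exact: measurable_cball.
  - exact: measurable_cball.
  - exact: measurable_funTS.
  - move=> x; rewrite /cball /= subr0 => hx.
    case: hw => ->; last by rewrite subr0; lra.
    by apply: le_trans (ler_normB _ _) _; rewrite mulr2n mulrDl mul1r lerD.
pose g1 := g (M%:R - 1).
have g10 w x : (0 <= g1 w x)%E by exact: g0.
have mD := measurable_cball (0%R : E) rho.
have mgD a w : measurable_fun (cball (0%R : E) rho : set T) (g a w) by exact: measurable_funTS.
apply: (@le_trans _ _ (\int[dV]_(x in cball (0%R : E) rho)
    ((3 `^ b)%:E * (g1 z x + g1 0%R x + q%:E * g b 0%R x)))%E).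
  apply: ge0_le_int => x; first by rewrite lee_fin kb_ge0.
  rewrite /cball /= subr0 => hx.
  rewrite [leRHS](_ : _ = (3 `^ b * (`|(x : E) - z| `^ (- (M%:R - 1)) +
    `|(x : E) - 0| `^ (- (M%:R - 1)) + q * `|(x : E) - 0| `^ (- b)))%:E) // lee_fin subr0.
  apply: le_trans (@kb_le b (2 * rho) `|x : E| `|(x : E) - z| `|z| b0 r2 _ _ _ _ _) _ => //.
  - by apply: le_trans (ler_normB _ _) _; rewrite mulr2n mulrDl mul1r lerD.
  - by rewrite -{1}(subKr x z); apply: ler_normB.
  - by rewrite /q; case: ifP => // _; rewrite !mul0r.
have mq : measurable_fun (cball (0%R : E) rho : set T) (fun x => q%:E * g b 0%R x)%E.
  exact: measurable_funeM.
have mg11 : measurable_fun (cball (0%R : E) rho : set T) (fun x => g1 z x + g1 0%R x)%E.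
  by apply: emeasurable_funD; exact: mgD.
rewrite ge0_integralZl_EFin ?powR_ge0 //; last 2 first.
- by move=> x _; apply: adde_ge0; [exact: adde_ge0|exact: mule_ge0].
- exact: emeasurable_funD.
rewrite ge0_integralD //; last 2 first.
- by move=> x _; exact: adde_ge0.
- by move=> x _; exact: mule_ge0.
rewrite ge0_integralD // ?ge0_integralZl_EFin //; [|exact: mgD..].
rewrite EFinM !EFinD EFinM; apply: lee_wpmul2l; first by rewrite lee_fin powR_ge0.
apply: leeD; last by apply: lee_wpmul2l => //; apply: hi => //; right.
by apply: leeD; apply: hi => //; [left|right].
Qed.

(** Tonelli's theorem requires the sigma-finite structure; the balls of integer radius have finite
    volume and exhaust the space. *)
Lemma sigma_finite_version :
  exists mu : {sigma_finite_measure set T -> \bar R}, (mu : {measure set T -> \bar R}) = dV.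
Proof.
have sf : sigma_finite setT dV.
  exists (fun k => cball (0 : E) k%:R) => [|k]; last first.
    by split; [exact: measurable_cball|apply: le_lt_trans (hK _ (ler0n _ k)) (ltry _)].
  apply/seteqP; split => // x _; exists (Num.bound `|x : E|) => //.
  by rewrite /cball /= subr0; apply: ltW; exact: archi_boundP.
pose H1 := isSFinite.Build _ _ _ _ (sfinite_measure_sigma_finite sf).
pose H2 := isSigmaFinite.Build _ _ _ _ sf.
pose mu := HB.pack_for (SigmaFiniteMeasure.type T R) (Measure.sort dV) H1 H2.
by exists mu; apply: eq_measure.
Qed.

(** The hypothesis relating p and m is exactly m q < 2n for the conjugate exponent q, which makes
    the first Schur integral finite. *)
Lemma kb_schur (m : nat) (p rho : R) : 1 < p -> M%:R < p * (M%:R - m%:R) -> 0 < rho ->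
  exists2 C, 0 <= C & forall u : T -> R, measurable_fun setT u -> (forall x, 0 <= u x) ->
    (\int[dV]_(z in cball (0%R : E) rho `\ (0%R : E))
        ((\int[dV]_(x in cball (0%R : E) rho)
            (kb m%:R `|x : E| `|(x : E) - z| `|z : E| * u x)%:E) `^ p)
      <= C%:E * \int[dV]_x (u x `^ p)%:E)%E.
Proof.
move=> p1 pM rho0; have m1 := M1_ge1.
have p0 : 0 < p by lra.
pose q := p / (p - 1).
have q0 : 0 < q by rewrite divr_gt0 //; lra.
have pn0 : p != 0 by lra.
have p1n0 : p - 1 != 0 by lra.
have pq : p^-1 + q^-1 = 1 by rewrite /q; field; rewrite p1n0 pn0.
have qp : q / p * (p - 1) = 1 by rewrite /q; field; rewrite p1n0 pn0.
have mR0 : 0 <= m%:R :> R by exact: ler0n.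
have mq0 : 0 <= m%:R * q by rewrite mulr_ge0 // ltW.
have mqM : m%:R * q < M%:R.
  by rewrite /q mulrA ltr_pdivrMr; [nra|lra].
have mM : m%:R < M%:R :> R by nra.
have [C1 C10 hC1] := kb_integral mq0 mqM rho0.
have [C2 C20 hC2] := kb_integral mR0 mM rho0.
(* With this exponent both Schur integrals close up: [al * p = m], [al * q * (p - 1) = m] and
   [m + al * q = m * q]. *)
pose al := m%:R / p.
have al0 : 0 <= al by rewrite divr_ge0 // ltW.
have alq : al * q * (p - 1) = m%:R.
  by rewrite /al /q; field; rewrite p1n0 pn0.
have mqE : m%:R * q = m%:R + al * q by rewrite /al /q; field; rewrite p1n0 pn0.
have [mu hmu] := sigma_finite_version; rewrite -hmu in hC1 hC2 *.
(* The two weights are inverse to each other only away from the vertex, which is removed; it is a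
   null set. *)
pose B0 : set T := cball (0%R : E) rho `\ (0 : E).
have mB0 : measurable B0.
  by apply: measurableD; [exact: measurable_cball|rewrite -cball0; exact: measurable_cball].
have B0P (x : T) : B0 x -> 0 < `|x : E| /\ `|x : E| <= rho.
  by move=> [+ /eqP x0]; rewrite /cball /= subr0 normr_gt0.
pose k (y : T * T) : R := \1_(B0 `*` B0) y * kb m%:R `|y.2 : E| `|(y.1 : E) - y.2| `|y.1 : E|.
have mnorm : measurable_fun [set: T] (fun x : T => `|x : E|).
  by rewrite (_ : (fun _ => _) = fun x : T => `|(x : E) - 0|); [exact: measurable_dist|apply/funext => x; rewrite subr0].
have mn1 : measurable_fun [set: T * T] (fun y : T * T => `|y.1 : E|) by exact: measurableT_comp.
have mn2 : measurable_fun [set: T * T] (fun y : T * T => `|y.2 : E|) by exact: measurableT_comp.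
have mk : measurable_fun setT k.
  apply: measurable_funM; first by apply: measurable_indic; exact: measurableX.
  apply: measurable_funM; [apply: measurable_funM|]; apply: measurable_powR_comp => //.
    exact: measurable_funD.
  exact: measurable_dist2.
have mkb1 (b : R) (z : E) : measurable_fun [set: T]
    (fun x : T => kb b `|x : E| `|(x : E) - z| `|z|).
  apply: measurable_funM; [apply: measurable_funM|]; apply: measurable_powR_comp => //.
    exact: measurable_funD.
  exact: measurable_dist.
have k0 y : 0 <= k y by rewrite mulr_ge0 // kb_ge0.
have kE z x : B0 z -> B0 x -> k (z, x) = kb m%:R `|x : E| `|(x : E) - z| `|z : E|.
  move=> hz hx; rewrite /k (_ : \1_(B0 `*` B0) (z, x) = 1) ?mul1r /=.
    by rewrite (distrC (z : E)).
  by rewrite indicE (_ : (z, x) \in _) // inE; split.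
have kN z x : ~ (B0 z /\ B0 x) -> k (z, x) = 0.
  by move=> hz; rewrite /k indicE memNset ?mul0r.
pose a (z : T) : R := C1 * `|z : E| `^ (- (al * q)).
exists (C1 `^ (p - 1) * C2); first by rewrite mulr_ge0 ?powR_ge0.
move=> u mu_ u0.
have mw (b : R) : measurable_fun [set: T] (fun x : T => `|x : E| `^ b) by exact: measurable_powR_comp.
have ma : measurable_fun setT a by exact: measurable_funM.
have a0 z : 0 <= a z by rewrite mulr_ge0 ?powR_ge0.
have kw z x : k (z, x) != 0 -> `|x : E| `^ (- al) * `|x : E| `^ al = 1.
  have [[hz hx] _|h] := pselect (B0 z /\ B0 x); last by rewrite kN ?eqxx.
  by rewrite powRN mulVf // gt_eqF // powR_gt0; case: (B0P _ hx).
have h1 z : (\int[mu]_x (k (z, x) * (`|x : E| `^ (- al)) `^ q)%:E <= (a z)%:E)%E.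
  have [hz|hz] := pselect (B0 z); last first.
    rewrite integral0_eq ?lee_fin // => x _.
    by rewrite kN ?mul0r // => -[].
  have [z0 zr] := B0P _ hz.
  apply: (@le_trans _ _ (\int[mu]_(x in cball (0%R : E) rho)
      ((`|z : E| `^ (- (al * q)))%:E *
       (kb (m%:R * q) `|x : E| `|(x : E) - z| `|z : E|)%:E))%E).
    rewrite [leRHS]integral_mkcond; apply: ge0_le_int => x _.
      by rewrite lee_fin mulr_ge0 ?powR_ge0.
    have [hx|hx] := pselect (B0 x); last first.
      rewrite kN ?mul0r; last by case.
      by apply: erestrict_ge0 => y _; rewrite -EFinM lee_fin mulr_ge0 ?powR_ge0 ?kb_ge0.
    have [x0 xr] := B0P _ hx.
    rewrite patchE mem_set /cball /= ?subr0 // -EFinM lee_fin kE // /kb mqE.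
    have e1 : (`|x : E| + `|z : E|) `^ (m%:R + al * q) =
        (`|x : E| + `|z : E|) `^ m%:R * (`|x : E| + `|z : E|) `^ (al * q).
      by apply: powRDp; exact: addr_gt0.
    have e2 : `|x : E| `^ (- (m%:R + al * q)) = `|x : E| `^ (- m%:R) * `|x : E| `^ (- (al * q)).
      by rewrite opprD powRDp.
    rewrite -powRrM mulNr e1 e2.
    set A := (_ + _) `^ m%:R; set t1 := `|x : E| `^ (- m%:R).
    set t2 := `|x : E| `^ (- (al * q)); set ss := _ `^ (1 - M%:R).
    set u1 := `|z : E| `^ (- (al * q)).
    (* Since |z| <= |x| + |z|, inserting this factor raises the exponent of the kernel from m to m q
       at the price of |z|^(-al q), which is the weight [a z]. *)
    have hu : 1 <= u1 * (`|x : E| + `|z : E|) `^ (al * q).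
      rewrite /u1 powRN ler_pdivlMl ?powR_gt0 // mulr1.
      have al1 : 0 <= al * q by rewrite mulr_ge0 // ltW.
      by apply: (ge0_ler_powR al1); rewrite ?nnegrE ?addr_ge0 ?lerDr.
    rewrite -[leLHS]mul1r.
    have -> : u1 * (A * (`|x : E| + `|z : E|) `^ (al * q) * (t1 * t2) * ss) =
      u1 * (`|x : E| + `|z : E|) `^ (al * q) * (A * t1 * ss * t2) by ring.
    by apply: ler_wpM2r => //; rewrite !mulr_ge0 ?powR_ge0.
  rewrite ge0_integralZl_EFin ?powR_ge0 //; last first.
  - by apply: measurable_funTS; apply/measurable_EFinP; exact: mkb1.
  - by move=> x _; rewrite lee_fin kb_ge0.
  - exact: measurable_cball.
  rewrite /a [C1 * _]mulrC EFinM; apply: lee_wpmul2l; first by rewrite lee_fin powR_ge0.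
  exact: hC1.
have h2 x : (\int[mu]_z (a z `^ (p - 1) * k (z, x) * (`|x : E| `^ al) `^ p)%:E <=
    (C1 `^ (p - 1) * C2)%:E)%E.
  have [hx|hx] := pselect (B0 x); last first.
    rewrite integral0_eq ?lee_fin ?mulr_ge0 ?powR_ge0 // => z _.
    by rewrite kN ?mulr0 ?mul0r // => -[].
  have [x0 xr] := B0P _ hx.
  apply: (@le_trans _ _ (\int[mu]_(z in cball (0%R : E) rho)
      ((C1 `^ (p - 1))%:E * (kb m%:R `|z : E| `|(z : E) - x| `|x : E|)%:E))%E).
    rewrite [leRHS]integral_mkcond; apply: ge0_le_int => z _.
      by rewrite lee_fin !mulr_ge0 ?powR_ge0.
    have [hz|hz] := pselect (B0 z); last first.
      rewrite kN ?mulr0 ?mul0r; last by case.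
      by apply: erestrict_ge0 => y _; rewrite -EFinM lee_fin mulr_ge0 ?powR_ge0 ?kb_ge0.
    have [z0 zr] := B0P _ hz.
    (* The weights cancel |x|^(-m) and supply |z|^(-m): what is left is the model kernel with its
       two variables exchanged. *)
    rewrite patchE mem_set /cball /= ?subr0 // -EFinM lee_fin kE // /kb.
    rewrite /a powRM ?powR_ge0 // -!powRrM mulNr alq.
    have -> : al * p = m%:R by rewrite /al; field.
    rewrite (distrC (z : E)) [`|z : E| + _]addrC.
    set A := (_ + _) `^ m%:R; set ss := _ `^ (1 - M%:R).
    rewrite le_eqVlt; apply/orP; left; apply/eqP.
    have e1 : `|x : E| `^ (- m%:R) * `|x : E| `^ m%:R = 1.
      by rewrite powRN mulVf // gt_eqF // powR_gt0.
    set c := C1 `^ _; set z1 := `|z : E| `^ _.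
    have -> : c * z1 * (A * `|x : E| `^ (- m%:R) * ss) * `|x : E| `^ m%:R =
      c * (A * z1 * ss) * (`|x : E| `^ (- m%:R) * `|x : E| `^ m%:R) by ring.
    by rewrite e1 mulr1.
  rewrite ge0_integralZl_EFin ?powR_ge0 //; last first.
  - by apply: measurable_funTS; apply/measurable_EFinP; exact: mkb1.
  - by move=> z _; rewrite lee_fin kb_ge0.
  - exact: measurable_cball.
  by rewrite EFinM; apply: lee_wpmul2l; [rewrite lee_fin powR_ge0|exact: hC2].
have {}H := (@schur_test _ T R mu p q p0 q0 pq k u (fun x => `|x : E| `^ (- al))
  (fun x => `|x : E| `^ al) a (C1 `^ (p - 1) * C2) mk mu_ (mw _) (mw _) ma k0 u0
  (fun x => powR_ge0 _ _) (fun x => powR_ge0 _ _) a0 kw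
  (mulr_ge0 (powR_ge0 _ _) C20) h1 h2).
apply: le_trans H; rewrite integral_mkcond; apply: ge0_le_int => z _.
  by apply: erestrict_ge0 => y _; exact: poweR_ge0.
rewrite patchE; case: ifPn => [|_]; last exact: poweR_ge0.
rewrite inE => hz.
have F0 (x : T) : (0 <= (kb m%:R `|x : E| `|(x : E) - z| `|z : E| * u x)%:E)%E.
  by rewrite lee_fin mulr_ge0 ?kb_ge0.
apply: gt0_ler_poweR; rewrite ?(ltW p0) ?in_itv /= ?leey ?andbT //.
- by apply: integral_ge0.
- by apply: integral_ge0 => x _; rewrite lee_fin mulr_ge0.
rewrite (@ge0_negligible_integral _ _ _ mu (cball (0%R : E) rho) [set (0 : E)]) //.
- rewrite integral_mkcond; apply: ge0_le_int => x _; first exact: erestrict_ge0.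
  rewrite patchE; case: ifPn => [|_]; last by rewrite lee_fin mulr_ge0.
  by rewrite inE => hx; rewrite kE.
- by rewrite -cball0; exact: measurable_cball.
- exact: measurable_cball.
- apply: measurable_funTS; apply/measurable_EFinP; apply: measurable_funM => //; exact: mkb1.
- by rewrite hmu dV_pt.
Qed.
End Riesz.

Local Close Scope classical_set_scope.

(** * The volume form of tangent spaces and bounds for the density *)

Section CommutingSquareZero.
Variables (K : fieldType) (G : finType).
Implicit Types (a b c x y : ext K G).

Lemma ewedge_pow_comm a b k : ewedge a b = ewedge b a -> ewedge (epow a k) b = ewedge b (epow a k).
Proof.
move=> ab; elim: k => [|k IH]; first by rewrite ewedge1l ewedge1r.
by rewrite !epowS -ewedgeA IH !ewedgeA ab.
Qed.

Lemma epowZ (t : K) a k : epow (t *: a) k = t ^+ k *: epow a k.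
Proof.
elim: k => [|k IH]; first by rewrite expr0 scale1r.
by rewrite !epowS IH ewedgeZl ewedgeZr scalerA -exprS.
Qed.

Lemma epow_add_sqz a b j : ewedge a b = ewedge b a -> ewedge b b = 0 ->
  epow (a + b) j.+1 = epow a j.+1 + j.+1%:R *: ewedge (epow a j) b.
Proof.
move=> ab bb; elim: j => [|j IH].
  by rewrite !epowS !ewedge1r ewedge1l scale1r.
rewrite epowS IH ewedgeDl !ewedgeDr !ewedgeZr.
have -> : ewedge b (ewedge (epow a j) b) = 0.
  by rewrite ewedgeA -(ewedge_pow_comm _ ab) -ewedgeA bb ewedge0r.
rewrite scaler0 addr0 -(ewedge_pow_comm j.+1 ab) ewedgeA -!epowS -addrA; congr (_ + _).
by rewrite -{2}[ewedge _ b]scale1r -scalerDl -[j.+2%:R]natr1.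
Qed.

Fixpoint eprod (a : nat -> ext K G) k : ext K G :=
  if k is k'.+1 then ewedge (eprod a k') (a k') else eone K G.

(** In the multinomial expansion only the squarefree product survives, k! times. The vanishing of
    the next power is carried along because it removes a term in the induction step. *)
Lemma epow_sum_sqz (a : nat -> ext K G) k :
  (forall i j, ewedge (a i) (a j) = ewedge (a j) (a i)) -> (forall i, ewedge (a i) (a i) = 0) ->
  epow (\sum_(i < k) a i) k = k`!%:R *: eprod a k /\ epow (\sum_(i < k) a i) k.+1 = 0.
Proof.
move=> ac a0; elim: k => [|k [IH1 IH2]].
  by rewrite big_ord0 fact0 scale1r; split=> //; rewrite epowS ewedge0l.
have com : ewedge (\sum_(i < k) a i) (a k) = ewedge (a k) (\sum_(i < k) a i).
  by rewrite ewedge_suml ewedge_sumr; apply: eq_bigr.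
rewrite big_ord_recr !(epow_add_sqz _ com (a0 k)) IH2 add0r ewedge0l scaler0 addr0.
split; first by rewrite IH1 ewedgeZl scalerA -natrM -factS.
by rewrite epowS IH2 ewedge0r.
Qed.

Lemma two_formC x y c : eone_form x -> eone_form y -> eone_form c ->
  ewedge (ewedge x y) c = ewedge c (ewedge x y).
Proof.
move=> hx hy hc; rewrite -ewedgeA (one_formC hy hc) ewedgeNr ewedgeA (one_formC hx hc).
by rewrite ewedgeNl opprK ewedgeA.
Qed.
End CommutingSquareZero.

Section Density.
Variables (R : realType) (n nu : nat).
Local Notation C := R[i].
Local Notation N := (n + nu)%N.
Local Notation E := (Cn R N).
Variable f : 'I_nu -> mpoly N C.

(** Gram-Schmidt on a basis of the kernel of the Jacobian: the rows form an orthonormal frame of the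
    tangent space. *)
Lemma orthonormal_kernel z : \rank (jac f z) = nu -> exists V : 'M[C]_(n, N),
  V *m (jac f z)^T = 0 /\ V *m map_mx (fun x : C => x^*) V^T = 1%:M.
Proof.
set A := jac f z => rA.
pose B := row_base (kermx A^T).
have rB : \rank (kermx A^T) = n by rewrite mxrank_ker mxrank_tr rA addnK.
have sB : (schmidt B :=: B)%MS by apply: eqmx_schmidt_free; exact: row_base_free.
have uB : schmidt B \is unitarymx by apply: schmidt_unitarymx; exact: rank_leq_col.
have kB : schmidt B *m A^T = 0.
  by apply/sub_kermxP; rewrite sB eq_row_base.
move: (schmidt B) uB kB; rewrite rB => V /unitarymxP uV kV.
by exists V; split => //; rewrite map_trmx.
Qed.

Lemma tproj_kernel z (V : 'M[C]_(n, N)) : V *m (jac f z)^T = 0 -> forall l j,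
  \sum_k tproj f z j k * V l k = V l j.
Proof.
move=> VA l j.
have e : tproj f z *m V^T = V^T.
  rewrite /tproj mulmxBl mul1mx -[X in _ - X]mulmxA.
  have -> : jac f z *m V^T = 0 by rewrite -[jac f z]trmxK -trmx_mul VA trmx0.
  by rewrite mulmx0 subr0.
have := congr1 (fun M : 'M[C]_(N, n) => M j l) e; rewrite !mxE => <-.
by apply: eq_bigr => k _; rewrite !mxE.
Qed.

Definition bigtheta z (g : gens N) : ext C (gens N) :=
  if g.1 == inord 1 then \sum_k tproj f z g.2 k *: egen C (gzeta k)
  else if g.1 == inord 2 then \sum_k (tproj f z g.2 k)^* *: egen C (gzetab k)
  else egen C g.

Lemma bigtheta1 z g : eone_form (bigtheta z g).
Proof.
rewrite /bigtheta; case: ifP => _; last (case: ifP => _; last exact: egen_one_form).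
  by apply: one_form_sum => k _; apply: one_formZ; exact: egen_one_form.
by apply: one_form_sum => k _; apply: one_formZ; exact: egen_one_form.
Qed.

Lemma gen_fst (i j : nat) : (i < 4)%N -> (j < 4)%N -> ((inord i : 'I_4) == inord j) = (i == j).
Proof. by move=> hi hj; rewrite -val_eqE /= !inordK. Qed.

(** Pull-back along the parametrisation of the tangent space by C^n that the frame defines; the n
    coordinates occupy the first n indices of the existing generators. *)
Definition frame (V : 'M[C]_(n, N)) (g : gens N) : ext C (gens N) :=
  if g.1 == inord 1 then \sum_l V l g.2 *: egen C (gzeta (lshift nu l))
  else if g.1 == inord 2 then \sum_l (V l g.2)^* *: egen C (gzetab (lshift nu l))
  else egen C g.

Lemma frame1 V g : eone_form (frame V g).
Proof.
rewrite /frame; case: ifP => _; last (case: ifP => _; last exact: egen_one_form).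
  by apply: one_form_sum => k _; apply: one_formZ; exact: egen_one_form.
by apply: one_form_sum => k _; apply: one_formZ; exact: egen_one_form.
Qed.

Lemma frame_zeta V j :
  frame V (gzeta j) = \sum_l V l j *: egen C (gzeta (lshift nu l)).
Proof. by rewrite /frame /= eqxx. Qed.

Lemma frame_zetab V j :
  frame V (gzetab j) = \sum_l (V l j)^* *: egen C (gzetab (lshift nu l)).
Proof. by rewrite /frame /= gen_fst // eqxx. Qed.

(** The parametrisation takes its values in the tangent space, which the projection fixes. *)
Lemma frame_bigrestr z V a : V *m (jac f z)^T = 0 ->
  esubst (frame V) (bigrestr f z a) = esubst (frame V) a.
Proof.
move=> VA; rewrite /bigrestr -/(bigtheta z) (esubst_comp _ _ (frame1 V)).
apply: eq_esubst => g; rewrite /bigtheta; case: ifP => g1.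
  rewrite esubst_sum /frame g1.
  under eq_bigr do rewrite esubstZ esubst_gen /= eqxx scaler_sumr.
  rewrite exchange_big /=; apply: eq_bigr => l _.
  rewrite -(tproj_kernel VA) scaler_suml; apply: eq_bigr => k _.
  by rewrite scalerA.
case: ifP => g2; last by rewrite esubst_gen.
rewrite esubst_sum /frame g1 g2.
under eq_bigr do rewrite esubstZ esubst_gen /= gen_fst // eqxx scaler_sumr.
rewrite exchange_big /=; apply: eq_bigr => l _.
rewrite -(tproj_kernel VA) rmorph_sum scaler_suml; apply: eq_bigr => k _.
by rewrite scalerA rmorphM.
Qed.

Definition dz2 (k : nat) : ext C (gens N) :=
  if insub k is Some l then
    ewedge (egen C (gzeta (lshift nu (l : 'I_n)))) (egen C (gzetab (lshift nu l)))
  else 0.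

Lemma dz2E (l : 'I_n) :
  dz2 l = ewedge (egen C (gzeta (lshift nu l))) (egen C (gzetab (lshift nu l))).
Proof. by rewrite /dz2 valK. Qed.

Lemma dz2C i j : ewedge (dz2 i) (dz2 j) = ewedge (dz2 j) (dz2 i).
Proof.
rewrite /dz2; case: insub => [l|]; last by rewrite ewedge0l ewedge0r.
case: insub => [m|]; last by rewrite ewedge0l ewedge0r.
rewrite ewedgeA (two_formC (egen_one_form _ _) (egen_one_form _ _) (egen_one_form _ _)).
by rewrite -ewedgeA (two_formC (egen_one_form _ _) (egen_one_form _ _) (egen_one_form _ _)) ewedgeA.
Qed.

Lemma dz2_sqr i : ewedge (dz2 i) (dz2 i) = 0.
Proof.
rewrite /dz2; case: insub => [l|]; last by rewrite ewedge0l.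
rewrite ewedgeA (two_formC (egen_one_form _ _) (egen_one_form _ _) (egen_one_form _ _)).
by rewrite ewedgeA egen_sqr !ewedge0l.
Qed.

(** The reordering sign is not tracked: later estimates need only its modulus. *)
Lemma eprod_dz2 k : (k <= n)%N -> exists c : C, cn c = 1 /\
  eprod dz2 k = c *: emono C [set g : gens N |
    ((g.1 == inord 1) || (g.1 == inord 2)) && (g.2 < k)%N]%SET.
Proof.
elim: k => [|k IH] kn /=.
  exists 1; rewrite cn1 scale1r; split => //; congr emono.
  by apply/setP => g; rewrite !inE andbF.
have [c [c1 ->]] := IH (ltnW kn).
have -> : k = Ordinal kn :> nat by [].
rewrite dz2E /egen ewedge_mono; case: ifP => [_|]; last first.
  move/negbT; rewrite -setI_eq0 => /set0Pn[g]; rewrite !inE => /andP[/eqP -> /eqP].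
  by case=> /eqP; rewrite gen_fst.
rewrite ewedgeZl ewedgeZr ewedge_mono; case: ifP => [_|]; last first.
  move/negbT; rewrite -setI_eq0 => /set0Pn[g]; rewrite !inE => /andP[/andP[_ gk]].
  by case/orP => /eqP e; move: gk; rewrite e /= ltnn.
rewrite !scalerA; eexists; split; last first.
  congr (_ *: emono _ _); apply/setP => -[i j]; rewrite !inE /= ltnS (leq_eqVlt j) !xpair_eqE /=.
  have -> : (j == lshift nu (Ordinal kn)) = (val j == k) by rewrite -val_eqE.
  by case: (i == _); case: (i == _); case: (_ == k); case: (_ < k)%N.
by rewrite !cnM c1 !cn_esgn !mulr1.
Qed.

Lemma frame_kahler V : V *m map_mx (fun x : C => x^*) V^T = 1%:M ->
  esubst (frame V) (kahler R n nu) = (ci R / 2) *: \sum_(l < n) dz2 l.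
Proof.
move=> VV; rewrite /kahler esubst_sum.
have VVE l m : \sum_j V l j * (V m j)^* = (l == m)%:R.
  have := congr1 (fun M : 'M[C]_n => M l m) VV; rewrite !mxE => <-.
  by apply: eq_bigr => j _; rewrite !mxE.
under eq_bigr do rewrite esubstZ (esubstM (frame1 V)) !esubst_gen.
rewrite -scaler_sumr; congr (_ *: _).
transitivity (\sum_(l < n) \sum_(m < n) (\sum_j V l j * (V m j)^*) *:
   ewedge (egen C (gzeta (lshift nu l))) (egen C (gzetab (lshift nu m)))).
  transitivity (\sum_j \sum_(l < n) \sum_(m < n) (V l j * (V m j)^*) *:
     ewedge (egen C (gzeta (lshift nu l))) (egen C (gzetab (lshift nu m)))).
    apply: eq_bigr => j _; rewrite frame_zeta frame_zetab ewedge_suml.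
    apply: eq_bigr => l _; rewrite ewedge_sumr; apply: eq_bigr => m _.
    by rewrite ewedgeZl ewedgeZr scalerA.
  rewrite exchange_big /=; apply: eq_bigr => l _.
  by rewrite exchange_big /=; apply: eq_bigr => m _; rewrite scaler_suml.
apply: eq_bigr => l _; rewrite (bigD1 l) //= VVE eqxx scale1r big1 ?addr0 ?dz2E // => m ml.
by rewrite VVE eq_sym (negbTE ml) scale0r.
Qed.

Lemma frame_volform z V : V *m (jac f z)^T = 0 ->
  V *m map_mx (fun x : C => x^*) V^T = 1%:M ->
  esubst (frame V) (volform f z) = (ci R / 2) ^+ n *: eprod dz2 n.
Proof.
move=> VA VV; rewrite /volform frame_bigrestr // esubstZ (esubst_pow (frame1 V)).
rewrite frame_kahler // epowZ (epow_sum_sqz n dz2C dz2_sqr).1 !scalerA.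
congr (_ *: _); by rewrite mulrC mulrA divff ?mul1r // pnatr_eq0 -lt0n fact_gt0.
Qed.

Lemma enrm_gen (G : finType) (g : G) : enrm (egen C g) = 1.
Proof. exact: enrm_mono. Qed.

Lemma frame_entry (V : 'M[C]_(n, N)) l j : V *m map_mx (fun x : C => x^*) V^T = 1%:M -> cn (V l j) <= 1.
Proof.
move=> VV.
have h : \sum_j cn (V l j) ^+ 2 = 1.
  have := congr1 (fun M : 'M[C]_n => complex.Re (M l l)) VV; rewrite !mxE eqxx /= => <-.
  under [in RHS]eq_bigr do rewrite !mxE mul_conj.
  by rewrite -rc_sum.
have : cn (V l j) ^+ 2 <= 1.
  by rewrite -h (bigD1 j) //= lerDl sumr_ge0 // => k _; exact: sqr_ge0.
by rewrite expr_le1 // cn_ge0.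
Qed.

(** In an orthonormal frame the volume form is (i/2)^n times a product of norm 1, and the frame
    substitution enlarges norms by at most [Q], independently of z. The factor [L] compares the l^1
    and l^2 norms of the coefficients. *)
Lemma volform_lower : exists2 c : R, 0 < c & forall z, \rank (jac f z) = nu ->
  c <= cn (edot (volform f z) (volform f z)).
Proof.
pose Q : R := n.+1%:R ^+ #|{: gens N}|.
have Q0 : 0 < Q by rewrite exprn_gt0.
pose e : R := (2^-1 ^+ n) / Q.
have e0 : 0 < e by rewrite divr_gt0 // exprn_gt0.
pose L : R := #|{set gens N}|%:R.
have L0 : 0 < L by rewrite ltr0n; apply/card_gt0P; exists finset.set0.
exists ((e / L) ^+ 2); first by rewrite exprn_gt0 // divr_gt0.
move=> z rz; have [V [VA VV]] := orthonormal_kernel rz.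
set v := volform f z.
have ev : e <= enrm v.
  rewrite /e ler_pdivrMr // mulrC.
  have <- : enrm (esubst (frame V) v) = 2^-1 ^+ n.
    rewrite /v frame_volform //; have [c [c1 ->]] := eprod_dz2 (leqnn n).
    rewrite scalerA enrmZ enrm_mono mulr1 cnM c1 mulr1 cnX cnM cnV cn_nat.
    rewrite (_ : cn (ci R) = 1) ?mul1r //.
    by rewrite cnE /= expr0n expr1n add0r sqrtr1.
  apply: enrm_subst => [|g]; first by rewrite ler1n.
  rewrite /frame; case: ifP => _; last (case: ifP => _; last by rewrite enrm_gen ler1n).
    apply: le_trans (enrm_sum _ _ _) _.
    apply: (@le_trans _ _ (\sum_(l < n) 1)); last by rewrite sumr_const card_ord ler_nat.
    by apply: ler_sum => l _; rewrite enrmZ enrm_gen mulr1 frame_entry.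
  apply: le_trans (enrm_sum _ _ _) _.
  apply: (@le_trans _ _ (\sum_(l < n) 1)); last by rewrite sumr_const card_ord ler_nat.
  by apply: ler_sum => l _; rewrite enrmZ enrm_gen mulr1 cn_conj frame_entry.
have -> : edot v v = rc (\sum_S cn (v S) ^+ 2).
  by rewrite rc_sum; apply: eq_bigr => S _; exact: mul_conj.
set s := \sum_S _.
have s0 : 0 <= s by apply: sumr_ge0 => S _; exact: sqr_ge0.
have hs S : cn (v S) <= Num.sqrt s.
  rewrite -(ger0_norm (cn_ge0 (v S))) -sqrtr_sqr ler_sqrt // /s (bigD1 S) //= lerDl.
  by apply: sumr_ge0 => T _; exact: sqr_ge0.
have : enrm v <= L * Num.sqrt s.
  apply: (@le_trans _ _ (\sum_(S : {set gens N}) Num.sqrt s)).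
    by apply: ler_sum => S _; exact: hs.
  by rewrite sumr_const mulr_natl.
rewrite cn_rc ger0_norm // => h1; rewrite -[leRHS]sqr_sqrtr //.
apply: lerXn2r; rewrite ?nnegrE ?sqrtr_ge0 //; first by rewrite divr_ge0 // ltW.
by rewrite ler_pdivrMr // mulrC (le_trans ev).
Qed.

Local Notation adj A := (map_mx (fun x : C => x^*) A^T).

Lemma adjM m1 m2 m3 (A : 'M[C]_(m1, m2)) (B : 'M[C]_(m2, m3)) : adj (A *m B) = adj B *m adj A.
Proof. by rewrite trmx_mul map_mxM. Qed.

Lemma adjK m1 m2 (A : 'M[C]_(m1, m2)) : adj (adj A) = A.
Proof. by apply/matrixP => i j; rewrite !mxE conjCK. Qed.

Lemma mul_adj_eq0 m1 m2 (A : 'M[C]_(m1, m2)) : A *m adj A = 0 -> A = 0.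
Proof.
move=> h; apply/matrixP => i j; rewrite mxE; apply: cn0_eq0.
have : \sum_k cn (A i k) ^+ 2 = 0.
  rewrite [RHS](_ : 0 = complex.Re ((A *m adj A) i i)); last by rewrite h mxE.
  rewrite mxE; under [in RHS]eq_bigr do rewrite !mxE mul_conj.
  by rewrite -rc_sum.
move/eqP; rewrite psumr_eq0 => [/allP/(_ j)|k _]; last exact: sqr_ge0.
by rewrite mem_index_enum => /(_ isT); rewrite expf_eq0 /= => /eqP.
Qed.

Lemma gram_unit m1 m2 (A : 'M[C]_(m1, m2)) : \rank A = m1 -> A *m adj A \in unitmx.
Proof.
move=> rA; rewrite -row_free_unit -kermx_eq0.
have fA : row_free A by rewrite /row_free rA.
rewrite -(mulmx_free_eq0 _ fA); apply/eqP; apply: mul_adj_eq0.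
by rewrite adjM mulmxA -[X in X *m _]mulmxA mulmx_ker mul0mx.
Qed.

Section Tproj.
Variable z : E.
Hypothesis rz : \rank (jac f z) = nu.
Local Notation P := (tproj f z).
Local Notation A := (jac f z).

Lemma tproj_adj : adj P = P.
Proof.
have G := gram_unit rz; set B := A *m adj A in G.
have hB : adj (invmx B) = invmx B.
  have e : adj (invmx B) *m B = 1%:M.
    rewrite -{2}(_ : adj B = B); last by rewrite /B adjM adjK.
    rewrite -adjM mulmxV //; apply/matrixP => i j; rewrite !mxE eq_sym.
    by case: (i == j); rewrite ?rmorph1 ?rmorph0.
  by rewrite -[LHS]mulmx1 -(mulmxV G) mulmxA e mul1mx.
rewrite {2}/tproj -/B.
have -> : adj P = 1%:M - adj (adj A *m invmx B *m A).
  apply/matrixP => i j; rewrite !mxE rmorphB eq_sym.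
  by congr (_ - _); case: (_ == _); rewrite ?rmorph1 ?rmorph0.
by rewrite !adjM adjK hB mulmxA.
Qed.

Lemma tproj_idem : P *m P = P.
Proof.
have G := gram_unit rz; rewrite /tproj; set B := A *m adj A in G *.
set Q := _ *m A.
have QQ : Q *m Q = Q.
  by rewrite /Q !mulmxA -[adj A *m _ *m A *m _]mulmxA -/B mulmxKV.
by rewrite mulmxBl mul1mx mulmxBr mulmx1 QQ subrr subr0.
Qed.

Lemma tproj_conj j k : (P j k)^* = P k j.
Proof. by rewrite -{2}tproj_adj !mxE. Qed.

(** For a self-adjoint idempotent P_jj is the sum of the |P_jk|^2; hence P_jj >= P_jj^2, so P_jj <=
    1 and every entry of the row is bounded by 1. *)
Lemma tproj_entry j k : cn (P j k) <= 1.
Proof.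
have e : P j j = rc (\sum_k cn (P j k) ^+ 2).
  rewrite -{1}tproj_idem mxE rc_sum; apply: eq_bigr => l _.
  by rewrite -(tproj_conj j l) mul_conj.
set s := \sum_k _ in e.
have s0 : 0 <= s by apply: sumr_ge0 => l _; exact: sqr_ge0.
have hs l : cn (P j l) ^+ 2 <= s.
  by rewrite /s (bigD1 l) //= lerDl sumr_ge0 // => m _; exact: sqr_ge0.
have s1 : s <= 1.
  have := hs j; rewrite e cn_rc ger0_norm // => h.
  by rewrite leNgt; apply/negP => s1; move: h; apply/negP; rewrite -ltNge expr2 ltr_pMl // (lt_trans ltr01).
have := le_trans (hs k) s1.
by rewrite expr_le1 // cn_ge0.
Qed.
End Tproj.

(** A row of the projection has N entries of modulus at most 1; the successor makes the constant at
    least 1, as [enrm_subst] requires. *)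
Definition Mrest : R := N.+1%:R.

Lemma Mrest_ge1 : 1 <= Mrest. Proof. by rewrite ler1n. Qed.

Lemma enrm_bigtheta z g : \rank (jac f z) = nu -> enrm (bigtheta z g) <= Mrest.
Proof.
move=> rz; rewrite /bigtheta; case: ifP => _; last (case: ifP => _).
- apply: le_trans (enrm_sum _ _ _) _.
  apply: (@le_trans _ _ (\sum_(k < N) 1)); last by rewrite sumr_const card_ord ler_nat.
  by apply: ler_sum => l _; rewrite enrmZ enrm_gen mulr1 tproj_entry.
- apply: le_trans (enrm_sum _ _ _) _.
  apply: (@le_trans _ _ (\sum_(k < N) 1)); last by rewrite sumr_const card_ord ler_nat.
  by apply: ler_sum => l _; rewrite enrmZ enrm_gen mulr1 cn_conj tproj_entry.
by rewrite enrm_gen Mrest_ge1.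
Qed.

Lemma enrm_bigrestr z a : \rank (jac f z) = nu ->
  enrm (bigrestr f z a) <= Mrest ^+ #|{: gens N}| * enrm a.
Proof.
move=> rz; apply: (enrm_subst (theta := bigtheta z)); first exact: Mrest_ge1.
by move=> g; exact: enrm_bigtheta.
Qed.

Lemma density_bound : exists2 c : R, 0 <= c & forall z Th, \rank (jac f z) = nu ->
  cn (density f z Th) <= c * enrm (bigrestr f z Th).
Proof.
have [c c0 hc] := volform_lower.
pose v0 := enrm (n`!%:R^-1 *: epow (kahler R n nu) n).
exists (Mrest ^+ #|{: gens N}| * v0 / c).
  by rewrite divr_ge0 ?(ltW c0) // mulr_ge0 ?enrm_ge0 // exprn_ge0 // (le_trans ler01 Mrest_ge1).
move=> z Th rz; rewrite /density cnM cnV.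
have c1 : 0 < cn (edot (volform f z) (volform f z)) by apply: lt_le_trans (hc z rz).
rewrite mulrAC; apply: ler_pM; rewrite ?invr_ge0 ?cn_ge0 //.
  apply: le_trans (cn_edot _ _) _; rewrite mulrC; apply: ler_wpM2r; first exact: enrm_ge0.
  exact: enrm_bigrestr.
by rewrite lef_pV2 // hc.
Qed.

Lemma bigrestrM z a b : bigrestr f z (ewedge a b) = ewedge (bigrestr f z a) (bigrestr f z b).
Proof. exact: (@esubstM _ _ _ (bigtheta z) (bigtheta1 z)). Qed.

Definition rtheta z (j : 'I_N) : ext C 'I_N := \sum_k (tproj f z j k)^* *: egen C k.

Lemma rtheta1 z j : eone_form (rtheta z j).
Proof. by apply: one_form_sum => k _; apply: one_formZ; exact: egen_one_form. Qed.

Lemma restrM z a b : restr f z (ewedge a b) = ewedge (restr f z a) (restr f z b).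
Proof. exact: (@esubstM _ _ _ (rtheta z) (rtheta1 z)). Qed.

Lemma enrm_restr z a : \rank (jac f z) = nu ->
  enrm (restr f z a) <= Mrest ^+ #|{: 'I_N}| * enrm a.
Proof.
move=> rz; apply: (enrm_subst (theta := rtheta z)).
  exact: Mrest_ge1.
move=> g; apply: le_trans (enrm_sum _ _ _) _.
apply: (@le_trans _ _ (\sum_(k < N) 1)); last by rewrite sumr_const card_ord ler_nat.
by apply: ler_sum => l _; rewrite enrmZ enrm_gen mulr1 cn_conj tproj_entry.
Qed.

Definition zb_form (a : ext C 'I_N) : ext C (gens N) := esubst (fun j => egen C (gzetab j)) a.

Lemma zb_form_one (j : 'I_N) : eone_form (egen C (gzetab j)).
Proof. exact: egen_one_form. Qed.

Lemma bigrestr_zb z a : bigrestr f z (zb_form a) = zb_form (restr f z a).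
Proof.
rewrite /bigrestr /zb_form /restr (esubst_comp _ _ (bigtheta1 z)).
rewrite (esubst_comp _ _ zb_form_one); apply: eq_esubst => j.
rewrite esubst_gen /bigtheta /= !gen_fst //= esubst_sum.
by apply: eq_bigr => k _; rewrite esubstZ esubst_gen.
Qed.

Lemma restr_idem z a : \rank (jac f z) = nu -> restr f z (restr f z a) = restr f z a.
Proof.
move=> rz; rewrite /restr (esubst_comp _ _ (rtheta1 z)); apply: eq_esubst => j.
rewrite esubst_sum; under eq_bigr do rewrite esubstZ esubst_gen scaler_sumr.
rewrite exchange_big /=; apply: eq_bigr => l _.
have -> : tproj f z j l = \sum_k tproj f z j k * tproj f z k l.
  by rewrite -{1}(tproj_idem rz) mxE.
rewrite rmorph_sum scaler_suml; apply: eq_bigr => k _.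
by rewrite scalerA rmorphM.
Qed.

Lemma enrm_zb a : enrm (zb_form a) <= enrm a.
Proof.
apply: le_trans (enrm_subst (M := 1) _ _ _) _ => //; first by move=> x; rewrite enrm_gen.
by rewrite expr1n mul1r.
Qed.
End Density.

(** * Compatibility of restriction with bidegrees *)

Section Graded.
Variables (F : fieldType) (G : finType) (K : eqType) (c : G -> K) (theta : G -> ext F G).
Hypothesis hc : forall x (V : {set G}), theta x V != 0 -> exists y, V = [set y]%SET /\ c y = c x.

(** Generators are coloured by [c] and each is replaced by a combination of generators of its own
    colour, so a monomial keeps the number of its factors of every colour. *)
Lemma esubst_graded (T U : {set G}) k : esubst theta (emono F T) U != 0 ->
  #|[set y in U | c y == k]| = #|[set y in T | c y == k]|.
Proof.
rewrite esubst_mono /etheta.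
have -> : #|[set y in T | c y == k]| = count (fun y => c y == k) (enum T).
  rewrite -size_filter cardE /enum_mem -filter_predI; congr size.
  by apply: eq_filter => y; rewrite /= !inE andbC.
elim: (enum T) U => [|x s IH] U /=.
  rewrite ffunE; have [->|U0] := eqVneq U finset.set0; last by rewrite eqxx.
  by move=> _; apply: eq_card0 => y; rewrite !inE.
rewrite ffunE => h.
have [V /andP[VU hV]] : exists V : {set G}, (V \subset U) && (theta x V * ewedges [seq theta y | y <- s] (U :\: V) != 0).
  apply/existsP; apply: contraNT h; rewrite negb_exists => /forallP h.
  apply/eqP; apply: big1 => V VU; have := h V; rewrite VU /= negbK -mulrA => /eqP ->.
  by rewrite mulr0.
move: hV; rewrite mulf_eq0 negb_or => /andP[/hc[y [Vy cy]] /IH <-].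
rewrite Vy in VU *; rewrite finset.sub1set in VU.
rewrite (cardsD1 y); congr (_ + _)%N; first by rewrite !inE VU /= cy.
by apply: eq_card => w; rewrite !inE andbA.
Qed.
End Graded.

Lemma esubst_id (F : fieldType) (G : finType) (a : ext F G) : esubst (egen F (G := G)) a = a.
Proof.
rewrite [RHS]ext_sum; apply: eq_bigr => S _; congr (_ *: _).
elim/set_rank_ind: S => [|x S xS xm IH]; first by rewrite enum_set0.
rewrite enum_setU1 //= IH /egen ewedge_mono disjoints1 xS esgn_min //.
by rewrite scale1r.
Qed.

Section ZPart.
Variables (R : realType) (n nu : nat).
Local Notation C := R[i].
Local Notation N := (n + nu)%N.
Local Notation E := (Cn R N).
Variable f : 'I_nu -> mpoly N C.
Implicit Types (S T U : {set gens N}) (L : {set 'I_N}).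

Definition gset (i : nat) : {set gens N} := [set g : gens N | g.1 == inord i]%SET.
Definition zbset L : {set gens N} := [set gzb j | j in L]%SET.

Lemma gzeta_gset : [set gzeta j | j : 'I_N]%SET = gset 1.
Proof.
apply/setP => -[i j]; rewrite inE /=; apply/imsetP/eqP => [[k _ [-> _]]//|->].
by exists j.
Qed.

Lemma gzetab_gset : [set gzetab j | j : 'I_N]%SET = gset 2.
Proof.
apply/setP => -[i j]; rewrite inE /=; apply/imsetP/eqP => [[k _ [-> _]]//|->].
by exists j.
Qed.

Lemma gset_disj i j g : (i < 4)%N -> (j < 4)%N -> i != j -> g \in gset i -> g \in gset j = false.
Proof. by move=> hi hj ij; rewrite !inE => /eqP ->; rewrite gen_fst // (negbTE ij). Qed.

Lemma mem_zbset L g : (g \in zbset L) = (g.1 == inord 3) && (g.2 \in L).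
Proof.
case: g => i j /=; apply/imsetP/andP => [[k kL [-> ->]]|[/eqP -> jL]]; first by rewrite eqxx.
by exists j.
Qed.

Definition bideg S := [&& #|S| == (n + n)%N, #|S :&: gset 1| == n & #|S :&: gset 2| == n].

Lemma bidegE S : bideg S = [&& S \subset gset 1 :|: gset 2, #|S :&: gset 1| == n & #|S :&: gset 2| == n].
Proof.
have e1 := cardsID (gset 1) S; have e2 := cardsID (gset 2) (S :\: gset 1).
have e3 : (S :\: gset 1) :&: gset 2 = S :&: gset 2.
  apply/setP => g; rewrite !finset.in_setI finset.in_setD.
  have [g2|_] := boolP (g \in gset 2); last by rewrite !andbF.
  by rewrite (gset_disj (i := 2)).
rewrite /bideg; apply/and3P/and3P => -[h1 h2 h3]; split => //; move: e2 e1; rewrite e3 (eqP h3) (eqP h2).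
- rewrite (eqP h1) => <- /addnI /eqP.
  rewrite -[X in _ == X]addn0 eqn_add2l cards_eq0 => /eqP e.
  apply/fintype.subsetP => g gS; rewrite finset.in_setU; apply: contraT; rewrite negb_or => /andP[g1 g2].
  by have := finset.in_set0 g; rewrite -e !finset.in_setD gS g1 g2.
- move=> <- <-.
  rewrite (_ : (S :\: gset 1) :\: gset 2 = finset.set0) ?cards0 ?addn0 //.
  apply/setP => g; rewrite !finset.in_setD finset.in_set0; apply/negbTE/negP => /and3P[g2 g1 gS].
  by have := fintype.subsetP h1 g gS; rewrite finset.in_setU (negbTE g1) (negbTE g2).
Qed.

Lemma bideg_disj S L : bideg S -> [disjoint S & zbset L].
Proof.
rewrite bidegE => /and3P[/fintype.subsetP h _ _]; 
  rewrite finset.disjoints_subset; apply/fintype.subsetP => g gS.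
rewrite finset.in_setC mem_zbset; apply/negP => /andP[/eqP g3 _].
by have := h g gS; rewrite !inE g3 !gen_fst.
Qed.

Lemma zpartE L Th S : zpart L Th S = if bideg S then esgn C S (zbset L) * Th (S :|: zbset L) else 0.
Proof. by rewrite /zpart ffunE gzeta_gset gzetab_gset. Qed.

Lemma zpartD L a b : zpart L (a + b) = zpart L a + zpart L b :> ext C (gens N).
Proof.
by apply/ffunP => S; rewrite !ffunE; case: ifP => _; rewrite ?addr0 // mulrDr.
Qed.

Lemma zpartZ L k a : zpart L (k *: a) = k *: zpart L a :> ext C (gens N).
Proof.
apply/ffunP => S; rewrite !ffunE; case: ifP => _; last by rewrite scaler0.
by rewrite /GRing.scale /= mulrCA.
Qed.

Lemma zpart0 L : zpart L 0 = 0 :> ext C (gens N).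
Proof. by rewrite -[X in zpart _ X](scale0r 0) zpartZ scale0r. Qed.

(** Adjoining the set of d zbar_L is injective on sets of bidegree (n, n), so the coefficients are,
    up to sign, distinct coefficients of [Th]. *)
Lemma enrm_zpart L (Th : ext C (gens N)) : enrm (zpart L Th) <= enrm Th.
Proof.
rewrite /enrm; under eq_bigr do rewrite zpartE.
rewrite (bigID bideg) /= [X in _ + X]big1 ?addr0; last by move=> S /negbTE ->; rewrite cn0.
under eq_bigr => S hS do rewrite hS cnM cn_esgn mul1r.
rewrite -(big_imset (fun T => cn (Th T))) /=; last first.
  move=> S S' hS hS' e; have dS := bideg_disj L hS; have dS' := bideg_disj L hS'.
  have := congr1 (fun T => T :\: zbset L) e.
  rewrite !finset.setDUl finset.setDv !finset.setU0; move/finset.setDidPl: dS => ->; move/finset.setDidPl: dS' => -> //.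
rewrite [leRHS](bigID (mem [set S :|: zbset L | S in bideg]%SET)) /= lerDl.
by apply: sumr_ge0 => S _; exact: cn_ge0.
Qed.

(** A generator is coloured by its block, except that each d zbar_j, which restriction leaves alone,
    has a colour of its own. Counting colours thus recovers bidegrees and the exact set of d
    zbar's. *)
Definition gclass (g : gens N) : 'I_4 + gens N := if g.1 == inord 3 then inr g else inl g.1.

Lemma bigtheta_graded z x (V : {set gens N}) : bigtheta f z x V != 0 ->
  exists y, V = [set y]%SET /\ gclass y = gclass x.
Proof.
rewrite /bigtheta.
have key (G : 'I_N -> gens N) (l : 'I_N -> C) : (\sum_k l k *: egen C (G k)) V != 0 ->
    exists k, V = [set G k]%SET.
  rewrite sum_ffunE => h.
  have [k hk] : exists k, (l k *: egen C (G k) : ext C (gens N)) V != 0.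
    by apply/existsP; apply: contraNT h; rewrite negb_exists => /forallP h; rewrite big1 // => k _; apply/eqP; rewrite -[_ == _]negbK.
  exists k; move: hk; have [->//|Vk] := eqVneq V [set G k]%SET.
  by rewrite !ffunE (negbTE Vk) /GRing.scale /= mulr0 eqxx.
case: ifP => [/eqP g1|_]; last (case: ifP => [/eqP g2|_]).
- by move=> /key[k ->]; exists (gzeta k); split => //; rewrite /gclass g1 /= gen_fst.
- by move=> /key[k ->]; exists (gzetab k); split => //; rewrite /gclass g2 /= gen_fst.
by rewrite ffunE; have [->|_] := eqVneq V [set x]%SET; [exists x|rewrite eqxx].
Qed.

Lemma bigrestr_graded z T U k : bigrestr f z (emono C T) U != 0 ->
  #|[set y in U | gclass y == k]| = #|[set y in T | gclass y == k]|.
Proof. exact: (esubst_graded (bigtheta_graded (z := z))). Qed.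

Lemma gclass_gset U i : (i < 3)%N -> #|U :&: gset i| = #|[set y in U | gclass y == inl (inord i)]|.
Proof.
move=> i3; apply: eq_card => g; rewrite !inE /gclass; congr (_ && _).
case: ifP => [/eqP ->|g3]; first by rewrite gen_fst ?(ltn_trans i3) // (gtn_eqF i3).
by [].
Qed.

Lemma gclass_sub U T : (forall k, #|[set y in U | gclass y == k]| = #|[set y in T | gclass y == k]|) ->
  forall g, g \in U -> exists2 g', g' \in T & gclass g' = gclass g.
Proof.
move=> h g gU; have : (0 < #|[set y in T | gclass y == gclass g]|)%N.
  by rewrite -h; apply/card_gt0P; exists g; rewrite !inE gU eqxx.
by case/card_gt0P => g'; rewrite !inE => /andP[g'T /eqP e]; exists g'.
Qed.

Lemma gclass_fst g g' : gclass g = gclass g' -> g.1 = g'.1.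
Proof.
rewrite /gclass; case: ifP => g3; case: ifP => g3' //; first by case=> ->.
by case.
Qed.

Lemma gclass_bideg U T : (forall k, #|[set y in U | gclass y == k]| = #|[set y in T | gclass y == k]|) ->
  bideg U -> bideg T.
Proof.
move=> h; rewrite !bidegE => /and3P[/fintype.subsetP sU h1 h2].
have c i : (i < 3)%N -> #|U :&: gset i| = #|T :&: gset i|.
  by move=> i3; rewrite !gclass_gset // h.
rewrite -!c // h1 h2 !andbT; apply/fintype.subsetP => g gT.
have [g' /sU g'U e] := @gclass_sub T U (fun k => esym (h k)) g gT.
by move: g'U; rewrite !inE (gclass_fst e).
Qed.

Lemma ewedge_zbset (a : ext C (gens N)) L S : bideg S -> (forall T, ~~ bideg T -> a T = 0) ->
  esgn C S (zbset L) * ewedge a (emono C (zbset L)) (S :|: zbset L) = a S.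
Proof.
move=> hS ha; rewrite {1}(ext_sum a) ewedge_suml sum_ffunE (bigD1 S) //= big1 ?addr0.
  rewrite ewedgeZl ewedge_mono bideg_disj // scalerA ffunE.
  rewrite [emono _ _ _]ffunE eqxx.
  by rewrite /GRing.scale /= mulr1 mulrCA esgn_sqr mulr1.
move=> T TS; have [hT|hT] := boolP (bideg T); last by rewrite ha // scale0r ewedge0l ffunE.
rewrite ewedgeZl ewedge_mono bideg_disj // !ffunE.
case: eqP => [e|_]; last by rewrite /GRing.scale /= !mulr0.
have dS := bideg_disj L hS; have dT := bideg_disj L hT.
have := congr1 (fun T => T :\: zbset L) e.
rewrite !finset.setDUl finset.setDv !finset.setU0; move/finset.setDidPl: dS => ->; move/finset.setDidPl: dT => -> ST.
by rewrite ST eqxx in TS.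
Qed.

Lemma bigrestr_zbset z L : bigrestr f z (emono C (zbset L)) = emono C (zbset L).
Proof.
rewrite -[RHS]esubst_id /bigrestr !esubst_mono /etheta; congr ewedges.
apply/eq_in_map => g; rewrite mem_enum mem_zbset => /andP[/eqP g3 _].
by rewrite g3 !gen_fst.
Qed.

(** Lets the norm of an integrand be taken after restriction to the tangent space. A monomial either
    splits as a set of bidegree (n, n) and exactly d zbar_L, and then both sides agree by
    multiplicativity, or it contributes to neither side because restriction preserves the
    colours. *)
Lemma bigrestr_zpart z L Th : bigrestr f z (zpart L Th) = zpart L (bigrestr f z Th).
Proof.
elim/ext_ind: Th => [|a b ha hb|k a ha|T].
- by rewrite zpart0 /bigrestr esubst0 zpart0.
- by rewrite zpartD /bigrestr !esubstD -!/(bigrestr f z _) ha hb zpartD.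
- by rewrite zpartZ /bigrestr !esubstZ -!/(bigrestr f z _) ha zpartZ.
pose S0 := T :\: zbset L.
have [/andP[LT hS0]|hT] := boolP ((zbset L \subset T) && bideg S0).
  have TE : S0 :|: zbset L = T.
    by rewrite /S0; apply/setP => g; rewrite !inE; have := fintype.subsetP LT g; case: (g \in zbset L) => /= [/(_ isT) ->//|_]; rewrite orbF.
  have -> : zpart L (emono C T) = esgn C S0 (zbset L) *: emono C S0.
    apply/ffunP => S; rewrite zpartE !ffunE.
    have [e|SS] := eqVneq S S0; first by rewrite e hS0 TE eqxx.
    rewrite /GRing.scale /= mulr0; case: ifP => // hS.
    case: eqP => [e|_]; last by rewrite mulr0.
    have := congr1 (fun U => U :\: zbset L) e; rewrite -/S0 finset.setDUl finset.setDv finset.setU0.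
    by move/finset.setDidPl: (bideg_disj L hS) => -> ES; rewrite ES eqxx in SS.
  have ES : emono C T = esgn C S0 (zbset L) *: ewedge (emono C S0) (emono C (zbset L)).
    by rewrite ewedge_mono bideg_disj // scalerA esgn_sqr scale1r TE.
  rewrite ES /bigrestr !esubstZ -!/(bigrestr f z _) zpartZ bigrestrM bigrestr_zbset; congr (_ *: _).
  have ha U : ~~ bideg U -> bigrestr f z (emono C S0) U = 0.
    move=> hU; apply/eqP; apply: contraNT hU => /bigrestr_graded h.
    by apply: (gclass_bideg (U := S0)) => // k; rewrite h.
  apply/ffunP => S; rewrite zpartE; have [hS|hS] := boolP (bideg S); last by rewrite ha.
  by rewrite ewedge_zbset.
have -> : zpart L (emono C T) = 0 :> ext C (gens N).
  apply/ffunP => S; rewrite zpartE !ffunE; case: ifP => // hS.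
  case: eqP => [e|_]; last by rewrite mulr0.
  case/negP: hT; rewrite -e finset.subsetUr /S0 -e finset.setDUl finset.setDv finset.setU0.
  by move/finset.setDidPl: (bideg_disj L hS) => ->.
rewrite /bigrestr esubst0 -/(bigrestr f z _); apply/ffunP => S; rewrite zpartE ffunE.
case: ifP => // hS; apply/esym/eqP; rewrite mulf_eq0; apply/orP; right.
apply: contraNT hT => /bigrestr_graded h.
(* A d zbar_j is alone in its colour, so the count for that colour decides membership. *)
have zT g : g.1 = inord 3 -> (g \in T) = (g \in S :|: zbset L).
  move=> g3; have := h (inr g).
  have one U : #|[set y in U | gclass y == inr g]%SET| = (g \in U).
    rewrite (_ : [set y in U | _]%SET = if g \in U then [set g]%SET else finset.set0).
      by case: (g \in U); rewrite ?cards1 ?cards0.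
    apply/setP => y; rewrite inE; case: (boolP (y == g)) => [/eqP ->|yg].
      by rewrite /gclass g3 eqxx eqxx andbT; case: (g \in U); rewrite !inE ?eqxx.
    have -> : (gclass y == inr g) = false.
      rewrite /gclass; case: ifP => // _; apply/eqP; case => e; by rewrite e eqxx in yg.
    by rewrite andbF; case: (g \in U); rewrite !inE ?(negbTE yg).
  by rewrite !one; do 2!case: (_ \in _).
have Szb g : g \in S -> g.1 != inord 3.
  move=> gS; move: hS; rewrite bidegE => /and3P[/fintype.subsetP /(_ g gS)].
  by rewrite !inE => /orP[]/eqP ->; rewrite gen_fst.
apply/andP; split.
  apply/fintype.subsetP => g gL; rewrite zT; first by rewrite finset.in_setU gL orbT.
  by move: gL; rewrite mem_zbset => /andP[/eqP].
apply: (gclass_bideg (U := S)) => // -[i|g].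
- have rem U : [set y in U :|: zbset L | gclass y == inl i]%SET = [set y in U | gclass y == inl i]%SET.
    apply/setP => y; rewrite !inE; case: (boolP (y \in U)) => //= _.
    rewrite mem_zbset; case: (boolP (y.1 == inord 3)) => //= y3.
    by rewrite /gclass y3 andbF.
  rewrite -rem h; apply: eq_card => y; rewrite !inE mem_zbset.
  case: (boolP (y.1 == inord 3)) => //= y3.
  by rewrite /gclass y3 !andbF.
- rewrite !eq_card0 // => y; rewrite !inE /gclass; last first.
    case: ifP => [/eqP y3|_]; last by rewrite andbF.
    by apply/negP => /andP[/Szb]; rewrite y3 eqxx.
  case: ifP => [/eqP y3|_]; last by rewrite andbF.
  apply/negP => /andP[/andP[yL yT] _]; move: yT; rewrite zT // finset.in_setU (negbTE yL) orbF.
  by move/Szb; rewrite y3 eqxx.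
Qed.
End ZPart.

Local Open Scope classical_set_scope.
Local Open Scope ring_scope.

(** * Bounds on compact sets and the size of the Bochner-Martinelli form *)

Section CompactBound.
Variables (R : realType) (V : normedModType R).
Local Notation C := R[i].

Lemma compact_cn_bound (K O : set V) (F : V -> C) : compact K -> K `<=` O -> cCk 0 O F ->
  exists2 M : R, 0 <= M & forall x, K x -> cn (F x) <= M.
Proof.
move=> cK KO [[cR _] [cI _]].
have bnd (g : V -> R^o) : (forall x, O x -> {for x, continuous g}) ->
    exists2 M : R, 0 <= M & forall x, K x -> `|g x| <= M.
  move=> cg; have [[x0 Kx0]|K0] := pselect (K !=set0); last first.
    by exists 0 => // x Kx; case: K0; exists x.
  have cgn : {within K, continuous (fun x => `|g x|)}.
    apply: continuous_in_subspaceT => x /set_mem Kx.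
    apply: (@continuous_comp _ _ _ g (fun y : R^o => `|y|)); first exact: (cg x (KO _ Kx)).
    exact: norm_continuous.
  have [a /set_mem Ka maxa] := compact_EVT_max (ex_intro _ x0 Kx0) cK cgn.
  by exists `|g a| => // x Kx; apply: maxa; rewrite inE.
have [M1 M10 h1] := bnd _ cR; have [M2 M20 h2] := bnd _ cI.
exists (M1 + M2); first exact: addr_ge0.
by move=> x Kx; apply: le_trans (cn_le _) _; apply: lerD; [exact: h1|exact: h2].
Qed.

Lemma cCk_derive k (U : set V) (F : V -> C) v : cCk k.+1 U F -> cCk k U (cderive v F).
Proof. by move=> [h1 h2]; split; [exact: (Ck_derive v h1)|exact: (Ck_derive v h2)]. Qed.

Lemma cCk_wirtb k (U : set V) (F : V -> C) u w : open U -> cCk k.+1 U F -> cCk k U (wirtb u w F).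
Proof.
move=> oU hF; apply: cCkM => //; last exact: cCk_cst.
apply: cCkD => //; first exact: cCk_derive.
by apply: cCkM => //; [exact: cCk_cst|exact: cCk_derive].
Qed.

Lemma cn_wirtb u w (F : V -> C) x : cn (wirtb u w F x) <= cn (cderive u F x) + cn (cderive w F x).
Proof.
have := cnD (cderive u F x) (ci R * cderive w F x).
rewrite [cn (ci R * _)]cnM (_ : cn (ci R) = 1) ?mul1r => [h|]; last first.
  by rewrite cnE /= expr0n expr1n add0r sqrtr1.
rewrite /wirtb cnM cnV (cn_nat _ 2); apply: le_trans h.
by rewrite ler_piMr ?cn_ge0 // invf_le1 ?ler1n.
Qed.

(* A map homogeneous of degree -1 has partial derivatives homogeneous of degree -2. *)
Lemma cderive_homog (F : V -> C) v x (t : R) : 0 < t ->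
  cCk 1 [set y | y != 0] F ->
  (forall (r : R) y, 0 < r -> F (r *: y) = rc r^-1 * F y) -> x != 0 ->
  cderive v F (t *: x) = rc (t ^+ 2)^-1 * cderive v F x.
Proof.
move=> t0 [hR hI] hF x0.
have tx0 : t *: x != 0 by rewrite scaler_eq0 negb_or x0 gt_eqF.
have key (g : V -> R^o) : Ck 1 [set y | y != 0] g -> (forall y, g (t *: y) = t^-1 * g y) ->
    'D_v g (t *: x) = (t ^+ 2)^-1 * 'D_v g x.
  move=> hg gt.
  have d1 : derivable g (0 + t *: x) v by rewrite add0r; exact: (@Ck_derivable R V 0 _ g _ v hg tx0).
  have := derive_affine d1.
  rewrite (_ : (fun y => g (0 + t *: y)) = fun y => t^-1 *: g y); last first.
    by apply/funext => y; rewrite add0r gt.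
  move=> /(@derive_val _ _ _ _ _ _ _).
  rewrite deriveZ; last exact: (@Ck_derivable R V 0 _ g _ v hg x0).
  rewrite add0r => h; apply: (mulfI (lt0r_neq0 t0)).
  rewrite -h /GRing.scale /= mulrA; congr (_ * _).
  by field; rewrite gt_eqF.
have ht y : F (t *: y) = rc t^-1 * F y by exact: hF.
apply: complexP; rewrite ?ReM ?ImM /= ?mul0r ?subr0 ?addr0; apply: key => //.
  by move=> y; rewrite ht ReM /= mul0r subr0.
by move=> y; rewrite ht ImM /= mul0r addr0.
Qed.
End CompactBound.

Section BochnerMartinelli.
Variables (R : realType) (n nu : nat).
Local Notation C := R[i].
Local Notation N := (n + nu)%N.
Local Notation E := (Cn R N).

Definition rho2 (a : E) : C := \sum_k crd a k * (crd a k)^*.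
(** The Bochner-Martinelli coefficients depend on zeta - z only; as functions of that difference
    they are homogeneous of degree -1. *)
Definition bmG (j : 'I_N) (a : E) : C := (crd a j)^* / (twopii R * rho2 a).

Lemma bmE j (p : E * E) : bm j p = bmG j (p.1 - p.2).
Proof.
by rewrite /bm /bmG /rho2 !crdB; under [in RHS]eq_bigr do rewrite crdB.
Qed.

Lemma rho2_eq0 a : rho2 a = 0 -> a = 0.
Proof.
move=> h; apply: crdP => j; rewrite crd0; apply: cn0_eq0.
have : \sum_k cn (crd a k) ^+ 2 = 0.
  have -> : \sum_k cn (crd a k) ^+ 2 = complex.Re (rho2 a).
    by rewrite /rho2; under [in RHS]eq_bigr do rewrite mul_conj; rewrite -rc_sum.
  by rewrite h.
move/eqP; rewrite psumr_eq0 => [/allP/(_ j)|k _]; last exact: sqr_ge0.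
by rewrite mem_index_enum => /(_ isT); rewrite expf_eq0 /= => /eqP.
Qed.

Lemma open_neq0 : open [set a : E | a != 0].
Proof.
rewrite (_ : [set a : E | a != 0] = (fun a : E => `|a - 0|) @^-1` [set y | 0 < y]).
  apply: open_comp; last exact: open_gt.
  by move=> a _; exact: norm_sub_continuous.
by apply/seteqP; split => a /=; rewrite subr0 normr_gt0.
Qed.

Lemma cCk_conj (V : normedModType R) k (U : set V) (F : V -> C) : open U -> cCk k U F ->
  cCk k U (fun x => (F x)^*).
Proof.
move=> oU [h1 h2]; split.
  by rewrite (_ : (fun x => _) = (fun x => complex.Re (F x))) //; apply/funext => x; rewrite conjE.
rewrite (_ : (fun x => _) = (fun x => - complex.Im (F x))); first exact: CkN.
by apply/funext => x; rewrite conjE.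
Qed.

Lemma bmG_cCk k j : cCk k [set a : E | a != 0] (bmG j).
Proof.
have o := open_neq0.
apply: cCkM => //; first by apply: cCk_conj => //; exact: crd_cCk.
apply: cCkV => //.
  move=> a /=; apply: contra_neq => /eqP; rewrite mulf_eq0 (negbTE (twopii_neq0 R)) /=.
  by move/eqP/rho2_eq0.
apply: cCkM => //; first exact: cCk_cst.
apply: cCk_sum => // l _; apply: cCkM => //; first exact: crd_cCk.
by apply: cCk_conj => //; exact: crd_cCk.
Qed.

Lemma conj_rc (t : R) : (rc t)^* = rc t :> C.
Proof. by rewrite conjE /rc /= oppr0. Qed.

Lemma bmG_homog j (t : R) a : 0 < t -> bmG j (t *: a) = rc t^-1 * bmG j a.
Proof.
move=> t0; rewrite /bmG /rho2.
have cr k : (crd (t *: a) k)^* = rc t * (crd a k)^*.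
  by rewrite crdZ rmorphM /= conj_rc.
have -> : \sum_k crd (t *: a) k * (crd (t *: a) k)^* = rc t ^+ 2 * \sum_k crd a k * (crd a k)^*.
  rewrite mulr_sumr; apply: eq_bigr => k _; rewrite cr crdZ; ring.
rewrite cr rcV.
have rt : rc t != 0 :> C by apply/eqP => /(congr1 (@complex.Re R)) /= /eqP; rewrite gt_eqF.
set r := \sum_k _; move: (twopii R) => tp; rewrite !invfM.
by set ri := r^-1; set ti := tp^-1; field.
Qed.

Lemma sphere_compact : compact [set a : E | `|a| = 1].
Proof.
apply: (@bounded_closed_compactC _ _ _ 1); last by move=> a /= ->.
rewrite (_ : [set a : E | `|a| = 1] = (fun a : E => `|a - 0|) @^-1` [set 1]).
  apply: preimage_closed => [a _|]; [exact: norm_sub_continuous|exact: closed_eq].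
by apply/seteqP; split => a /=; rewrite subr0.
Qed.

Lemma sphere_neq0 : [set a : E | `|a| = 1] `<=` [set a | a != 0].
Proof. by move=> a /= ha; rewrite -normr_gt0 ha. Qed.

(** Maximum on the compact unit sphere, extended by homogeneity of degree -1. *)
Lemma bmG_bound j : exists2 M : R, 0 <= M & forall a, a != 0 -> cn (bmG j a) <= M * `|a|^-1.
Proof.
have [M M0 hM] := compact_cn_bound sphere_compact
  sphere_neq0 (bmG_cCk 0 j).
exists M => // a a0; have na : 0 < `|a| by rewrite normr_gt0.
have -> : a = `|a| *: (`|a|^-1 *: a) by rewrite scalerA divff ?gt_eqF // scale1r.
rewrite bmG_homog // cnM cn_rc ger0_norm ?invr_ge0 ?normr_ge0 // mulrC normrZ normr_id.
rewrite normrZ normfV normr_id mulVf ?gt_eqF // mulr1.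
by apply: ler_wpM2r; rewrite ?invr_ge0 //; apply: hM; rewrite /= normrZ normfV normr_id mulVf ?gt_eqF.
Qed.

Lemma bmG_derive_bound j v : exists2 M : R, 0 <= M & forall a, a != 0 ->
  cn (cderive v (bmG j) a) <= M * `|a| ^- 2.
Proof.
have [M M0 hM] := compact_cn_bound sphere_compact
  sphere_neq0 (cCk_derive v (bmG_cCk 1 j)).
exists M => // a a0; have na : 0 < `|a| by rewrite normr_gt0.
have e : a = `|a| *: (`|a|^-1 *: a) by rewrite scalerA divff ?gt_eqF // scale1r.
have b0 : `|a|^-1 *: a != 0 by rewrite scaler_eq0 negb_or invr_eq0 normr_eq0 a0.
rewrite {1}e (cderive_homog v na (bmG_cCk 1 j) _ b0); last by move=> r y; exact: bmG_homog.
rewrite cnM cn_rc ger0_norm ?invr_ge0 ?exprn_ge0 // mulrC.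
by apply: ler_wpM2r; rewrite ?invr_ge0 ?exprn_ge0 //; apply: hM; rewrite /= normrZ normfV normr_id mulVf ?gt_eqF.
Qed.

(** The two difference quotients coincide literally, so the equality also holds at points where [g]
    is not differentiable. *)
Lemma derive_sub (g : E -> R^o) (v w : E) (p : E * E) :
  'D_(v, w) (fun p : E * E => g (p.1 - p.2) : R^o) p = 'D_(v - w) g (p.1 - p.2).
Proof.
rewrite /derive.
have -> : (fun h : R => h^-1 *: (((fun p : E * E => g (p.1 - p.2)) \o shift p) (h *: (v, w)) -
    g (p.1 - p.2))) =
  (fun h : R => h^-1 *: ((g \o shift (p.1 - p.2)) (h *: (v - w)) - g (p.1 - p.2))) :> (R -> R^o).
  apply/funext => h; congr (_ *: (g _ - _)).
  by rewrite /= scalerBr opprD addrACA.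
by [].
Qed.

Lemma cderive_sub (F : E -> C) (v w : E) (p : E * E) :
  cderive (v, w) (fun p : E * E => F (p.1 - p.2)) p = cderive (v - w) F (p.1 - p.2).
Proof.
by rewrite /cderive (derive_sub (fun a => complex.Re (F a))) (derive_sub (fun a => complex.Im (F a))).
Qed.

Lemma bm_fun (j : 'I_N) : bm j = (fun p : E * E => bmG j (p.1 - p.2)).
Proof. by apply/funext => p; rewrite bmE. Qed.

Lemma enrm_oneform (s : 'I_N -> E * E -> C) (p : E * E) :
  enrm (oneform s p) <= \sum_j cn (s j p).
Proof.
apply: le_trans (enrm_sum _ _ _) _; apply: ler_sum => j _.
by rewrite enrmZ enrm_gen mulr1.
Qed.

Lemma enrm_dbar_fun (F : E * E -> C) (p : E * E) :
  enrm (dbar_fun F p) <= \sum_k (cn (delb_zeta k F p) + cn (delb_z k F p)).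
Proof.
apply: le_trans (enrm_sum _ _ _) _; apply: ler_sum => j _.
by apply: le_trans (enrmD _ _) _; apply: lerD; rewrite enrmZ enrm_gen mulr1.
Qed.

Lemma enrm_dbar_oneform (s : 'I_N -> E * E -> C) (p : E * E) :
  enrm (dbar_oneform s p) <= \sum_j enrm (dbar_fun (s j) p).
Proof.
apply: le_trans (enrm_sum _ _ _) _; apply: ler_sum => j _.
by apply: le_trans (enrmM _ _) _; rewrite enrm_gen mulr1.
Qed.

Lemma enrm_fullform (s : 'I_N -> E * E -> C) (p : E * E) (A B : R) :
  0 <= A -> enrm (oneform s p) <= A -> enrm (dbar_oneform s p) <= B ->
  enrm (fullform s p) <= \sum_(k < n) A * B ^+ k.
Proof.
move=> A0 hA hB; apply: le_trans (enrm_sum _ _ _) _; apply: ler_sum => k _.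
apply: le_trans (enrmM _ _) _; apply: ler_pM; rewrite ?enrm_ge0 //.
apply: le_trans (enrm_pow _ _) _; apply: lerXn2r => //; rewrite nnegrE ?enrm_ge0 //.
exact: le_trans (enrm_ge0 _) hB.
Qed.

Lemma fin_bound (I : finType) (X : Type) (P : X -> Prop) (F : I -> X -> R) (w : X -> R) :
  (forall x, P x -> 0 <= w x) ->
  (forall i, exists2 M : R, 0 <= M & forall x, P x -> F i x <= M * w x) ->
  exists2 M : R, 0 <= M & forall x, P x -> \sum_i F i x <= M * w x.
Proof.
move=> w0 h; have [M hM] := choice (fun i => let: ex_intro2 M a b := h i in
  ex_intro (fun M => 0 <= M /\ forall x, P x -> F i x <= M * w x) M (conj a b)).
exists (\sum_i M i); first by apply: sumr_ge0 => i _; case: (hM i).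
by move=> x Px; rewrite mulr_suml; apply: ler_sum => i _; case: (hM i) => _; apply.
Qed.

(** The k-th summand has size |eta|^(-1-2k) with k <= n - 1. On |eta| <= rho each is absorbed into
    the most singular one, |eta|^(1-2n), at the cost of rho^(2(n-1-k)). *)
Lemma bm_full_bound (rho : R) : 0 < rho -> exists2 M : R, 0 <= M & forall p : E * E,
  p.1 - p.2 != 0 -> `|p.1 - p.2| <= rho ->
  enrm (fullform (@bm R n nu) p) <= M * `|p.1 - p.2| `^ (1 - (n + n)%:R).
Proof.
move=> rho0.
have [A A0 hA] : exists2 A : R, 0 <= A & forall p : E * E, p.1 - p.2 != 0 ->
    \sum_j cn (bm j p) <= A * `|p.1 - p.2|^-1.
  apply: fin_bound => [p _|j]; first by rewrite invr_ge0.
  have [M M0 hM] := bmG_bound j; exists M => // p hp.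
  by rewrite bmE; exact: hM.
have [B B0 hB] : exists2 B : R, 0 <= B & forall p : E * E, p.1 - p.2 != 0 ->
    \sum_j \sum_k (cn (delb_zeta k (bm j) p) + cn (delb_z k (bm j) p)) <= B * `|p.1 - p.2| ^- 2.
  apply: fin_bound => [p _|j]; first by rewrite invr_ge0 exprn_ge0.
  apply: fin_bound => [p _|k]; first by rewrite invr_ge0 exprn_ge0.
  have [M1 M10 h1] := bmG_derive_bound j (ure R k - 0); have [M2 M20 h2] := bmG_derive_bound j (uim R k - 0).
  have [M3 M30 h3] := bmG_derive_bound j (0 - ure R k); have [M4 M40 h4] := bmG_derive_bound j (0 - uim R k).
  exists ((M1 + M2) + (M3 + M4)) => [|p hp]; first by rewrite !addr_ge0.
  rewrite mulrDl; apply: lerD; apply: le_trans (cn_wirtb _ _ _ _) _; rewrite mulrDl bm_fun !cderive_sub.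
    by apply: lerD; [exact: h1|exact: h2].
  by apply: lerD; [exact: h3|exact: h4].
exists (\sum_(k < n) A * B ^+ k * rho ^+ (2 * (n - 1 - k))).
  by apply: sumr_ge0 => k _; rewrite !mulr_ge0 ?exprn_ge0 // ltW.
move=> p hp hr; set t := `|p.1 - p.2|; have t0 : 0 < t by rewrite normr_gt0.
apply: le_trans (@enrm_fullform _ p (A * t^-1) (B * t ^- 2) _ _ _) _.
- by rewrite mulr_ge0 // invr_ge0 (ltW t0).
- by apply: le_trans (enrm_oneform _ _) _; exact: hA.
- apply: le_trans (enrm_dbar_oneform _ _) _; apply: le_trans (hB p hp).
  by apply: ler_sum => j _; exact: enrm_dbar_fun.
rewrite mulr_suml; apply: ler_sum => k _.
have kn := ltn_ord k.
have -> : t `^ (1 - (n + n)%:R) = t ^- (2 * (n - 1 - k) + (1 + 2 * k)).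
  rewrite (_ : (2 * (n - 1 - k) + (1 + 2 * k))%N = (n + n).-1); last by lia.
  rewrite -powR_mulrn ?(ltW t0) // -powRN; congr powR.
  have -> : (n + n)%:R = (n + n).-1.+1%:R :> R by congr (_%:R); lia.
  by rewrite -natr1; ring.
have -> : A * t^-1 * (B * t ^- 2) ^+ k = A * B ^+ k * t ^- (1 + 2 * k).
  rewrite exprMn exprVn -exprM exprD expr1.
  by rewrite [X in _ = _ * X]invfM; ring.
rewrite [t ^+ (2 * (n - 1 - k) + _)]exprD [X in _ <= _ * X]invfM.
rewrite -!mulrA; apply: ler_wpM2l => //; apply: ler_wpM2l; first by rewrite exprn_ge0.
rewrite mulrA ler_peMl ?invr_ge0 ?exprn_ge0 ?(ltW t0) //.
rewrite ler_pdivlMr ?exprn_gt0 // mul1r.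
by apply: lerXn2r; rewrite ?nnegrE // ltW.
Qed.
End BochnerMartinelli.

(** * Homogeneity of the Hefer form and of the structure form *)

Section KernelFactors.
Variables (R : realType) (n nu : nat).
Local Notation C := R[i].
Local Notation N := (n + nu)%N.
Local Notation E := (Cn R N).
Variable f : 'I_nu -> mpoly N C.
Variable d : 'I_nu -> nat.
Variable h : 'I_nu -> 'I_N -> mpoly (N + N)%N C.
Hypothesis hH : hefer f d h.
Hypothesis hf : forall i, (0 < d i)%N /\ f i \is @ishomog1 _ _ (d i) mdeg.
Hypothesis hci : smooth_ci f.
Local Notation X := (coneX f).

(** The integer m of the overview, as a sum over the equations: each row of the Jacobian and each
    Hefer factor is homogeneous of degree d_i - 1. *)
Definition mdef : nat := (\sum_i (d i).-1)%N.

Lemma heferform_bound : exists2 M : R, 0 <= M & forall p : E * E,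
  enrm (heferform h p) <= M * (`|p.1| + `|p.2|) ^+ mdef.
Proof.
have hi i : exists2 M : R, 0 <= M & forall p : E * E, True ->
    \sum_j cn (hval h i j p) <= M * (`|p.1| + `|p.2|) ^+ (d i).-1.
  apply: fin_bound => [p _|j]; first by rewrite exprn_ge0 // addr_ge0.
  have [M M0 hM] := hG_bound hH i j; exists (M / cn (twopii R)).
    by rewrite divr_ge0 ?cn_ge0.
  move=> p _; rewrite mulrAC ler_pdivlMr ?cn_twopii // mulrC -cnM.
  by rewrite {1}(surjective_pairing p); apply: hM; rewrite ?lerDl ?lerDr.
have [M hM] := choice (fun i => let: ex_intro2 M a b := hi i in
  ex_intro (fun M => 0 <= M /\ forall p, True -> \sum_j cn (hval h i j p) <=
    M * (`|p.1| + `|p.2|) ^+ (d i).-1) M (conj a b)).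
exists (\prod_i M i); first by apply: prodr_ge0 => i _; case: (hM i).
move=> p; apply: le_trans (enrm_wedges _) _; rewrite big_map big_enum /=.
rewrite /mdef expr_sum -big_split /= [leLHS](eq_bigl xpredT) //; apply: ler_prod => i _; rewrite enrm_ge0 /=.
by apply: le_trans (enrm_oneform _ _) _; case: (hM i) => _; apply.
Qed.

(** A matrix of rank nu has nu independent columns; listing them through [enum] of the set of their
    indices makes the selection increasing. *)
Lemma minor_exists z : \rank (jac f z) = nu ->
  exists2 I : {ffun 'I_nu -> 'I_N}, increasing I & minor f z I != 0.
Proof.
move=> rz; set A := jac f z.
have rf : row_full A^T by rewrite /row_full mxrank_tr rz.
pose g := fullrankfun rf.
pose S := [set g i | i : 'I_nu]%SET.
have cS : #|S| = nu by rewrite card_imset ?card_ord //; exact: fullrankfun_inj.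
pose I : {ffun 'I_nu -> 'I_N} := [ffun a => enum_val (cast_ord (esym cS) a)].
have gI i : exists j, I j = g i.
  have gS : g i \in S by apply: imset_f.
  exists (cast_ord cS (enum_rank_in gS (g i))).
  by rewrite ffunE cast_ordK enum_rankK_in.
have sub : (rowsub g A^T <= rowsub I A^T)%MS.
  apply/row_subP => i; have [j e] := gI i.
  rewrite (_ : row i (rowsub g A^T) = row j (rowsub I A^T)) ?row_sub //.
  by apply/rowP => l; rewrite !mxE e.
exists I.
  apply/forallP => a; apply/forallP => b; apply/implyP => ab.
  have tr : transitive (fun x y : 'I_N => (enum_rank x < enum_rank y)%N).
    by move=> x y w; exact: ltn_trans.
  have sz (c : 'I_nu) : (c < size (enum S))%N by rewrite -cardE cS.
  have := sorted_ltn_nth tr (g a) (enum_sorted S) a b (sz a) (sz b) ab.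
  have eI c : I c = nth (g a) (enum S) c.
    by rewrite [LHS]ffunE; exact: (enum_val_nth (g a) (cast_ord (esym cS) c)).
  by rewrite !eI !enum_rank_ord.
have uI : rowsub I A^T \in unitmx.
  rewrite -row_full_unit -col_leq_rank; apply: leq_trans (mxrankS sub).
  by rewrite mxrank_fullrowsub.
rewrite /minor -det_tr; move: uI; rewrite unitmxE unitfE.
by congr (\det _ != 0); apply/matrixP => a b; rewrite !mxE.
Qed.

(** The denominator of the structure form as a real number; it is homogeneous of degree 2m. *)
Definition sig (z : E) : R :=
  \sum_(I : {ffun 'I_nu -> 'I_N} | increasing I) cn (minor f z I) ^+ 2.

Lemma sigE z : \sum_(I | increasing I) minor f z I * (minor f z I)^* = rc (sig z).
Proof. by rewrite /sig rc_sum; apply: eq_bigr => I _; exact: mul_conj. Qed.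

Lemma sig_gt0 z : \rank (jac f z) = nu -> 0 < sig z.
Proof.
move=> /minor_exists[I hI mI]; rewrite /sig (bigD1 I) //=.
apply: ltr_pwDl; last by apply: sumr_ge0 => J _; exact: sqr_ge0.
by rewrite exprn_gt0 // lt_def cn_ge0 andbT; apply: contra_neq mI => /cn0_eq0.
Qed.

Lemma minor_scale (t : R) z I : minor f (t *: z) I = rc t ^+ mdef * minor f z I.
Proof.
rewrite /minor.
have -> : \matrix_(a, b) jac f (t *: z) a (I b) =
    diag_mx (\row_i rc t ^+ (d i).-1) *m \matrix_(a, b) jac f z a (I b).
  by apply/matrixP => a b; rewrite mul_diag_mx [LHS]mxE [RHS]mxE [X in _ = X * _]mxE [X in _ = _ * X]mxE (jacZ hH).
rewrite det_mulmx det_diag; congr (_ * _); rewrite /mdef expr_sum.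
by apply: eq_bigr => i _; rewrite mxE.
Qed.

Lemma sig_scale (t : R) z : 0 <= t -> sig (t *: z) = (t ^+ mdef) ^+ 2 * sig z.
Proof.
move=> t0; rewrite /sig mulr_sumr; apply: eq_bigr => I _.
by rewrite minor_scale cnM exprMn cnX cn_rc ger0_norm.
Qed.

Lemma sig_continuous (z : E) : {for z, continuous (sig : E -> R^o)}.
Proof.
have hs : Ck 0 setT (sig : E -> R^o).
  rewrite (_ : (sig : E -> R^o) = fun z => complex.Re (\sum_(I | increasing I) minor f z I * (minor f z I)^*)).
    have hm I : cCk 0 setT (fun z => minor f z I).
      apply: cCk_det; first exact: openT.
      move=> a b; rewrite (_ : (fun z => _) = fun z : E => meval (crd z) (mderiv (I b) (f a))).
        apply: cCk_meval; first exact: openT.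
        by move=> l; exact: crd_cCk.
      by apply/funext => w; rewrite mxE.
    suff [] : cCk 0 setT (fun z => \sum_(I | increasing I) minor f z I * (minor f z I)^*) by [].
    apply: cCk_sum => [|I _]; first exact: openT.
    apply: cCkM => //; first exact: openT.
    by apply: cCk_conj; first exact: openT.
  by apply/funext => w; rewrite sigE.
exact: hs.1.
Qed.

(** A positive continuous function attains a positive minimum on the compact unit sphere of the
    cone; homogeneity extends the bound. If that sphere is empty the cone is the vertex alone and
    the claim is void. *)
Lemma sig_lower : exists2 c : R, 0 < c & forall z, X z -> z != 0 -> c * `|z| ^+ mdef <= Num.sqrt (sig z).
Proof.
pose K := [set z : E | X z /\ `|z| = 1].
have cK : compact K.
  rewrite (_ : K = X `&` [set z | `|z| = 1]) //.
  rewrite setIC; apply: (@compact_closedI E _ _ (@sphere_compact R n nu)).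
  exact: (@closed_coneX R n nu f).
have [[z0 Kz0]|K0] := pselect (K !=set0); last first.
  exists 1 => // z Xz z0; exfalso; apply: K0; exists (`|z|^-1 *: z); split.
    exact: (coneX_scale hf).
  by rewrite normrZ normfV normr_id mulVf // normr_eq0.
have cg : {within K, continuous (sig : E -> R^o)}.
  by apply: continuous_in_subspaceT => x _; exact: sig_continuous.
have [a /set_mem [Xa a1] mina] := compact_EVT_min (ex_intro _ z0 Kz0) cK cg.
have sa : 0 < sig a by apply: sig_gt0; apply: hci => //; rewrite -normr_gt0 a1.
exists (Num.sqrt (sig a)); first by rewrite sqrtr_gt0.
move=> z Xz z0'; have nz : 0 < `|z| by rewrite normr_gt0.
have e : z = `|z| *: (`|z|^-1 *: z) by rewrite scalerA divff ?gt_eqF // scale1r.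
rewrite {2}e sig_scale // sqrtrM ?sqr_ge0 // sqrtr_sqr ger0_norm ?exprn_ge0 // mulrC.
apply: ler_wpM2l; first by rewrite exprn_ge0.
apply: ler_wsqrtr; apply: mina; rewrite inE; split; first exact: (coneX_scale hf).
by rewrite normrZ normfV normr_id mulVf ?gt_eqF.
Qed.

(** The numerator is at most a constant times the square root of [sig] and the denominator is [sig],
    so one inverse square root remains, of size |z|^(-m). *)
Lemma omegaX_bound : exists2 M : R, 0 <= M & forall z, X z -> z != 0 ->
  enrm (omegaX f z) <= M * `|z| ^- mdef.
Proof.
have [c c0 hc] := sig_lower.
pose L : R := \sum_(I : {ffun 'I_nu -> 'I_N} | increasing I) 1.
have L0 : 0 <= L by apply: sumr_ge0.
exists (cn (twopii R ^+ nu) * L / c); first by rewrite divr_ge0 ?(ltW c0) // mulr_ge0 ?cn_ge0.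
move=> z Xz z0; have nz : 0 < `|z| by rewrite normr_gt0.
have s0 : 0 < sig z by apply: sig_gt0; exact: hci.
have q0 : 0 < Num.sqrt (sig z) by rewrite sqrtr_gt0.
rewrite /omegaX enrmZ sigE cnM cnV cn_rc gtr0_norm //.
have hs : enrm (\sum_(I | increasing I) (minor f z I)^* *: hatdzeta R I) <= L * Num.sqrt (sig z).
  apply: le_trans (enrm_sum _ _ _) _; rewrite mulr_suml; apply: ler_sum => I hI.
  rewrite mul1r enrmZ /hatdzeta enrmZ enrm_mono cn_esgn !mulr1 cn_conj.
  rewrite -(ger0_norm (cn_ge0 (minor f z I))) -sqrtr_sqr ler_sqrt ?(ltW s0) // /sig (bigD1 I) //= lerDl.
  by apply: sumr_ge0 => J _; exact: sqr_ge0.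
apply: (@le_trans _ _ (cn (twopii R ^+ nu) / sig z * (L * Num.sqrt (sig z)))).
  by apply: ler_wpM2l => //; rewrite divr_ge0 ?cn_ge0 ?(ltW s0).
have -> : cn (twopii R ^+ nu) / sig z * (L * Num.sqrt (sig z)) =
    cn (twopii R ^+ nu) * L * (Num.sqrt (sig z))^-1.
  by rewrite -{1}(sqr_sqrtr (ltW s0)); field; rewrite gt_eqF.
rewrite -!mulrA; apply: ler_wpM2l; first exact: cn_ge0.
apply: ler_wpM2l => //; rewrite -invfM lef_pV2 ?posrE ?mulr_gt0 ?exprn_gt0 //.
exact: hc.
Qed.
End KernelFactors.

Local Close Scope classical_set_scope.

(** * Degree counts for the kernel *)

Section Degrees.
Variables (R : realType) (n nu : nat).
Local Notation C := R[i].
Local Notation N := (n + nu)%N.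
Local Notation E := (Cn R N).
Local Notation bigform := (ext C (gens N)).
Local Notation etas := (etas n nu).
Implicit Types (a b : bigform) (S T : {set gens N}).

(* [a] is a sum of monomials whose eta-degree exceeds the degree in the other generators by [i - j] *)
Definition eta_excess (i j : nat) a := forall S, a S != 0 ->
  (#|S :\: etas| + i = #|S :&: etas| + j)%N.

Lemma ewedge_neq0 (G : finType) (a b : ext C G) (S : {set G}) : ewedge a b S != 0 ->
  exists T : {set G}, [/\ T \subset S, a T != 0 & b (S :\: T)%SET != 0].
Proof.
rewrite ffunE => h.
have [T /and3P[h1 h2 h3]] : exists T : {set G}, [&& T \subset S, a T != 0 & b (S :\: T)%SET != 0].
  apply/existsP; apply: contraNT h; rewrite negb_exists => /forallP h.
  apply/eqP; apply: big1 => T TS; have := h T; rewrite TS /= negb_and !negbK => /orP[] /eqP ->.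
    by rewrite mulr0 mul0r.
  by rewrite mulr0.
by exists T.
Qed.

Lemma card_split (G : finType) (S T B : {set G}) : T \subset S ->
  (#|S :&: B| = #|T :&: B| + #|(S :\: T) :&: B|)%N /\
  (#|S :\: B| = #|T :\: B| + #|(S :\: T) :\: B|)%N.
Proof.
move=> TS.
have key (P : {set G}) : (#|S :&: P| = #|T :&: P| + #|(S :\: T) :&: P|)%N.
  rewrite -(cardsID T (S :&: P)); congr (_ + _)%N; apply: eq_card => x; rewrite !inE.
    by have := fintype.subsetP TS x; case: (x \in T) => [-> //|_]; rewrite ?andbF //= andbT.
  by case: (x \in S); case: (x \in T); case: (x \in P).
by split; [exact: key|rewrite !(finset.setDE _ B); exact: key].
Qed.

Lemma excess_wedge i j k l a b : eta_excess i j a -> eta_excess k l b ->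
  eta_excess (i + k) (j + l) (ewedge a b).
Proof.
move=> ha hb S /ewedge_neq0[T [TS /ha h1 /hb h2]].
by have [-> ->] := card_split etas TS; lia.
Qed.

Lemma excess_sum (I : finType) (F : I -> bigform) i j :
  (forall k, eta_excess i j (F k)) -> eta_excess i j (\sum_k F k).
Proof.
move=> h S; rewrite sum_ffunE => hS.
have [k hk] : exists k, F k S != 0.
  by apply/existsP; apply: contraNT hS; rewrite negb_exists => /forallP hS; rewrite big1 // => k _; apply/eqP; rewrite -[_ == _]negbK.
exact: (h k).
Qed.

Lemma excess_scale (c : C) a i j : eta_excess i j a -> eta_excess i j (c *: a).
Proof.
by move=> h S; rewrite ffunE => hS; apply: h; apply: contraNneq hS => ->; rewrite /GRing.scale /= mulr0.
Qed.

Lemma excess_add a b i j : eta_excess i j a -> eta_excess i j b -> eta_excess i j (a + b).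
Proof.
move=> ha hb S; rewrite ffunE => hS; have [a0|] := eqVneq (a S) 0; last exact: ha.
by apply: hb; move: hS; rewrite a0 add0r.
Qed.

Lemma excess_gen (g : gens N) i j :
  (nat_of_bool (g.1 != inord 0) + i = nat_of_bool (g.1 == inord 0) + j)%N ->
  eta_excess i j (egen C g).
Proof.
move=> h S; rewrite ffunE; have [->|_] := eqVneq S [set g]%SET; last by rewrite eqxx.
move=> _; have -> : #|[set g]%SET :\: etas| = (g.1 != inord 0) :> nat.
  have [g0|g0] := boolP (g.1 == inord 0).
    by rewrite (_ : _ :\: _ = finset.set0) ?cards0 //; apply/eqP; rewrite finset.setD_eq0 finset.sub1set inE.
  rewrite (_ : _ :\: _ = [set g]%SET) ?cards1 //; apply/finset.setDidPl.
  by rewrite disjoints1 inE.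
have -> : #|[set g]%SET :&: etas| = (g.1 == inord 0) :> nat.
  have [g0|g0] := boolP (g.1 == inord 0).
    by rewrite (_ : _ :&: _ = [set g]%SET) ?cards1 //; apply/finset.setIidPl; rewrite finset.sub1set inE.
  by rewrite (_ : _ :&: _ = finset.set0) ?cards0 //; apply/eqP; rewrite finset.setI_eq0 disjoints1 inE.
by [].
Qed.

Lemma excess_one : eta_excess 0 0 (eone C (gens N)).
Proof.
by move=> S; rewrite ffunE; have [->|_] := eqVneq S finset.set0; rewrite ?eqxx // finset.set0D finset.set0I.
Qed.

Lemma excess_eta j : eta_excess 1 0 (egen C (@geta N j)).
Proof. by apply: excess_gen; rewrite /geta /= eqxx. Qed.

Lemma excess_oneform (s : 'I_N -> E * E -> C) p : eta_excess 1 0 (oneform s p).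
Proof.
by apply: excess_sum => j; apply: excess_scale; exact: excess_eta.
Qed.

Lemma excess_dbar_fun (F : E * E -> C) p : eta_excess 0 1 (dbar_fun F p).
Proof.
apply: excess_sum => j; apply: excess_add; apply: excess_scale; apply: excess_gen.
  by rewrite /= gen_fst.
by rewrite /= gen_fst.
Qed.

Lemma excess_dbar_oneform (s : 'I_N -> E * E -> C) p : eta_excess 1 1 (dbar_oneform s p).
Proof.
apply: excess_sum => j; exact: (@excess_wedge 0 1 1 0 _ _ (@excess_dbar_fun _ p) (@excess_eta j)).
Qed.

Lemma excess_weaken i a : eta_excess i i a -> eta_excess 0 0 a.
Proof. by move=> h S /h; lia. Qed.

Lemma excess_fullform (s : 'I_N -> E * E -> C) p : eta_excess 1 0 (fullform s p).
Proof.
have hp k : eta_excess 0 0 (epow (dbar_oneform s p) k).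
  elim: k => [|l IH]; first exact: excess_one.
  exact: (@excess_wedge 0 0 0 0 _ _ (@excess_weaken 1 _ (@excess_dbar_oneform s p)) IH).
by apply: excess_sum => k; exact: (@excess_wedge 1 0 0 0 _ _ (@excess_oneform s p) (hp k)).
Qed.

Lemma excess_weight (chi : E -> R) s p : eta_excess 0 0 (weight chi s p).
Proof.
apply: excess_add; first by apply: excess_scale; exact: excess_one.
rewrite -scaleN1r; apply: excess_scale; apply: (@excess_weaken 1 _).
exact: (@excess_wedge 0 1 1 0 _ _ (@excess_dbar_fun _ p) (@excess_fullform s p)).
Qed.

Lemma wedges_card (G : finType) (I : Type) (r : seq I) (F : I -> ext C G) (P : pred G) (S : {set G}) :
  (forall i V, F i V != 0 -> exists2 y, V = [set y]%SET & P y) ->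
  ewedges [seq F i | i <- r] S != 0 -> #|S| = size r /\ {in S, forall y, P y}.
Proof.
move=> hF; elim: r S => [|i r IH] S /=.
  rewrite ffunE; have [->|_] := eqVneq S finset.set0; last by rewrite eqxx.
  by move=> _; split; [exact: cards0|move=> y; rewrite inE].
move=> /ewedge_neq0[T [TS /hF[y Ty Py] /IH[h1 h2]]].
rewrite Ty in TS h1 h2; rewrite finset.sub1set in TS; split.
  by rewrite (cardsD1 y) TS h1.
by move=> x xS; have [->//|xy] := eqVneq x y; apply: h2; rewrite !inE xy.
Qed.

Lemma oneform_supp (s : 'I_N -> E * E -> C) p V : oneform s p V != 0 ->
  exists2 y : gens N, V = [set y]%SET & y.1 == inord 0.
Proof.
rewrite /oneform sum_ffunE => hS.
have [k hk] : exists k, (s k p *: egen C (geta k)) V != 0.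
  by apply/existsP; apply: contraNT hS; rewrite negb_exists => /forallP hS; rewrite big1 // => k _; apply/eqP; rewrite -[_ == _]negbK.
exists (geta k) => //; move: hk; rewrite !ffunE; have [//|_] := eqVneq V [set geta k]%SET.
by rewrite /GRing.scale /= mulr0 eqxx.
Qed.

(** The Hefer form has only d eta's, the weight has excess 0 and B has excess 1. The part of
    eta-degree n of their product therefore carries n - 1 other generators, and these survive when
    the d eta's are removed. *)
Lemma Ktilde_card chi s h (p : E * E) T : Ktilde chi s h p T != 0 -> (#|T|.+1 = n)%N.
Proof.
rewrite /Ktilde ffunE; have [T0|_] := eqVneq (T :&: etas) finset.set0; last by rewrite eqxx.
rewrite mulf_eq0 negb_or => /andP[_ /ewedge_neq0[S1 [S1T h1 h2]]].
have [c1 hS1] := wedges_card (P := fun g => g.1 == inord 0)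
  (fun i V hV => oneform_supp hV) h1.
move: h2; rewrite ffunE; case: ifP => [/eqP c2|_]; last by rewrite eqxx.
set S2 := (T :|: etas) :\: S1 in c2 * => h2.
have := @excess_wedge 0 0 1 0 _ _ (@excess_weight chi s p) (@excess_fullform (@bm R n nu) p) S2 h2.
have gT g : g \in T -> (g.1 == inord 0) = false.
  move=> hg; apply/negbTE/negP => g0; have := finset.in_set0 g.
  by rewrite -T0 finset.in_setI hg inE g0.
move=> ex; have -> : #|T| = #|S2 :\: etas|; last by move: ex c2; lia.
apply: eq_card => g; rewrite /S2 !inE.
case: (boolP (g \in T)) => [/gT g0|_] /=; last by case: (g.1 == inord 0); rewrite ?andbF.
by rewrite g0 /= andbT; apply/esym/negP => /hS1; rewrite g0.
Qed.

Lemma hatdzeta_card (I : {ffun 'I_nu -> 'I_N}) S : increasing I -> hatdzeta R I S != 0 -> #|S| = n.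
Proof.
move=> hI; rewrite /hatdzeta !ffunE; set T := _ :\: _.
have [->|_] := eqVneq S T; last by rewrite /GRing.scale /= mulr0 eqxx.
move=> _; rewrite /T cardsD.
have ij : injective I.
  move=> a b e; have [ab|ba|/val_inj//] := ltngtP a b; move/forallP: hI.
    by move=> /(_ a)/forallP/(_ b)/implyP/(_ ab); rewrite e ltnn.
  by move=> /(_ b)/forallP/(_ a)/implyP/(_ ba); rewrite e ltnn.
rewrite (finset.setIidPr _); last first.
  by apply/fintype.subsetP => g /imsetP[a _ ->]; apply: imset_f.
rewrite !card_imset ?card_ord ?addnK // => [a b []|a b [] //].
exact: ij.
Qed.

Lemma ASkernel_card chi s h eps (f : 'I_nu -> mpoly N C) (x z : E) S :
  ASkernel f chi s h eps x z S != 0 -> (#|S|.+1 = n + n)%N.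
Proof.
rewrite ffunE => hS; have : ewedge (omegaX f x) (Ktilde chi s h (x, z)) S != 0.
  by apply: contraNneq hS => ->; rewrite /GRing.scale /= mulr0.
move=> /ewedge_neq0[T [TS h1 /Ktilde_card h2]].
have -> : #|S| = (#|T| + #|S :\: T|)%N.
  by rewrite -(cardsID T S); congr (_ + _)%N; congr #|pred_of_set _|; apply/finset.setIidPr.
rewrite -addnS h2; congr (_ + _)%N.
move: h1; rewrite /omegaX ffunE sum_ffunE => h1.
have [I /andP[hI mI]] : exists I, increasing I && (hatdzeta R I T != 0).
  apply/existsP; apply: contraNT h1; rewrite negb_exists => /forallP h1.
  rewrite [X in _ *: X]big1 ?scaler0 // => I hI; have := h1 I; rewrite hI /= negbK => /eqP hT.
  rewrite ffunE hT.
  by rewrite scaler0.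
exact: hatdzeta_card hI mI.
Qed.

Lemma zb_form_card q (a : ext C 'I_N) S : ehomog q a -> zb_form a S != 0 -> #|S| = q.
Proof.
move=> ha; rewrite /zb_form /esubst sum_ffunE => hS.
have [J hJ] : exists J, (a J *: ewedges [seq egen C (gzetab x) | x <- enum J]) S != 0.
  by apply/existsP; apply: contraNT hS; rewrite negb_exists => /forallP hS; rewrite big1 // => k _; apply/eqP; rewrite -[_ == _]negbK.
have [aJ wJ] : a J != 0 /\ ewedges [seq egen C (gzetab x) | x <- enum J] S != 0.
  move: hJ; rewrite ffunE; split; apply: contraNneq hJ => ->.
    by rewrite scale0r.
  by rewrite scaler0.
rewrite -(ha J aJ); have [|-> _] := wedges_card (P := predT) _ wJ; last by rewrite -cardE.
move=> i V; rewrite ffunE; have [->|_] := eqVneq V [set gzetab i]%SET; last by rewrite eqxx.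
by move=> _; exists (gzetab i).
Qed.

Lemma card_zbset (L : {set 'I_N}) : #|zbset L| = #|L|.
Proof. by rewrite card_imset // => i j []. Qed.

(** Kernel and form have total degree (2n - 1) + q, while the part extracted for L has degree 2n +
    |L|; unless |L| = q - 1 nothing is extracted. *)
Lemma ASintegrand_homog chi s h eps (f : 'I_nu -> mpoly N C) (phi : E -> ext C 'I_N) q x z
    (L : {set 'I_N}) : ehomog q (phi x) -> #|L|.+1 != q ->
  ASintegrand f chi s h eps phi z L x = 0.
Proof.
move=> hq hL; rewrite /ASintegrand -/(zb_form (phi x)).
have -> : zpart L (ewedge (ASkernel f chi s h eps x z) (zb_form (phi x))) = 0 :> bigform.
  apply/ffunP => S; rewrite zpartE [RHS]ffunE; case: ifP => // hS.
  apply/eqP; apply: contraNT hL; rewrite mulf_eq0 negb_or => /andP[_ /ewedge_neq0[T [TS]]].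
  move=> /ASkernel_card h1 /(zb_form_card hq) h2.
  have dS := bideg_disj L hS.
  have c1 : #|S :|: zbset L| = (n + n + #|L|)%N.
    move: dS; rewrite -finset.setI_eq0 => /eqP dS.
    by rewrite cardsU dS cards0 subn0 card_zbset; case/and3P: hS => /eqP ->.
  have : (#|T| + #|(S :|: zbset L) :\: T| = n + n + #|L|)%N.
    rewrite -c1 -[RHS](cardsID T); congr (_ + _)%N; congr #|pred_of_set _|.
    by apply/esym/finset.setIidPr.
  by rewrite h2; move: h1; lia.
by rewrite /density /bigrestr esubst0 /edot big1 ?mul0r // => S _; rewrite ffunE mul0r.
Qed.
End Degrees.
Local Open Scope classical_set_scope.
Local Open Scope ring_scope.

Lemma open_setX (T1 T2 : topologicalType) (U : set T1) (W : set T2) :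
  open U -> open W -> open (U `*` W).
Proof.
move=> oU oW; rewrite (_ : U `*` W = (fst @^-1` U) `&` (snd @^-1` W)) //.
by apply: openI; apply: open_comp => // p _; [exact: cvg_fst|exact: cvg_snd].
Qed.

(** * The pointwise estimate of the integrand *)

Section KernelBound.
Variables (R : realType) (n nu : nat).
Local Notation C := R[i].
Local Notation N := (n + nu)%N.
Local Notation E := (Cn R N).
Variable f : 'I_nu -> mpoly N C.
Variable d : 'I_nu -> nat.
Variable h : 'I_nu -> 'I_N -> mpoly (N + N)%N C.
Hypothesis hH : hefer f d h.
Hypothesis hf : forall i, (0 < d i)%N /\ f i \is @ishomog1 _ _ (d i) mdeg.
Hypothesis hci : smooth_ci f.
Variables (Om Om' : set E) (chi : E -> R) (s : 'I_N -> E * E -> C) (eps : bool).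
Hypothesis hchi : smooth setT chi.
Hypothesis hs : weight_section Om chi s.
Hypothesis cOm : compact (closure Om).
Hypothesis cOm' : compact (closure Om').
Local Notation X := (coneX f).

Lemma chi_cCk k : cCk k setT (fun y => rc (chi y)).
Proof. by split; [exact: hchi|exact: Ck_cst]. Qed.

Lemma derive_fst (g : E -> R^o) (v w : E) (p : E * E) :
  'D_(v, w) (fun p : E * E => g p.1 : R^o) p = 'D_v g p.1.
Proof.
rewrite /derive.
have -> : (fun a : R => a^-1 *: (((fun p : E * E => g p.1) \o shift p) (a *: (v, w)) - g p.1)) =
  (fun a : R => a^-1 *: ((g \o shift p.1) (a *: v) - g p.1)) :> (R -> R^o) by [].
by [].
Qed.

Lemma delb_zeta_fst (F : E -> C) k (p : E * E) :
  delb_zeta k (fun p : E * E => F p.1) p = delb k F p.1.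
Proof.
by rewrite /delb_zeta /delb /wirtb /cderive !(derive_fst (fun a => complex.Re (F a)))
  !(derive_fst (fun a => complex.Im (F a))).
Qed.

Lemma delb_z_fst (F : E -> C) k (p : E * E) : delb_z k (fun p : E * E => F p.1) p = 0.
Proof.
rewrite /delb_z /wirtb /cderive !(derive_fst (fun a => complex.Re (F a)))
  !(derive_fst (fun a => complex.Im (F a))) !derive0.
by rewrite (_ : (0 +i* 0)%C = 0 :> C) // mulr0 addr0 mul0r.
Qed.

Definition dchi_supp : set E := [set z | exists k, delb k (fun y => rc (chi y)) z != 0].

(** Smoothness of [s] is given only near the support of dbar chi; elsewhere its arbitrary values
    must be seen to be multiplied by zero. *)
Lemma weight_off p : ~ dchi_supp p.1 -> weight chi s p = rc (chi p.1) *: eone C (gens N).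
Proof.
move=> hp; rewrite /weight (_ : dbar_fun _ p = 0) ?ewedge0l ?subr0 //.
rewrite /dbar_fun big1 // => k _.
rewrite (delb_zeta_fst (fun y => rc (chi y))) (delb_z_fst (fun y => rc (chi y))) scale0r addr0.
have [->|h1] := eqVneq (delb k (fun y => rc (chi y)) p.1) 0; first by rewrite scale0r.
by case: hp; exists k.
Qed.

Lemma fin_max (I : finType) (Y : Type) (P : Y -> Prop) (F : I -> Y -> R) :
  (forall i, exists2 M : R, 0 <= M & forall x, P x -> F i x <= M) ->
  exists2 M : R, 0 <= M & forall x, P x -> \sum_i F i x <= M.
Proof.
move=> hF; have [i|M M0 hM] := @fin_bound R I Y P F (fun=> 1) (fun _ _ => ler01).
  by have [M M0 hM] := hF i; exists M => // x Px; rewrite mulr1; exact: hM.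
by exists M => // x /hM; rewrite mulr1.
Qed.

(** The terms with [s] live on the compact set where zeta is in the support of dbar chi and z in the
    closure of Omega; there [s] and its first derivatives are continuous, hence bounded. *)
Lemma weight_bound : exists2 M : R, 0 <= M & forall p : E * E,
  closure Om' p.1 -> closure Om p.2 -> enrm (weight chi s p) <= M.
Proof.
have [U [W [[oU oW] ZU OW sm _]]] := hs.
have [A A0 hA] := compact_cn_bound cOm' (fun _ _ => I) (chi_cCk 0).
have [B B0 hB] : exists2 B : R, 0 <= B & forall x, closure Om' x ->
    \sum_k cn (delb k (fun y => rc (chi y)) x) <= B.
  apply: fin_max => k.
  exact: (compact_cn_bound cOm' (fun _ _ => I) (cCk_wirtb _ _ (@openT E) (chi_cCk 1))).
pose Z := closure dchi_supp.
pose KK := (closure Om' `&` Z) `*` closure Om.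
have cKK : compact KK.
  apply: compact_setX => //; apply: compact_closedI => //; exact: closed_closure.
have sKK : KK `<=` U `*` W by move=> p [[_ /ZU h1] /OW h2].
have oUW : open (U `*` W) by exact: open_setX.
have smk i k : cCk k (U `*` W) (s i) by have [+ _] := csmoothP (U `*` W) (s i); apply; exact: sm.
have [M1 M10 h1] : exists2 M1 : R, 0 <= M1 & forall p, KK p -> \sum_j cn (s j p) <= M1.
  by apply: fin_max => j; exact: (compact_cn_bound cKK sKK (smk j 0)).
have [M2 M20 h2] : exists2 M2 : R, 0 <= M2 & forall p, KK p ->
    \sum_j \sum_k (cn (delb_zeta k (s j) p) + cn (delb_z k (s j) p)) <= M2.
  apply: fin_max => j; apply: fin_max => k.
  have [a a0 ha] := compact_cn_bound cKK sKK (cCk_wirtb (ure R k, 0) (uim R k, 0) oUW (smk j 1)).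
  have [b b0 hb] := compact_cn_bound cKK sKK (cCk_wirtb (0, ure R k) (0, uim R k) oUW (smk j 1)).
  exists (a + b); first exact: addr_ge0.
  by move=> p Kp; apply: lerD; [exact: ha|exact: hb].
pose F := \sum_(k < n) M1 * M2 ^+ k.
have F0 : 0 <= F by apply: sumr_ge0 => k _; rewrite mulr_ge0 // exprn_ge0.
exists (A + B * F); first by rewrite addr_ge0 // mulr_ge0.
move=> p p1 p2; have hA1 := hA _ p1.
have [hp|hp] := pselect (dchi_supp p.1); last first.
  rewrite weight_off // enrmZ enrm_mono mulr1; apply: le_trans hA1 _.
  by rewrite lerDl mulr_ge0.
apply: le_trans (enrmB _ _) _; apply: lerD; first by rewrite enrmZ enrm_mono mulr1.
have Kp : KK p := conj (conj p1 (@subset_closure E dchi_supp _ hp)) p2.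
apply: le_trans (enrmM _ _) _; apply: ler_pM; rewrite ?enrm_ge0 //.
  apply: le_trans (enrm_dbar_fun _ _) _; apply: le_trans (hB _ p1).
  apply: ler_sum => k _.
  by rewrite (delb_zeta_fst (fun y => rc (chi y))) (delb_z_fst (fun y => rc (chi y))) cn0 addr0.
apply: enrm_fullform => //; first by apply: le_trans (enrm_oneform _ _) _; exact: h1.
apply: le_trans (enrm_dbar_oneform _ _) _; apply: le_trans (h2 _ Kp).
by apply: ler_sum => j _; exact: enrm_dbar_fun.
Qed.

Lemma sum_inj_le (I : finType) (P : pred I) (g : I -> I) (F : I -> R) :
  (forall i, 0 <= F i) -> {in P &, injective g} -> \sum_(i | P i) F (g i) <= \sum_i F i.
Proof.
move=> F0 gi; rewrite -(big_imset F gi) /=.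
rewrite [leRHS](bigID (mem [set g i | i in P]%SET)) /= lerDl.
by apply: sumr_ge0.
Qed.

(** Adjoining all d eta's is injective on sets that contain none, so the coefficients are signed
    coefficients of [hgB]. *)
Lemma enrm_Ktilde p : enrm (Ktilde chi s h p) <= enrm (hgB chi s h p).
Proof.
pose P (T : {set gens N}) := (T :&: etas n nu == finset.set0)%SET.
apply: le_trans (sum_inj_le (P := P) (g := fun T => (T :|: etas n nu)%SET) (fun S => cn_ge0 (hgB chi s h p S)) _); last first.
  move=> S T /eqP hS /eqP hT e.
  have := congr1 (fun U => (U :\: etas n nu)%SET) e; rewrite /= !finset.setDUl finset.setDv !finset.setU0.
  have key U : (U :&: etas n nu)%SET = finset.set0 -> (U :\: etas n nu)%SET = U.
    by move=> U0; apply/finset.setDidPl; rewrite -finset.setI_eq0 U0.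
  by rewrite !key.
rewrite /enrm [leLHS](bigID P) /= [X in _ + X]big1 ?addr0.
  by apply: ler_sum => T hT; rewrite ffunE (_ : (_ == _) = true) // cnM cn_esgn mul1r.
by move=> T hT; rewrite ffunE (_ : (_ == _) = false) ?cn0 //; exact: negbTE.
Qed.

Lemma enrm_restr_fnorm z (a : ext C 'I_N) :
  enrm (restr f z a) <= #|{set 'I_N}|%:R * fnorm f z a.
Proof.
rewrite /fnorm; set q := \sum_S _.
have q0 : 0 <= q by apply: sumr_ge0 => S _; rewrite addr_ge0 // sqr_ge0.
rewrite mulr_natl -sumr_const; apply: ler_sum => S _.
rewrite cnE; apply: ler_wsqrtr; rewrite /q (bigD1 S) //= lerDl.
by apply: sumr_ge0 => T _; rewrite addr_ge0 // sqr_ge0.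
Qed.

Lemma fnorm_enrm z (a : ext C 'I_N) : fnorm f z a <= enrm (restr f z a).
Proof.
rewrite /fnorm -(ger0_norm (enrm_ge0 (restr f z a))) -sqrtr_sqr; apply: ler_wsqrtr.
rewrite /enrm expr2 mulr_suml; apply: ler_sum => S _; rewrite -cn_sqr expr2.
by apply: ler_wpM2l; [exact: cn_ge0|exact: cn_enrm].
Qed.

Lemma fnorm_ge0 z (a : ext C 'I_N) : 0 <= fnorm f z a.
Proof. exact: sqrtr_ge0. Qed.

Lemma integrandE phi z L x : ASintegrand f chi s h eps phi z L x =
  density f x (zpart L (ewedge (ASkernel f chi s h eps x z) (zb_form (phi x)))).
Proof. by []. Qed.

Lemma density_restr x L K (a : ext C 'I_N) : \rank (jac f x) = nu ->
  density f x (zpart L (ewedge K (zb_form (restr f x a)))) =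
  density f x (zpart L (ewedge K (zb_form a))).
Proof.
by move=> rx; rewrite /density !bigrestr_zpart !bigrestrM !bigrestr_zb restr_idem.
Qed.

Lemma kernel_bound (rho : R) : 0 < rho -> (forall x, closure Om' x -> `|x| <= rho) ->
  (forall x, closure Om x -> `|x| <= rho) ->
  exists2 M : R, 0 <= M & forall phi z L x, closure Om z -> closure Om' x -> X x -> x != 0 -> x != z ->
  cn (ASintegrand f chi s h eps phi z L x) <=
    M * (kb n (mdef d)%:R `|x| `|x - z| `|z| * fnorm f x (phi x)).
Proof.
move=> rho0 b1 b2.
have [c c0 hc] := density_bound f.
have [A A0 hA] := omegaX_bound hH hf hci.
have [B B0 hB] := heferform_bound hH.
have [W W0 hW] := weight_bound.
have r2 : 0 < rho + rho by exact: addr_gt0.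
have [F F0 hF] := bm_full_bound n nu r2.
pose Q := Mrest R n nu ^+ #|{: gens N}|.
have Q0 : 0 <= Q by rewrite exprn_ge0 // (le_trans ler01 (Mrest_ge1 R n nu)).
pose L' : R := #|{set 'I_N}|%:R.
exists (c * (Q * (A * (B * (W * F)))) * L') => [|phi z L x hz hx Xx x0 xz].
  by rewrite !mulr_ge0.
have nx : 0 < `|x| by rewrite normr_gt0.
have rx : \rank (jac f x) = nu by exact: hci.
have dxz : x - z != 0 by rewrite subr_eq0.
rewrite integrandE; apply: le_trans (hc _ _ rx) _.
(* Restriction is carried through to the form before norms are taken, so the bound involves the
   intrinsic norm [fnorm] and not the size of the ambient representative. *)
rewrite bigrestr_zpart bigrestrM bigrestr_zb.
set m := mdef d; set t := `|x|; set u := `|z|; set ss := `|x - z|.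
have kbE : kb n m%:R t ss u = (t + u) ^+ m * t ^- m * ss `^ (1 - (n + n)%:R).
  have t0 : 0 <= t by exact: normr_ge0.
  have u0 : 0 <= u by exact: normr_ge0.
  have e1 : (t + u) `^ m%:R = (t + u) ^+ m by rewrite powR_mulrn // addr_ge0.
  have e2 : t `^ (- m%:R) = t ^- m by rewrite powRN powR_mulrn.
  by rewrite /kb e1 e2.
have hK : enrm (ASkernel f chi s h eps x z) <= (A * t ^- m) * ((B * (t + u) ^+ m) * (W * (F * ss `^ (1 - (n + n)%:R)))).
  rewrite enrmZ cn_sign mul1r; apply: le_trans (enrmM _ _) _.
  apply: ler_pM; rewrite ?enrm_ge0 //; first exact: hA.
  apply: le_trans (enrm_Ktilde _) _; apply: le_trans (enrmM _ _) _.
  have hBz := hB (x, z); rewrite /= -/t -/u -/m in hBz.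
  apply: (ler_pM (enrm_ge0 _) (enrm_ge0 _) hBz).
  apply: le_trans (enrm_part _ _) _; apply: le_trans (enrmM _ _) _.
  apply: (ler_pM (enrm_ge0 _) (enrm_ge0 _) (hW (x, z) hx hz)).
  apply: (hF (x, z)) => //=.
  by apply: le_trans (ler_normB _ _) _; apply: lerD; [exact: b1|exact: b2].
have hphi : enrm (zb_form (restr f x (phi x))) <= L' * fnorm f x (phi x).
  by apply: le_trans (enrm_zb _) _; exact: enrm_restr_fnorm.
rewrite kbE -!mulrA; apply: ler_wpM2l => //.
apply: le_trans (enrm_zpart _ _) _; apply: le_trans (enrmM _ _) _.
have hQ := enrm_bigrestr (ASkernel f chi s h eps x z) rx.
apply: (@le_trans _ _ ((Q * ((A * t ^- m) * ((B * (t + u) ^+ m) * (W * (F * ss `^ (1 - (n + n)%:R)))))) *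
    (L' * fnorm f x (phi x)))).
  apply: ler_pM; rewrite ?enrm_ge0 //; apply: le_trans hQ _; exact: ler_wpM2l.
rewrite le_eqVlt; apply/orP; left; apply/eqP; ring.
Qed.
End KernelBound.

(** * Joint measurability of the integrand *)

Section MeasurableForms.
Context d0 (T0 : measurableType d0) (R : realType).
Local Notation C := R[i].
Variable D : set T0.

Definition cms (F : T0 -> C) : Prop :=
  measurable_fun D (fun x => complex.Re (F x)) /\ measurable_fun D (fun x => complex.Im (F x)).

Lemma cms_eq F G : (forall x, D x -> F x = G x) -> cms F -> cms G.
Proof.
move=> e [h1 h2]; split.
  by apply: eq_measurable_fun h1 => x /set_mem Dx; rewrite e.
by apply: eq_measurable_fun h2 => x /set_mem Dx; rewrite e.
Qed.

Lemma cms_cst c : cms (fun=> c).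
Proof. by split; exact: measurable_cst. Qed.

Lemma cmsD F G : cms F -> cms G -> cms (fun x => F x + G x).
Proof.
move=> [a b] [c e]; split.
  by rewrite (_ : (fun x => _) = (fun x => complex.Re (F x) + complex.Re (G x))); [exact: measurable_funD|apply/funext => x; rewrite ReD].
by rewrite (_ : (fun x => _) = (fun x => complex.Im (F x) + complex.Im (G x))); [exact: measurable_funD|apply/funext => x; rewrite ImD].
Qed.

Lemma cmsN F : cms F -> cms (fun x => - F x).
Proof.
move=> [a b]; split.
  by rewrite (_ : (fun x => _) = (fun x => - complex.Re (F x))); [exact: measurable_funN|apply/funext => x; rewrite ReN].
by rewrite (_ : (fun x => _) = (fun x => - complex.Im (F x))); [exact: measurable_funN|apply/funext => x; rewrite ImN].
Qed.

Lemma cmsM F G : cms F -> cms G -> cms (fun x => F x * G x).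
Proof.
move=> [a b] [c e]; split.
  rewrite (_ : (fun x => _) = (fun x => complex.Re (F x) * complex.Re (G x) - complex.Im (F x) * complex.Im (G x))).
    by apply: measurable_funB; exact: measurable_funM.
  by apply/funext => x; rewrite ReM.
rewrite (_ : (fun x => _) = (fun x => complex.Re (F x) * complex.Im (G x) + complex.Im (F x) * complex.Re (G x))).
  by apply: measurable_funD; exact: measurable_funM.
by apply/funext => x; rewrite ImM.
Qed.

Lemma cms_conj F : cms F -> cms (fun x => (F x)^*).
Proof.
move=> [a b]; split.
  by rewrite (_ : (fun x => _) = (fun x => complex.Re (F x))) //; apply/funext => x; rewrite conjE.
rewrite (_ : (fun x => _) = (fun x => - complex.Im (F x))); first exact: measurable_funN.
by apply/funext => x; rewrite conjE.
Qed.

Lemma measurable_powR_on (a : R) (g : T0 -> R) : measurable_fun D g -> measurable_fun D (fun x => g x `^ a).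
Proof. exact: (@measurableT_comp _ _ _ _ _ _ (@powR R ^~ a)). Qed.

Lemma cmsV F : cms F -> cms (fun x => (F x)^-1).
Proof.
move=> [a b].
have q : measurable_fun D (fun x => (cn (F x) ^+ 2)^-1).
  rewrite (_ : (fun x => _) = (fun x => (complex.Re (F x) ^+ 2 + complex.Im (F x) ^+ 2) `^ (- 1))).
    by apply: measurable_powR_on; apply: measurable_funD; exact: measurable_funX.
  by apply/funext => x; rewrite -cn_sqr powR_inv1 // sqr_ge0.
split.
  by rewrite (_ : (fun x => _) = (fun x => complex.Re (F x) * (cn (F x) ^+ 2)^-1)); [exact: measurable_funM|apply/funext => x; rewrite ReV].
rewrite (_ : (fun x => _) = (fun x => - (complex.Im (F x) * (cn (F x) ^+ 2)^-1))); last by apply/funext => x; rewrite ImV.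
by apply: measurable_funN; exact: measurable_funM.
Qed.

Lemma cms_sum (I : Type) (r : seq I) (P : pred I) (F : I -> T0 -> C) :
  (forall i, cms (F i)) -> cms (fun x => \sum_(i <- r | P i) F i x).
Proof.
move=> h; elim: r => [|i r IH].
  by apply: cms_eq (cms_cst 0) => x _; rewrite big_nil.
have h2 : cms (fun x => if P i then F i x + \sum_(j <- r | P j) F j x else \sum_(j <- r | P j) F j x).
  by case: (P i) => //; exact: cmsD.
by apply: cms_eq h2 => x _; rewrite big_cons.
Qed.

Lemma cms_prod (I : Type) (r : seq I) (P : pred I) (F : I -> T0 -> C) :
  (forall i, cms (F i)) -> cms (fun x => \prod_(i <- r | P i) F i x).
Proof.
move=> h; elim: r => [|i r IH].
  by apply: cms_eq (cms_cst 1) => x _; rewrite big_nil.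
have h2 : cms (fun x => if P i then F i x * \prod_(j <- r | P j) F j x else \prod_(j <- r | P j) F j x).
  by case: (P i) => //; exact: cmsM.
by apply: cms_eq h2 => x _; rewrite big_cons.
Qed.

Lemma cms_det m (A : T0 -> 'M[C]_m) : (forall i j, cms (fun x => A x i j)) -> cms (fun x => \det (A x)).
Proof.
move=> h; apply: cms_sum => sg; apply: cmsM; first exact: cms_cst.
by apply: cms_prod => i; exact: h.
Qed.

Definition mxms m1 m2 (A : T0 -> 'M[C]_(m1, m2)) := forall i j, cms (fun x => A x i j).

Lemma mxmsM m1 m2 m3 (A : T0 -> 'M[C]_(m1, m2)) (B : T0 -> 'M[C]_(m2, m3)) :
  mxms A -> mxms B -> mxms (fun x => A x *m B x).
Proof.
move=> hA hB i j; apply: (@cms_eq (fun x => \sum_k A x i k * B x k j)).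
  by move=> x _; rewrite mxE.
by apply: cms_sum => k; exact: cmsM.
Qed.

Lemma mxms_inv m (A : T0 -> 'M[C]_m) : (forall x, D x -> A x \in unitmx) -> mxms A ->
  mxms (fun x => invmx (A x)).
Proof.
move=> uA hA i j.
apply: (@cms_eq (fun x => (\det (A x))^-1 * cofactor (A x) j i)).
  by move=> x Dx; rewrite /invmx uA // !mxE.
apply: cmsM; first by apply: cmsV; exact: cms_det.
apply: cmsM; first exact: cms_cst.
apply: cms_det => k l; apply: (@cms_eq (fun x => A x (lift j k) (lift i l))) => [x _|].
  by rewrite !mxE.
exact: hA.
Qed.

Section Ext.
Variable G : finType.

Definition ems (a : T0 -> ext C G) : Prop := forall S, cms (fun x => a x S).

Lemma ems_eq a b : (forall x, D x -> a x = b x) -> ems a -> ems b.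
Proof. by move=> e h S; apply: cms_eq (h S) => x Dx; rewrite e. Qed.

Lemma ems_cst c : ems (fun=> c).
Proof. by move=> S; exact: cms_cst. Qed.

Lemma emsD a b : ems a -> ems b -> ems (fun x => a x + b x).
Proof.
move=> ha hb S; apply: (@cms_eq (fun x => a x S + b x S)) => [x _|]; last exact: cmsD.
by rewrite ffunE.
Qed.

Lemma emsZ (k : T0 -> C) a : cms k -> ems a -> ems (fun x => k x *: a x).
Proof.
move=> hk ha S; apply: (@cms_eq (fun x => k x * a x S)) => [x _|]; last exact: cmsM.
by rewrite ffunE.
Qed.

Lemma ems_sum (I : Type) (r : seq I) (P : pred I) (F : I -> T0 -> ext C G) :
  (forall i, ems (F i)) -> ems (fun x => \sum_(i <- r | P i) F i x).
Proof.
move=> h S; apply: (@cms_eq (fun x => \sum_(i <- r | P i) F i x S)) => [x _|].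
  by rewrite sum_ffunE.
by apply: cms_sum => i; exact: h.
Qed.

Lemma ems_wedge a b : ems a -> ems b -> ems (fun x => ewedge (a x) (b x)).
Proof.
move=> ha hb S; apply: (@cms_eq (fun x => \sum_(T : {set G} | T \subset S)
    esgn C T (S :\: T)%SET * a x T * b x (S :\: T)%SET)) => [x _|]; first by rewrite ffunE.
apply: cms_sum => T; apply: cmsM; last exact: hb.
by apply: cmsM; [exact: cms_cst|exact: ha].
Qed.

Lemma ems_pow a k : ems a -> ems (fun x => epow (a x) k).
Proof.
move=> ha; elim: k => [|k IH]; first exact: ems_cst.
exact: ems_wedge.
Qed.

Lemma ems_wedges (I : Type) (r : seq I) (F : I -> T0 -> ext C G) :
  (forall i, ems (F i)) -> ems (fun x => ewedges [seq F i x | i <- r]).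
Proof.
move=> h; elim: r => [|i r IH] /=; first exact: ems_cst.
exact: ems_wedge.
Qed.
End Ext.

Lemma ems_subst (G H : finType) (theta : T0 -> G -> ext C H) (a : T0 -> ext C G) :
  (forall g, ems (theta ^~ g)) -> ems a -> ems (fun x => esubst (theta x) (a x)).
Proof.
move=> ht ha; apply: ems_sum => S; apply: emsZ; first exact: ha.
exact: (ems_wedges _ ht).
Qed.
End MeasurableForms.

Section IntegrandMeasurable.
Variables (R : realType) (n nu : nat).
Local Notation C := R[i].
Local Notation N := (n + nu)%N.
Local Notation E := (Cn R N).
Local Notation T := (borelCn R n nu).
Variable f : 'I_nu -> mpoly N C.
Variable h : 'I_nu -> 'I_N -> mpoly (N + N)%N C.
Variables (Om : set E) (chi : E -> R) (s : 'I_N -> E * E -> C) (eps : bool).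
Hypothesis hchi : smooth setT chi.
Hypothesis hs : weight_section Om chi s.
Hypothesis oOm : open Om.

Lemma cCk_cms (O : set (E * E)) (F : E * E -> C) (D : set (T * T)) :
  open O -> D `<=` O -> cCk 0 O F -> cms D (F : T * T -> C).
Proof.
move=> oO DO [[c1 _] [c2 _]]; have mO := open_borel2 oO.
split; apply: (measurable_funS mO DO).
  exact: (continuous_borel2 oO c1).
exact: (continuous_borel2 oO c2).
Qed.

Variable D : set (T * T).
Hypothesis mD : measurable D.
Hypothesis Dreg : forall p, D p -> \rank (jac f p.1) = nu.
Hypothesis Dneq : forall p, D p -> (p.1 : E) != p.2.
Hypothesis DOm : forall p, D p -> Om p.2.

Lemma cms_jac : mxms D (fun p : T * T => jac f p.1).
Proof.
move=> i j; apply: (@cCk_cms setT) => //; first exact: openT.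
rewrite (_ : (fun x => _) = (fun p : E * E => meval (crd p.1) (mderiv j (f i)))).
  by apply: cCk_meval; [exact: openT|move=> k; exact: crd1_cCk].
by apply/funext => p; rewrite mxE.
Qed.

Lemma cms_tproj : mxms D (fun p : T * T => tproj f p.1).
Proof.
have hA := cms_jac.
have hB : mxms D (fun p : T * T => map_mx (fun x : C => x^*) (jac f p.1)^T).
  move=> i j; apply: (@cms_eq _ _ _ _ (fun p : T * T => (jac f p.1 j i)^*)) => [p _|].
    by rewrite !mxE.
  by apply: cms_conj; exact: hA.
have hI := mxms_inv (fun p Dp => gram_unit (Dreg Dp)) (mxmsM hA hB).
move=> i j; apply: (@cms_eq _ _ _ _ (fun p : T * T => (1%:M : 'M[C]_N) i j -
  (map_mx (fun x : C => x^*) (jac f p.1)^T *m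
   invmx (jac f p.1 *m map_mx (fun x : C => x^*) (jac f p.1)^T) *m jac f p.1) i j)) => [p _|].
  by rewrite /tproj [RHS]mxE; congr (_ + _); rewrite [RHS]mxE.
apply: cmsD; first exact: cms_cst.
by apply: cmsN; exact: (mxmsM (mxmsM hB hI) hA).
Qed.

Lemma ems_bigtheta g : ems D (fun p : T * T => bigtheta f p.1 g).
Proof.
rewrite /bigtheta; case: (g.1 == inord 1); last (case: (g.1 == inord 2); last exact: ems_cst).
  by apply: ems_sum => k; apply: emsZ; [exact: cms_tproj|exact: ems_cst].
apply: ems_sum => k; apply: emsZ; last exact: ems_cst.
by apply: cms_conj; exact: cms_tproj.
Qed.

Lemma cms_density (Th : T * T -> ext C (gens N)) : ems D Th -> cms D (fun p => density f p.1 (Th p)).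
Proof.
move=> hTh.
have hr a : ems D a -> ems D (fun p => bigrestr f p.1 (a p)).
  by move=> ha; exact: (ems_subst ems_bigtheta ha).
have hv : ems D (fun p : T * T => volform f p.1) by apply: hr; exact: ems_cst.
have hd a b : ems D a -> ems D b -> cms D (fun p => edot (a p) (b p)).
  by move=> ha hb; apply: cms_sum => S; apply: cmsM; [exact: ha|apply: cms_conj; exact: hb].
by apply: cmsM; [apply: hd => //; exact: hr|apply: cmsV; exact: hd].
Qed.

Lemma ems_omegaX : ems D (fun p : T * T => omegaX f p.1).
Proof.
have hm I : cms D (fun p : T * T => minor f p.1 I).
  apply: cms_det => a b; apply: (@cms_eq _ _ _ _ (fun p : T * T => jac f p.1 a (I b))) => [p _|].
    by rewrite mxE.
  exact: cms_jac.
apply: emsZ.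
  apply: cmsM; first exact: cms_cst.
  apply: cmsV; apply: cms_sum => I; apply: cmsM; first exact: hm.
  by apply: cms_conj; exact: hm.
apply: ems_sum => I; apply: emsZ; last exact: ems_cst.
by apply: cms_conj; exact: hm.
Qed.

Lemma ems_oneform (w : 'I_N -> E * E -> C) (B : set (T * T)) :
  (forall j, cms B (w j : T * T -> C)) -> ems B (fun p : T * T => oneform w p).
Proof. by move=> hw; apply: ems_sum => j; apply: emsZ; [exact: hw|exact: ems_cst]. Qed.

Lemma ems_fullform (w : 'I_N -> E * E -> C) (O : set (E * E)) (B : set (T * T)) :
  open O -> B `<=` O -> (forall j, cCk 1 O (w j)) -> ems B (fun p : T * T => fullform w p).
Proof.
move=> oO BO hw.
have hd k u v : cms B (fun p : T * T => wirtb u v (w k) p).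
  by apply: (cCk_cms oO BO); apply: (cCk_wirtb _ _ oO); exact: hw.
apply: ems_sum => k; apply: ems_wedge.
  by apply: ems_oneform => j; apply: (cCk_cms oO BO); case: (hw j) => a b; split; exact: CkW.
apply: ems_pow; apply: ems_sum => j; apply: ems_wedge; last exact: ems_cst.
apply: ems_sum => l; apply: emsD; apply: emsZ; try exact: ems_cst; exact: hd.
Qed.

Definition offdiag : set (E * E) := [set p | p.1 - p.2 != 0].

Lemma open_offdiag : open offdiag.
Proof.
rewrite (_ : offdiag = (fun p : E * E => p.1 - p.2) @^-1` [set a : E | a != 0]) //.
apply: open_comp => [p _|]; last exact: open_neq0.
by apply: cvgB; [exact: cvg_fst|exact: cvg_snd].
Qed.

Lemma bm_cCk k j : cCk k offdiag (@bm R n nu j).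
Proof.
have o := open_offdiag.
have hc l : cCk k offdiag (fun p : E * E => crd p.1 l - crd p.2 l).
  by apply: cCkD => //; [exact: crd1_cCk|apply: cCkN => //; exact: crd2_cCk].
apply: cCkM => //; first exact: cCk_conj.
apply: cCkV => //.
  move=> p /=; apply: contra_neq => /eqP; rewrite mulf_eq0 (negbTE (twopii_neq0 R)) /=.
  move/eqP => e; apply: rho2_eq0; rewrite /rho2 -[RHS]e.
  by apply: eq_bigr => l _; rewrite !crdB.
apply: cCkM => //; first exact: cCk_cst.
by apply: cCk_sum => // l _; apply: cCkM => //; exact: cCk_conj.
Qed.

Lemma cms_fst (F : E -> C) (B : set (T * T)) : cCk 0 setT F -> cms B (fun p : T * T => F p.1).
Proof.
move=> [[c1 _] [c2 _]].
have key (g : E -> R^o) : (forall x, [set: E] x -> {for x, continuous g}) ->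
    measurable_fun B (fun p : T * T => g p.1 : R).
  move=> cg; have mg : measurable_fun [set: T] (g : T -> R) := continuous_borel (@openT E) cg.
  apply: measurable_funTS.
  exact: (measurableT_comp mg measurable_fst).
by split; [exact: (key (fun x => complex.Re (F x)) c1)|exact: (key (fun x => complex.Im (F x)) c2)].
Qed.

Lemma open_dchi : open (dchi_supp chi).
Proof.
rewrite openE => x [k xk].
have [c1 c2] := cCk_wirtb (ure R k) (uim R k) (@openT E) (chi_cCk hchi 1).
have := cCk_near_neq0 (conj c1 c2) I xk.
by move=> hn; near=> y; exists k; near: y.
Unshelve. all: by end_near. Qed.

Lemma cms_union (B1 B2 : set (T * T)) (F : T * T -> C) : measurable B1 -> measurable B2 ->
  cms B1 F -> cms B2 F -> cms (B1 `|` B2) F.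
Proof.
by move=> m1 m2 [a b] [c e]; split; apply/measurable_funU.
Qed.

(** The set where dbar chi is nonzero is open, hence measurable; on it [s] is smooth, and off it the
    weight reduces to chi. *)
Lemma ems_weight : ems D (fun p : T * T => weight chi s p).
Proof.
have [U [W [[oU oW] ZU OW sm _]]] := hs.
have oUW : open (U `*` W) by exact: open_setX.
pose B : set (T * T) := [set p | dchi_supp chi p.1].
have mB : measurable B.
  rewrite (_ : B = (dchi_supp chi : set T) `*` setT); last by apply/seteqP; split => [p //|p []].
  by apply: measurableX => //; apply: open_borel; exact: open_dchi.
have mDB : measurable (D `&` B) by exact: measurableI.
have mDC : measurable (D `\` B) by exact: measurableD.
have hc B' : cms B' (fun p : T * T => rc (chi p.1)) by exact: (cms_fst _ (chi_cCk hchi 0)).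
have sub : D `&` B `<=` U `*` W.
  move=> p [Dp Bp]; split; first by apply: ZU; exact: subset_closure.
  by apply: OW; apply: subset_closure; exact: DOm.
move=> S; rewrite -(setUIDK D B) setUC; apply: cms_union => //.
  have hw : ems (D `\` B) (fun p : T * T => weight chi s p).
    apply: (@ems_eq _ _ _ _ _ (fun p : T * T => rc (chi p.1) *: eone C (gens N))) => [p [_ pB]|].
      by rewrite weight_off.
    by apply: emsZ; [exact: hc|exact: ems_cst].
  exact: hw.
have hw : ems (D `&` B) (fun p : T * T => weight chi s p).
  apply: (@ems_eq _ _ _ _ _ (fun p : T * T => rc (chi p.1) *: eone C (gens N) +
     (- 1) *: ewedge (dbar_fun (fun p' => rc (chi p'.1)) p) (fullform s p))) => [p _|].
    by rewrite scaleN1r.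
  apply: emsD; first by apply: emsZ; [exact: hc|exact: ems_cst].
  apply: emsZ; first exact: cms_cst.
  apply: ems_wedge; last first.
    apply: (ems_fullform oUW sub) => j.
    by have [+ _] := csmoothP (U `*` W) (s j); apply; exact: sm.
  apply: ems_sum => k; apply: emsD; apply: emsZ; try exact: ems_cst.
    apply: (@cms_eq _ _ _ _ (fun p : T * T => delb k (fun y => rc (chi y)) p.1)) => [p _|].
      by rewrite (delb_zeta_fst (fun y => rc (chi y))).
    apply: cms_fst; exact: (cCk_wirtb _ _ (@openT E) (chi_cCk hchi 1)).
  apply: (@cms_eq _ _ _ _ (fun=> 0)) => [p _|]; last exact: cms_cst.
  by rewrite (delb_z_fst (fun y => rc (chi y))).
exact: hw.
Qed.

(** The form is replaced by its restriction, whose coefficients are the ones known to be measurable;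
    the density does not see the difference. *)
Lemma cms_integrand (phi : E -> ext C 'I_N) (L : {set 'I_N}) :
  (forall S, cms D (fun p : T * T => restr f p.1 (phi p.1) S)) ->
  cms D (fun p : T * T => ASintegrand f chi s h eps phi p.2 L p.1).
Proof.
move=> hphi.
apply: (@cms_eq _ _ _ _ (fun p : T * T => density f p.1 (zpart L
   (ewedge (ASkernel f chi s h eps p.1 p.2) (zb_form (restr f p.1 (phi p.1))))))) => [p Dp|].
  by rewrite density_restr //; exact: Dreg.
apply: cms_density => S.
have hp : ems D (fun p : T * T => ewedge (ASkernel f chi s h eps p.1 p.2)
    (zb_form (restr f p.1 (phi p.1)))).
  apply: ems_wedge; last first.
    by apply: (ems_subst (theta := fun _ j => egen C (gzetab j))) => [g|]; [exact: ems_cst|exact: hphi].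
  apply: emsZ; first exact: cms_cst.
  apply: ems_wedge; first exact: ems_omegaX.
  have hgb : ems D (fun p : T * T => hgB chi s h (p.1, p.2)).
    apply: ems_wedge.
      apply: ems_wedges => i; apply: ems_oneform => j.
      apply: (@cCk_cms setT) => //; first exact: openT.
      apply: cCk_meval; first exact: openT.
      by move=> k; case: (fintype.split k) => l; [exact: crd1_cCk|exact: crd2_cCk].
    move=> S'.
    have hw : ems D (fun p : T * T => ewedge (weight chi s (p.1, p.2)) (fullform (@bm R n nu) (p.1, p.2))).
      apply: (@ems_eq _ _ _ _ _ (fun p : T * T => ewedge (weight chi s p) (fullform (@bm R n nu) p))) => [[x z] _ //|].
      apply: ems_wedge; first exact: ems_weight.
      apply: (ems_fullform open_offdiag); last by move=> j; exact: bm_cCk.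
      by move=> p Dp; rewrite /offdiag /= subr_eq0; exact: Dneq.
    apply: (@cms_eq _ _ _ _ (fun p : T * T => if #|S' :&: etas n nu|%SET == n then
       ewedge (weight chi s (p.1, p.2)) (fullform (@bm R n nu) (p.1, p.2)) S' else 0)) => [p _|].
      by rewrite [RHS]ffunE.
    by case: (_ == n); [exact: hw|exact: cms_cst].
  move=> S'; apply: (@cms_eq _ _ _ _ (fun p : T * T => if (S' :&: etas n nu == finset.set0)%SET then
     esgn C S' (etas n nu) * hgB chi s h (p.1, p.2) (S' :|: etas n nu)%SET else 0)) => [p _|].
    by rewrite [RHS]ffunE.
  case: (S' :&: etas n nu == finset.set0)%SET; last exact: cms_cst.
  by apply: cmsM; [exact: cms_cst|exact: hgb].
apply: (@cms_eq _ _ _ _ (fun p : T * T => if bideg S then esgn C S (zbset L) *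
   ewedge (ASkernel f chi s h eps p.1 p.2) (zb_form (restr f p.1 (phi p.1))) (S :|: zbset L)%SET
   else 0)) => [p _|]; first by rewrite zpartE.
case: (bideg S); last exact: cms_cst.
by apply: cmsM; [exact: cms_cst|exact: hp].
Qed.
End IntegrandMeasurable.

(** * The integral operator on L^p *)

Section Operator.
Variables (R : realType) (n nu : nat).
Local Notation C := R[i].
Local Notation N := (n + nu)%N.
Local Notation E := (Cn R N).
Local Notation T := (borelCn R n nu).
Local Notation form := (ext C 'I_N).
Variable f : 'I_nu -> mpoly N C.
Variable d : 'I_nu -> nat.
Variable h : 'I_nu -> 'I_N -> mpoly (N + N)%N C.
Hypothesis hH : hefer f d h.
Hypothesis hf : forall i, (0 < d i)%N /\ f i \is @ishomog1 _ _ (d i) mdeg.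
Hypothesis hci : smooth_ci f.
Variables (Om Om' : set E) (chi : E -> R) (s : 'I_N -> E * E -> C) (eps : bool).
Hypothesis hchi : smooth setT chi.
Hypothesis hs : weight_section Om chi s.
Hypothesis oOm : open Om.
Hypothesis oOm' : open Om'.
Hypothesis cOm : compact (closure Om).
Hypothesis cOm' : compact (closure Om').
Variable dV : {measure set T -> \bar R}.
Hypothesis hdV : is_volume f dV.
Hypothesis n0 : (0 < n)%N.
Local Notation X := (coneX f).
Local Notation A1 := ((X `&` Om') `&` regX f : set T).
Local Notation A2 := ((X `&` Om) `&` regX f : set T).
Local Notation ASint := (ASintegrand f chi s h eps).
Local Notation AS := (ASop f dV (X `&` Om') chi s h eps).

Lemma measurable_coneX_open (O : set E) : open O ->
  measurable ((X `&` O) `&` regX f : set T).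
Proof.
move=> oO; apply: measurableI; last exact: (measurable_regX hci).
by apply: measurableI; [apply: closed_borel; exact: closed_coneX|exact: open_borel].
Qed.

Lemma measurable_pt (z : E) : measurable ([set z] : set T).
Proof. by rewrite -cball0; exact: measurable_cball. Qed.

(** Joint measurability is available off the diagonal only, so a section at fixed z misses the
    single point z, restored here. *)
Lemma measurable_add_pt d1 (T1 : measurableType d1) (A : set T) (z : E) (g : T -> T1) : measurable A ->
  measurable_fun (A `\ z) g -> measurable_fun A g.
Proof.
move=> mA mg; have mz := measurable_pt z.
have mAz : measurable (A `\ z : set T) by exact: measurableD.
have mU : measurable (A `\ z `|` [set z] : set T) by exact: measurableU.
apply: (measurable_funS mU); last by apply/measurable_funU => //; split => //; exact: measurable_fun_set1.
by move=> x Ax; have [->|xz] := pselect (x = z); [right|left].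
Qed.

Definition Dprod : set (T * T) := [set p | [/\ A1 p.1, Om p.2 & (p.1 : E) != p.2]].

Lemma measurable_Dprod : measurable Dprod.
Proof.
rewrite (_ : Dprod = (A1 `*` (Om : set T)) `&` (@offdiag R n nu : set (T * T))).
  apply: measurableI; last by apply: open_borel2; exact: open_offdiag.
  by apply: measurableX; [exact: measurable_coneX_open|exact: open_borel].
apply/seteqP; split => p; rewrite /offdiag /= subr_eq0; first by case.
by case=> -[].
Qed.

Definition Lp_meas (phi : E -> form) : Prop :=
  forall S : {set 'I_N}, cmeasurable (X `&` Om' `&` regX f) (fun z => restr f z (phi z) S).

Lemma cms_ASint phi L : Lp_meas phi -> cms Dprod (fun p : T * T => ASint phi p.2 L p.1).
Proof.
move=> hphi; have mA := measurable_coneX_open oOm'.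
have h1 (p : T * T) : Dprod p -> \rank (jac f p.1) = nu by case=> -[_ []].
have h2 (p : T * T) : Dprod p -> (p.1 : E) != p.2 by case.
have h3 (p : T * T) : Dprod p -> Om p.2 by case.
apply: (@cms_integrand R n nu f h Om chi s eps hchi hs Dprod measurable_Dprod h1 h2 h3 phi L) => S.
have [c1 c2] := hphi S.
have key (g : T -> R) : measurable_fun A1 g -> measurable_fun Dprod (fun p : T * T => g p.1).
  move=> mg; apply: (@measurable_comp _ _ _ _ _ _ A1 g Dprod fst mA) => //.
  - by move=> x [p [h4 _ _] <-].
  - by apply: measurable_funTS; exact: measurable_fst.
by split; [exact: (key _ c1)|exact: (key _ c2)].
Qed.

Lemma cms_section phi L z : Om z -> Lp_meas phi -> cms A1 (fun x : T => ASint phi z L x).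
Proof.
move=> Oz hphi; have mA := measurable_coneX_open oOm'; have [c1 c2] := cms_ASint L hphi.
have key (g : T * T -> R) : measurable_fun Dprod g -> measurable_fun A1 (fun x : T => g (x, z)).
  move=> mg; apply: (@measurable_add_pt _ _ _ z) => //.
  apply: (@measurable_comp _ _ _ _ _ _ Dprod g (A1 `\ z) (fun x => (x, z)) measurable_Dprod) => //.
    by move=> p [x [h1 xz] <-]; split => //; apply/eqP.
  by apply: measurable_funTS; apply: measurable_fun_pair; [exact: measurable_id|exact: measurable_cst].
by split; [exact: (key _ c1)|exact: (key _ c2)].
Qed.

Hypothesis growth : exists2 K : R, 0 < K &
  forall (z : E) r, 0 <= r -> (dV (cball z r) <= (K * r ^+ (n + n))%:E)%E.

Lemma dV_point (z : E) : dV [set z] = 0%E.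
Proof. by have [K _ hK] := growth; exact: (dV_pt hK n0). Qed.

Lemma fubini_measurable (F : T * T -> \bar R) : measurable_fun setT F -> (forall p, 0 <= F p)%E ->
  measurable_fun setT (fun z : T => \int[dV]_x F (x, z))%E.
Proof.
move=> mF F0; have [K K0 hK] := growth; have [mu hmu] := sigma_finite_version hK.
rewrite -hmu; exact: (@measurable_fun_fubini_tonelli_G _ _ _ _ _ mu F mF F0).
Qed.

(** Extends the integrand by zero to the whole product, the lost point of the diagonal being null,
    and splits it by sign, since measurability of partial integrals is a statement about nonnegative
    functions. *)
Lemma section_integral (g : T * T -> R) (z : E) : Om z -> measurable_fun A1 (fun x : T => g (x, z)) ->
  (\int[dV]_(x in A1) (g (x, z))%:E =
   \int[dV]_x ((EFin \o g) \_ Dprod)^\+ (x, z) - \int[dV]_x ((EFin \o g) \_ Dprod)^\- (x, z))%E.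
Proof.
move=> Oz mg; have mA := measurable_coneX_open oOm'; have mz := measurable_pt z.
have mE : measurable_fun A1 (fun x : T => (g (x, z))%:E) by exact/measurable_EFinP.
have key (G : T * T -> \bar R) : (forall p, 0 <= G p)%E ->
    measurable_fun A1 (fun x : T => G (x, z)) ->
    (\int[dV]_(x in A1) G (x, z) = \int[dV]_x (G \_ Dprod) (x, z))%E.
  move=> G0 mG; rewrite (@ge0_negligible_integral _ _ _ dV A1 [set z]) //; last exact: dV_point.
  rewrite integral_mkcond; apply: eq_integral => x _; rewrite !patchE.
  have [hx|hx] := pselect ((A1 `\ z) x).
    rewrite mem_set // mem_set //; case: hx => h1 xz; split => //.
    by apply/eqP.
  rewrite memNset // memNset // => -[h1 _ /= /eqP xz]; exact: hx.
rewrite integralE; congr (_ - _)%E.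
  have m1 : measurable_fun A1 (fun x : T => (EFin \o g)^\+%E (x, z)).
    by apply: eq_measurable_fun (measurable_funepos mE) => x _; rewrite !funeposE.
  rewrite funepos_restrict -(key _ (fun y => funepos_ge0 _ y) m1).
  by apply: eq_integral => x _; rewrite !funeposE.
have m1 : measurable_fun A1 (fun x : T => (EFin \o g)^\-%E (x, z)).
  by apply: eq_measurable_fun (measurable_funeneg mE) => x _; rewrite !funenegE.
rewrite funeneg_restrict -(key _ (fun y => funeneg_ge0 _ y) m1).
by apply: eq_integral => x _; rewrite !funenegE.
Qed.

Lemma cms_ASop phi L : Lp_meas phi -> cms (Om : set T) (fun z : T => AS phi z L).
Proof.
move=> hphi; have [c1 c2] := cms_ASint L hphi.
have key (g : T * T -> R) : measurable_fun Dprod g ->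
    (forall z, Om z -> measurable_fun A1 (fun x : T => g (x, z))) ->
    measurable_fun (Om : set T) (fun z : T => fine (\int[dV]_(x in A1) (g (x, z))%:E)%E).
  move=> mg ms.
  have mF : measurable_fun setT ((EFin \o g) \_ Dprod).
    by apply/(measurable_restrictT _ measurable_Dprod); exact/measurable_EFinP.
  apply: (@eq_measurable_fun _ _ _ _ _ (fun z : T => fine (
   \int[dV]_x ((EFin \o g) \_ Dprod)^\+ (x, z) - \int[dV]_x ((EFin \o g) \_ Dprod)^\- (x, z))%E)).
    by move=> z /set_mem Oz; rewrite section_integral //; exact: ms.
  have m1 : measurable_fun setT (fun z : T => \int[dV]_x ((EFin \o g) \_ Dprod)^\+ (x, z) -
      \int[dV]_x ((EFin \o g) \_ Dprod)^\- (x, z))%E.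
    apply: emeasurable_funB; apply: fubini_measurable => //.
      exact: measurable_funepos.
    exact: measurable_funeneg.
  exact: (measurable_funTS (measurableT_comp (fine_measurable measurableT) m1)).
have sec z : Om z -> cms A1 (fun x : T => ASint phi z L x) by move=> Oz; exact: cms_section.
have e z : AS phi z L = cintegral dV (X `&` Om' `&` regX f) (ASint phi z L) by rewrite ffunE.
split.
  apply: (@eq_measurable_fun _ _ _ _ _ (fun z : T => fine (\int[dV]_(x in A1) (complex.Re (ASint phi z L x))%:E)%E)).
    by move=> z _; rewrite e.
  by apply: (key (fun p => complex.Re (ASint phi p.2 L p.1))) => // z /sec[].
apply: (@eq_measurable_fun _ _ _ _ _ (fun z : T => fine (\int[dV]_(x in A1) (complex.Im (ASint phi z L x))%:E)%E)).
  by move=> z _; rewrite e.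
by apply: (key (fun p => complex.Im (ASint phi p.2 L p.1))) => // z /sec[].
Qed.

Lemma cms_tproj1 : mxms (regX f : set T) (fun z : T => tproj f z).
Proof.
have mr := measurable_regX hci.
pose D : set (T * T) := (regX f : set T) `*` setT.
have mD : measurable D by exact: measurableX.
move=> i j; have [|c1 c2] := @cms_tproj R n nu f D _ i j; first by move=> p [[]].
have key (g : T * T -> R) : measurable_fun D g -> measurable_fun (regX f : set T) (fun z : T => g (z, z)).
  move=> mg; apply: (@measurable_comp _ _ _ _ _ _ D g (regX f : set T) (fun z : T => (z, z)) mD) => //.
    by move=> p [z hz <-].
  apply: measurable_funTS.
  by apply: measurable_fun_pair; exact: measurable_id.
by split; [exact: (key _ c1)|exact: (key _ c2)].
Qed.

Lemma cms_restr (A : set T) (v : E -> form) : measurable A -> A `<=` regX f ->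
  (forall S, cms A (fun z : T => v z S)) -> forall S, cms A (fun z : T => restr f z (v z) S).
Proof.
move=> mA sA hv.
have ht i j : cms A (fun z : T => tproj f z i j).
  by have [c1 c2] := cms_tproj1 i j; split; apply: (measurable_funS (measurable_regX hci) sA).
move=> S; apply: (@ems_subst _ T R A _ _ (fun z => rtheta f z) v _ hv S) => g.
apply: ems_sum => k; apply: emsZ; last exact: ems_cst.
by apply: cms_conj; exact: ht.
Qed.

Lemma cms_restr_ASop phi S : Lp_meas phi ->
  cmeasurable (X `&` Om `&` regX f) (fun z => restr f z (AS phi z) S).
Proof.
move=> hphi; apply: cms_restr => [||L]; [exact: measurable_coneX_open|by move=> z []|].
have [c1 c2] := cms_ASop L hphi.
by split; apply: (measurable_funS (open_borel oOm)) => // z [[]].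
Qed.

Lemma measurable_fnorm (A : set T) (v : E -> form) :
  (forall S, cms A (fun z : T => restr f z (v z) S)) -> measurable_fun A (fun z : T => fnorm f z (v z)).
Proof.
move=> hv; rewrite (_ : (fun z => _) = (fun z : T => (\sum_(S : {set 'I_N})
    (complex.Re (restr f z (v z) S) ^+ 2 + complex.Im (restr f z (v z) S) ^+ 2)) `^ 2^-1)); last first.
  apply/funext => z; rewrite powR12_sqrt //; apply: sumr_ge0 => S _.
  by rewrite addr_ge0 // sqr_ge0.
apply: measurable_powR_on; apply: measurable_sum => S; have [c1 c2] := hv S.
by apply: measurable_funD; exact: measurable_funX.
Qed.

(** The p-th power of [Lpnorm]: additive in the domain and comparable without taking roots. *)
Definition Lint (B : set E) (p : R) (v : E -> form) : \bar R :=
  (\int[dV]_(z in (B `&` regX f : set T)) (fnorm f z (v z) `^ p)%:E)%E.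

Lemma LpnormE B p v : 0 < p -> Lpnorm f dV B p v = (Lint B p v `^ p^-1)%E.
Proof.
move=> p0; rewrite /Lpnorm unlock /Lint; congr (_ `^ _)%E.
rewrite [RHS]integral_mkcond; apply: eq_integral => z _; rewrite !patchE.
case: ifP => _ /=; first by rewrite ger0_norm ?fnorm_ge0.
by rewrite normr0 powR0 // gt_eqF.
Qed.

Lemma Lint_ge0 B p v : (0 <= Lint B p v)%E.
Proof. by apply: integral_ge0 => z _; rewrite lee_fin powR_ge0. Qed.

Lemma esubstB1 (G H : finType) (th : G -> ext C H) (a b : ext C G) :
  esubst th (a - b) = esubst th a - esubst th b.
Proof. by rewrite -(scaleN1r b) esubstD esubstZ scaleN1r. Qed.

Lemma edotBl (a b c : ext C (gens N)) : edot (a - b) c = edot a c - edot b c.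
Proof. by rewrite /edot -sumrB; apply: eq_bigr => S _; rewrite !ffunE mulrBl. Qed.

Lemma densityB x (Th1 Th2 : ext C (gens N)) :
  density f x (Th1 - Th2) = density f x Th1 - density f x Th2.
Proof. by rewrite /density /bigrestr esubstB1 edotBl mulrBl. Qed.

Lemma ASintegrandB phi psi z L x :
  ASint (fun y => phi y - psi y) z L x = ASint phi z L x - ASint psi z L x.
Proof.
rewrite !integrandE -densityB /zb_form esubstB1; congr (density f x _).
rewrite -(scaleN1r (esubst _ (psi x))) ewedgeDr ewedgeZr zpartD zpartZ.
by rewrite scaleN1r.
Qed.

Variables (p rho : R).
Hypothesis p1 : 1 < p.
Hypothesis hp : (n + n)%:R < p * ((n + n)%:R - (mdef d)%:R).
Hypothesis rho0 : 0 < rho.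
Hypothesis bOm' : forall x : E, closure Om' x -> `|x| <= rho.
Hypothesis bOm : forall x : E, closure Om x -> `|x| <= rho.

Local Notation mD := (mdef d)%:R.

Definition fn (phi : E -> form) (x : T) : R := if x \in A1 then fnorm f x (phi x) else 0.

Lemma fn_ge0 phi x : 0 <= fn phi x.
Proof. by rewrite /fn; case: ifP => // _; exact: fnorm_ge0. Qed.

Lemma measurable_fn phi : Lp_meas phi -> measurable_fun setT (fn phi).
Proof.
move=> hphi; have mA := measurable_coneX_open oOm'.
have : measurable_fun setT ((fun z : T => fnorm f z (phi z)) \_ A1).
  by apply/(measurable_restrictT _ mA); apply: measurable_fnorm; exact: hphi.
by apply: eq_measurable_fun => x _; rewrite patchE /fn.
Qed.

Definition kfun (phi : E -> form) (y : T * T) : R :=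
  kb n mD `|y.1 : E| `|(y.1 : E) - y.2| `|y.2 : E| * fn phi y.1.

Lemma kfun_ge0 phi y : 0 <= kfun phi y.
Proof. by rewrite mulr_ge0 ?kb_ge0 ?fn_ge0. Qed.

Lemma measurable_kfun phi : Lp_meas phi -> measurable_fun setT (kfun phi).
Proof.
move=> hphi.
have m0 : measurable_fun setT (fun x : T => `|x : E|).
  by apply: eq_measurable_fun (@measurable_dist R n nu 0) => x _; rewrite subr0.
have m1 : measurable_fun setT (fun y : T * T => `|y.1 : E|) by exact: (measurableT_comp m0).
have m2 : measurable_fun setT (fun y : T * T => `|y.2 : E|) by exact: (measurableT_comp m0).
apply: measurable_funM; last exact: (measurableT_comp (measurable_fn hphi)).
apply: measurable_funM; last by apply: measurable_powR_comp; exact: measurable_dist2.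
apply: measurable_funM; last exact: measurable_powR_comp.
by apply: measurable_powR_comp; exact: measurable_funD.
Qed.

(** The positive operator with the model kernel, applied to the pointwise norm of the form. It
    majorises the integral operator and is the one to which Schur's test applies. *)
Definition Iop (phi : E -> form) (z : T) : \bar R :=
  (\int[dV]_(x in (cball (0%R : E) rho : set T)) (kfun phi (x, z))%:E)%E.

Lemma Iop_ge0 phi z : (0 <= Iop phi z)%E.
Proof. by apply: integral_ge0 => x _; rewrite lee_fin kfun_ge0. Qed.

Lemma measurable_Iop phi : Lp_meas phi -> measurable_fun setT (Iop phi).
Proof.
move=> hphi; have mB := @measurable_cball R n nu 0 rho.
have mF : measurable_fun setT ((fun y : T * T => (kfun phi y)%:E) \_ ((cball (0 : E) rho : set T) `*` setT)).
  apply/(measurable_restrictT _ (measurableX mB measurableT)).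
  by apply: measurable_funTS; apply/measurable_EFinP; exact: measurable_kfun.
apply: eq_measurable_fun (fubini_measurable mF _) => [z _|y].
  rewrite /Iop [RHS]integral_mkcond; apply: eq_integral => x _; rewrite !patchE.
  by congr (if _ then _ else _); apply/idP/idP; rewrite !inE //= => -[].
by apply: erestrict_ge0 => w _; rewrite lee_fin kfun_ge0.
Qed.

Lemma Lint_fn phi : (\int[dV]_x (fn phi x `^ p)%:E = Lint (X `&` Om') p phi)%E.
Proof.
rewrite /Lint [RHS]integral_mkcond; apply: eq_integral => x _; rewrite patchE /fn.
by case: ifP => // _; rewrite powR0 // gt_eqF // (lt_trans ltr01).
Qed.

Lemma Iop_bound : exists2 c : R, 0 <= c & forall phi, Lp_meas phi ->
  (\int[dV]_(z in (cball (0%R : E) rho `\ (0%R : E) : set T)) (Iop phi z `^ p) <= c%:E * Lint (X `&` Om') p phi)%E.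
Proof.
have [K K0 hK] := growth.
have [c c0 hc] := kb_schur K0 hK n0 p1 hp rho0; exists c => // phi hphi.
rewrite -Lint_fn; exact: (hc _ (measurable_fn hphi) (fn_ge0 phi)).
Qed.

Lemma sub_cball (O : set E) : (forall x : E, closure O x -> `|x| <= rho) ->
  (X `&` O) `&` regX f `<=` cball (0 : E) rho.
Proof. by move=> hO x [[_ Ox] _]; rewrite /cball /= subr0; apply: hO; exact: subset_closure. Qed.

Lemma kernel_le : exists2 M : R, 0 < M & forall phi (g : T -> R) z L, Om z -> Lp_meas phi ->
  measurable_fun A1 g -> (forall x, `|g x| <= cn (ASint phi z L x)) ->
  (\int[dV]_(x in A1) (`|g x|)%:E <= M%:E * Iop phi z)%E.
Proof.
have [M M0 hM] := kernel_bound hH hf hci eps hchi hs cOm cOm' rho0 bOm' bOm.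
(* A strictly positive constant keeps the product with an infinite [Iop] infinite. *)
exists (M + 1) => [|phi g z L Oz hphi mg gb]; first by rewrite ltr_wpDl.
have mA := measurable_coneX_open oOm'; have mz := measurable_pt z; have m0 := measurable_pt 0.
have M1 : 0 <= M + 1 by rewrite addr_ge0.
have mk : measurable_fun setT (fun x : T => (kfun phi (x, z))%:E).
  by apply/measurable_EFinP; exact: (measurable_fun_pair1 (f := kfun phi) z (measurable_kfun hphi)).
rewrite (@ge0_negligible_integral _ _ _ dV A1 ([set z] `|` [set (0 : E)])) //; last 3 first.
- exact: measurableU.
- by apply/measurable_EFinP; exact: measurableT_comp.
- by apply/eqP; rewrite -measure_le0; apply: (@le_trans _ _ (dV [set z] + dV [set (0%R : E)])%E); [exact: measureU2|by rewrite !dV_point adde0].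
rewrite -ge0_integralZl_EFin //; last 3 first.
- exact: measurable_cball.
- by move=> x _; rewrite lee_fin kfun_ge0.
- exact: measurable_funTS.
rewrite integral_mkcond [leRHS]integral_mkcond; apply: ge0_le_int => x _.
  by apply: erestrict_ge0 => y _; rewrite lee_fin.
rewrite !patchE; case: ifPn => [|_]; last by case: ifP => // _; rewrite lee_fin mulr_ge0 ?kfun_ge0.
rewrite inE => -[Ax hx]; rewrite mem_set; last exact: (sub_cball bOm').
rewrite lee_fin; apply: (le_trans (gb x)).
apply: (@le_trans _ _ (M * kfun phi (x, z))); last by rewrite ler_wpM2r ?kfun_ge0 // lerDl.
rewrite /kfun /fn mem_set //=; case: (Ax) => -[Xx Ox] _; apply: hM => //.
- exact: subset_closure.
- exact: subset_closure.
- by apply/eqP => x0; apply: hx; right.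
- by apply/eqP => xz; apply: hx; left.
Qed.

Lemma AS_conv phi z : Om z -> Lp_meas phi -> (Iop phi z < +oo)%E ->
  ASconverges f dV (X `&` Om') chi s h eps phi z.
Proof.
move=> Oz hphi hI L; have [M M0 hM] := kernel_le; have [c1 c2] := cms_section L Oz hphi.
have key (g : T -> R) : measurable_fun A1 g -> (forall x, `|g x| <= cn (ASint phi z L x)) ->
    dV.-integrable A1 (fun x => (g x)%:E).
  move=> mg gb; apply/integrableP; split; first exact/measurable_EFinP.
  rewrite (eq_integral (fun x => (`|g x|)%:E)) //; apply: le_lt_trans (hM _ _ _ _ Oz hphi mg gb) _.
  by rewrite lte_mul_pinfty // lee_fin (ltW M0).
split; [exact: (key (fun x => complex.Re (ASint phi z L x)) c1 (fun x => cn_Re _))|].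
exact: (key (fun x => complex.Im (ASint phi z L x)) c2 (fun x => cn_Im _)).
Qed.

Lemma AS_sub phi psi z : ASconverges f dV (X `&` Om') chi s h eps phi z ->
  ASconverges f dV (X `&` Om') chi s h eps psi z ->
  AS (fun y => phi y - psi y) z = AS phi z - AS psi z.
Proof.
move=> h1 h2; apply/ffunP => L; rewrite !ffunE /cintegral.
have mA := measurable_coneX_open oOm'; have [h3 h4] := h1 L; have [h5 h6] := h2 L.
apply: complexP; rewrite ?ReB ?ImB /= ?ReD ?ImD ?ReN ?ImN /=.
  rewrite -(@RintegralB _ _ _ dV A1 (fun x => complex.Re (ASint phi z L x)) (fun x => complex.Re (ASint psi z L x)) mA h3 h5).
  by apply: eq_Rintegral => x _; rewrite ASintegrandB ReD ReN.
rewrite -(@RintegralB _ _ _ dV A1 (fun x => complex.Im (ASint phi z L x)) (fun x => complex.Im (ASint psi z L x)) mA h4 h6).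
  by apply: eq_Rintegral => x _; rewrite ASintegrandB ImD ImN.
Qed.

Lemma AS_le : exists2 M : R, 0 < M & forall phi z, Om z -> Lp_meas phi ->
  ((enrm (AS phi z))%:E <= M%:E * Iop phi z)%E.
Proof.
have [M M0 hM] := kernel_le; pose k := #|{set 'I_N}|.
exists (k%:R * (2 * M)) => [|phi z Oz hphi].
  by rewrite !mulr_gt0 // ltr0n; apply/card_gt0P; exists finset.set0.
(* Where the majorant is infinite there is nothing to show; where it is finite the defining
   integrals converge and are bounded by it. *)
have := Iop_ge0 phi z; case hI : (Iop phi z) => [r| |] // r0; last first.
  by rewrite gt0_muley ?leey // lte_fin !mulr_gt0 // ltr0n; apply/card_gt0P; exists finset.set0.
have hfin : (Iop phi z < +oo)%E by rewrite hI ltry.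
have hc := AS_conv Oz hphi hfin; have mA := measurable_coneX_open oOm'.
rewrite -EFinM lee_fin /enrm.
suff hL L : cn (AS phi z L) <= 2 * M * r.
  by rewrite -(mulrA k%:R) (mulr_natl _ k) -sumr_const; apply: ler_sum => L _; exact: hL.
have [h1 h2] := hc L; have [c1 c2] := cms_section L Oz hphi.
have key (g : T -> R) : measurable_fun A1 g -> (forall x, `|g x| <= cn (ASint phi z L x)) ->
    dV.-integrable A1 (EFin \o g) -> `|Rintegral dV A1 g| <= M * r.
  move=> mg gb ig; rewrite -lee_fin EFinM -hI; apply: le_trans (hM _ _ _ _ Oz hphi mg gb).
  rewrite /Rintegral -abse_EFin fineK; last exact: integrable_fin_num.
  by apply: le_trans (le_abse_integral _ _ _) _ => //; exact/measurable_EFinP.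
rewrite ffunE; apply: (le_trans (cn_le _)); rewrite -mulrA mulr_natl mulr2n /cintegral /=.
by apply: lerD; [apply: (key _ c1 _ h1) => x; exact: cn_Re|apply: (key _ c2 _ h2) => x; exact: cn_Im].
Qed.

(** A function whose p-th power has finite integral is finite almost everywhere; this is the source
    of the convergence of the operator. *)
Lemma Iop_ae phi : Lp_meas phi -> (Lint (X `&` Om') p phi < +oo)%E ->
  {ae dV, forall z, (cball (0 : E) rho `\ (0 : E)) z -> (Iop phi z < +oo)%E}.
Proof.
move=> hphi hL; have [c c0 hc] := Iop_bound; have p0 : 0 < p by rewrite (lt_trans ltr01).
have mB : measurable (cball (0 : E) rho `\ (0 : E) : set T).
  by apply: measurableD; [exact: measurable_cball|exact: measurable_pt].
have i1 : dV.-integrable (cball (0 : E) rho `\ (0 : E) : set T) (fun z => Iop phi z `^ p)%E.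
  apply/integrableP; split.
    by apply: measurable_funTS; apply: (measurableT_comp (measurable_poweR _)); exact: measurable_Iop.
  under eq_integral do rewrite gee0_abs ?poweR_ge0 //.
  by apply: le_lt_trans (hc _ hphi) _; rewrite lte_mul_pinfty // lee_fin.
apply: filterS (integrable_ae mB i1) => z hz Bz; have := hz Bz.
by case: (Iop phi z) (Iop_ge0 phi z) => [r| |] //= _; rewrite ?ltry // gt_eqF.
Qed.

Lemma AS_converges_ae phi : Lp_meas phi -> (Lint (X `&` Om') p phi < +oo)%E ->
  {ae dV, forall z, A2 z -> Om z /\ ASconverges f dV (X `&` Om') chi s h eps phi z}.
Proof.
move=> hphi hL.
have h0 : {ae dV, forall z : T, (z : E) != 0}.
  exists [set (0 : E)]; split; [exact: measurable_pt|exact: dV_point|].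
  by move=> z /= /negP; rewrite negbK => /eqP.
apply: (@filterS2 _ (almost_everywhere dV) _ _ _ _ _ (Iop_ae hphi hL) h0) => z h1 z0 Az; have Oz : Om z by case: Az => -[].
split=> //; apply: AS_conv => //; apply: h1; split; first exact: (sub_cball bOm).
by move=> /= e; rewrite e eqxx in z0.
Qed.

Lemma AS_Lint : exists2 c : R, 0 <= c & forall phi, Lp_meas phi ->
  (Lint (X `&` Om) p (AS phi) <= c%:E * Lint (X `&` Om') p phi)%E.
Proof.
have [M M0 hM] := AS_le; have [c c0 hc] := Iop_bound; have p0 : 0 < p by rewrite (lt_trans ltr01).
pose M2 := Mrest R n nu ^+ #|{: 'I_N}|.
have M20 : 0 <= M2 by apply: exprn_ge0; exact: le_trans ler01 (Mrest_ge1 _ _ _).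
exists ((M2 * M) `^ p * c) => [|phi hphi]; first by rewrite mulr_ge0 ?powR_ge0.
have mA := measurable_coneX_open oOm; have m0 := measurable_pt 0.
have mB : measurable (cball (0 : E) rho `\ (0 : E) : set T).
  by apply: measurableD => //; exact: measurable_cball.
rewrite EFinM -muleA; apply: le_trans (lee_wpmul2l _ (hc _ hphi)); last by rewrite lee_fin powR_ge0.
rewrite -ge0_integralZl_EFin ?powR_ge0 //; last 2 first.
- by move=> z _; exact: poweR_ge0.
- by apply: measurable_funTS; apply: (measurableT_comp (measurable_poweR _)); exact: measurable_Iop.
rewrite /Lint (@ge0_negligible_integral _ _ _ dV A2 [set (0 : E)]) //; last 3 first.
- apply/measurable_EFinP; apply: measurable_powR_on; apply: measurable_fnorm => S.
  exact: cms_restr_ASop.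
- by move=> z _; rewrite lee_fin powR_ge0.
- exact: dV_point.
rewrite integral_mkcond [leRHS]integral_mkcond; apply: ge0_le_int => x _.
  by apply: erestrict_ge0 => y _; rewrite lee_fin powR_ge0.
rewrite !patchE; case: ifPn => [|_]; last first.
  by case: ifP => // _; rewrite mule_ge0 ?poweR_ge0 // lee_fin powR_ge0.
rewrite inE => -[Ax hx]; rewrite mem_set; last by split => //; exact: (sub_cball bOm).
have [[Xx Ox] Rx] := Ax.
rewrite -!poweR_EFin -poweRM ?Iop_ge0 //; last by rewrite lee_fin mulr_ge0 // ltW.
apply: gt0_ler_poweR; rewrite ?(ltW p0) ?in_itv /= ?leey ?andbT ?lee_fin ?fnorm_ge0 //.
  by rewrite mule_ge0 ?Iop_ge0 // lee_fin mulr_ge0 // ltW.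
rewrite EFinM -muleA; apply: le_trans (lee_wpmul2l _ (hM _ _ Ox hphi)); last by rewrite lee_fin.
rewrite -EFinM lee_fin; apply: (le_trans (fnorm_enrm _ _ _)); apply: enrm_restr.
by case: Rx.
Qed.

Lemma extB (G : finType) (a b : ext C G) S : (a - b) S = a S - b S.
Proof. by rewrite !ffunE. Qed.

Lemma cms_restrB (A : set T) (u v : E -> form) :
  (forall S, cms A (fun z : T => restr f z (u z) S)) ->
  (forall S, cms A (fun z : T => restr f z (v z) S)) ->
  forall S, cms A (fun z : T => restr f z (u z - v z) S).
Proof.
move=> hu hv S; apply: (@cms_eq _ T R A (fun z => restr f z (u z) S + - restr f z (v z) S)).
  by move=> z _; rewrite /restr esubstB1 extB.
by apply: cmsD; [exact: hu|apply: cmsN; exact: hv].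
Qed.

Lemma fnorm_restr0 x (a : form) : restr f x a = 0 -> fnorm f x a = 0.
Proof.
move=> h0; apply/eqP; rewrite eq_le fnorm_ge0 andbT.
by apply: (le_trans (fnorm_enrm _ _ _)); rewrite h0 enrm0.
Qed.

(** On a set of finite volume this turns p-integrability into integrability. *)
Lemma fn_powR_le phi x : fn phi x <= 1 + fn phi x `^ p.
Proof.
have [h1|h1] := leP (fn phi x) 1; first by rewrite (le_trans h1) // lerDl powR_ge0.
rewrite (@le_trans _ _ (fn phi x `^ p)) ?lerDr //.
by rewrite -{1}(powRr1 (fn_ge0 phi x)) ler_powR // ltW.
Qed.

(** For |z| < r/2 and |zeta| >= r one has |zeta - z| >= r/2 and |zeta| + |z| <= 2 |zeta|, so the
    kernel is at most the constant [c], and the operator is bounded by the L^1 norm of the form. *)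
Lemma AS_bounded phi r : 0 < r -> Lp_meas phi -> (Lint (X `&` Om') p phi < +oo)%E ->
  (forall x, A1 x -> `|x : E| < r -> restr f x (phi x) = 0) ->
  exists2 B : R, 0 <= B & forall z, A2 z -> `|z : E| < r / 2 -> fnorm f z (AS phi z) <= B.
Proof.
move=> r0 hphi hL hz; have [M M0 hM] := AS_le; have [K K0 hK] := growth.
have mB := @measurable_cball R n nu 0 rho; have r20 : 0 < r / 2 by rewrite divr_gt0.
pose c := 2 `^ mD * (r / 2) `^ (1 - (n + n)%:R).
have c0 : 0 <= c by rewrite mulr_ge0 ?powR_ge0.
have mf : measurable_fun setT (fun x : T => (fn phi x)%:E) by apply/measurable_EFinP; exact: measurable_fn.
pose J := (\int[dV]_(x in (cball (0%R : E) rho : set T)) (fn phi x)%:E)%E.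
have J0 : (0 <= J)%E by apply: integral_ge0 => x _; rewrite lee_fin fn_ge0.
have mp : measurable_fun setT (fun x : T => (fn phi x `^ p)%:E).
  by apply/measurable_EFinP; apply: measurable_powR_comp; exact: measurable_fn.
have JL : (J < +oo)%E.
  apply: (@le_lt_trans _ _ (\int[dV]_(x in (cball (0%R : E) rho : set T)) (1 + (fn phi x `^ p)%:E))%E).
    by apply: ge0_le_int => x _; rewrite -?EFinD lee_fin ?fn_ge0 // fn_powR_le.
  rewrite ge0_integralD //; last 2 first.
  - by move=> x _; rewrite lee_fin powR_ge0.
  - exact: measurable_funTS.
  rewrite (integral_cst dV mB) mul1e; apply: lte_add_pinfty.
    by apply: le_lt_trans (hK 0 rho (ltW rho0)) _; rewrite ltry.
  apply: le_lt_trans hL; rewrite -Lint_fn; apply: ge0_subset_integral => //.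
  by move=> x _; rewrite lee_fin powR_ge0.
have hI z : A2 z -> `|z : E| < r / 2 -> (Iop phi z <= c%:E * J)%E.
  move=> Az zr; rewrite -ge0_integralZl_EFin //; last 2 first.
  - by move=> x _; rewrite lee_fin fn_ge0.
  - exact: measurable_funTS.
  apply: ge0_le_int => x _; first by rewrite lee_fin kfun_ge0.
  rewrite -EFinM lee_fin /kfun /=; have [e|ne] := eqVneq (fn phi x) 0; first by rewrite e !mulr0.
  have xr : r <= `|x : E|.
    rewrite leNgt; apply/negP => xr; move: ne; rewrite /fn; case: ifP => [|_]; last by rewrite eqxx.
    rewrite inE => Ax; by rewrite fnorm_restr0 ?eqxx //; exact: hz.
  apply: ler_wpM2r; first exact: fn_ge0.
  have x0 : 0 < `|x : E| by apply: lt_le_trans xr.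
  have d1 : r / 2 <= `|(x : E) - z|.
    have := ler_normB (x : E) ((x : E) - z); rewrite opprB addrC subrK => h1.
    by have := lerB_dist (x : E) z; lra.
  rewrite /kb /c; apply: ler_pM; rewrite ?mulr_ge0 ?powR_ge0 //.
    have e1 : 2 `^ mD = (2 * `|x : E|) `^ mD * `|x : E| `^ (- mD).
      by rewrite powRM // -mulrA powRN divff ?mulr1 // gt_eqF // powR_gt0.
    rewrite e1; apply: ler_wpM2r; first exact: powR_ge0.
    by apply: ge0_ler_powR; rewrite ?nnegrE ?addr_ge0 ?mulr_ge0 //; lra.
  have e2 : 1 - (n + n)%:R = - ((n + n)%:R - 1) :> R by rewrite opprB.
  have M1 : 0 <= (n + n)%:R - 1 :> R by rewrite subr_ge0 ler1n addn_gt0 n0.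
  rewrite e2 !powRN lef_pV2 ?posrE ?powR_gt0 //; last by apply: lt_le_trans d1.
  by apply: ge0_ler_powR; rewrite ?nnegrE // ltW.
pose M2 := Mrest R n nu ^+ #|{: 'I_N}|.
have M20 : 0 <= M2 by apply: exprn_ge0; exact: le_trans ler01 (Mrest_ge1 _ _ _).
have fJ0 : 0 <= fine J by exact: fine_ge0.
have fJ : J = (fine J)%:E by rewrite fineK // ge0_fin_numE.
exists (M2 * (M * (c * fine J))) => [|z Az zr].
  by apply: (mulr_ge0 M20); apply: (mulr_ge0 (ltW M0)); exact: (mulr_ge0 c0 fJ0).
have [[_ Oz] [_ Rz]] := Az.
apply: (le_trans (fnorm_enrm _ _ _)); apply: (le_trans (enrm_restr _ Rz)); apply: ler_wpM2l => //.
rewrite -lee_fin; apply: le_trans (hM _ _ Oz hphi) _; rewrite EFinM; apply: lee_wpmul2l.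
  by rewrite lee_fin ltW.
by rewrite EFinM -fJ; exact: hI.
Qed.

Lemma AS_homog phi q : (0 < q)%N -> (forall x, A1 x -> ehomog q (phi x)) ->
  forall z, ehomog q.-1 (AS phi z).
Proof.
move=> q0 hphi z L; apply: contraNeq => hq; apply/eqP; rewrite ffunE.
have h0 x : A1 x -> ASint phi z L x = 0.
  move=> Ax; apply: (ASintegrand_homog chi s h eps f z (hphi _ Ax)).
  by apply: contraNneq hq => <-.
rewrite /cintegral; apply: complexP => /=; rewrite /Rintegral.
  by rewrite (eq_integral (cst 0%E)) ?integral0 // => x /set_mem Ax; rewrite h0.
by rewrite (eq_integral (cst 0%E)) ?integral0 // => x /set_mem Ax; rewrite h0.
Qed.

Lemma AS_in_Lp phi q : (0 < q)%N -> in_Lp f dV (X `&` Om') p q phi ->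
  in_Lp f dV (X `&` Om) p q.-1 (AS phi).
Proof.
move=> q0 [h1 h2 h3]; have p0 : 0 < p by rewrite (lt_trans ltr01).
have hL : (Lint (X `&` Om') p phi < +oo)%E.
  move: h3; rewrite LpnormE //; case: (Lint _ _ _) (Lint_ge0 (X `&` Om') p phi) => [r| |] //= _.
  - by move=> _; rewrite ltry.
  - by rewrite gt_eqF // invr_gt0.
split.
- by move=> z _ _; apply: AS_homog => // x [[Xx Ox] Rx]; exact: h1.
- by move=> S; exact: cms_restr_ASop.
- have [c c0 hc] := AS_Lint; rewrite LpnormE //; apply: poweR_lty.
  by apply: le_lt_trans (hc _ h2) _; rewrite lte_mul_pinfty // lee_fin.
Qed.

(** Integrals that diverge have default values, so the operator is additive only where they
    converge, that is, almost everywhere; the two integrals over D are therefore equal. *)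
Lemma AS_Lint_sub : exists2 c : R, 0 <= c & forall phi psi, Lp_meas phi -> Lp_meas psi ->
  (Lint (X `&` Om') p phi < +oo)%E -> (Lint (X `&` Om') p psi < +oo)%E ->
  (Lint (X `&` Om) p (fun z => AS phi z - AS psi z)%R <=
   c%:E * Lint (X `&` Om') p (fun z => phi z - psi z)%R)%E.
Proof.
have [c c0 hc] := AS_Lint; exists c => [|phi psi hphi hpsi Lphi Lpsi]; first exact: c0.
have hd : Lp_meas (fun z => phi z - psi z) by exact: (cms_restrB hphi hpsi).
apply: le_trans (hc _ hd); rewrite le_eqVlt; apply/orP; left; apply/eqP; apply: ae_eq_integral.
- exact: measurable_coneX_open.
- apply/measurable_EFinP; apply: measurable_powR_on; apply: measurable_fnorm.
  by apply: cms_restrB => S; exact: cms_restr_ASop.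
- apply/measurable_EFinP; apply: measurable_powR_on; apply: measurable_fnorm => S.
  exact: cms_restr_ASop.
apply: (@filterS2 _ (almost_everywhere dV) _ _ _ _ _ (AS_converges_ae hphi Lphi) (AS_converges_ae hpsi Lpsi)).
by move=> z h1 h2 Az; have [_ k1] := h1 Az; have [_ k2] := h2 Az; rewrite AS_sub.
Qed.
End Operator.

(** * Logarithmic cut-off functions and the integral of their gradients *)

Section SmallBalls.
Variables (R : realType) (n nu : nat).
Local Notation N := (n + nu)%N.
Local Notation E := (Cn R N).
Local Notation T := (borelCn R n nu).

(** Dominated convergence along balls of radius 1/(k+1): off the vertex, a null set, the truncated
    functions are eventually zero. *)
Lemma small_ball (dV : {measure set T -> \bar R}) (D : set T) (g : T -> R) : dV [set (0 : E)] = 0%E ->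
  measurable D -> (forall x, 0 <= g x) -> dV.-integrable D (EFin \o g) -> forall e : R, 0 < e ->
  exists2 r : R, 0 < r & (\int[dV]_(x in D `&` (cball (0%R : E) r : set T)) (g x)%:E <= e%:E)%E.
Proof.
move=> d0 mD g0 ig e e0; pose B k : set T := cball (0 : E) (k.+1%:R^-1 : R).
have mB k : measurable (B k) by exact: measurable_cball.
pose F k := (EFin \o g) \_ (B k).
have mg : measurable_fun D (EFin \o g) by case/integrableP: ig.
have F0 k x : (0 <= F k x)%E by apply: erestrict_ge0 => y _; rewrite lee_fin.
have mF k : measurable_fun D (F k).
  by apply/(measurable_restrict _ (mB k) mD); apply: measurable_funS mg => //; exact: subIsetl.
have m0 : measurable ([set (0 : E)] : set T) by rewrite -cball0; exact: measurable_cball.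
have cF : {ae dV, forall x, D x -> F ^~ x @ \oo --> 0%E}.
  exists [set (0 : E)]; split => // x /= hx; apply: contrapT => x0; apply: hx => _.
  have xp : 0 < `|x : E| by rewrite normr_gt0; apply/eqP.
  apply: cvg_near_cst; exists (Num.truncn `|x : E|^-1).+1 => // k /= hk.
  rewrite /F patchE memNset // /B /cball /= subr0 => /=.
  apply/negP; rewrite -ltNge invf_plt ?posrE // (lt_le_trans (truncnS_gt _)) // ler_nat.
  by apply: leq_trans hk _; rewrite leqnSn.
have hg : {ae dV, forall x k, D x -> (`|F k x| <= (EFin \o g) x)%E}.
  by apply: aeW => x k Dx; rewrite gee0_abs // /F patchE; case: ifP => //= _; rewrite lee_fin.
have [_ _ h] := @dominated_convergence _ _ _ dV D mD F (cst 0%E) (EFin \o g) mF (measurable_cst _) cF ig hg.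
rewrite integral0 in h.
have [k hk] : exists k, (\int[dV]_(x in D) F k x < e%:E)%E.
  apply: contrapT => hn; have : (e%:E <= 0)%E.
    apply: (cvge_ge _ h); apply: nearW => k; rewrite leNgt; apply/negP => hk; apply: hn.
    by exists k.
  by rewrite leNgt lte_fin e0.
exists k.+1%:R^-1; first by rewrite invr_gt0.
apply: le_trans (ltW hk); rewrite integral_mkcondr le_eqVlt; apply/orP; left; apply/eqP.
by apply: eq_integral.
Qed.
End SmallBalls.

Section Family.
Variables (R : realType) (N : nat).
Local Notation C := R[i].
Local Notation E := (Cn R N).
Variables (th : E -> R) (de Rr : R).
Hypothesis sth : smooth setT th.
Hypothesis de0 : 0 < de.
Hypothesis deR : de < Rr.
Hypothesis th1 : forall z : E, `|z| <= de -> th z = 1.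
Hypothesis th0 : forall z : E, Rr <= `|z| -> th z = 0.

Lemma ball_bound (g : E -> R) : Ck 0 setT g -> exists2 M : R, 0 <= M & forall z : E, `|z| <= Rr -> `|g z| <= M.
Proof.
move=> hg; have c0 : cCk 0 (setT : set E) (fun z => rc (g z)).
  by split => //; exact: Ck_cst.
have [M M0 hM] := compact_cn_bound (@closed_ball_compact R N 0 Rr) (@subsetT _ _) c0.
by exists M => // z zR; rewrite -cn_rc; apply: hM; rewrite /= subr0.
Qed.

Lemma cutoff_bound : exists2 B : R, 0 <= B & forall z, `|th z| <= B.
Proof.
have [M M0 hM] := ball_bound (sth 0); exists M => // z.
have [zR|zR] := leP `|z| Rr; first exact: hM.
by rewrite th0 ?normr0 // ltW.
Qed.

Lemma derive_cutoff_off v z : `|z| < de \/ Rr < `|z| -> 'D_v (th : E -> R^o) z = 0.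
Proof.
move=> hz; have [c hc] : exists c : R, \forall y \near z, th y = c.
  case: hz => hz; [exists 1|exists 0].
    have d0 : 0 < de - `|z| by rewrite subr_gt0.
    near=> y; apply: th1; have h1 : `|z - y| < de - `|z| by near: y; exact: (near_dist z d0).
    by have := ler_distD z y 0; rewrite !subr0 distrC; lra.
  have d0 : 0 < `|z| - Rr by rewrite subr_gt0.
  near=> y; apply: th0; have h1 : `|z - y| < `|z| - Rr by near: y; exact: (near_dist z d0).
  by have := ler_distD y z 0; rewrite !subr0; lra.
rewrite (@near_eq_derive _ _ _ (th : E -> R^o) (cst c)) //.
exact: derive_cst.
Unshelve. all: by end_near. Qed.

Lemma derive_cutoff_bound : exists2 G : R, 0 <= G & forall j z,
  `|'D_(ure R j) (th : E -> R^o) z| <= G /\ `|'D_(uim R j) (th : E -> R^o) z| <= G.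
Proof.
have key v : exists2 M : R, 0 <= M & forall z, `|'D_v (th : E -> R^o) z| <= M.
  have [M M0 hM] := ball_bound (Ck_derive v (sth 1)); exists M => // z.
  have [zR|zR] := leP `|z| Rr; first exact: hM.
  by rewrite derive_cutoff_off ?normr0 //; right.
pose F (i : 'I_N + 'I_N) (z : E) := match i with inl j => `|'D_(ure R j) (th : E -> R^o) z|
  | inr j => `|'D_(uim R j) (th : E -> R^o) z| end.
have F0 i z : 0 <= F i z by case: i => j; exact: normr_ge0.
have [|G G0 hG] := @fin_max R ('I_N + 'I_N)%type E (fun=> True) F.
  by case=> j; [have [M M0 hM] := key (ure R j)|have [M M0 hM] := key (uim R j)]; exists M => // z _; exact: hM.
exists G => // j z; have le i : F i z <= G.
  by apply: le_trans (hG z I); rewrite (bigD1 i) //= lerDl; apply: sumr_ge0.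
by split; [exact: (le (inl j))|exact: (le (inr j))].
Qed.

Variables (m : nat) (s0 : R).
Hypothesis m0 : (0 < m)%N.
Hypothesis s01 : 1 <= s0.

(* Consecutive scales are separated by more than [Rr / de], so that the annuli where the gradients live are disjoint. *)
Definition scl (i : nat) : R := s0 * (2 * Rr / de) ^+ i.

Lemma ratio_gt2 : 2 < 2 * Rr / de.
Proof. by rewrite ltr_pdivlMr // ltr_pM2l. Qed.

Lemma scl_ge i : s0 <= scl i.
Proof.
rewrite /scl ler_peMr ?(le_trans ler01) // exprn_ege1 // ltW // (lt_trans _ ratio_gt2) //.
by rewrite ltr1n.
Qed.

Lemma scl_gt0 i : 0 < scl i.
Proof. by apply: lt_le_trans (scl_ge i); apply: lt_le_trans s01. Qed.

Lemma scl_lt i j : (i < j)%N -> Rr * scl i < de * scl j.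
Proof.
move=> ij; have -> : de * scl j = de * (2 * Rr / de) ^+ (j - i) * scl i.
  by rewrite /scl -{1}(subnK (ltnW ij)) exprD; ring.
rewrite ltr_pM2r ?scl_gt0 //; apply: (@lt_le_trans _ _ (de * (2 * Rr / de))).
  by rewrite mulrC mulfVK ?gt_eqF // mulr_natl mulr2n ltrDl (lt_trans de0).
rewrite ler_pM2l //; rewrite -{1}(expr1 (2 * Rr / de)); apply: ler_weXn2l; last by rewrite subn_gt0.
by rewrite ltW // (lt_trans _ ratio_gt2) // ltr1n.
Qed.

Lemma scl_mono i j : (i <= j)%N -> scl i <= scl j.
Proof.
move=> ij; rewrite /scl ler_wpM2l ?(le_trans ler01) //; apply: ler_weXn2l => //.
by rewrite ltW // (lt_trans _ ratio_gt2) // ltr1n.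
Qed.

(** A discretised logarithmic cut-off: the average of m dilates, at geometrically spaced scales, of
    a function rising from 0 to 1. At distance |z| from the vertex its gradient is of size 1/(m
    |z|). *)
Definition kap (z : E) : R := m%:R^-1 * \sum_(i < m) (1 - th (scl i *: z)).

Definition ann (i : 'I_m) (z : E) : bool := (de <= scl i * `|z|) && (scl i * `|z| <= Rr).

Definition grad (z : E) : R := \sum_(i < m | ann i z) m%:R^-1 * scl i.

Lemma grad_ge0 z : 0 <= grad z.
Proof. by apply: sumr_ge0 => i _; rewrite mulr_ge0 ?invr_ge0 // ltW // scl_gt0. Qed.

Lemma norm_scl i (z : E) : `|scl i *: z| = scl i * `|z|.
Proof. by rewrite normrZ gtr0_norm // scl_gt0. Qed.

Lemma ann_excl i j z : ann i z -> ann j z -> i = j.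
Proof.
wlog ij : i j / (i <= j)%N => [hw h1 h2|].
  by have [h|h] := leP (i : nat) j; [exact: hw|apply/esym; apply: hw => //; exact: ltnW].
move=> /andP[h1 h2] /andP[h3 h4]; apply/val_inj/eqP; rewrite eqn_leq ij /= leqNgt; apply/negP => /scl_lt h5.
have z0 : 0 <= `|z| by [].
have h6 : de * (scl j * `|z|) <= Rr * de by rewrite mulrC ler_pM2r.
have h7 : Rr * de <= Rr * (scl i * `|z|) by rewrite ler_pM2l // (lt_trans de0).
have zp : 0 < `|z|.
  by rewrite lt_def z0 andbT; apply/eqP => e; move: h1; rewrite e mulr0 leNgt de0.
have : Rr * scl i * `|z| < de * scl j * `|z| by rewrite ltr_pM2r.
by move=> h8; lra.
Qed.

(** At each point at most one annulus is active, so the power of the sum is the sum of the powers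
    and no constant depending on m is lost. *)
Lemma grad_powR p z : 0 < p -> grad z `^ p = \sum_(i < m | ann i z) (m%:R^-1 * scl i) `^ p.
Proof.
move=> p0; rewrite /grad; case: (pickP (ann ^~ z)) => [i ai|h].
  have e j : ann j z = (j == i) by apply/idP/eqP => [aj|->]; [exact: ann_excl aj ai|].
  by rewrite !(eq_bigl _ _ e) !big_pred1_eq.
by rewrite !big_pred0 // powR0 // gt_eqF.
Qed.

Lemma grad_off z : Rr < s0 * `|z| -> grad z = 0.
Proof.
move=> hz; rewrite /grad big1 // => i /andP[_ h]; exfalso; move: h; apply/negP; rewrite -ltNge.
by apply: lt_le_trans hz _; apply: ler_wpM2r => //; exact: scl_ge.
Qed.

Lemma kap_smooth : smooth setT kap.
Proof.
move=> k; have oT : open (setT : set E) by exact: openT.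
have hi (i : 'I_m) : Ck k setT (fun x : E => 1 - th (scl i *: x) : R^o).
  have h : Ck k setT (fun x : E => th (scl i *: x)).
    rewrite (_ : (fun x : E => _) = (fun x => th (0 + scl i *: x))).
      exact: (Ck_affine (0 : E) (scl i) oT (sth k)).
    by apply/funext => x; rewrite add0r.
  exact: (CkD oT (@Ck_cst R E k setT 1) (CkN oT h)).
have h := @Ck_sum R E k setT 'I_m (index_enum 'I_m) xpredT (fun i x => 1 - th (scl i *: x)) oT (fun i _ => hi i).
exact: (@CkZ R E k setT m%:R^-1 _ oT h).
Qed.

Lemma derive_kap v z : 'D_v (kap : E -> R^o) z =
  - (m%:R^-1 * \sum_(i < m) scl i * 'D_v (th : E -> R^o) (scl i *: z)).
Proof.
have h1 i : is_derive z v (fun x : E => th (scl i *: x) : R^o) (scl i * 'D_v (th : E -> R^o) (scl i *: z)).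
  have := @derive_affine R E (th : E -> R^o) 0 (scl i) z v; rewrite !add0r => h.
  rewrite (_ : (fun x : E => th (scl i *: x) : R^o) = (fun x : E => th (0 + scl i *: x))).
    by apply: h; exact: (@Ck_derivable R E 0 setT (th : E -> R^o) (scl i *: z) v (sth 1) I).
  by apply/funext => x; rewrite add0r.
pose g (i : 'I_m) : E -> R^o := fun x => 1 - th (scl i *: x).
have h2 i : is_derive z v (g i) (- (scl i * 'D_v (th : E -> R^o) (scl i *: z))).
  by rewrite -sub0r; apply: is_deriveB.
have h3 : is_derive z v (m%:R^-1 *: \sum_(i < m) g i) (m%:R^-1 *: \sum_(i < m) (- (scl i * 'D_v (th : E -> R^o) (scl i *: z)))).
  by apply: is_deriveZ; apply: is_derive_sum.
rewrite (_ : (kap : E -> R^o) = m%:R^-1 *: \sum_(i < m) g i).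
  by rewrite derive_val /= sumrN scalerN.
by apply/funext => x; rewrite /kap /= fct_sumE.
Qed.

Lemma derive_kap_le G v z : (forall y, `|'D_v (th : E -> R^o) y| <= G) ->
  `|'D_v (kap : E -> R^o) z| <= G * grad z.
Proof.
move=> hG; rewrite derive_kap normrN /grad mulr_sumr [leRHS]mulr_sumr.
apply: (le_trans (ler_norm_sum _ _ _)); rewrite [leRHS]big_mkcond; apply: ler_sum => i _.
have sp := scl_gt0 i; have mi : 0 <= m%:R^-1 :> R by [].
have key (x : R) : `|m%:R^-1 * (scl i * x)| = m%:R^-1 * scl i * `|x|.
  by rewrite mulrA normrM ger0_norm // mulr_ge0 // ltW.
apply: (@le_trans _ _ (m%:R^-1 * scl i * `|('D_v (th : E -> R^o) (scl i *: z) : R)|)).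
  by rewrite le_eqVlt; apply/orP; left; apply/eqP; exact: key.
case: ifPn => [_|].
  rewrite [leRHS]mulrC; apply: ler_wpM2l; last exact: hG.
  by rewrite mulr_ge0 // ltW.
rewrite negb_and -!ltNge -norm_scl => /orP h; rewrite derive_cutoff_off ?normr0 ?mulr0 //.
Qed.

Lemma kap_sub1 B z : (forall y, `|th y| <= B) -> `|kap z - 1| <= B.
Proof.
move=> hB; rewrite /kap big_split /= sumr_const card_ord sumrN mulrBr mulVf ?pnatr_eq0 -?lt0n //.
rewrite addrAC subrr add0r normrN normrM ger0_norm ?invr_ge0 // mulrC ler_pdivrMr ?ltr0n //.
apply: (le_trans (ler_norm_sum _ _ _)); apply: (le_trans (ler_sum _ (fun i _ => hB _))).
by rewrite sumr_const card_ord mulr_natr.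
Qed.

Lemma kap_eq1 z : Rr <= s0 * `|z| -> kap z = 1.
Proof.
move=> hz; rewrite /kap (eq_bigr (fun=> 1)) => [|i _]; last first.
  rewrite th0 ?subr0 // norm_scl; apply: le_trans hz _; apply: ler_wpM2r => //; exact: scl_ge.
by rewrite sumr_const card_ord mulVf // pnatr_eq0 -lt0n.
Qed.

Lemma kap_eq0 : exists2 w : R, 0 < w & forall z, `|z| < w -> kap z = 0.
Proof.
exists (de / scl m) => [|z]; first by rewrite divr_gt0 // scl_gt0.
rewrite ltr_pdivlMr ?scl_gt0 // => hz; rewrite /kap big1 ?mulr0 // => i _.
rewrite th1 ?subrr // norm_scl; apply: le_trans (ltW hz); rewrite mulrC; apply: ler_wpM2l => //.
by apply: scl_mono; exact: ltnW.
Qed.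
End Family.

Section GradInt.
Variables (R : realType) (n nu : nat).
Local Notation N := (n + nu)%N.
Local Notation E := (Cn R N).
Local Notation T := (borelCn R n nu).
Variables (dV : {measure set T -> \bar R}) (K p de Rr s0 : R) (m : nat).
Hypothesis K0 : 0 < K.
Hypothesis growth : forall (z : E) r, 0 <= r -> (dV (cball z r) <= (K * r ^+ (n + n))%:E)%E.
Hypothesis p0 : 0 < p.
Hypothesis pn : p <= (n + n)%:R.
Hypothesis de0 : 0 < de.
Hypothesis deR : de < Rr.
Hypothesis m0 : (0 < m)%N.
Hypothesis s01 : 1 <= s0.

(** The annulus of scale c contributes at most (c/m)^p K (Rr/c)^(2n), which is at most K Rr^(2n)
    m^(-p) because c >= 1 and p <= 2n. At p = 2n the scale drops out, and the m summands leave
    m^(1-p). *)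
Lemma grad_integral (A : set T) : measurable A ->
  (\int[dV]_(z in A) (grad de Rr m s0 (z : E) `^ p)%:E <= (K * Rr ^+ (n + n) * m%:R `^ (1 - p))%:E)%E.
Proof.
move=> mA; pose sc := scl de Rr s0; pose a (i : 'I_m) := (m%:R^-1 * sc i) `^ p.
have sp i : 0 < sc i by exact: scl_gt0.
have R0 : 0 < Rr by rewrite (lt_trans de0).
pose B (i : 'I_m) : set T := cball (0 : E) (Rr / sc i).
have mB i : measurable (B i) by exact: measurable_cball.
have a0 i : 0 <= a i by exact: powR_ge0.
apply: (@le_trans _ _ (\int[dV]_z (\sum_(i < m) (a i)%:E * (\1_(B i) z)%:E))%E).
  rewrite integral_mkcond; apply: ge0_le_int => z _.
    by apply: erestrict_ge0 => y _; rewrite lee_fin powR_ge0.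
  have S0 : (0 <= \sum_(i < m) (a i)%:E * (\1_(B i) z)%:E)%E.
    by apply: sume_ge0 => i _; rewrite -EFinM lee_fin mulr_ge0.
  rewrite patchE; case: ifP => // _; rewrite grad_powR // -sumEFin big_mkcond /=.
  apply: lee_sum => i _; case: ifPn => [/andP[_ h]|_]; last by rewrite -EFinM lee_fin mulr_ge0.
  by rewrite indicE mem_set ?mule1 // /B /cball /= subr0 ler_pdivlMr // mulrC.
rewrite ge0_integral_sum //; last 2 first.
- by move=> i; apply/measurable_EFinP; apply: measurable_funM => //; exact: measurable_indic.
- by move=> i z _; rewrite -EFinM lee_fin mulr_ge0.
have hi i : (\int[dV]_z ((a i)%:E * (\1_(B i) z)%:E) <= (K * Rr ^+ (n + n) * m%:R `^ (- p))%:E)%E.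
  rewrite ge0_integralZl_EFin //; last first.
    by apply/measurable_EFinP; exact: measurable_indic.
  rewrite integral_indic // setIT; apply: (@le_trans _ _ ((a i)%:E * (K * (Rr / sc i) ^+ (n + n))%:E)%E).
    by apply: lee_wpmul2l; [rewrite lee_fin|apply: growth; rewrite divr_ge0 // ltW].
  have hm : m%:R^-1 `^ p = (m%:R `^ p)^-1 :> R by rewrite -powR_inv1 // -powRrM mulN1r powRN.
  rewrite -EFinM lee_fin /a powRM ?invr_ge0 // ?(ltW (sp i)) // expr_div_n powRN hm.
  have h1 : sc i `^ p <= sc i ^+ (n + n).
    by rewrite -powR_mulrn ?(ltW (sp i)) // ler_powR // (le_trans s01) // scl_ge.
  have h2 : 0 < sc i ^+ (n + n) by rewrite exprn_gt0.
  have h3 : sc i `^ p / sc i ^+ (n + n) <= 1 by rewrite ler_pdivrMr // mul1r.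
  rewrite [leLHS](_ : _ = K * Rr ^+ (n + n) * (m%:R `^ p)^-1 * (sc i `^ p / sc i ^+ (n + n))); last by ring.
  by rewrite ler_piMr // !mulr_ge0 ?invr_ge0 ?powR_ge0 ?exprn_ge0 // ltW.
apply: (le_trans (lee_sum _ (fun i _ => hi i))).
have e : m%:R `^ (1 - p) = m%:R `^ (- p) * m%:R :> R by rewrite powRDp ?ltr0n // powRr1 // mulrC.
by rewrite sumEFin lee_fin sumr_const card_ord e mulrA -[leLHS]mulr_natr.
Qed.
End GradInt.

(** * The Leibniz rule for dbar and cut-off functions *)

Section Leibniz.
Variables (R : realType) (n nu : nat).
Local Notation C := R[i].
Local Notation N := (n + nu)%N.
Local Notation E := (Cn R N).
Local Notation form := (ext C 'I_N).

Lemma ehomogZ (q : nat) (c : C) (a : form) : ehomog q a -> ehomog q (c *: a).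
Proof.
move=> ha S; rewrite (_ : (c *: a) S = c * a S); last by rewrite !ffunE.
by rewrite mulf_eq0 negb_or => /andP[_ /ha].
Qed.

Lemma ehomogD (q : nat) (a b : form) : ehomog q a -> ehomog q b -> ehomog q (a + b).
Proof.
move=> ha hb S; rewrite (_ : (a + b) S = a S + b S); last by rewrite !ffunE.
by have [e|h] := eqVneq (a S) 0; [rewrite e add0r => /hb|move=> _; exact: ha].
Qed.

Lemma ehomogB (q : nat) (a b : form) : ehomog q a -> ehomog q b -> ehomog q (a - b).
Proof. by move=> ha hb; rewrite -(scaleN1r b); apply: ehomogD => //; exact: ehomogZ. Qed.

Lemma ehomog_wedge (k l : nat) (a b : form) : ehomog k a -> ehomog l b -> ehomog (k + l) (ewedge a b).
Proof.
move=> ha hb S; rewrite ffunE => h.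
have [U /andP[US hU]] : exists U : {set 'I_N}, (U \subset S) && (esgn C U (S :\: U) * a U * b (S :\: U) != 0).
  apply/existsP; apply: contraNT h; rewrite negb_exists => /forallP h.
  rewrite big1 // => U US; have := h U; rewrite US /= negbK => /eqP; exact.
move: hU; rewrite !mulf_eq0 !negb_or => /andP[/andP[_ /ha h1] /hb h2].
by rewrite -h1 -h2 -(cardsID U S) (finset.setIidPr US).
Qed.

Definition dbarf (kap : E -> R) (z : E) : form :=
  \sum_k delb k (fun y => rc (kap y)) z *: egen C k.

Lemma ehomog_dbarf kap z : ehomog 1 (dbarf kap z).
Proof.
rewrite /dbarf; apply: (big_ind (fun a : form => ehomog 1 a)).
- by move=> S; rewrite ffunE eqxx.
- by move=> a b; exact: ehomogD.
- move=> k _; apply: ehomogZ => S; rewrite !ffunE.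
  by have [->|_] := eqVneq S [set k]%SET; rewrite ?cards1 // eqxx.
Qed.

Lemma cderiveM (V : normedModType R) (U : set V) (F G : V -> C) v x : U x -> cCk 1 U F -> cCk 1 U G ->
  cderive v (fun y => F y * G y) x = cderive v F x * G x + F x * cderive v G x.
Proof.
move=> Ux [f1 f2] [g1 g2].
have d1 := @Ck_derivable R V 0 U _ x v f1 Ux; have d2 := @Ck_derivable R V 0 U _ x v f2 Ux.
have d3 := @Ck_derivable R V 0 U _ x v g1 Ux; have d4 := @Ck_derivable R V 0 U _ x v g2 Ux.
have kR (a b c e : V -> R^o) : derivable a x v -> derivable b x v -> derivable c x v -> derivable e x v ->
    ('D_v (fun y => a y * b y - c y * e y : R^o) x =
    'D_v a x * b x + a x * 'D_v b x - ('D_v c x * e x + c x * 'D_v e x)) *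
    ('D_v (fun y => a y * b y + c y * e y : R^o) x =
    'D_v a x * b x + a x * 'D_v b x + ('D_v c x * e x + c x * 'D_v e x)).
  move=> da db dc dE; have m1 := derivableM da db; have m2 := derivableM dc dE.
  have e1 := deriveB m1 m2; have e2 := deriveD m1 m2.
  have e3 := deriveM da db; have e4 := deriveM dc dE.
  split; [apply: etrans e1 _|apply: etrans e2 _]; rewrite e3 e4 /GRing.scale /=;
    move: ('D_v a x) ('D_v b x) ('D_v c x) ('D_v e x) (a x) (b x) (c x) (e x) => *; ring.
apply: complexP; rewrite /cderive /= !(ReM, ImM, ReD, ImD) /=.
  have -> : (fun y => complex.Re (F y * G y)) =
    (fun y => complex.Re (F y) * complex.Re (G y) - complex.Im (F y) * complex.Im (G y)).
    by apply/funext => y; rewrite ReM.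
  by rewrite (kR _ _ _ _ d1 d3 d2 d4); ring.
have -> : (fun y => complex.Im (F y * G y)) =
    (fun y => complex.Re (F y) * complex.Im (G y) + complex.Im (F y) * complex.Re (G y)).
  by apply/funext => y; rewrite ImM.
by rewrite (kR _ _ _ _ d1 d4 d2 d3); ring.
Qed.

Lemma delbM (U : set E) (F G : E -> C) k x : U x -> cCk 1 U F -> cCk 1 U G ->
  delb k (fun y => F y * G y) x = delb k F x * G x + F x * delb k G x.
Proof.
move=> Ux hF hG; rewrite /delb /wirtb !(cderiveM _ Ux hF hG).
move: (cderive (ure R k) F x) (cderive (uim R k) F x) (cderive (ure R k) G x) (cderive (uim R k) G x) (F x) (G x).
by move=> *; ring.
Qed.

Lemma rc_cCk (kap : E -> R) k : smooth setT kap -> cCk k (setT : set E) (fun y => rc (kap y)).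
Proof. by move=> hk; split; [exact: hk|exact: Ck_cst]. Qed.

Variable f : 'I_nu -> mpoly N C.

Lemma dbar_mul (kap : E -> R) (ph : E -> form) (U : set E) z : open U -> U z -> smooth setT kap ->
  (forall S, csmooth U (fun z => ph z S)) ->
  dbar_form (fun y => rc (kap y) *: ph y) z =
  ewedge (dbarf kap z) (ph z) + rc (kap z) *: dbar_form ph z.
Proof.
move=> oU Uz hk hph; rewrite /dbar_form /dbarf [X in ewedge _ X](ext_sum (ph z)) ewedge_sumr scaler_sumr -big_split /=.
apply: eq_bigr => S _; rewrite ewedge_suml scaler_sumr -big_split /=; apply: eq_bigr => k _.
have h1 : cCk 1 U (fun z => ph z S) by have /csmoothP := hph S; apply.
have h2 : cCk 1 U (fun y => rc (kap y)) by apply: (@cCk_sub R E 1 setT U) => //; exact: rc_cCk.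
rewrite (_ : (fun y => (rc (kap y) *: ph y) S) = (fun y => rc (kap y) * ph y S)); last first.
  by apply/funext => y; rewrite !ffunE.
rewrite (delbM k Uz h2 h1) ewedgeZl ewedgeZr scalerDl !scalerA; congr (_ *: _ + _).
Qed.

(** The local smooth extensions are multiplied by the cut-off function, and restriction, an algebra
    morphism, carries the Leibniz rule to the cone. *)
Lemma is_dbar_mul (A : set E) (q : nat) (kap : E -> R) (u du : E -> form) : smooth setT kap ->
  is_dbar f A q u du ->
  is_dbar f A q (fun z => rc (kap z) *: u z) (fun z => ewedge (dbarf kap z) (u z) + rc (kap z) *: du z).
Proof.
move=> hk hu z0 Az0; have [U [ph [oU Uz0 hph hz]]] := hu z0 Az0.
exists U, (fun z => rc (kap z) *: ph z); split; [exact: oU|exact: Uz0| | ].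
  move=> S; apply/csmoothP => k; rewrite (_ : (fun z => _) = (fun z => rc (kap z) * ph z S)); last first.
    by apply/funext => y; rewrite !ffunE.
  apply: cCkM => //; first by apply: (@cCk_sub R E k setT U) => //; exact: rc_cCk.
  by have /csmoothP := hph S; apply.
move=> z Uz Az Rz; have [h1 h2 h3 h4] := hz z Uz Az Rz; split.
- exact: ehomogZ.
- by apply: ehomogD; [rewrite -add1n; apply: ehomog_wedge => //; exact: ehomog_dbarf|exact: ehomogZ].
- by rewrite /restr !esubstZ; congr (_ *: _).
- rewrite (dbar_mul oU Uz hk hph).
  have eD (a b : form) : restr f z (a + b) = restr f z a + restr f z b by exact: esubstD.
  have eZ c (a : form) : restr f z (c *: a) = c *: restr f z a by exact: esubstZ.
  by rewrite !eD !eZ !restrM h3 h4.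
Qed.
End Leibniz.

(** * Approximation in the graph norm by forms vanishing near the vertex *)

Section Cutoff.
Variables (R : realType) (n nu : nat).
Local Notation C := R[i].
Local Notation N := (n + nu)%N.
Local Notation E := (Cn R N).
Local Notation T := (borelCn R n nu).
Local Notation form := (ext C 'I_N).
Variable f : 'I_nu -> mpoly N C.
Hypothesis hci : smooth_ci f.
Variable dV : {measure set T -> \bar R}.
Local Notation X := (coneX f).
Local Notation kN := (#|{set 'I_N}|%:R : R).
Local Notation Mr := (Mrest R n nu ^+ #|{: 'I_N}|).

Lemma kN_ge1 : 1 <= kN.
Proof. by rewrite ler1n; apply/card_gt0P; exists finset.set0. Qed.

Lemma Mr_ge0 : 0 <= Mr.
Proof. by apply: exprn_ge0; exact: le_trans ler01 (Mrest_ge1 _ _ _). Qed.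

Lemma restrD z (a b : form) : restr f z (a + b) = restr f z a + restr f z b.
Proof. exact: esubstD. Qed.

Lemma restrZ z c (a : form) : restr f z (c *: a) = c *: restr f z a.
Proof. exact: esubstZ. Qed.

(** The comparison passes through [enrm], hence the factor [kN]. Such constants are harmless, since
    only smallness is at stake. *)
Lemma fnormD z (a b : form) : fnorm f z (a + b) <= kN * (fnorm f z a + fnorm f z b).
Proof.
apply: (le_trans (fnorm_enrm _ _ _)); rewrite restrD; apply: (le_trans (enrmD _ _)).
by rewrite mulrDr lerD // enrm_restr_fnorm.
Qed.

Lemma fnormZ z c (a : form) : fnorm f z (c *: a) <= cn c * kN * fnorm f z a.
Proof.
apply: (le_trans (fnorm_enrm _ _ _)); rewrite restrZ enrmZ -mulrA.
by apply: ler_wpM2l; [exact: cn_ge0|exact: enrm_restr_fnorm].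
Qed.

Lemma fnormN z (a : form) : fnorm f z (- a) <= kN * fnorm f z a.
Proof. by rewrite -scaleN1r; apply: le_trans (fnormZ _ _ _) _; rewrite cnN cn1 mul1r. Qed.

Lemma fnorm_wedge z (a b : form) : \rank (jac f z) = nu ->
  fnorm f z (ewedge a b) <= Mr * enrm a * (kN * fnorm f z b).
Proof.
move=> rk; apply: (le_trans (fnorm_enrm _ _ _)); rewrite restrM; apply: (le_trans (enrmM _ _)).
apply: ler_pM; rewrite ?enrm_ge0 //; [exact: enrm_restr|exact: enrm_restr_fnorm].
Qed.

Variable p : R.
Hypothesis p1 : 1 < p.

Lemma p_gt0 : 0 < p. Proof. exact: lt_trans ltr01 p1. Qed.

Definition fmeas (B : set E) (u : E -> form) : Prop :=
  forall S : {set 'I_N}, cmeasurable (B `&` regX f) (fun z => restr f z (u z) S).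

Lemma measurable_fpow B u : fmeas B u ->
  measurable_fun (B `&` regX f : set T) (fun z : T => (fnorm f z (u z) `^ p)%:E).
Proof. by move=> hu; apply/measurable_EFinP; apply: measurable_powR_on; exact: measurable_fnorm. Qed.

Lemma powR_add_le (a b : R) : 0 <= a -> 0 <= b -> (a + b) `^ p <= 2 `^ p * (a `^ p + b `^ p).
Proof.
move=> a0 b0; wlog ab : a b a0 b0 / a <= b => [hw|].
  by have [h|/ltW h] := leP a b; [exact: hw|rewrite addrC (addrC (a `^ p)); exact: hw].
have h : (a + b) `^ p <= (2 * b) `^ p.
  by apply: ge0_ler_powR; rewrite ?nnegrE ?addr_ge0 ?mulr_ge0 ?(ltW p_gt0) //; lra.
by apply: (le_trans h); rewrite powRM // ler_wpM2l ?powR_ge0 // lerDr powR_ge0.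
Qed.

Lemma Lint_le_scale (c : R) (B : set E) u v : 0 <= c -> measurable (B `&` regX f : set T) -> fmeas B v ->
  (forall z, B z -> regX f z -> fnorm f z (u z) <= c * fnorm f z (v z)) ->
  (Lint f dV B p u <= (c `^ p)%:E * Lint f dV B p v)%E.
Proof.
move=> c0 mB hv huv; rewrite /Lint -ge0_integralZl_EFin ?powR_ge0 //; last 2 first.
- by move=> z _; rewrite lee_fin powR_ge0.
- exact: measurable_fpow.
apply: ge0_le_int => z [Bz Rz]; first by rewrite lee_fin powR_ge0.
rewrite -EFinM lee_fin -powRM ?fnorm_ge0 //; apply: ge0_ler_powR; rewrite ?nnegrE ?fnorm_ge0 ?mulr_ge0 ?fnorm_ge0 ?(ltW p_gt0) //.
exact: huv.
Qed.

(** The constant of the quasi-triangle inequality for [Lint]: the first factor comes from [fnormD],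
    the second from [powR_add_le]. *)
Definition cD : R := kN `^ p * 2 `^ p.

Lemma cD_ge1 : 1 <= cD.
Proof.
have key (x : R) : 1 <= x -> 1 <= x `^ p.
  move=> x1; have e : 1 = 1 `^ p :> R by rewrite powR1.
  by rewrite [leLHS]e; apply: ge0_ler_powR; rewrite ?nnegrE ?(ltW p_gt0) // (le_trans ler01 x1).
by rewrite -[1]mulr1; apply: ler_pM => //; apply: key; rewrite ?kN_ge1 // ler1n.
Qed.

Lemma cD_ge0 : 0 <= cD. Proof. exact: le_trans ler01 cD_ge1. Qed.

Lemma LintD (B : set E) u v : measurable (B `&` regX f : set T) -> fmeas B u -> fmeas B v ->
  (Lint f dV B p (fun z => u z + v z)%R <= cD%:E * (Lint f dV B p u + Lint f dV B p v))%E.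
Proof.
move=> mB hu hv; rewrite /Lint -ge0_integralD //; last 4 first.
- by move=> z _; rewrite lee_fin powR_ge0.
- exact: measurable_fpow.
- by move=> z _; rewrite lee_fin powR_ge0.
- exact: measurable_fpow.
rewrite -ge0_integralZl_EFin ?cD_ge0 //; last 2 first.
- by move=> z _; rewrite -EFinD lee_fin addr_ge0 ?powR_ge0.
- by apply: emeasurable_funD; exact: measurable_fpow.
apply: ge0_le_int => z [Bz Rz]; first by rewrite lee_fin powR_ge0.
rewrite -EFinD -EFinM lee_fin /cD -mulrA.
apply: (@le_trans _ _ ((kN * (fnorm f z (u z) + fnorm f z (v z))) `^ p)).
  apply: ge0_ler_powR; rewrite ?nnegrE ?(ltW p_gt0) ?fnorm_ge0 ?fnormD //.
  by rewrite mulr_ge0 ?addr_ge0 ?fnorm_ge0.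
rewrite powRM ?addr_ge0 ?fnorm_ge0 //; apply: ler_wpM2l; first exact: powR_ge0.
by apply: powR_add_le; exact: fnorm_ge0.
Qed.

Lemma LintN (B : set E) u : measurable (B `&` regX f : set T) -> fmeas B u ->
  (Lint f dV B p (fun z => - u z)%R <= cD%:E * Lint f dV B p u)%E.
Proof.
move=> mB hu; have h : (Lint f dV B p (fun z => - u z)%R <= (kN `^ p)%:E * Lint f dV B p u)%E.
  by apply: Lint_le_scale => // z _ _; exact: fnormN.
apply: (le_trans h); apply: lee_wpmul2r; first exact: Lint_ge0.
have e : 1 = 1 `^ p :> R by rewrite powR1.
rewrite lee_fin /cD ler_peMr ?powR_ge0 // [leLHS]e; apply: ge0_ler_powR;
  by rewrite ?nnegrE ?(ltW p_gt0) // ler1n.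
Qed.

Lemma Lint_fin B u q : in_Lp f dV B p q u <->
  [/\ (forall z, B z -> regX f z -> ehomog q (u z)), fmeas B u & (Lint f dV B p u < +oo)%E].
Proof.
have key : (Lpnorm f dV B p u < +oo)%E <-> (Lint f dV B p u < +oo)%E.
  rewrite LpnormE ?p_gt0 //; split; last exact: poweR_lty.
  case: (Lint _ _ _ _ _) (Lint_ge0 f dV B p u) => [r| |] //= _; first by move=> _; rewrite ltry.
  by rewrite gt_eqF // invr_gt0 p_gt0.
by split=> -[h1 h2 h3]; split => //; exact/key.
Qed.

Lemma fmeasD B u v : fmeas B u -> fmeas B v -> fmeas B (fun z => u z + v z).
Proof.
move=> hu hv S; apply: (@cms_eq _ T R (B `&` regX f : set T) (fun z => restr f z (u z) S + restr f z (v z) S)).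
  by move=> z _; rewrite restrD [RHS]ffunE.
by apply: cmsD; [exact: hu|exact: hv].
Qed.

Lemma fmeasB B u v : fmeas B u -> fmeas B v -> fmeas B (fun z => u z - v z).
Proof. by move=> hu hv; exact: (cms_restrB hu hv). Qed.

Lemma fmeasZ B (c : E -> C) u : cms (B `&` regX f : set T) (fun z : T => c z) -> fmeas B u ->
  fmeas B (fun z => c z *: u z).
Proof.
move=> hc hu S; apply: (@cms_eq _ T R (B `&` regX f : set T) (fun z => c z * restr f z (u z) S)).
  by move=> z _; rewrite restrZ [RHS]ffunE.
by apply: cmsM; [exact: hc|exact: hu].
Qed.

Lemma fmeas_wedge B (w u : E -> form) : fmeas B w -> fmeas B u -> fmeas B (fun z => ewedge (w z) (u z)).
Proof.
move=> hw hu S; apply: (@cms_eq _ T R (B `&` regX f : set T) (fun z => ewedge (restr f z (w z)) (restr f z (u z)) S)).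
  by move=> z _; rewrite restrM.
exact: (@ems_wedge _ T R (B `&` regX f : set T) _ (fun z => restr f z (w z)) (fun z => restr f z (u z)) hw hu S).
Qed.

Lemma LintB (B : set E) u v : measurable (B `&` regX f : set T) -> fmeas B u -> fmeas B v ->
  (Lint f dV B p (fun z => u z - v z)%R <= (cD * cD)%:E * (Lint f dV B p u + Lint f dV B p v))%E.
Proof.
move=> mB hu hv; have hv' : fmeas B (fun z => - v z).
  move=> S; apply: (@cms_eq _ T R (B `&` regX f : set T) (fun z => - restr f z (v z) S)).
    by move=> z _; rewrite -(scaleN1r (v z)) restrZ scaleN1r [RHS]ffunE.
  by apply: cmsN; exact: hv.
have key : (Lint f dV B p u + Lint f dV B p (fun z => - v z)%R <= cD%:E * (Lint f dV B p u + Lint f dV B p v))%E.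
  rewrite ge0_muleDr ?Lint_ge0 //; apply: leeD; last exact: LintN.
  by rewrite -[leLHS]mul1e; apply: lee_wpmul2r; [exact: Lint_ge0|rewrite lee_fin cD_ge1].
have c0 : (0 <= cD%:E :> \bar R)%E by rewrite lee_fin cD_ge0.
by apply: (le_trans (LintD mB hu hv')); rewrite (EFinM cD cD) -muleA; exact: (lee_wpmul2l c0 key).
Qed.

Lemma LintT (B : set E) u v w : measurable (B `&` regX f : set T) -> fmeas B u -> fmeas B v -> fmeas B w ->
  (Lint f dV B p (fun z => u z - w z)%R <= cD%:E *
    (Lint f dV B p (fun z => u z - v z)%R + Lint f dV B p (fun z => v z - w z)%R))%E.
Proof.
move=> mB hu hv hw; rewrite (_ : (fun z => u z - w z) = (fun z => (u z - v z) + (v z - w z))).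
  exact: (LintD mB (fmeasB hu hv) (fmeasB hv hw)).
by apply/funext => z; rewrite addrA subrK.
Qed.

Lemma fmeasS (A B : set E) u : A `<=` B -> measurable (B `&` regX f : set T) -> fmeas B u -> fmeas A u.
Proof.
move=> AB mB hu S; have [c1 c2] := hu S.
have s : A `&` regX f `<=` B `&` regX f by move=> z [/AB Bz Rz].
by split; exact: (measurable_funS mB s).
Qed.

Lemma LintS (A B : set E) u : A `<=` B -> measurable (A `&` regX f : set T) ->
  measurable (B `&` regX f : set T) -> fmeas B u -> (Lint f dV A p u <= Lint f dV B p u)%E.
Proof.
move=> AB mA mB hu; apply: ge0_subset_integral => //; first exact: measurable_fpow.
  by move=> z _; rewrite lee_fin powR_ge0.
by move=> z [/AB Bz Rz].
Qed.

Lemma in_LpB (B : set E) u v q : measurable (B `&` regX f : set T) ->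
  in_Lp f dV B p q u -> in_Lp f dV B p q v -> in_Lp f dV B p q (fun z => u z - v z).
Proof.
move=> mB /Lint_fin[h1 h2 h3] /Lint_fin[h4 h5 h6]; apply/Lint_fin; split.
- by move=> z Bz Rz; apply: ehomogB; [exact: h1|exact: h4].
- exact: fmeasB.
- apply: le_lt_trans (LintB mB h2 h5) _; rewrite lte_mul_pinfty ?lee_fin ?mulr_ge0 ?cD_ge0 //.
  exact: (lte_add_pinfty h3 h6).
Qed.

Lemma in_LpS (A B : set E) u q : A `<=` B -> measurable (A `&` regX f : set T) ->
  measurable (B `&` regX f : set T) -> in_Lp f dV B p q u -> in_Lp f dV A p q u.
Proof.
move=> AB mA mB /Lint_fin[h1 h2 h3]; apply/Lint_fin; split.
- by move=> z /AB Bz; exact: h1.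
- exact: fmeasS h2.
- exact: le_lt_trans (LintS AB mA mB h2) h3.
Qed.

(** The exponent 1 - p is negative, so a large number of scales compensates any constant. *)
Lemma small_power (c e : R) : 0 <= c -> 0 < e -> exists2 m : nat, (0 < m)%N & c * m%:R `^ (1 - p) <= e.
Proof.
move=> c0 e0; have a0 : 0 < p - 1 by rewrite subr_gt0.
pose m := (Num.truncn ((c / e) `^ (p - 1)^-1)).+1; exists m => //.
have ce : 0 <= c / e by rewrite divr_ge0 // ltW.
have h1 : c / e <= m%:R `^ (p - 1).
  have e3 : c / e = ((c / e) `^ (p - 1)^-1) `^ (p - 1) by rewrite -powRrM mulVf ?powRr1 // gt_eqF.
  rewrite [leLHS]e3; apply: ge0_ler_powR.
  - exact: ltW.
  - by rewrite nnegrE powR_ge0.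
  - by rewrite nnegrE.
  - by rewrite ltW // truncnS_gt.
have -> : 1 - p = - (p - 1) by rewrite opprB.
by rewrite powRN ler_pdivrMr ?powR_gt0 ?ltr0n // mulrC -ler_pdivrMr.
Qed.

Variables (th : E -> R) (de Rr : R).
Hypothesis sth : smooth setT th.
Hypothesis de0 : 0 < de.
Hypothesis deR : de < Rr.
Hypothesis th1 : forall z : E, `|z| <= de -> th z = 1.
Hypothesis th0 : forall z : E, Rr <= `|z| -> th z = 0.
Hypothesis n0 : (0 < n)%N.
Variable K : R.
Hypothesis K0 : 0 < K.
Hypothesis growth : forall (z : E) r, 0 <= r -> (dV (cball z r) <= (K * r ^+ (n + n))%:E)%E.
Hypothesis pn : p <= (n + n)%:R.

Lemma cms_smooth (A : set T) (F : E -> C) : cCk 0 setT F -> cms A (fun z : T => F z).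
Proof.
move=> [[c1 _] [c2 _]]; split; apply: measurable_funTS.
  exact: (@continuous_borel R n nu setT (fun z => complex.Re (F z)) openT c1).
exact: (@continuous_borel R n nu setT (fun z => complex.Im (F z)) openT c2).
Qed.

(** Isolates the properties of [kap] that the approximation uses: it is 1 beyond radius Rr/s0, 0
    near the vertex, and its dbar is controlled by [grad]. *)
Lemma cutoff_function (B G : R) m s0 : (forall z, `|th z| <= B) ->
  (forall j z, `|'D_(ure R j) (th : E -> R^o) z| <= G /\ `|'D_(uim R j) (th : E -> R^o) z| <= G) ->
  (0 < m)%N -> 1 <= s0 -> exists kp : E -> R, [/\ smooth setT kp,
    (forall z, Rr <= s0 * `|z| -> kp z = 1), (forall z, `|kp z - 1| <= B),
    (forall z, enrm (dbarf kp z) <= N%:R * (2 * G) * grad de Rr m s0 z) &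
    (exists2 w : R, 0 < w & forall z, `|z| < w -> kp z = 0 /\ dbarf kp z = 0)].
Proof.
move=> hB hG m0 s01; exists (kap th de Rr m s0).
have [w w0 hw] := kap_eq0 de0 deR th1 m s01.
have skp : smooth setT (kap th de Rr m s0) by exact: kap_smooth.
have h1 z : Rr <= s0 * `|z| -> kap th de Rr m s0 z = 1 by exact: (kap_eq1 de0 deR th0 m0 s01).
have h2 z : `|kap th de Rr m s0 z - 1| <= B by apply: kap_sub1.
have h3 v z : (forall y, `|'D_v (th : E -> R^o) y| <= G) ->
    `|'D_v (kap th de Rr m s0 : E -> R^o) z| <= G * grad de Rr m s0 z.
  by apply: derive_kap_le.
move: (kap th de Rr m s0) skp h1 h2 h3 hw => kp skp h1 h2 h3 hw.
have e2 v z : cderive v (fun y => rc (kp y)) z = rc ('D_v (kp : E -> R^o) z).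
  by rewrite /cderive /rc /=; congr (_ +i* _)%C; exact: derive_cst.
split => //.
  move=> z; apply: (le_trans (enrm_sum _ _ _)).
  apply: (@le_trans _ _ (\sum_(k < N) (2 * G * grad de Rr m s0 z))); last first.
    by rewrite sumr_const card_ord -[leLHS]mulr_natl mulrA.
  apply: ler_sum => k _; rewrite enrmZ enrm_gen mulr1.
  have g1 : `|'D_(ure R k) (kp : E -> R^o) z| <= G * grad de Rr m s0 z by apply: h3 => y; have [] := hG k y.
  have g2 : `|'D_(uim R k) (kp : E -> R^o) z| <= G * grad de Rr m s0 z by apply: h3 => y; have [] := hG k y.
  apply: (le_trans (cn_wirtb _ _ _ _)).
  have -> : 2 * G * grad de Rr m s0 z = G * grad de Rr m s0 z + G * grad de Rr m s0 z by ring.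
  have q v : `|'D_v (kp : E -> R^o) z| <= G * grad de Rr m s0 z ->
      cn (cderive v (fun y => rc (kp y)) z) <= G * grad de Rr m s0 z by rewrite e2 cn_rc.
  exact: (lerD (q _ g1) (q _ g2)).
exists w => // z zw; split; first exact: hw.
have hne : \forall y \near z, kp y = 0.
  have dz : 0 < w - `|z| by rewrite subr_gt0.
  near=> y; apply: hw; have h4 : `|z - y| < w - `|z| by near: y; exact: (near_dist z dz).
  by have := ler_distD z y 0; rewrite !subr0 distrC; lra.
have d1 v : 'D_v (kp : E -> R^o) z = 0.
  by rewrite (@near_eq_derive _ _ _ (kp : E -> R^o) (cst 0)) //; exact: derive_cst.
have d2 v : cderive v (fun y => rc (kp y)) z = 0 by rewrite e2 d1.
by rewrite /dbarf big1 // => k _; rewrite /delb /wirtb !d2 mulr0 addr0 mul0r scale0r.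
Unshelve. all: by end_near. Qed.

Lemma measurable_grad m s0 : 1 <= s0 -> measurable_fun setT (fun z : T => grad de Rr m s0 (z : E)).
Proof.
move=> s01; have m0' : measurable_fun setT (fun x : T => `|x : E|).
  by apply: eq_measurable_fun (@measurable_dist R n nu 0) => x _; rewrite subr0.
pose S (i : 'I_m) : set T := [set x : T | `|x : E| \in `[de / scl de Rr s0 i, Rr / scl de Rr s0 i]].
have mS i : measurable (S i).
  by rewrite -[X in measurable X]setTI; exact: (m0' measurableT _ (measurable_itv _)).
have mg : measurable_fun setT (fun z : T => \sum_(i < m) (m%:R^-1 * scl de Rr s0 i) * (\1_(S i) z)).
  by apply: measurable_sum => i; apply: measurable_funM => //; exact: measurable_indic.
apply: eq_measurable_fun mg => z _; rewrite /grad [RHS]big_mkcond; apply: eq_bigr => i _; rewrite indicE.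
have sp := scl_gt0 de0 deR s01 i.
have -> : (z \in S i) = ann de Rr s0 i z.
  by apply/idP/idP; rewrite inE /S /= in_itv /= /ann ler_pdivrMr // ler_pdivlMr // ![`|z : E| * _]mulrC.
by case: ifP; rewrite ?mulr1 ?mulr0.
Qed.

Lemma Lint_cut (D : set E) v (kp : E -> R) (B r : R) : 0 <= B -> measurable (D `&` regX f : set T) ->
  fmeas D v -> (forall z, `|kp z - 1| <= B) -> (forall z, r <= `|z| -> kp z = 1) ->
  (Lint f dV D p (fun z => rc (kp z - 1)%R *: v z)%R <= ((B * kN) `^ p)%:E *
   \int[dV]_(x in (D `&` regX f : set T) `&` (cball (0%R : E) r : set T)) (fnorm f x (v x) `^ p)%:E)%E.
Proof.
move=> B0 mD mv hB far.
have mI : measurable ((D `&` regX f : set T) `&` (cball (0 : E) r : set T)).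
  by apply: measurableI => //; exact: measurable_cball.
rewrite -ge0_integralZl_EFin ?powR_ge0 //; last 2 first.
- by move=> z _; rewrite lee_fin powR_ge0.
- by apply: (measurable_funS mD); [exact: subIsetl|exact: measurable_fpow].
rewrite /Lint [leLHS]integral_mkcond [leRHS]integral_mkcond; apply: ge0_le_int => z _.
  by apply: erestrict_ge0 => y _; rewrite lee_fin powR_ge0.
rewrite !patchE; case: ifPn => [|_]; last first.
  by case: ifP => // _; rewrite -EFinM lee_fin mulr_ge0 ?powR_ge0.
rewrite inE => Dz; have kB : 0 <= B * kN by rewrite mulr_ge0.
have [zr|zr] := leP `|z : E| r.
  rewrite mem_set; last by split => //; rewrite /cball /= subr0.
  rewrite -EFinM lee_fin -powRM ?fnorm_ge0 //; apply: ge0_ler_powR;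
    rewrite ?nnegrE ?(ltW p_gt0) ?fnorm_ge0 //; first by rewrite mulr_ge0 ?fnorm_ge0.
  apply: (le_trans (fnormZ _ _ _)); rewrite cn_rc; apply: ler_wpM2r; first exact: fnorm_ge0.
  by apply: ler_wpM2r.
rewrite memNset; last by move=> -[_]; rewrite /cball /= subr0 leNgt zr.
rewrite far ?(ltW zr) // subrr (_ : rc 0 *: v z = 0); last by rewrite (_ : rc 0 = 0) // scale0r.
by rewrite fnorm_restr0 ?powR0 ?gt_eqF ?p_gt0 //; exact: esubst0.
Qed.

(** The condition [Rr < s0 * r0] confines the gradient to the ball where [u] is bounded by [Bu], so
    [u] leaves the integral as a constant. *)
Lemma Lint_dbar_cut (D : set E) u (kp : E -> R) (G Bu r0 s0 : R) m : measurable (D `&` regX f : set T) ->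
  0 <= G -> 0 <= Bu -> (0 < m)%N -> 1 <= s0 -> Rr < s0 * r0 ->
  (forall z, enrm (dbarf kp z) <= N%:R * (2 * G) * grad de Rr m s0 z) ->
  (forall z, (D `&` regX f) z -> `|z| < r0 -> fnorm f z (u z) <= Bu) ->
  (Lint f dV D p (fun z => ewedge (dbarf kp z) (u z))%R <=
    ((Mr * (N%:R * (2 * G)) * (kN * Bu)) `^ p * (K * Rr ^+ (n + n)) * m%:R `^ (1 - p))%:E)%E.
Proof.
move=> mD G0 Bu0 m0 s01 sr henrm hb; set C3 := Mr * _ * _.
have C30 : 0 <= C3 by rewrite /C3 !mulr_ge0 ?Mr_ge0.
have h1 := grad_integral K0 growth p_gt0 pn de0 deR m0 s01 mD.
apply: (@le_trans _ _ ((C3 `^ p)%:E * (\int[dV]_(z in (D `&` regX f : set T)) (grad de Rr m s0 (z : E) `^ p)%:E))%E); last first.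
  rewrite -mulrA (EFinM (C3 `^ p)); apply: lee_wpmul2l; last exact: h1.
  by rewrite lee_fin powR_ge0.
rewrite /Lint -ge0_integralZl_EFin ?powR_ge0 //; last 2 first.
- by move=> z _; rewrite lee_fin powR_ge0.
- by apply/measurable_EFinP; apply: measurable_funTS; apply: measurable_powR_comp; exact: measurable_grad.
apply: ge0_le_int => z [Dz Rz]; first by rewrite lee_fin powR_ge0.
have g0 : 0 <= grad de Rr m s0 z by apply: grad_ge0.
have rk : \rank (jac f z) = nu by case: Rz.
rewrite -EFinM lee_fin -powRM //; apply: ge0_ler_powR; rewrite ?nnegrE ?(ltW p_gt0) ?fnorm_ge0 //.
  exact: mulr_ge0 C30 g0.
apply: (le_trans (fnorm_wedge _ _ rk)); have [zr|zr] := ltP `|z| r0.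
  have -> : C3 * grad de Rr m s0 z = Mr * (N%:R * (2 * G) * grad de Rr m s0 z) * (kN * Bu) by rewrite /C3; ring.
  apply: ler_pM.
  - by apply: mulr_ge0; [exact: Mr_ge0|exact: enrm_ge0].
  - by apply: mulr_ge0 => //; exact: fnorm_ge0.
  - by apply: ler_wpM2l; [exact: Mr_ge0|exact: henrm].
  - by apply: ler_wpM2l => //; exact: hb.
have gz : grad de Rr m s0 z = 0.
  apply: grad_off => //; apply: (lt_le_trans sr); apply: ler_wpM2l => //.
  exact: le_trans ler01 s01.
have -> : enrm (dbarf kp z) = 0.
  by apply/eqP; rewrite eq_le enrm_ge0 andbT; apply: le_trans (henrm z) _; rewrite gz mulr0.
by rewrite gz !mulr0 mul0r.
Qed.

(* On a neighbourhood of the vertex [u] is bounded, so [dbar kap /\ u] is controlled by the L^p norm of [grad],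
   which tends to 0 as the number of scales grows because [p <= 2n] and [1 < p]. *)
Lemma cutoff_approx (O : set E) q u du (r0 Bu e : R) : open O ->
  in_Lp f dV (X `&` O) p q u -> in_Lp f dV (X `&` O) p q.+1 du ->
  is_dbar f (X `&` O `&` regX f) q u du ->
  0 < r0 -> 0 <= Bu ->
  (forall z, (X `&` O `&` regX f) z -> `|z| < r0 -> fnorm f z (u z) <= Bu) -> 0 < e ->
  exists u' du', [/\ in_Lp f dV (X `&` O) p q u', in_Lp f dV (X `&` O) p q.+1 du',
    is_dbar f (X `&` O) q u' du',
    (exists2 w : R, 0 < w & forall z, `|z| < w -> u' z = 0 /\ du' z = 0) &
    (Lint f dV (X `&` O) p (fun z => u' z - u z)%R <= e%:E)%E /\
    (Lint f dV (X `&` O) p (fun z => du' z - du z)%R <= e%:E)%E].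
Proof.
move=> oO Lu Ldu hd r00 Bu0 hb e0; have mD := measurable_coneX_open hci oO.
have DX z : (X `&` O) z -> X z by case.
move: (X `&` O) DX Lu Ldu hd hb mD => D DX /Lint_fin[hu1 hu2 hu3] /Lint_fin[hd1 hd2 hd3] hd hb mD.
have [B B0 hB] := cutoff_bound sth th0; have [G G0 hG] := derive_cutoff_bound sth th1 th0.
have R0 : 0 < Rr by apply: lt_trans deR.
pose cB := (B * kN) `^ p; have cB0 : 0 <= cB by exact: powR_ge0.
pose C3 := Mr * (N%:R * (2 * G)) * (kN * Bu).
(* Chosen so that [cB * e1 <= e / (2 * cD)], half of the error before the quasi-triangle inequality;
   the added 1 guards against cB = 0. *)
pose e1 := e / (2 * cD * (cB + 1)).
have c1 := cD_ge1; have cDp : 0 < cD by exact: lt_le_trans c1.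
have cB1 : 0 < cB + 1 by rewrite ltr_wpDl.
have cp : 0 < 2 * cD * (cB + 1) by exact: (mulr_gt0 (mulr_gt0 (ltr0Sn _ 1) cDp) cB1).
have e10 : 0 < e1 by exact: divr_gt0.
have d0 : dV [set (0 : E)] = 0%E by exact: (dV_pt growth n0).
have int v : fmeas D v -> (Lint f dV D p v < +oo)%E ->
    exists2 r : R, 0 < r & (\int[dV]_(x in (D `&` regX f : set T) `&` (cball (0%R : E) r : set T)) (fnorm f x (v x) `^ p)%:E <= e1%:E)%E.
  move=> mv Lv; apply: (@small_ball R n nu dV (D `&` regX f : set T) (fun x => fnorm f x (v x) `^ p)) => //; first by move=> x; exact: powR_ge0.
  apply/integrableP; split; first exact: measurable_fpow.
  apply: le_lt_trans Lv; rewrite /Lint; apply: ge0_le_int => x _ //.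
  by rewrite /= ger0_norm // powR_ge0.
have [ru ru0 hru] := int u hu2 hu3; have [rd rd0 hrd] := int du hd2 hd3.
(* Within this radius [u] is bounded and both [u] and [du] have small p-th power integrals. *)
pose r := Num.min r0 (Num.min ru rd); have rp : 0 < r by rewrite !lt_min r00 ru0 rd0.
have r_u : r <= ru by rewrite /r !ge_min lexx !orbT.
have r_d : r <= rd by rewrite /r !ge_min lexx !orbT.
have r_0 : r <= r0 by rewrite /r !ge_min lexx.
(* Makes Rr/s0 smaller than r, so that the cut-off function is 1 outside the ball of radius r. *)
pose s0 := Num.max 1 (2 * Rr / r).
have s01 : 1 <= s0 by rewrite le_max lexx.
have s0p : 0 < s0 by exact: lt_le_trans s01.
have sr : Rr < s0 * r.
  apply: (@lt_le_trans _ _ (2 * Rr / r * r)); last by rewrite ler_pM2r // le_max lexx orbT.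
  by rewrite mulfVK ?gt_eqF // mulr_natl mulr2n ltrDl.
have ec : 0 < e / (2 * cD) by apply: divr_gt0 => //; exact: (mulr_gt0 (ltr0Sn _ 1) cDp).
have cm : 0 <= C3 `^ p * (K * Rr ^+ (n + n)) by exact: (mulr_ge0 (powR_ge0 _ _) (mulr_ge0 (ltW K0) (exprn_ge0 _ (ltW R0)))).
(* The gradient bound does not involve [s0], so the number of scales depends only on [Bu], the
   constants and the error. *)
have [m m0 hm] := small_power cm ec.
have [kp [skp kfar ksub kgrad [w w0 kzero]]] := cutoff_function hB hG m0 s01.
have far z : r <= `|z| -> kp z = 1.
  by move=> hz; apply: kfar; apply: le_trans (ltW sr) _; apply: ler_wpM2l => //; exact: ltW.
have ckp k : cCk k (setT : set E) (fun y => rc (kp y)) by exact: rc_cCk.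
have mkp : cms (D `&` regX f : set T) (fun z : T => rc (kp z)) by apply: cms_smooth; exact: ckp.
have mdb : fmeas D (dbarf kp).
  move=> S; apply: (cms_restr hci mD) => [z []//|S']; apply: ems_sum => k; apply: emsZ; last exact: ems_cst.
  by apply: cms_smooth; apply: cCk_wirtb; [exact: openT|exact: ckp].
have rsub z : rc (kp z) - 1 = rc (kp z - 1) by apply: complexP => /=; rewrite ?subr0.
have part v rv : fmeas D v -> r <= rv -> (\int[dV]_(x in (D `&` regX f : set T) `&` (cball (0%R : E) rv : set T)) (fnorm f x (v x) `^ p)%:E <= e1%:E)%E ->
    (Lint f dV D p (fun z => rc (kp z - 1)%R *: v z)%R <= (cB * e1)%:E)%E.
  move=> mv rrv hv; have fr z : rv <= `|z| -> kp z = 1 by move=> h; apply: far; exact: le_trans h.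
  apply: (le_trans (Lint_cut B0 mD mv ksub fr)); rewrite (EFinM cB); apply: lee_wpmul2l; last exact: hv.
  by rewrite lee_fin.
have hce : cB * e1 <= e / (2 * cD).
  rewrite /e1 mulrA ler_pdivrMr //.
  have -> : e / (2 * cD) * (2 * cD * (cB + 1)) = e * cB + e by field; rewrite gt_eqF.
  by rewrite mulrC lerDl ltW.
have hee : e / (2 * cD) <= e.
  have h2 : 1 <= 2 * cD by lra.
  rewrite ler_pdivrMr ?(lt_le_trans ltr01 h2) // -{1}(mulr1 e); exact: (ler_wpM2l (ltW e0) h2).
have e2 : (fun z => rc (kp z) *: u z - u z) = (fun z => rc (kp z - 1) *: u z).
  by apply/funext => z; rewrite -rsub scalerBl scale1r.
have e3 : (fun z => ewedge (dbarf kp z) (u z) + rc (kp z) *: du z - du z) =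
    (fun z => ewedge (dbarf kp z) (u z) + rc (kp z - 1) *: du z).
  by apply/funext => z; rewrite -rsub scalerBl scale1r addrA.
have hU : (Lint f dV D p (fun z => rc (kp z) *: u z - u z)%R <= e%:E)%E.
  rewrite e2; apply: (le_trans (part _ _ hu2 r_u hru)); rewrite lee_fin; exact: (le_trans hce hee).
have mwu : fmeas D (fun z => ewedge (dbarf kp z) (u z)) by exact: (fmeas_wedge mdb hu2).
have mk1 : cms (D `&` regX f : set T) (fun z : T => rc (kp z - 1)).
  by apply: cms_smooth; apply: rc_cCk => k; apply: (CkD openT (skp k)); exact: Ck_cst.
have mkd : fmeas D (fun z => rc (kp z - 1) *: du z) by exact: (fmeasZ mk1 hd2).
have hW : (Lint f dV D p (fun z => ewedge (dbarf kp z) (u z))%R <= (e / (2 * cD))%:E)%E.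
  have sr0 : Rr < s0 * r0 by apply: (lt_le_trans sr); apply: ler_wpM2l => //; exact: ltW.
  by apply: (le_trans (Lint_dbar_cut mD G0 Bu0 m0 s01 sr0 kgrad hb)); rewrite lee_fin.
have hdU : (Lint f dV D p (fun z => ewedge (dbarf kp z) (u z) + rc (kp z) *: du z - du z)%R <= e%:E)%E.
  rewrite e3; apply: (le_trans (LintD mD mwu mkd)).
  have hP := part _ _ hd2 r_d hrd.
  have hP2 : (Lint f dV D p (fun z => rc (kp z - 1)%R *: du z)%R <= (e / (2 * cD))%:E)%E.
    by apply: (le_trans hP); rewrite lee_fin.
  have c0 : (0 <= cD%:E :> \bar R)%E by rewrite lee_fin ltW.
  apply: (le_trans (lee_wpmul2l c0 (leeD hW hP2))).
  rewrite -(EFinD (e / _)) -(EFinM cD) lee_fin le_eqVlt; apply/orP; left; apply/eqP; field.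
  by rewrite gt_eqF.
have mu' : fmeas D (fun z => rc (kp z) *: u z) by exact: (fmeasZ mkp hu2).
have mdu' : fmeas D (fun z => ewedge (dbarf kp z) (u z) + rc (kp z) *: du z).
  exact: (fmeasD mwu (fmeasZ mkp hd2)).
have fin v v' : fmeas D v -> fmeas D v' -> (Lint f dV D p v < +oo)%E ->
    (Lint f dV D p (fun z => v' z - v z)%R <= e%:E)%E -> (Lint f dV D p v' < +oo)%E.
  move=> mv mv' Lv Le; have ev : v' = (fun z => (v' z - v z) + v z) by apply/funext => z; rewrite subrK.
  rewrite ev; apply: le_lt_trans (LintD mD (fmeasB mv' mv) mv) _.
  rewrite lte_mul_pinfty ?lee_fin ?(ltW cDp) //.
  exact: (lte_add_pinfty (le_lt_trans Le (ltry e)) Lv).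
have hdb := is_dbar_mul skp hd.
have hh z : D z -> regX f z -> ehomog q (rc (kp z) *: u z) /\ ehomog q.+1 (ewedge (dbarf kp z) (u z) + rc (kp z) *: du z).
  move=> Dz Rz; split; first by apply: ehomogZ; exact: hu1.
  apply: ehomogD; last by apply: ehomogZ; exact: hd1.
  by rewrite -add1n; apply: ehomog_wedge; [exact: ehomog_dbarf|exact: hu1].
have Lu' := fin _ _ hu2 mu' hu3 hU; have Ldu' := fin _ _ hd2 mdu' hd3 hdU.
have zero z : `|z| < w -> rc (kp z) *: u z = 0 /\ ewedge (dbarf kp z) (u z) + rc (kp z) *: du z = 0.
  by move=> /kzero[-> ->]; rewrite (_ : rc 0 = 0) // !scale0r ewedge0l addr0.
exists (fun z => rc (kp z) *: u z), (fun z => ewedge (dbarf kp z) (u z) + rc (kp z) *: du z); split; [| | |exists w; [exact: w0|exact: zero]|exact: (conj hU hdU)].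
- apply/Lint_fin; split; [|exact: mu'|exact: Lu'].
  by move=> z Dz Rz; have [] := hh z Dz Rz.
- apply/Lint_fin; split; [|exact: mdu'|exact: Ldu'].
  by move=> z Dz Rz; have [] := hh z Dz Rz.
(* The Leibniz rule covers regular points only. At the vertex the zero form serves as the smooth
   extension, as the cut-off form and its dbar vanish identically nearby. *)
move=> z0 Dz0; have [zz|zz] := eqVneq z0 0; last first.
  have Rz0 : regX f z0 by split; [exact: DX|exact: (hci (DX _ Dz0) zz)].
  have [U [ph [oU Uz hph hz]]] := hdb z0 (conj Dz0 Rz0).
  by exists U, ph; split; [exact: oU|exact: Uz|exact: hph|move=> z Uz' Dz Rz; exact: (hz z Uz' (conj Dz Rz) Rz)].
exists [set z : E | `|z - 0| < w], (fun=> 0); split.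
- exact: open_norm_lt.
- by rewrite /= zz subrr normr0.
- move=> S; have -> : (fun z : E => (0 : form) S) = (fun=> 0) by apply/funext => y; rewrite ffunE.
  by apply/csmoothP => k; exact: cCk_cst.
move=> z /=; rewrite subr0 => zw Dz Rz; have [h1 h2] := zero z zw; have [h3 h4] := hh z Dz Rz.
have db0 : dbar_form (fun=> (0 : form)) z = 0.
  rewrite /dbar_form big1 // => S _; rewrite big1 // => k _.
  have e4 v : cderive v (fun y : E => (0 : form) S) z = 0.
    by apply: complexP; rewrite /cderive /=; exact: derive_cst.
  by rewrite /delb /wirtb !e4 mulr0 addr0 mul0r scale0r.
by split; [exact: h3|exact: h4|rewrite h1|rewrite h2 db0].
Qed.

Lemma is_dbarS (A B : set E) q u du : A `<=` B -> is_dbar f B q u du -> is_dbar f A q u du.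
Proof.
move=> AB h z0 /AB Bz; have [U [ph [oU Uz hph hz]]] := h z0 Bz.
by exists U, ph; split; [exact: oU|exact: Uz|exact: hph|move=> z Uz' /AB Bz' Rz; exact: (hz z Uz' Bz' Rz)].
Qed.

Lemma Lint_self (B : set E) u : Lint f dV B p (fun z => u z - u z) = 0%E.
Proof.
rewrite /Lint (eq_integral (cst 0%E)) ?integral0 // => z _.
rewrite (_ : fnorm f z (u z - u z) = 0) ?powR0 ?gt_eqF ?p_gt0 //.
by apply: fnorm_restr0; rewrite subrr; exact: esubst0.
Qed.

(** If the vertex is not in the domain, every point is regular and nothing has to be cut off. *)
Lemma approx_off_zero (O : set E) q u du (e : R) : open O ->
  in_Lp f dV (X `&` O) p q u -> in_Lp f dV (X `&` O) p q.+1 du ->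
  is_dbar f (X `&` O `&` regX f) q u du ->
  ((X `&` O) 0 -> exists r0 Bu : R, [/\ 0 < r0, 0 <= Bu &
    forall z, (X `&` O `&` regX f) z -> `|z| < r0 -> fnorm f z (u z) <= Bu]) -> 0 < e ->
  exists u' du', [/\ in_Lp f dV (X `&` O) p q u', in_Lp f dV (X `&` O) p q.+1 du',
    is_dbar f (X `&` O) q u' du',
    ((X `&` O) 0 -> exists2 w : R, 0 < w & forall z, `|z| < w -> u' z = 0) &
    (Lint f dV (X `&` O) p (fun z => u' z - u z)%R <= e%:E)%E /\
    (Lint f dV (X `&` O) p (fun z => du' z - du z)%R <= e%:E)%E].
Proof.
move=> oO Lu Ldu hd hb e0; have [hO|hO] := pselect ((X `&` O) 0).
  have [r0 [Bu [r00 Bu0 hB]]] := hb hO.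
  have [u' [du' [h1 h2 h3 [w w0 hw] h5]]] := cutoff_approx oO Lu Ldu hd r00 Bu0 hB e0.
  exists u', du'; split; [exact: h1|exact: h2|exact: h3| |exact: h5].
  by move=> _; exists w; [exact: w0|move=> z /hw[]].
exists u, du; split; [exact: Lu|exact: Ldu| |by move=> /hO|].
  apply: is_dbarS hd => z Dz; split; first exact: Dz.
  split; first by case: Dz.
  by apply: hci; [case: Dz|apply/eqP => z0; apply: hO; rewrite -z0].
by split; rewrite Lint_self lee_fin ltW.
Qed.

Lemma Lpnorm_le (B : set E) v (e : R) : 0 <= e -> (Lint f dV B p v <= (e `^ p)%:E)%E ->
  (Lpnorm f dV B p v <= e%:E)%E.
Proof.
move=> e0 h; rewrite LpnormE ?p_gt0 //.
have -> : e%:E = ((e `^ p)%:E `^ p^-1)%E :> \bar R by rewrite poweR_EFin -powRrM mulfV ?powRr1 // gt_eqF // p_gt0.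
apply: gt0_ler_poweR; rewrite ?in_itv /= ?leey ?andbT ?Lint_ge0 ?lee_fin ?powR_ge0 //.
by rewrite invr_ge0 ltW // p_gt0.
Qed.

Lemma Lint_le (B : set E) v (e : R) : 0 <= e -> (Lpnorm f dV B p v <= e%:E)%E ->
  (Lint f dV B p v <= (e `^ p)%:E)%E.
Proof.
move=> e0 h; have -> : Lint f dV B p v = (Lpnorm f dV B p v `^ p)%E.
  by rewrite LpnormE ?p_gt0 // -poweRrM mulVf ?poweRe1 ?Lint_ge0 // gt_eqF // p_gt0.
rewrite -poweR_EFin; apply: gt0_ler_poweR; rewrite ?in_itv /= ?leey ?andbT ?lee_fin //.
  by rewrite ltW // p_gt0.
by rewrite LpnormE ?p_gt0 //; exact: poweR_ge0.
Qed.

Lemma Lint_small (B : set E) (v_ : nat -> E -> form) : (fun k => Lpnorm f dV B p (v_ k)) @ \oo --> 0%E ->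
  forall e : R, 0 < e -> \forall k \near \oo, (Lint f dV B p (v_ k) <= e%:E)%E.
Proof.
move=> hv e e0; have e1 : 0 < e `^ p^-1 by exact: powR_gt0.
have ee : e = (e `^ p^-1) `^ p by rewrite -powRrM mulVf ?powRr1 ?ltW // gt_eqF // p_gt0.
have /fine_cvgP[h1 /cvgr0Pnorm_le/(_ _ e1) h2] := hv.
near=> k; rewrite ee; apply: Lint_le; first exact: ltW.
have f1 : Lpnorm f dV B p (v_ k) \is a fin_num by near: k; exact: h1.
rewrite -(fineK f1) lee_fin; apply: le_trans (ler_norm _) _.
by near: k; exact: h2.
Unshelve. all: by end_near. Qed.

Lemma dom_criterion (B : set E) q u v : in_Lp f dV B p q u -> in_Lp f dV B p q.+1 v ->
  (forall e : R, 0 < e -> exists a da, [/\ in_Lp f dV B p q a, is_dbar f (B `&` regX f) q a da,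
    in_Lp f dV B p q.+1 da, supp_off_zero f B a &
    (Lint f dV B p (fun z => a z - u z)%R <= e%:E)%E /\ (Lint f dV B p (fun z => da z - v z)%R <= e%:E)%E]) ->
  dom_dbar_s f dV B p q u.
Proof.
move=> hu hv happ; split; first exact: hu.
(* [Lint] is a p-th power, so the k-th tolerance is the p-th power of 1/(k+1). *)
have ek (k : nat) : 0 < (k.+1%:R^-1 : R) `^ p by rewrite powR_gt0 // invr_gt0.
have [F hF] := choice (fun k => happ _ (ek k)); have [G hG] := choice hF.
have cv (w_ : nat -> E -> form) : (forall k, (Lint f dV B p (w_ k) <= ((k.+1%:R^-1 : R) `^ p)%:E)%E) ->
    (fun k => Lpnorm f dV B p (w_ k)) @ \oo --> 0%E.
  move=> hw; apply: (@squeeze_cvge _ _ _ _ (cst 0%E) _ (fun k => (k.+1%:R^-1 : R)%:E)).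
  - apply: nearW => k; apply/andP; split; first by rewrite LpnormE ?p_gt0 //; exact: poweR_ge0.
    by apply: Lpnorm_le; [rewrite invr_ge0|exact: hw].
  - exact: cvg_cst.
  - by apply: cvg_EFin; [exact: nearW|exact: cvg_harmonic].
exists v, F, G; split; first exact: hv.
- by move=> k; have [h1 h2 h3 h4 _] := hG k.
- apply: (cv (fun k z => F k z - u z)) => k; have [_ _ _ _ [h1 _]] := hG k; exact: h1.
- apply: (cv (fun k z => G k z - v z)) => k; have [_ _ _ _ [_ h1]] := hG k; exact: h1.
Qed.
End Cutoff.

(** * Assembly: two successive cut-offs around the Koppelman formula *)

Lemma compact_norm_bound (R : realType) (V : normedModType R) (A : set V) : compact A ->
  exists2 r : R, 0 < r & forall x, A x -> `|x| <= r.
Proof.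
move=> /compact_bounded[M [Mr hM]]; exists (Num.max M 0 + 1).
  by rewrite ltr_wpDl // le_max lexx orbT.
by move=> x Ax; apply: hM => //; apply: (@le_lt_trans _ _ (Num.max M 0)); [rewrite le_max lexx|rewrite ltrDl].
Qed.

(** The function [chi] is 1 near a point [a] of Omega and has compact support; translating it by [a]
    gives a smooth function equal to 1 near the origin and 0 far away, the profile from which [kap]
    is built. *)
Lemma translated_cutoff (R : realType) (n nu : nat) (Om Om' : set (Cn R (n + nu))) (chi : Cn R (n + nu) -> R) a :
  cutoff Om Om' chi -> Om a -> exists (th : Cn R (n + nu) -> R) (de Rr : R),
  [/\ smooth setT th, 0 < de, de < Rr, (forall z, `|z| <= de -> th z = 1) &
      (forall z, Rr <= `|z| -> th z = 0)].
Proof.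
move=> [schi csupp _ [W [oW sW hW]]] Oa.
have [r r0 hr] := compact_norm_bound csupp.
have Wa : W a by apply: sW; exact: subset_closure.
have [e /= e0 he] := (nbhs_normP _ _).1 (open_nbhs_nbhs (conj oW Wa)).
exists (fun z => chi (a + 1 *: z)), (e / 2), (r + `|a| + 1 + e); split.
- by move=> k; exact: (Ck_affine a 1 openT (schi k)).
- by rewrite divr_gt0.
- have a0 : 0 <= `|a| by []. lra.
- move=> z hz; rewrite scale1r; apply: hW; apply: he; rewrite /ball_ /= opprD addNKr normrN.
  by apply: le_lt_trans hz _; lra.
- move=> z hz; rewrite scale1r; apply/eqP; apply: contrapT => /negP hc.
  have h1 : `|a + z| <= r by apply: hr; exact: subset_closure.
  have h2 := ler_normB (a + z) a; rewrite addrAC subrr add0r in h2; lra.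
Qed.

Theorem theorem1p4 (R : realType) (n nu : nat)
    (f : 'I_nu -> mpoly (n + nu) R[i]) (d : 'I_nu -> nat)
    (Om Om' : set (Cn R (n + nu)))
    (dV : {measure set (borelCn R n nu) -> \bar R})
    (chi : Cn R (n + nu) -> R)
    (s : 'I_(n + nu) -> Cn R (n + nu) * Cn R (n + nu) -> R[i])
    (h : 'I_nu -> 'I_(n + nu) -> mpoly ((n + nu) + (n + nu)) R[i])
    (eps : bool) (p : R) (q : nat)
    (phi : Cn R (n + nu) -> ext R[i] 'I_(n + nu)) :
  let X := coneX f in
  let D := X `&` Om in
  let D' := X `&` Om' in
  let deg := (\sum_i d i)%N in
  (* X is the cone over a smooth complete intersection of degree deg *)
  (forall i, (0 < d i)%N /\ f i \is @ishomog1 _ _ (d i) mdeg) ->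
  smooth_ci f ->
  (deg < 2 * n + nu - 1)%N ->
  is_volume f dV ->
  strictly_pseudoconvex Om -> strictly_pseudoconvex Om' -> rcinto Om Om' ->
  smooth_boundary f D ->
  (* the data defining the operator *)
  hefer f d h ->
  cutoff Om Om' chi ->
  weight_section Om chi s ->
  koppelman f dV D' chi s h eps D ->
  (1 <= q <= n)%N ->
  (2 * n)%:R / ((2 * n)%:R - (deg%:R - nu%:R)) < p -> p <= (2 * n)%:R ->
  dom_dbar_s f dV D' p q phi ->
  {ae dV, forall z, (D `&` regX f) z ->
            ASconverges f dV D' chi s h eps phi z} /\
  dom_dbar_s f dV D p q.-1 (ASop f dV D' chi s h eps phi).
Proof.
move=> X D D' deg hf hci hdeg hdV sOm sOm' [_ hOO] _ hH hcut hs hK hq hp1 hpn hdom.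
have [oOm _ cOm _] := sOm; have [oOm' _ cOm' _] := sOm'; have [schi _ _ _] := hcut.
have /andP[q0 qn] := hq; have n0 : (0 < n)%N by exact: leq_trans qn.
have growth := volume_growth hH hf hci hdV n0; have [K K0 hKg] := growth.
(* The quantity d - nu of the statement is [mdef d]; the degree hypothesis then reads m + 1 < 2n. *)
have edeg : deg = (mdef d + nu)%N.
  rewrite /deg /mdef (eq_bigr (fun i => (d i).-1 + 1)%N) => [|i _].
    by rewrite big_split /= sum_nat_const card_ord muln1.
  by rewrite addn1 prednK //; have [] := hf i.
have hm : (mdef d + 1 < n + n)%N by move: hdeg; rewrite edeg; lia.
have hm2 : (mdef d)%:R + 1 < (n + n)%:R :> R by rewrite -(natrD _ (mdef d) 1) ltr_nat.
have m0 : 0 <= (mdef d)%:R :> R by [].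
have e2n : (2 * n)%N = (n + n)%N by rewrite mul2n addnn.
rewrite e2n edeg (natrD _ (mdef d) nu) addrK in hp1; rewrite e2n in hpn.
have tm : 0 < (n + n)%:R - (mdef d)%:R :> R by lra.
have hp : (n + n)%:R < p * ((n + n)%:R - (mdef d)%:R) by rewrite -ltr_pdivrMr.
(* The lower bound 2n/(2n - m) is at least 1. *)
have p1 : 1 < p.
  by apply: le_lt_trans hp1; rewrite ler_pdivlMr // mul1r; lra.
have [r1 r10 hr1] := compact_norm_bound cOm'; have [r2 r20 hr2] := compact_norm_bound cOm.
pose rho := Num.max r1 r2; have rho0 : 0 < rho by rewrite lt_max r10.
have bOm' x : closure Om' x -> `|x| <= rho by move=> /hr1 h1; rewrite le_max h1.
have bOm x : closure Om x -> `|x| <= rho by move=> /hr2 h1; rewrite le_max h1 orbT.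
have subO : Om `<=` Om' by move=> x Ox; apply: hOO; exact: subset_closure.
have subD : D `<=` D' by move=> x [Xx /subO Ox].
have mD : measurable (D `&` regX f : set (borelCn R n nu)) by exact: measurable_coneX_open.
have mD' : measurable (D' `&` regX f : set (borelCn R n nu)) by exact: measurable_coneX_open.
have [hphi [psi [phi_ [dphi_ [hpsi happ cphi cpsi]]]]] := hdom.
have /(Lint_fin f dV p1)[_ mphi Lphi] := hphi; have /(Lint_fin f dV p1)[_ mpsi Lpsi] := hpsi.
have ASin := @AS_in_Lp R n nu f d h hH hf hci Om Om' chi s eps schi hs oOm oOm' cOm cOm' dV n0 growth p rho p1 hp rho0 bOm' bOm.
have ASbd := @AS_bounded R n nu f d h hH hf hci Om Om' chi s eps schi hs oOm oOm' cOm cOm' dV n0 growth p rho p1 rho0 bOm' bOm.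
have [c c0 hc] := AS_Lint_sub hH hf hci eps schi hs oOm oOm' cOm cOm' n0 growth p1 hp rho0 bOm' bOm.
split.
  apply: filterS (AS_converges_ae hH hf hci eps schi hs oOm oOm' cOm cOm' n0 growth p1 hp rho0 bOm' bOm mphi Lphi).
  by move=> z hz Dz; have [] := hz Dz.
pose AS := ASop f dV D' chi s h eps.
have qq : q.-1.+1 = q by exact: prednK.
have iAphi : in_Lp f dV D p q.-1 (AS phi) by exact: (ASin phi q q0 hphi).
(* By the Koppelman formula the dbar of K phi should be phi - K psi, where psi is the dbar of
   phi. *)
have iv : in_Lp f dV D p q.-1.+1 (fun z => phi z - AS psi z).
  rewrite qq; apply: (in_LpB p1 mD); first exact: (in_LpS p1 subD mD mD' hphi).
  exact: (ASin psi q.+1 isT hpsi).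
apply: (dom_criterion p1 iAphi iv) => e e0.
(* An empty Omega offers no point to which the cut-off function could be translated, but then every
   condition on D is void. *)
have [Om0|/set0P[a0 Oa0]] := eqVneq Om set0.
  have D0 z : ~ D z by rewrite /D Om0 => -[].
  have L0 w : (Lint f dV D p w <= e%:E)%E.
    rewrite /Lint (_ : D `&` regX f = set0) ?integral_set0 ?lee_fin ?ltW //.
    by apply/seteqP; split => z // -[/D0].
  exists (AS phi), (fun z => phi z - AS psi z); split; [exact: iAphi|by move=> z [/D0]|exact: iv|by move=> /D0|by split; exact: L0].
have [th [de [Rr [sth de0 deR th1 th0]]]] := translated_cutoff hcut Oa0.
have approx := fun O q u du e => @approx_off_zero R n nu f hci dV p p1 th de Rr sth de0 deR th1 th0 n0 K K0 hKg hpn O q u du e.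
pose k1 := cD n nu p; have k11 : 1 <= k1 by exact: cD_ge1.
have k10 : 0 < k1 by exact: lt_le_trans k11.
have k20 : 0 < 2 * k1 by exact: (mulr_gt0 (ltr0Sn _ 1) k10).
(* The tolerances are computed backwards: [e2] is half of [e] up to the quasi-triangle constant,
   [e1] absorbs the continuity constant [c] of K and the two constants of a difference, and [e3]
   splits [e1] between the defining sequence and the first cut-off. *)
pose e2 := e / (2 * k1); have e20 : 0 < e2 by exact: divr_gt0 e0 k20.
pose e1 := e2 / (k1 * k1 * (1 + c)).
have c1 : 0 < 1 + c by rewrite ltr_pwDl.
have kc : 0 < k1 * k1 * (1 + c) by exact: (mulr_gt0 (mulr_gt0 k10 k10) c1).
have e10 : 0 < e1 by exact: divr_gt0.
have he1 : k1 * k1 * (1 + c) * e1 = e2 by rewrite /e1 mulrC divfK // gt_eqF.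
have he2 : k1 * (e2 + e2) = e by rewrite /e2; field; rewrite gt_eqF.
pose e3 := e1 / (2 * k1); have e30 : 0 < e3 by exact: divr_gt0 e10 k20.
have he3 : k1 * (e3 + e3) = e1 by rewrite /e3; field; rewrite gt_eqF.
have [k [hk1 hk2]] : exists k, (Lint f dV D' p (fun z => phi_ k z - phi z)%R <= e3%:E)%E /\
    (Lint f dV D' p (fun z => dphi_ k z - psi z)%R <= e3%:E)%E.
  have [k _ hk] := filterI (Lint_small p1 cphi e30) (Lint_small p1 cpsi e30).
  by exists k; apply: hk => /=.
have [i1 i2 i3 i4] := happ k.
(* The restrictions of the approximating form vanish near the vertex, so the bound there is 0. *)
have near0 : (X `&` Om') 0 -> exists r0 Bu : R, [/\ 0 < r0, 0 <= Bu &
    forall z, (X `&` Om' `&` regX f) z -> `|z| < r0 -> fnorm f z (phi_ k z) <= Bu].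
  move=> h0; have [W [oW W0 hW]] := i4 h0.
  have [r /= r0 hr] := (nbhs_normP _ _).1 (open_nbhs_nbhs (conj oW W0)).
  exists r, 0; split => // z [Dz Rz] zr; rewrite (fnorm_restr0 (hW z _ Dz Rz)) //.
  by apply: hr; rewrite /ball_ /= sub0r normrN.
(* First cut-off, on D'. The vertex becomes an ordinary point for [is_dbar], as the Koppelman
   formula demands on all of D'. *)
have [a [da [j1 j2 j3 j4 [j5 j6]]]] := approx Om' q (phi_ k) (dphi_ k) e3 oOm' i1 i3 i2 near0 e30.
have /(Lint_fin f dV p1)[ja1 ma La] := j1; have /(Lint_fin f dV p1)[_ mda Lda] := j2.
have /(Lint_fin f dV p1)[_ mk Lk] := i1; have /(Lint_fin f dV p1)[_ mdk Ldk] := i3.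
have sum2 (x y : \bar R) (b t : R) : (x <= b%:E)%E -> (y <= b%:E)%E -> k1 * (b + b) = t -> (k1%:E * (x + y) <= t%:E)%E.
  move=> hx hy <-; rewrite (EFinM k1) (EFinD b); have k0 : (0 <= k1%:E :> \bar R)%E by rewrite lee_fin ltW.
  exact: (lee_wpmul2l k0 (leeD hx hy)).
have la : (Lint f dV D' p (fun z => a z - phi z)%R <= e1%:E)%E.
  by apply: (le_trans (LintT dV p1 mD' ma mk mphi)); exact: (sum2 _ _ _ _ j5 hk1 he3).
have lda : (Lint f dV D' p (fun z => da z - psi z)%R <= e1%:E)%E.
  by apply: (le_trans (LintT dV p1 mD' mda mdk mpsi)); exact: (sum2 _ _ _ _ j6 hk2 he3).
have hkop := hK q a da q0 j3.
have iA : in_Lp f dV D p q.-1 (AS a) by exact: (ASin a q q0 j1).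
have iAd : in_Lp f dV D p q (AS da) by exact: (ASin da q.+1 isT j2).
have iaD : in_Lp f dV D p q a by exact: (in_LpS p1 subD mD mD' j1).
have iw : in_Lp f dV D p q.-1.+1 (fun z => a z - AS da z) by rewrite qq; exact: (in_LpB p1 mD iaD iAd).
(* As [a] vanishes near the vertex, K a is bounded there, which is the condition for cutting it
   off. *)
have nearA : (X `&` Om) 0 -> exists r0 Bu : R, [/\ 0 < r0, 0 <= Bu &
    forall z, (X `&` Om `&` regX f) z -> `|z| < r0 -> fnorm f z (AS a z) <= Bu].
  move=> h0; have [w w0 hw] := j4 (subD _ h0).
  have hz x : (D' `&` regX f) x -> `|x| < w -> restr f x (a x) = 0 by move=> _ /hw ->; exact: esubst0.
  have [Bu Bu0 hB] := ASbd a w w0 ma La hz.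
  by exists (w / 2), Bu; split; [rewrite divr_gt0|exact: Bu0|exact: hB].
(* Second cut-off, on D, applied to K a, whose dbar on the regular part is a - K da by the Koppelman
   formula. *)
have [b [db [b1 b2 b3 b4 [b5 b6]]]] := approx Om q.-1 (AS a) (fun z => a z - AS da z) e2 oOm iA iw hkop nearA e20.
have /(Lint_fin f dV p1)[_ mb _] := b1; have /(Lint_fin f dV p1)[_ mdb _] := b2.
have /(Lint_fin f dV p1)[_ mA _] := iA; have /(Lint_fin f dV p1)[_ mAd _] := iAd.
have /(Lint_fin f dV p1)[_ mAphi _] := iAphi; have /(Lint_fin f dV p1)[_ mv _] := iv.
have /(Lint_fin f dV p1)[_ mw _] := iw; have /(Lint_fin f dV p1)[_ maD _] := iaD.
have mphiD : fmeas f D phi by exact: (fmeasS subD mD' mphi).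
have mApsi : fmeas f D (AS psi) by have /(Lint_fin f dV p1)[] := ASin psi q.+1 isT hpsi.
have s1 : (Lint f dV D p (fun z => AS a z - AS phi z)%R <= (c * e1)%:E)%E.
  apply: (le_trans (hc _ _ ma mphi La Lphi)); rewrite (EFinM c).
  have c0' : (0 <= c%:E :> \bar R)%E by rewrite lee_fin.
  exact: (lee_wpmul2l c0' la).
have s2 : (Lint f dV D p (fun z => AS da z - AS psi z)%R <= (c * e1)%:E)%E.
  apply: (le_trans (hc _ _ mda mpsi Lda Lpsi)); rewrite (EFinM c).
  have c0' : (0 <= c%:E :> \bar R)%E by rewrite lee_fin.
  exact: (lee_wpmul2l c0' lda).
have ce : c * e1 <= e2.
  rewrite -he1; apply: ler_wpM2r; first exact: ltW.
  have h1 : 1 <= k1 * k1 by rewrite -[1]mulr1 ler_pM.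
  have h2 : 1 * (1 + c) <= k1 * k1 * (1 + c) by rewrite ler_pM2r.
  by apply: le_trans h2; rewrite mul1r lerDr.
exists b, db; split; [exact: b1|by apply: is_dbarS b3 => z []|exact: b2| |split].
- move=> h0; have [w w0 hw] := b4 h0; exists [set z | `|z - 0| < w]; split.
  + exact: open_norm_lt.
  + by rewrite /= subrr normr0.
  + by move=> z /=; rewrite subr0 => /hw -> _ _; exact: esubst0.
- apply: (le_trans (LintT dV p1 mD mb mA mAphi)); apply: (sum2 _ _ _ _ b5 _ he2).
  by apply: (le_trans s1); rewrite lee_fin.
apply: (le_trans (LintT dV p1 mD mdb mw mv)); apply: (sum2 _ _ _ _ b6 _ he2).
(* Regrouped so that the error is that of [a] itself minus that of K da, each already estimated. *)
have ew : (fun z => a z - AS da z - (phi z - AS psi z)) = (fun z => (a z - phi z) - (AS da z - AS psi z)).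
  by apply/funext => z; rewrite !opprB addrACA [RHS]addrACA; congr (_ + _); rewrite addrC.
rewrite ew; apply: (le_trans (LintB dV p1 mD (fmeasB maD mphiD) (fmeasB mAd mApsi))).
have laD : (Lint f dV D p (fun z => a z - phi z)%R <= e1%:E)%E.
  exact: (le_trans (LintS dV p subD mD mD' (fmeasB ma mphi)) la).
have kk : (0 <= (k1 * k1)%:E :> \bar R)%E by rewrite lee_fin mulr_ge0 // ltW.
apply: (le_trans (lee_wpmul2l kk (leeD laD s2))).
rewrite -(EFinD e1) -(EFinM (k1 * k1)) lee_fin -he1 le_eqVlt; apply/orP; left; apply/eqP; ring.
Qed.
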